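(* Let $N>2$, $p_0:=N/(N-2)$, $q_0:=N/2$. Suppose $f$ satisfies (A1)–(A3) and: (A7) $q_S\le q_f<q_0$; (A8) there exists a positive radial function $u^*\in C^2(\mathbb{R}^N\setminus\{0\})$ solving $-\Delta u^*=f(u^* )$ in $\mathbb{R}^N\setminus\{0\}$ such that \[ u^*(x)=F^{-1}\!\left[\frac{|x|^2}{2N-4q_f}(1+\theta(|x|))\right]\quad\text{as } |x|\to0^+, \] where $\theta\in C^1(0,r_1)$ for some $r_1>0$, $\lim_{r\to0^+}\theta(r)=0$ and $\lim_{r\to0^+}r\theta'(r)=0$. Then the Cauchy problem $\partial_tu-\Delta u=f(u)$ in $\mathbb{R}^N\times(0,\infty)$, $u(x,0)=u^*(x)$, has at least two positive solutions in the integral sense defined in the context. One of them is $u(x,t)=u^*(x)$ a.e. in $\mathbb{R}^N\times[0,\infty)$. The other is a solution $u$ on $\mathbb{R}^N\times[0,t_0)$ for some $t_0>0$ satisfying $u\in L^\infty_{loc}((0,t_0),L^\infty(\mathbb{R}^N))$, $u$ is a classical solution of $\partial_tu-\Delta u=f(u)$ in $\mathbb{R}^N\times(0,t_0)$, and $\lim_{t\to0^+}\|u(t)-u^*\|_{L^\gamma_{ul}(\mathbb{R}^N)}=0$ for every $1\le\gamma<\gamma^*$.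
   Context: $q_S:=(N+2)/4$. The function $f$ (extended by $0$ on $(-\infty,0)$) satisfies: (A1) $f\in C^1[0,\infty)\cap C^2(0,\infty)$, $f(0)=0$, $f'(0)=0$; (A2) $f'(u)>0$, $f''(u)>0$ for $u>0$; (A3) the finite limit $q_f:=\lim_{u\to\infty}\frac{f'(u)^2}{f(u)f''(u)}$ exists. $F(u):=\int_u^\infty ds/f(s)$ for $u>0$, with inverse $F^{-1}$. $\gamma^*:=\frac{N}{2(q_f-1)}$ if $q_f>1$, $\gamma^*:=\infty$ if $q_f=1$. For $1\le p<\infty$, $\|u\|_{L^p_{ul}}:=\sup_{z\in\mathbb{R}^N}(\int_{B(z,1)}|u|^p)^{1/p}$. $G_t(x):=(4\pi t)^{-N/2}e^{-|x|^2/(4t)}$. Definition (solution): a nonnegative measurable $u$ on $\mathbb{R}^N\times[0,T)$ is a solution with initial datum $u_0\ge0$ in $\mathbb{R}^N\times[0,T)$ if \[ \infty>u(x,t)=\int_{\mathbb{R}^N}G_t(x-y)u_0(y)\,dy+\int_0^t\int_{\mathbb{R}^N}G_{t-s}(x-y)f(u(y,s))\,dy\,ds \] for a.a. $(x,t)\in\mathbb{R}^N\times[0,T)$. *)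

(* Defs.v *)
(* R : realType, R^N = 'rV[R]_N with the EUCLIDEAN norm
   [enorm] (the library's matrix norm is the max norm, so we do not use it). *)
From HB Require Import structures.
From mathcomp Require Import all_boot all_order all_algebra.
From mathcomp Require Import all_classical all_reals all_analysis.
Set Implicit Arguments. Unset Strict Implicit. Unset Printing Implicit Defensive.
Import Order.TTheory GRing.Theory Num.Theory.
Import numFieldNormedType.Exports.
Local Open Scope classical_set_scope.
Local Open Scope ring_scope.

Section Defs.
Variable R : realType.

Definition enorm (n : nat) (x : 'rV[R]_n) : R := Num.sqrt (\sum_i (x 0 i) ^+ 2).

Definition ei (n : nat) (i : 'I_n) : 'rV[R]_n := delta_mx 0 i.

(* Borel sigma-algebra on R^n: generated by the boxes prod_i A_i, A_i Borel. *)
Definition boxes (n : nat) : set (set 'rV[R]_n) :=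
  [set B | exists A : 'I_n -> set R,
      (forall i, measurable (A i)) /\ B = [set x : 'rV[R]_n | forall i, A i (x 0 i)]].
Definition measurableRn (n : nat) (B : set 'rV[R]_n) : Prop :=
  <<s (@boxes n) >> B.

(* n-dimensional Lebesgue integral of a (nonnegative) function, computed as the
   iterated one-dimensional Lebesgue integral (Tonelli). *)
Fixpoint iint (n : nat) : ('rV[R]_n -> \bar R) -> \bar R :=
  match n return ('rV[R]_n -> \bar R) -> \bar R with
  | 0 => fun g => g 0
  | m.+1 => fun g =>
      (\int[@lebesgue_measure R]_(s in [set: R])
         iint (fun v : 'rV[R]_m => g (row_mx (s%:M : 'rV[R]_1) v)))%E
  end.

(* ---------- space-time R^N x R, points z = (x, t) in 'rV_(N+1) ---------- *)
Definition xpt (N : nat) (z : 'rV[R]_(N + 1)) : 'rV[R]_N := lsubmx z.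
Definition tpt (N : nat) (z : 'rV[R]_(N + 1)) : R := rsubmx z 0 0.

Definition stdom (N : nat) (T : \bar R) (z : 'rV[R]_(N + 1)) : Prop :=
  0 <= tpt z /\ ((tpt z)%:E < T)%E.

Definition ae_st (N : nat) (T : \bar R) (P : 'rV[R]_N -> R -> Prop) : Prop :=
  exists E : set 'rV[R]_(N + 1),
    measurableRn E /\ iint (fun z => (\1_E z)%:E) = 0%E /\
    forall z, stdom T z -> ~ P (xpt z) (tpt z) -> E z.

Definition measurable_st (N : nat) (T : \bar R) (u : 'rV[R]_N -> R -> R) : Prop :=
  forall B : set R, measurable B ->
    measurableRn [set z | stdom T z /\ B (u (xpt z) (tpt z))].

Definition heatG (N : nat) (t : R) (x : 'rV[R]_N) : R :=
  powR (4 * pi * t) (- (N%:R / 2)) * expR (- (enorm x ^+ 2) / (4 * t)).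

Definition heat_term (N : nat) (u0 : 'rV[R]_N -> R) (x : 'rV[R]_N) (t : R) : \bar R :=
  iint (fun y => (heatG t (x - y) * u0 y)%:E).

Definition duhamel_term (N : nat) (f : R -> R) (u : 'rV[R]_N -> R -> R)
  (x : 'rV[R]_N) (t : R) : \bar R :=
  (\int[@lebesgue_measure R]_(s in `[0%R, t]%classic)
     iint (fun y => (heatG (t - s) (x - y) * f (u y s))%:E))%E.

Definition is_solution (N : nat) (f : R -> R) (u0 : 'rV[R]_N -> R) (T : \bar R)
  (u : 'rV[R]_N -> R -> R) : Prop :=
  (forall x t, 0 <= t -> (t%:E < T)%E -> 0 <= u x t) /\
  measurable_st T u /\
  ae_st T (fun x t => (u x t)%:E = (heat_term u0 x t + duhamel_term f u x t)%E).

Definition partial (N : nat) (i : 'I_N) (g : 'rV[R]_N -> R) : 'rV[R]_N -> R :=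
  'D_(ei i) g.

Definition laplacian (N : nat) (g : 'rV[R]_N -> R) (x : 'rV[R]_N) : R :=
  \sum_i partial i (partial i g) x.

Definition C2_on (N : nat) (U : set 'rV[R]_N) (g : 'rV[R]_N -> R) : Prop :=
  forall x, U x ->
    {for x, continuous g} /\
    (forall i, derivable g x (ei i) /\ {for x, continuous (partial i g)}) /\
    (forall i j, derivable (partial i g) x (ei j) /\
                 {for x, continuous (partial j (partial i g))}).

Definition classical_solution (N : nat) (f : R -> R) (t0 : R)
  (u : 'rV[R]_N -> R -> R) : Prop :=
  let Om := [set p : 'rV[R]_N * R | 0 < p.2 < t0] in
  (forall x t, Om (x, t) ->
     derivable (u x) t 1 /\
     (forall i, derivable (fun y => u y t) x (ei i)) /\
     (forall i j, derivable (partial i (fun y => u y t)) x (ei j))) /\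
  (forall p, Om p ->
     {for p, continuous (fun q : 'rV[R]_N * R => u q.1 q.2)} /\
     {for p, continuous (fun q : 'rV[R]_N * R => derive1 (u q.1) q.2)} /\
     (forall i, {for p, continuous (fun q : 'rV[R]_N * R =>
                     partial i (fun y => u y q.2) q.1)}) /\
     (forall i j, {for p, continuous (fun q : 'rV[R]_N * R =>
                     partial j (partial i (fun y => u y q.2)) q.1)})) /\
  (forall x t, Om (x, t) ->
     derive1 (u x) t - laplacian (fun y => u y t) x = f (u x t)).

Definition ul_norm (N : nat) (p : R) (g : 'rV[R]_N -> R) : \bar R :=
  ereal_sup (range (fun z : 'rV[R]_N =>
    poweR (iint (fun y => (\1_[set y' | enorm (y' - z) < 1] y * powR `|g y| p)%:E))
          p^-1)).

Definition Fint (f : R -> R) (u : R) : \bar R :=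
  (\int[@lebesgue_measure R]_(s in `[u, +oo[%classic) ((f s)^-1)%:E)%E.

Definition Finv (f : R -> R) (y : R) : R :=
  xget 0 [set u | 0 < u /\ Fint f u = y%:E].

Definition gamma_star (N : nat) (qf : R) : \bar R :=
  if 1 < qf then (N%:R / (2 * (qf - 1)))%:E else +oo%E.

End Defs.

(* Main.v *)
(** The second solution is obtained by solving the problem from below. Let [W p m] be
    smooth concave truncations of [ustar], increasing to [ustar], and let [fM f m] be [f]
    continued beyond [m] by its tangent line. The Picard iterates with data [W p m] and
    nonlinearity [fM f m] increase to bounded solutions [appr f p m <= ustar], which in turn
    increase with [m] to a solution [u].

    That [ustar] itself solves the integral equation follows from the Duhamel formula for
    the truncations: it contains the error term [- tr'' (ustar) |grad ustar|^2], which, because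
    [|grad ustar|^2 <= C (1 + ustar f(ustar))], is dominated by [C/m] plus a difference of
    convergent integrals.

    The solution [u] is bounded at positive times: [F(appr)] satisfies a parabolic
    inequality near the origin, and comparison with the barrier [A (|x|^2 + b + d t)]
    gives [F(appr) >= A d t] uniformly in [m]. Admissible constants
    [A < (2N - 4q)^-1] exist because [q > N/4]. Hence [u] differs from [ustar], which is
    unbounded, and by the regularizing effect of the heat kernel it is classical.

    Finally [0 <= ustar - u <= (ustar - W p m) + C_m t], and for [gam < gamma^*] the function
    [(ustar)^gam] is [O(|x|^(-2k))] near the origin with [2k < N], hence locally
    integrable; this gives the convergence in [L^gam_ul]. *)
Require Import Defs.
From HB Require Import structures.
From mathcomp Require Import all_boot all_order all_algebra.
From mathcomp Require Import all_classical all_reals all_analysis.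
From mathcomp Require Import measurable_realfun ring lra.
Set Implicit Arguments. Unset Strict Implicit. Unset Printing Implicit Defensive.
Import Order.TTheory GRing.Theory Num.Theory.
Import numFieldNormedType.Exports.
Local Open Scope classical_set_scope.
Local Open Scope ring_scope.

(** [ustar] is stationary, so a solution built from below could coincide with it; what separates the
    two is an upper bound that improves with time. In the variable F(u) the singularity of [ustar]
    becomes the regular function |x|^2 / (2N - 4q), and a smaller slope A leaves room for a term d
    t. At a first contact the gradient term f'(u) |grad u|^2 / f(u)^2 equals 4 A^2 |x|^2 f'(u); it
    is controlled because f' F is at most about q and because F(u) >= A' |x|^2 is inherited from u
    <= [ustar]. What remains is a quadratic inequality in a = A (2N - 4q) with roots 1 and N / (2q)
    - 1; the choice is their midpoint N / (4q), which lies below 1 exactly when q > N/4. F is used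
    on large values only, hence the recurring maximum with a threshold [K]. Regularity is a
    bootstrap: the gradient of a bounded mild solution solves a linear problem of the same kind, so
    that first-order estimates applied twice give second derivatives. Radial functions are written
    in r = |x|^2, a polynomial, in which the equation reads 4 r p'' + 2 N p' = - f(p). *)

Section RowVectorMeasure.
Variable R : realType.
Implicit Types n : nat.
Local Notation leb := (@lebesgue_measure R).

(** Turns the bare predicate [measurableRn] of the definitions into a measurable structure, so that
    the general integration theory applies to row vectors. *)
HB.instance Definition _ n := @isMeasurable.Build (sigma_display (@boxes R n)) 'rV[R]_n
  (@measurableRn R n) (@sigma_algebra0 _ setT (@boxes R n))
  (@sigma_algebraC _ (@boxes R n)) (@sigma_algebra_bigcup _ setT (@boxes R n)).

Lemma measurable_rV d (T : measurableType d) n (h : T -> 'rV[R]_n) :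
  (forall i, measurable_fun setT (fun x => h x 0 i)) -> measurable_fun setT h.
Proof.
move=> mh; apply: (measurability (@boxes R n)) => // _ [_ [A [mA ->]] <-].
rewrite setTI (_ : _ @^-1` _ =
    \bigcap_(i in [set: 'I_n]) ((fun x => h x 0 i) @^-1` A i)); last first.
  by apply/seteqP; split => x /= Ax i; [move=> _|]; exact: Ax.
apply: fin_bigcap_measurable => // i _.
by rewrite -[X in measurable X]setTI; exact: mh.
Qed.

Lemma measurable_coord n (i : 'I_n) :
  measurable_fun setT (fun x : 'rV[R]_n => x 0 i).
Proof.
move=> _ B mB; rewrite setTI; apply: sub_sigma_algebra.
exists (fun j => if j == i then B else setT); split.
  by move=> j; case: ifP.
apply/seteqP; split => x /=; last by move=> /(_ i); rewrite eqxx.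
by move=> Bx j; case: eqP => // ->.
Qed.

Lemma measurable_coord_comp d (T : measurableType d) n (h : T -> 'rV[R]_n) i :
  measurable_fun setT h -> measurable_fun setT (fun x => h x 0 i).
Proof. by move=> mh; apply: (measurableT_comp (@measurable_coord n i)). Qed.

Lemma measurable_addv d (T : measurableType d) n (h k : T -> 'rV[R]_n) :
  measurable_fun setT h -> measurable_fun setT k ->
  measurable_fun setT (fun x => h x + k x).
Proof.
move=> mh mk; apply: measurable_rV => i.
under eq_fun do rewrite mxE.
by apply: measurable_funD; exact: measurable_coord_comp.
Qed.

Lemma measurable_subv d (T : measurableType d) n (h k : T -> 'rV[R]_n) :
  measurable_fun setT h -> measurable_fun setT k ->
  measurable_fun setT (fun x => h x - k x).
Proof.
move=> mh mk; apply: measurable_rV => i.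
under eq_fun do rewrite !mxE.
by apply: measurable_funB; exact: measurable_coord_comp.
Qed.

Lemma measurable_enorm n : measurable_fun setT (@enorm R n).
Proof.
have ms : measurable_fun setT (@Num.sqrt R).
  by apply: continuous_measurable_fun; exact: sqrt_continuous.
apply: (measurableT_comp ms); apply: measurable_sum => i.
by apply: measurable_funX; exact: measurable_coord.
Qed.

(** The map by which [iint] peels off one coordinate, uncurried so that measures can be pushed
    forward along it. *)
Definition consv n (p : R * 'rV[R]_n) : 'rV[R]_n.+1 := row_mx (p.1%:M : 'rV[R]_1) p.2.

Lemma consv0 n p : @consv n p 0 0 = p.1.
Proof.
have -> : 0 = lshift n (0 : 'I_1) by apply/val_inj.
by rewrite /consv (@row_mxEl _ 1 1 n) mxE eqxx.
Qed.

Lemma consvS n p i : @consv n p 0 (lift 0 i) = p.2 0 i.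
Proof.
have -> : lift 0 i = rshift 1 i by apply/val_inj.
by rewrite /consv (@row_mxEr _ 1 1 n).
Qed.

Lemma measurable_consv n : measurable_fun setT (@consv n).
Proof.
apply: measurable_rV => i; have [j ->|->] := unliftP 0 i.
  by under eq_fun do rewrite consvS; apply: measurable_coord_comp.
by under eq_fun do rewrite consv0; exact: measurable_fst.
Qed.

Section Step.
Variables (n : nat) (m : {sigma_finite_measure set 'rV[R]_n -> \bar R}).

Definition leb_step : set 'rV[R]_n.+1 -> \bar R :=
  pushforward (leb \x m)%E (@consv n).

HB.instance Definition _ := Measure.copy leb_step
  (measure_function_pushforward__canonical__measure_function_Measure
    (leb \x m)%E (@measurable_consv n)).

(** The exhausting sets are products of exhausting sets of the two factors, transported along the
    inverse [sp] of [consv]. Both exhaustions being nondecreasing, the index [maxn i j] serves for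
    both coordinates. *)
Let leb_step_sigma_finite : sigma_finite setT leb_step.
Proof.
have [F1 [F1T F1n F1m]] : exists F, [/\ [set: R] = \bigcup_i F i,
    {homo F : i j / (i <= j)%N >-> i `<=` j} & forall i, measurable (F i) /\ (leb (F i) < +oo)%E].
  have /sigma_finiteP[F [FT Fn Fm]] := @sigma_finiteT _ _ _ leb.
  by exists F; split => // i j /Fn/subsetPset.
have [F2 [F2T F2n F2m]] : exists F, [/\ [set: 'rV[R]_n] = \bigcup_i F i,
    {homo F : i j / (i <= j)%N >-> i `<=` j} & forall i, measurable (F i) /\ (m (F i) < +oo)%E].
  have /sigma_finiteP[F [FT Fn Fm]] := @sigma_finiteT _ _ _ m.
  by exists F; split => // i j /Fn/subsetPset.
pose sp (x : 'rV[R]_n.+1) : R * 'rV[R]_n := (x 0 0, \row_i x 0 (lift 0 i)).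
have msp : measurable_fun setT sp.
  apply/measurable_fun_pair; first exact: measurable_coord.
  apply: measurable_rV => i; under eq_fun do rewrite mxE; exact: measurable_coord.
exists (fun i => sp @^-1` (F1 i `*` F2 i)).
  apply/esym/seteqP; split => // x _.
  have [i _ Fi] : (\bigcup_i F1 i) (sp x).1 by rewrite -F1T.
  have [j _ Fj] : (\bigcup_i F2 i) (sp x).2 by rewrite -F2T.
  exists (maxn i j) => //; split; [apply: F1n Fi|apply: F2n Fj].
    exact: leq_maxl.
  exact: leq_maxr.
move=> i; split.
  rewrite -[X in measurable X]setTI; apply: msp => //.
  by apply: measurableX; [case: (F1m i)|case: (F2m i)].
rewrite /leb_step /pushforward.
have -> : @consv n @^-1` (sp @^-1` (F1 i `*` F2 i)) = F1 i `*` F2 i.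
  apply/seteqP; split => -[s v] /=; rewrite consv0/= (_ : \row__ _ = v) //;
    by apply/rowP => j; rewrite mxE consvS.
have [? ?] := F1m i; have [? ?] := F2m i.
by rewrite product_measure1E// lte_mul_pinfty// ge0_fin_numE.
Qed.

HB.instance Definition _ := @Measure_isSigmaFinite.Build _ _ _ leb_step leb_step_sigma_finite.

End Step.

(** The recursion copies that of [iint], so that Tonelli identifies the two integrals on nonnegative
    measurable functions ([iintE]). *)
Fixpoint lebn n : {sigma_finite_measure set 'rV[R]_n -> \bar R} :=
  match n with
  | 0 => [the {sigma_finite_measure set _ -> \bar R} of dirac (0 : 'rV[R]_0)]
  | n'.+1 => [the {sigma_finite_measure set _ -> \bar R} of leb_step (lebn n')]
  end.

Lemma integral_lebnS n (g : 'rV[R]_n.+1 -> \bar R) :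
  measurable_fun setT g -> (forall x, 0 <= g x)%E ->
  (\int[lebn n.+1]_x g x = \int[leb]_s \int[lebn n]_v g (consv (s, v)))%E.
Proof.
move=> mg g0 /=; rewrite /leb_step ge0_integral_pushforward//=; last exact: measurable_consv.
rewrite preimage_setT fubini_tonelli1//=.
by apply: measurableT_comp => //; exact: measurable_consv.
Qed.

Lemma integral_lebn0 (g : 'rV[R]_0 -> \bar R) : measurable_fun setT g ->
  (\int[lebn 0]_x g x = g 0%R)%E.
Proof. by move=> mg; rewrite integral_dirac//= diracT mul1e. Qed.

Lemma measurable_consv_sec n (g : 'rV[R]_n.+1 -> \bar R) s :
  measurable_fun setT g -> measurable_fun setT (fun v : 'rV[R]_n => g (consv (s, v))).
Proof.
move=> mg; apply: (measurableT_comp mg).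
apply: (measurableT_comp (@measurable_consv n)).
by apply/measurable_fun_pair.
Qed.

Lemma iintE n (g : 'rV[R]_n -> \bar R) :
  measurable_fun setT g -> (forall x, 0 <= g x)%E -> iint g = (\int[lebn n]_x g x)%E.
Proof.
elim: n g => [|n IH] g mg g0; first by rewrite integral_lebn0.
rewrite integral_lebnS//=; apply: eq_integral => s _; rewrite -IH//.
exact: (measurable_consv_sec s mg).
Qed.

(** The pushforward of Lebesgue measure under x |-> a x + c, scaled by |a|, gives every half-open
    interval its length, hence is Lebesgue measure by uniqueness. For a < 0 the preimage of ]p, q]
    is open at the other end, whence the two cases. *)
Lemma integral_affine1 (a c : R) (g : R -> \bar R) : a != 0 ->
  measurable_fun setT g -> (forall x, 0 <= g x)%E ->
  (`|a|%:E * \int[leb]_x g (a * x + c)%R = \int[leb]_x g x)%E.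
Proof.
move=> a0 mg g0.
have mh : measurable_fun setT (fun x : R => a * x + c : measurableTypeR R).
  by apply: measurable_funD => //; apply: measurable_funM.
pose m := mscale (NngNum (normr_ge0 a))
  (measure_function_pushforward__canonical__measure_function_Measure leb mh).
transitivity (\int[m]_x g x)%E.
  rewrite ge0_integral_mscale//; congr (_ * _)%E.
  by rewrite ge0_integral_pushforward//= preimage_setT.
apply: eq_measure_integral => A mA _; apply/esym.
apply: lebesgue_measure_unique => // _ [[p q] _ <-].
rewrite /m /= /mscale /pushforward /=.
move: a0; rewrite neq_lt => /orP[a0|a0].
  transitivity (`|a|%:E * leb `[((q - c) / a)%R, ((p - c) / a)%R[%classic)%E; last first.
    congr (_ * leb _)%E; apply/seteqP; split => x /=; rewrite !in_itv/= => /andP[];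
      rewrite ler_ndivrMr// ltr_ndivlMr// => ? ?; apply/andP; split; nra.
  rewrite !lebesgue_measure_itv/= !lte_fin ltr_nM2r ?invr_lt0// ltrD2r.
  case: ifP => // _; last by rewrite mule0.
  by rewrite -!EFinB -EFinM ltr0_norm//; congr EFin; field; rewrite lt_eqF.
transitivity (`|a|%:E * leb `]((p - c) / a)%R, ((q - c) / a)%R]%classic)%E; last first.
  congr (_ * leb _)%E; apply/seteqP; split => x /=; rewrite !in_itv/= => /andP[];
    rewrite ler_pdivlMr// ltr_pdivrMr// => ? ?; apply/andP; split; nra.
rewrite !lebesgue_measure_itv/= !lte_fin ltr_pM2r ?invr_gt0// ltrD2r.
case: ifP => // _; last by rewrite mule0.
by rewrite -!EFinB -EFinM gtr0_norm//; congr EFin; field; rewrite gt_eqF.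
Qed.

Definition affv n (a c : 'I_n -> R) (x : 'rV[R]_n) : 'rV[R]_n :=
  \row_i (a i * x 0 i + c i).

Lemma measurable_affv n (a c : 'I_n -> R) : measurable_fun setT (affv a c).
Proof.
apply: measurable_rV => i; under eq_fun do rewrite mxE.
apply: measurable_funD => //; apply: measurable_funM => //; exact: measurable_coord.
Qed.

Lemma affv_consv n (a c : 'I_n.+1 -> R) s v :
  affv a c (consv (s, v)) =
  consv (a 0 * s + c 0, affv (fun i => a (lift 0 i)) (fun i => c (lift 0 i)) v).
Proof.
apply/rowP => i; rewrite mxE; have [j ->|->] := unliftP 0 i.
  by rewrite !consvS/= mxE.
by rewrite !consv0.
Qed.

Lemma integral_affv n (a c : 'I_n -> R) (g : 'rV[R]_n -> \bar R) :
  (forall i, a i != 0) -> measurable_fun setT g -> (forall x, 0 <= g x)%E ->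
  ((\prod_i `|a i|)%R%:E * \int[lebn n]_x g (affv a c x) = \int[lebn n]_x g x)%E.
Proof.
elim: n a c g => [|n IH] a c g a0 mg g0.
  rewrite big_ord0 mul1e !integral_lebn0//; first by congr g; apply/rowP => -[].
  by apply: (measurableT_comp mg); exact: measurable_affv.
rewrite !integral_lebnS//; last first.
  by apply: measurableT_comp => //; exact: measurable_affv.
rewrite big_ord_recl EFinM -muleA.
have mG s : measurable_fun setT (fun v : 'rV_n => g (consv (s, v))).
  exact: measurable_consv_sec.
have mI : measurable_fun setT (fun s => (\int[lebn n]_v g (consv (s, v)))%E).
  apply: (measurable_fun_fubini_tonelli_F (m2 := lebn n) (fun p => g (consv p))) => //.
  by apply: measurableT_comp => //; exact: measurable_consv.
rewrite -[RHS](@integral_affine1 (a 0) (c 0))//; last by move=> x; exact: integral_ge0.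
congr (_ * _)%E; rewrite -ge0_integralZl//=; last 3 first.
- apply: (measurable_fun_fubini_tonelli_F (m2 := lebn n) (fun p => g (affv a c (consv p)))) => //.
  apply: measurableT_comp => //; apply: measurableT_comp; first exact: measurable_affv.
  exact: measurable_consv.
- by move=> s _; exact: integral_ge0.
- by rewrite lee_fin prodr_ge0.
apply: eq_integral => s _.
under eq_integral do rewrite affv_consv.
exact: (IH (fun i => a (lift 0 i)) (fun i => c (lift 0 i)) (fun v => g (consv (a 0 * s + c 0, v)))).
Qed.

Lemma integral_prodv n (h : 'I_n -> R -> R) :
  (forall i, measurable_fun setT (h i)) -> (forall i s, 0 <= h i s) ->
  (\int[lebn n]_x (\prod_i h i (x 0 i))%:E = \prod_i \int[leb]_s (h i s)%:E)%E.
Proof.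
have mP k (h' : 'I_k -> R -> R) : (forall i, measurable_fun setT (h' i)) ->
    measurable_fun setT (fun x : 'rV[R]_k => \prod_i h' i (x 0 i)).
  move=> mh; apply: measurable_prod => i _.
  by apply: measurableT_comp => //; exact: measurable_coord.
elim: n h => [|n IH] h mh h0.
  rewrite integral_lebn0; first by rewrite !big_ord0.
  by apply/measurable_EFinP; exact: (mP _ h).
rewrite integral_lebnS//; last 2 first.
- by apply/measurable_EFinP; exact: (mP _ h).
- by move=> x; rewrite lee_fin prodr_ge0.
rewrite big_ord_recl -IH//.
transitivity (\int[leb]_s ((h ord0 s)%:E * \int[lebn n]_x (\prod_i h (lift ord0 i) (x 0%R i))%:E))%E.
  apply: eq_integral => s _; rewrite -ge0_integralZl//.
  - apply: eq_integral => v _; rewrite -EFinM big_ord_recl consv0; congr (_ * _)%:E.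
    by apply: eq_bigr => i _; rewrite consvS.
  - by apply/measurable_EFinP; exact: (mP _ (fun i => h (lift ord0 i))).
  - by move=> x _; rewrite lee_fin prodr_ge0.
  - by rewrite lee_fin.
rewrite ge0_integralZr//.
- by apply/measurable_EFinP; exact: (mh ord0).
- by move=> x _; rewrite lee_fin.
- by apply: integral_ge0 => x _; rewrite lee_fin prodr_ge0.
Qed.

End RowVectorMeasure.

(** Inversion is not continuous at 0; writing 1/x as x (x^2)^(-1) reduces the claim to [powR], and
    at 0 both sides are 0 by convention. *)
Lemma measurable_invr (R : realType) : measurable_fun setT (@GRing.inv R).
Proof.
rewrite (_ : GRing.inv = fun x : R => x * (x ^+ 2) `^ (- 1)); last first.
  apply/funext => x; have [->|x0] := eqVneq x 0; first by rewrite invr0 mul0r.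
  by rewrite powR_inv1 ?sqr_ge0// expr2 invfM mulrA divff// mul1r.
apply: measurable_funM => //.
apply: (measurableT_comp (@measurable_powR R (-1))).
exact: measurable_funX.
Qed.

(** * The heat kernel as a product of one-dimensional Gaussians, and its semigroup law *)

Section Gaussian.
Variable R : realType.
Local Notation leb := (@lebesgue_measure R).

Lemma enorm_sq n (x : 'rV[R]_n) : enorm x ^+ 2 = \sum_i (x 0 i) ^+ 2.
Proof. by rewrite /enorm sqr_sqrtr// sumr_ge0// => i _; exact: sqr_ge0. Qed.

Lemma enorm_ge0 n (x : 'rV[R]_n) : 0 <= enorm x.
Proof. exact: sqrtr_ge0. Qed.

Lemma enorm_eq0 n (x : 'rV[R]_n) : (enorm x == 0) = (x == 0).
Proof.
apply/eqP/eqP => [x0|->]; last first.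
  by rewrite /enorm big1 ?sqrtr0// => i _; rewrite mxE expr0n.
apply/rowP => i; rewrite mxE; apply/eqP; rewrite -sqrf_eq0; apply/eqP.
have : enorm x ^+ 2 = 0 by rewrite x0 expr0n.
rewrite enorm_sq => /eqP; rewrite psumr_eq0; last by move=> j _; exact: sqr_ge0.
by move=> /allP /(_ i (mem_index_enum _)) /= /eqP.
Qed.

Lemma enorm_gt0 n (x : 'rV[R]_n) : (0 < enorm x) = (x != 0).
Proof. by rewrite lt0r enorm_ge0 andbT enorm_eq0. Qed.

Lemma coord_le_enorm n (x : 'rV[R]_n) i : `|x 0 i| <= enorm x.
Proof.
rewrite -ler_sqr ?nnegrE ?enorm_ge0// real_normK ?num_real// enorm_sq.
by rewrite (bigD1 i)//= lerDl sumr_ge0// => j _; exact: sqr_ge0.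
Qed.

Definition gauss1 (t s : R) : R := (4 * pi * t) `^ (- (1 / 2)) * expR (- s ^+ 2 / (4 * t)).

Lemma gauss1_normal (t s : R) : 0 < t -> gauss1 t s = normal_pdf 0 (Num.sqrt (2 * t)) s.
Proof.
move=> t0; have t2 : 0 < 2 * t by lra.
rewrite normal_pdfE; last by rewrite gt_eqF// sqrtr_gt0.
rewrite /gauss1 /normal_peak /normal_fun sqr_sqrtr ?ltW// subr0.
congr (_ * expR (_ / _)); last by rewrite -mulr_natr; ring.
rewrite powRN div1r powR12_sqrt; first by congr (_^-1); congr Num.sqrt; rewrite -mulr_natr; ring.
by rewrite !mulr_ge0// ?pi_ge0// ltW.
Qed.

Lemma gauss1_ge0 (t s : R) : 0 <= gauss1 t s.
Proof. by rewrite mulr_ge0 ?powR_ge0 ?expR_ge0. Qed.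

Lemma measurable_gauss1 (t : R) : measurable_fun setT (gauss1 t).
Proof.
apply: measurable_funM => //; apply: measurableT_comp => //.
apply: measurable_funM => //; apply: measurableT_comp => //; exact: measurable_funX.
Qed.

Lemma integral_gauss1 (t : R) : 0 < t -> (\int[leb]_s (gauss1 t s)%:E = 1)%E.
Proof.
move=> t0; under eq_integral do rewrite gauss1_normal//.
exact: integral_normal_pdf.
Qed.

(** Completing the square in r: the product is a Gaussian in a - b times a Gaussian in r centred at
    the weighted mean of a and b. *)
Lemma gauss1_mul (t s : R) (a b r : R) : 0 < t -> 0 < s ->
  gauss1 t (a - r) * gauss1 s (r - b) =
  gauss1 (t + s) (a - b) * gauss1 (t * s / (t + s)) (r - (s * a + t * b) / (t + s)).
Proof.
move=> t0 s0; have ts : 0 < t + s by lra.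
rewrite /gauss1 !mulrA (mulrAC (powR _ _) (expR _)) (mulrAC (powR _ _) (expR _) (powR _ _)).
have pp := @pi_gt0 R.
rewrite -powRM; [|by rewrite !mulr_ge0// ltW..].
rewrite -powRM; [|by rewrite !mulr_ge0// ?invr_ge0 ltW..].
rewrite -!mulrA -!expRD; congr (_ `^ _ * expR _).
  by field; rewrite gt_eqF.
by field; rewrite !gt_eqF.
Qed.

Lemma integral_gauss1_mul (t s : R) (a b : R) : 0 < t -> 0 < s ->
  (\int[leb]_r (gauss1 t (a - r) * gauss1 s (r - b))%:E = (gauss1 (t + s) (a - b))%:E)%E.
Proof.
move=> t0 s0; have ts : 0 < t + s by lra.
under eq_integral do rewrite gauss1_mul// EFinM.
set m := (s * a + t * b) / (t + s); set c := t * s / (t + s).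
have c0 : 0 < c by rewrite divr_gt0// mulr_gt0.
have m1 := measurable_gauss1 c.
rewrite ge0_integralZl//; last 3 first.
- apply/measurable_EFinP; apply: measurableT_comp => //; exact: measurable_funB.
- by move=> r _; rewrite lee_fin gauss1_ge0.
- by rewrite lee_fin gauss1_ge0.
rewrite -[RHS]mule1 -(integral_gauss1 c0); congr (_ * _)%E.
rewrite -[RHS](@integral_affine1 R 1 (- m))//; last 2 first.
- exact/measurable_EFinP.
- by move=> x; rewrite lee_fin gauss1_ge0.
by rewrite normr1 mul1e; apply: eq_integral => r _; rewrite mul1r.
Qed.

Variable N : nat.
Local Notation V := 'rV[R]_N.
Local Notation mu := (lebn R N).

Lemma heatG_prod (t : R) (x : V) : 0 < t -> heatG t x = \prod_i gauss1 t (x 0 i).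
Proof.
move=> t0; rewrite /heatG /gauss1 big_split /= prodr_const card_ord.
rewrite -expR_sum -(powR_mulrn N (powR_ge0 _ _)) -powRrM; congr (_ `^ _ * expR _).
  by field.
by rewrite enorm_sq -sumrN mulr_suml.
Qed.

Lemma heatG_ge0 (t : R) (x : V) : 0 <= heatG t x.
Proof. by rewrite mulr_ge0 ?powR_ge0 ?expR_ge0. Qed.

Lemma measurable_heatG_param d (T : measurableType d) (tau : T -> R) (xi : T -> V) :
  measurable_fun setT tau -> measurable_fun setT xi ->
  measurable_fun setT (fun p => heatG (tau p) (xi p)).
Proof.
move=> mt mx; apply: measurable_funM.
  apply: (measurableT_comp (@measurable_powR R _)); exact: measurable_funM.
apply: measurableT_comp => //; apply: measurable_funM.
  apply: measurableT_comp => //; apply: measurable_funX.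
  by apply: (measurableT_comp (@measurable_enorm R N)).
by apply: (measurableT_comp (@measurable_invr R)); exact: measurable_funM.
Qed.

Lemma measurable_heatG (t : R) : measurable_fun setT (@heatG R N t).
Proof. by apply: measurable_heatG_param. Qed.

Lemma integral_subv (g : V -> \bar R) (x : V) : measurable_fun setT g -> (forall x, 0 <= g x)%E ->
  (\int[mu]_y g (x - y)%R = \int[mu]_y g y)%E.
Proof.
move=> mg g0; rewrite -[RHS](@integral_affv R N (fun=> -1) (fun i => x 0 i))//.
rewrite big1 ?mul1e; last by move=> i _; rewrite normrN normr1.
apply: eq_integral => y _; congr g; apply/rowP => i; rewrite !mxE; ring.
Qed.

Lemma integral_addv (g : V -> \bar R) (x : V) : measurable_fun setT g -> (forall x, 0 <= g x)%E ->
  (\int[mu]_y g (y + x)%R = \int[mu]_y g y)%E.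
Proof.
move=> mg g0; rewrite -[RHS](@integral_affv R N (fun=> 1) (fun i => x 0 i))//.
rewrite big1 ?mul1e; last by move=> i _; rewrite normr1.
apply: eq_integral => y _; congr g; apply/rowP => i; rewrite !mxE; ring.
Qed.

Lemma integral_heatG (t : R) : 0 < t -> (\int[mu]_y (heatG t y)%:E = 1)%E.
Proof.
move=> t0; under eq_integral do rewrite heatG_prod//.
rewrite (@integral_prodv R N (fun=> gauss1 t)); last 2 first.
- by move=> i; exact: measurable_gauss1.
- by move=> i s; exact: gauss1_ge0.
by rewrite big1// => i _; exact: integral_gauss1.
Qed.

Lemma integral_heatG_sub (t : R) (x : V) : 0 < t -> (\int[mu]_y (heatG t (x - y))%:E = 1)%E.
Proof.
move=> t0; rewrite (integral_subv (g := fun y => (heatG t y)%:E))//.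
- exact: integral_heatG.
- by apply/measurable_EFinP; exact: measurable_heatG.
- by move=> z; rewrite lee_fin heatG_ge0.
Qed.

Lemma heatG_convolution (t s : R) (x z : V) : 0 < t -> 0 < s ->
  (\int[mu]_y (heatG t (x - y) * heatG s (y - z))%:E = (heatG (t + s) (x - z))%:E)%E.
Proof.
move=> t0 s0; have ts : 0 < t + s by lra.
under eq_integral => y _.
  rewrite !heatG_prod// -big_split /=.
  under eq_bigr do rewrite !mxE.
  over.
rewrite (@integral_prodv R N (fun i r => gauss1 t (x 0 i - r) * gauss1 s (r - z 0 i))).
- under eq_bigr do rewrite integral_gauss1_mul//.
  rewrite heatG_prod//; elim/big_ind2: _ => // [_ a _ b -> ->//|i _].
  by rewrite !mxE.
- move=> i; apply: measurable_funM; (apply: measurableT_comp; first exact: measurable_gauss1);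
    exact: measurable_funB.
- by move=> i r; rewrite mulr_ge0 ?gauss1_ge0.
Qed.

(** The heat semigroup on extended-valued functions. Tonelli and monotone limits are carried out at
    this level for nonnegative functions; [heatH] below is the real counterpart for bounded ones. *)
Definition heatE (t : R) (w : V -> \bar R) (x : V) : \bar R :=
  (\int[mu]_y ((heatG t (x - y))%:E * w y))%E.

Lemma heatE_ge0 (t : R) (w : V -> \bar R) (x : V) : (forall y, 0 <= w y)%E -> (0 <= heatE t w x)%E.
Proof. by move=> w0; apply: integral_ge0 => y _; rewrite mule_ge0// lee_fin heatG_ge0. Qed.

Lemma measurable_heatE_param d (T : measurableType d) (tau : T -> R) (xi : T -> V)
    (w : T * V -> \bar R) :
  measurable_fun setT tau -> measurable_fun setT xi -> measurable_fun setT w ->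
  (forall p, 0 <= w p)%E ->
  measurable_fun setT (fun p => heatE (tau p) (fun y => w (p, y)) (xi p)).
Proof.
move=> mt mx mw w0.
apply: (measurable_fun_fubini_tonelli_F
  (fun q : T * V => ((heatG (tau q.1) (xi q.1 - q.2))%:E * w q)%E)); last first.
  by move=> q; rewrite mule_ge0// lee_fin heatG_ge0.
apply: emeasurable_funM => //; apply/measurable_EFinP; apply: measurable_heatG_param.
  exact: measurableT_comp.
by apply: measurable_subv => //; exact: measurableT_comp.
Qed.

Lemma measurable_heatE (t : R) (w : V -> \bar R) : measurable_fun setT w -> (forall y, 0 <= w y)%E ->
  measurable_fun setT (heatE t w).
Proof.
move=> mw w0; apply: (@measurable_heatE_param _ _ (fun=> t) id (fun p => w p.2)) => //.
exact: measurableT_comp.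
Qed.

Lemma measurable_heat_integrand (t : R) (w : V -> \bar R) (x : V) : measurable_fun setT w ->
  measurable_fun setT (fun y : V => ((heatG t (x - y))%:E * w y)%E).
Proof.
move=> mw; apply: emeasurable_funM => //; apply/measurable_EFinP.
by apply: measurable_heatG_param => //; exact: measurable_subv.
Qed.

Lemma heatE_semigroup (t s : R) (w : V -> \bar R) (x : V) : 0 < t -> 0 < s ->
  measurable_fun setT w -> (forall y, 0 <= w y)%E ->
  heatE t (heatE s w) x = heatE (t + s) w x.
Proof.
move=> t0 s0 mw w0; rewrite /heatE.
pose k := fun q : V * V => ((heatG t (x - q.1) * heatG s (q.1 - q.2))%:E * w q.2)%E.
have mk : measurable_fun setT k.
  apply: emeasurable_funM; last exact: measurableT_comp.
  apply/measurable_EFinP; apply: measurable_funM; apply: measurable_heatG_param => //;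
    exact: measurable_subv.
have k0 q : (0 <= k q)%E by rewrite mule_ge0// lee_fin mulr_ge0// heatG_ge0.
transitivity (\int[mu]_y \int[mu]_z k (y, z))%E.
  apply: eq_integral => y _; rewrite -ge0_integralZl//; last 3 first.
  - exact: measurable_heat_integrand.
  - by move=> z _; rewrite mule_ge0// lee_fin heatG_ge0.
  - by rewrite lee_fin heatG_ge0.
  by apply: eq_integral => z _; rewrite /k/= EFinM muleA.
rewrite fubini_tonelli//; apply: eq_integral => z _.
rewrite -heatG_convolution// -ge0_integralZr//; last 2 first.
- apply/measurable_EFinP; apply: measurable_funM; apply: measurable_heatG_param => //;
    exact: measurable_subv.
- by move=> y _; rewrite lee_fin mulr_ge0// heatG_ge0.
Qed.

End Gaussian.

Section RealParametricIntegral.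
Context d1 d2 (T1 : measurableType d1) (T2 : measurableType d2) (R : realType).
Variable m2 : {sigma_finite_measure set T2 -> \bar R}.

(** Positive and negative parts are treated separately, because measurability of parametric
    integrals comes from Tonelli for nonnegative integrands. *)
Lemma measurable_Rintegral_param (k : T1 * T2 -> R) : measurable_fun setT k ->
  measurable_fun setT (fun p => \int[m2]_y k (p, y)).
Proof.
move=> mk; rewrite /Rintegral; apply: measurableT_comp => //.
under eq_fun do rewrite integralE.
have mk' : measurable_fun setT (EFin \o k) by exact/measurable_EFinP.
have mp := measurable_funepos mk'; have mn := measurable_funeneg mk'.
apply: emeasurable_funB.
  rewrite (_ : (fun _ => _) = fubini_F m2 (EFin \o k)^\+%E).
    by apply: measurable_fun_fubini_tonelli_F => // q; exact: funepos_ge0.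
  by apply/funext => x; apply: eq_integral => y _; rewrite !funeposE.
rewrite (_ : (fun _ => _) = fubini_F m2 (EFin \o k)^\-%E).
  by apply: measurable_fun_fubini_tonelli_F => // q; exact: funeneg_ge0.
by apply/funext => x; apply: eq_integral => y _; rewrite !funenegE.
Qed.

End RealParametricIntegral.

Section BoundedMul.
Context d (T : measurableType d) (R : realType) (mu : {measure set T -> \bar R}).

Lemma integrable_mul_bounded (D : set T) (k w : T -> R) (B : R) : measurable D ->
  mu.-integrable D (EFin \o k) -> measurable_fun D w -> (forall y, D y -> `|w y| <= B) ->
  mu.-integrable D (fun y => (k y * w y)%:E).
Proof.
move=> mD ik mw wB; have mk : measurable_fun D k by apply/measurable_EFinP; case/integrableP: ik.
apply: (le_integrable mD (f := fun y => (k y * w y)%:E) (g := fun y => (B%:E * (EFin \o k) y)%E)).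
- by apply/measurable_EFinP; exact: measurable_funM.
- move=> y Dy; rewrite /= !lee_fin !normrM mulrC ler_wpM2r//.
  by rewrite (le_trans (wB _ Dy))// ler_norm.
- exact: integrableZl.
Qed.

Lemma normr_Rintegral_le (D : set T) (k g : T -> R) : measurable D ->
  mu.-integrable D (EFin \o k) -> mu.-integrable D (EFin \o g) ->
  (forall y, D y -> `|k y| <= g y) -> `|\int[mu]_(y in D) k y| <= \int[mu]_(y in D) g y.
Proof.
move=> mD ik ig kg; apply: (le_trans (le_normr_Rintegral mD ik)).
apply: le_Rintegral => //.
by have := integrable_abse ik; apply: eq_integrable.
Qed.

End BoundedMul.

Section LineDerivative.
Variable R : realType.

(** Moves directional derivatives to the real line, where the chain rule, the mean value theorem and
    differentiation under the integral are available. *)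
Lemma derive_line (U : normedModType R) (f : U -> R) x v (l : R) :
  is_derive x v f l <-> is_derive (0 : R) 1 (fun s : R => f (s *: v + x)) l.
Proof.
have E : (fun h : R => h^-1 *: ((f \o shift x) (h *: v) - f x)) =
    (fun h : R => h^-1 *: (((fun s : R => f (s *: v + x)) \o shift 0) (h *: 1) - f (0 *: v + x))).
  by apply/funext => h /=; rewrite scale0r add0r addr0 [h *: 1]mulr1.
split=> -[H1 H2]; (apply: DeriveDef; [move: H1|move: H2]); by rewrite /derivable /derive E.
Qed.

Lemma derive_line_at (U : normedModType R) (f : U -> R) x v (s l : R) :
  is_derive (s *: v + x) v f l <-> is_derive s 1 (fun s : R => f (s *: v + x)) l.
Proof.
rewrite derive_line.
have E : (fun h : R => h^-1 *: (((fun s : R => f (s *: v + x)) \o shift s) (h *: 1) - f (s *: v + x))) =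
    (fun h : R => h^-1 *: (((fun r : R => f (r *: v + (s *: v + x))) \o shift 0) (h *: 1)
      - f (0 *: v + (s *: v + x)))).
  by apply/funext => h /=; rewrite scale0r add0r addr0 addrA -scalerDl.
split=> -[H1 H2]; (apply: DeriveDef; [move: H1|move: H2]); by rewrite /derivable /derive E.
Qed.

End LineDerivative.

(** * Heat operators on bounded functions: first derivatives *)

Section HeatOperators.
Variables (R : realType) (N : nat).
Local Notation V := 'rV[R]_N.
Local Notation mu := (lebn R N).
Local Notation leb := (@lebesgue_measure R).

Definition heatDG (j : 'I_N) (t : R) (z : V) : R := - (z 0 j / (2 * t)) * heatG t z.

Definition heatH (t : R) (w : V -> R) (x : V) : R := \int[mu]_y (heatG t (x - y) * w y).

Definition heatK (j : 'I_N) (t : R) (w : V -> R) (x : V) : R :=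
  \int[mu]_y (heatDG j t (x - y) * w y).

Definition bmeas (B : R) (w : V -> R) := measurable_fun setT w /\ forall x, `|w x| <= B.

Lemma measurable_heatDG_param d (T : measurableType d) j (tau : T -> R) (xi : T -> V) :
  measurable_fun setT tau -> measurable_fun setT xi ->
  measurable_fun setT (fun p => heatDG j (tau p) (xi p)).
Proof.
move=> mt mx; apply: measurable_funM; last exact: measurable_heatG_param.
apply: measurableT_comp => //; apply: measurable_funM; first exact: measurable_coord_comp.
by apply: (measurableT_comp (@measurable_invr R)); exact: measurable_funM.
Qed.

Lemma integrable_heatG_sub (t : R) (x : V) : 0 < t ->
  mu.-integrable setT (fun y => (heatG t (x - y))%:E).
Proof.
move=> t0; apply/integrableP; split.
  apply/measurable_EFinP; apply: measurable_heatG_param => //; exact: measurable_subv.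
under eq_integral do rewrite /= ger0_norm ?heatG_ge0//.
by rewrite integral_heatG_sub// ltry.
Qed.

Lemma Rintegral_heatG_sub (t : R) (x : V) : 0 < t -> \int[mu]_y (heatG t (x - y)) = 1.
Proof. by move=> t0; rewrite /Rintegral integral_heatG_sub. Qed.

(** The normalising factor lost when G_t, possibly times a polynomial, is dominated by the wider
    Gaussian G_2t. All kernel estimates have this form, so that their integrals are explicit
    constants. *)
Definition cN : R := 2 `^ (N%:R / 2).

Lemma cN_ge0 : 0 <= cN. Proof. exact: powR_ge0. Qed.

Lemma heatG_2t (t : R) (z : V) : 0 < t ->
  (4 * pi * t) `^ (- (N%:R / 2)) * expR (- enorm z ^+ 2 / (8 * t)) = cN * heatG (2 * t) z.
Proof.
move=> t0; rewrite /heatG /cN mulrA; congr (_ * expR (_ / _)); last by ring.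
have pp := @pi_gt0 R.
rewrite (_ : 4 * pi * (2 * t) = 2 * (4 * pi * t)); last by ring.
rewrite (@powRM R 2 (4 * pi * t)) ?mulr_ge0 ?ltW//.
by rewrite mulrA [in X in _ = _ * X * _]powRN divff ?mul1r// gt_eqF// powR_gt0.
Qed.

(** From |z|^2 <= 2 |z'|^2 + 2 |z' - z|^2. One integrable function thus dominates the kernel along a
    whole segment, as differentiation under the integral requires. *)
Lemma heatG_shift_le (t : R) (z z' : V) : 0 < t -> enorm (z' - z) ^+ 2 <= 1 ->
  heatG t z' <= cN * expR (1 / (4 * t)) * heatG (2 * t) z.
Proof.
move=> t0 zz; rewrite mulrAC -heatG_2t// -[leRHS]mulrA /heatG -expRD ler_wpM2l ?powR_ge0// ler_expR.
have : enorm z ^+ 2 <= 2 * enorm z' ^+ 2 + 2 * enorm (z' - z) ^+ 2.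
  rewrite !enorm_sq !mulr_sumr -big_split /= ler_sum// => i _; rewrite !mxE.
  have := sqr_ge0 (z' 0 i + (z' 0 i - z 0 i)); nra.
move=> H; rewrite (_ : _ + _ = (2 - enorm z ^+ 2) / (8 * t)); last by field; rewrite gt_eqF.
rewrite (_ : - enorm z' ^+ 2 / (4 * t) = (- 2 * enorm z' ^+ 2) / (8 * t)); last first.
  by field; rewrite gt_eqF.
by rewrite ler_pM2r ?invr_gt0 ?mulr_gt0//; lra.
Qed.

Lemma heatDG_le j (t : R) (z : V) : 0 < t ->
  `|heatDG j t z| <= Num.sqrt 2 * cN / Num.sqrt t * heatG (2 * t) z.
Proof.
move=> t0; rewrite /heatDG normrM normrN (ger0_norm (heatG_ge0 _ _)).
rewrite -(mulrA _ _ (heatG _ _)) -mulrA [_^-1 * _]mulrC (mulrA cN) -heatG_2t//.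
have st : 0 < Num.sqrt t by rewrite sqrtr_gt0.
have s2 : Num.sqrt t ^+ 2 = t by rewrite sqr_sqrtr// ltW.
have r2 : Num.sqrt 2 ^+ 2 = 2 :> R by rewrite sqr_sqrtr.
have r20 : 0 < Num.sqrt 2 :> R by rewrite sqrtr_gt0.
rewrite /heatG.
set c := (_ `^ _); set e := enorm z ^+ 2.
(* One half of the exponent is kept for G_2t; the other half, [E], absorbs the linear factor because
   y exp(- y^2) <= 1. *)
have -> : - e / (4 * t) = - e / (8 * t) + - e / (8 * t) by field; rewrite gt_eqF.
rewrite expRD; set E := expR _.
have E0 : 0 < E by exact: expR_gt0.
have c0 : 0 <= c by exact: powR_ge0.
suff H : `|z 0 j / (2 * t)| * E <= Num.sqrt 2 / Num.sqrt t.
  rewrite (_ : _ * (c * (E * E)) = (c * E) * (`|z 0 j / (2 * t)| * E)); last by ring.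
  rewrite (_ : Num.sqrt 2 * _ = (c * E) * (Num.sqrt 2 / Num.sqrt t)); last by ring.
  by rewrite ler_wpM2l// mulr_ge0// ltW.
set y := enorm z / (2 * Num.sqrt 2 * Num.sqrt t).
have y2 : y ^+ 2 = e / (8 * t).
  rewrite /y exprMn exprVn !exprMn s2 r2 /e; field; rewrite gt_eqF//.
have Ey : y * E <= 1.
  rewrite /E mulNr -y2 expRN ler_pdivrMr ?expR_gt0// mul1r.
  apply: (le_trans _ (expR_ge1Dx _)); nra.
have zy : `|z 0 j / (2 * t)| <= y * (Num.sqrt 2 / Num.sqrt t).
  rewrite normrM [X in _ * X]gtr0_norm ?invr_gt0 ?mulr_gt0//.
  rewrite (_ : y * _ = enorm z / (2 * t)); last first.
    by rewrite -[X in _ = _ / (2 * X)]s2 /y; field; rewrite !gt_eqF.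
  by apply: ler_wpM2r; [rewrite invr_ge0 mulr_ge0// ltW|exact: coord_le_enorm].
apply: (le_trans (ler_wpM2r (ltW E0) zy)).
rewrite mulrAC -[leRHS]mul1r ler_wpM2r// divr_ge0// ltW//.
Qed.

Lemma integrable_heatDG_sub j (t : R) (x : V) : 0 < t ->
  mu.-integrable setT (fun y => (heatDG j t (x - y))%:E).
Proof.
move=> t0.
apply: (@le_integrable _ _ _ mu setT _ ( fun y => (heatDG j t (x - y))%:E)
  (fun y => ((Num.sqrt 2 * cN / Num.sqrt t)%:E * (heatG (2 * t) (x - y))%:E)%E)) => //.
- apply/measurable_EFinP; apply: measurable_heatDG_param => //; exact: measurable_subv.
- by move=> y _; rewrite -EFinM /= lee_fin (le_trans (heatDG_le _ _ t0))// ler_norm.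
- by apply: integrableZl => //; apply: integrable_heatG_sub; rewrite mulr_gt0.
Qed.

Lemma integrable_heatH (t B : R) (w : V -> R) (x : V) : 0 < t -> bmeas B w ->
  mu.-integrable setT (fun y => (heatG t (x - y) * w y)%:E).
Proof.
move=> t0 [mw wB]; apply: (integrable_mul_bounded (B := B)) => //.
exact: (integrable_heatG_sub x t0).
Qed.

Lemma integrable_heatK j (t B : R) (w : V -> R) (x : V) : 0 < t -> bmeas B w ->
  mu.-integrable setT (fun y => (heatDG j t (x - y) * w y)%:E).
Proof.
move=> t0 [mw wB]; apply: (integrable_mul_bounded (B := B)) => //.
exact: (integrable_heatDG_sub j x t0).
Qed.

Lemma bmeas_ge0 B w : bmeas B w -> 0 <= B.
Proof. by case=> _ /(_ 0); apply: le_trans. Qed.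

Lemma heatH_le (t B : R) (w : V -> R) (x : V) : 0 < t -> bmeas B w -> `|heatH t w x| <= B.
Proof.
move=> t0 bw; have ig := integrable_heatG_sub x t0.
apply: (@le_trans _ _ (\int[mu]_y (B * heatG t (x - y)))).
  apply: normr_Rintegral_le => //; first exact: (integrable_heatH x t0 bw).
    exact: (integrableZl _ _ ig).
  move=> y _; rewrite normrM ger0_norm ?heatG_ge0// mulrC ler_wpM2r ?heatG_ge0//.
  by case: bw.
by rewrite RintegralZl// Rintegral_heatG_sub// mulr1.
Qed.

Lemma heatK_le j (t B : R) (w : V -> R) (x : V) : 0 < t -> bmeas B w ->
  `|heatK j t w x| <= Num.sqrt 2 * cN / Num.sqrt t * B.
Proof.
move=> t0 bw; have t2 : 0 < 2 * t by lra.
have ig := integrable_heatG_sub x t2.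
set c := (_ / _); have c0 : 0 <= c by rewrite divr_ge0 ?mulr_ge0 ?sqrtr_ge0 ?cN_ge0.
apply: (@le_trans _ _ (\int[mu]_y (c * B * heatG (2 * t) (x - y)))).
  apply: normr_Rintegral_le => //; first exact: (integrable_heatK j x t0 bw).
    exact: (integrableZl _ _ ig).
  move=> y _; rewrite normrM mulrAC; apply: ler_pM => //; first exact: heatDG_le.
  by case: bw.
by rewrite RintegralZl// Rintegral_heatG_sub// mulr1.
Qed.

Lemma heatHD (t B1 B2 : R) w1 w2 x : 0 < t -> bmeas B1 w1 -> bmeas B2 w2 ->
  heatH t (fun y => w1 y + w2 y) x = heatH t w1 x + heatH t w2 x.
Proof.
move=> t0 b1 b2; rewrite /heatH -RintegralD//.
- by apply: eq_Rintegral => y _; rewrite mulrDr.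
- exact: (integrable_heatH x t0 b1).
- exact: (integrable_heatH x t0 b2).
Qed.

Lemma heatHB (t B1 B2 : R) w1 w2 x : 0 < t -> bmeas B1 w1 -> bmeas B2 w2 ->
  heatH t (fun y => w1 y - w2 y) x = heatH t w1 x - heatH t w2 x.
Proof.
move=> t0 b1 b2; rewrite /heatH -RintegralB//.
- by apply: eq_Rintegral => y _; rewrite mulrBr.
- exact: (integrable_heatH x t0 b1).
- exact: (integrable_heatH x t0 b2).
Qed.

Lemma heatKB j (t B1 B2 : R) w1 w2 x : 0 < t -> bmeas B1 w1 -> bmeas B2 w2 ->
  heatK j t (fun y => w1 y - w2 y) x = heatK j t w1 x - heatK j t w2 x.
Proof.
move=> t0 b1 b2; rewrite /heatK -RintegralB//.
- by apply: eq_Rintegral => y _; rewrite mulrBr.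
- exact: (integrable_heatK j x t0 b1).
- exact: (integrable_heatK j x t0 b2).
Qed.

Lemma heatH_cst (t c : R) x : 0 < t -> heatH t (fun=> c) x = c.
Proof.
move=> t0; rewrite /heatH; have ig := integrable_heatG_sub x t0.
by rewrite RintegralZr// Rintegral_heatG_sub// mul1r.
Qed.

Lemma bmeas_cst (c : R) : bmeas `|c| (fun=> c).
Proof. by split. Qed.

Lemma bmeasD B1 B2 w1 w2 : bmeas B1 w1 -> bmeas B2 w2 -> bmeas (B1 + B2) (fun y => w1 y + w2 y).
Proof.
move=> [m1 b1] [m2 b2]; split; first exact: measurable_funD.
by move=> x; apply: (le_trans (ler_normD _ _)); exact: lerD.
Qed.

Lemma bmeasB B1 B2 w1 w2 : bmeas B1 w1 -> bmeas B2 w2 -> bmeas (B1 + B2) (fun y => w1 y - w2 y).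
Proof.
move=> [m1 b1] [m2 b2]; split; first exact: measurable_funB.
by move=> x; apply: (le_trans (ler_normB _ _)); exact: lerD.
Qed.

Lemma measurable_heatH (t : R) (w : V -> R) : measurable_fun setT w -> measurable_fun setT (heatH t w).
Proof.
move=> mw; apply: (@measurable_Rintegral_param _ _ _ _ _ mu
  (fun q : V * V => heatG t (q.1 - q.2) * w q.2)).
apply: measurable_funM; last exact: measurableT_comp.
by apply: measurable_heatG_param => //; exact: measurable_subv.
Qed.

Lemma bmeas_heatH (t B : R) (w : V -> R) : 0 < t -> bmeas B w -> bmeas B (heatH t w).
Proof.
move=> t0 bw; split; first by apply: measurable_heatH; case: bw.
by move=> x; exact: heatH_le.
Qed.

Lemma heatH_heatE (t B : R) (w : V -> R) (x : V) : 0 < t -> bmeas B w ->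
  (heatH t w x)%:E = heatE t (EFin \o w) x.
Proof.
move=> t0 bw; rewrite /heatH /Rintegral fineK//.
exact: (integrable_fin_num _ (integrable_heatH x t0 bw)).
Qed.

(** [heatE_semigroup] concerns nonnegative functions; adding the constant [B], which every heat
    operator reproduces, makes [w] nonnegative. *)
Lemma heatH_semigroup (t s B : R) (w : V -> R) (x : V) : 0 < t -> 0 < s -> bmeas B w ->
  heatH t (heatH s w) x = heatH (t + s) w x.
Proof.
move=> t0 s0 bw; have ts : 0 < t + s by lra.
have B0 := bmeas_ge0 bw.
have bB := bmeas_cst B; have bwB := bmeasD bw bB.
have E u y : 0 < u -> heatH u w y = heatH u (fun z => w z + B) y - B.
  by move=> u0; rewrite (heatHD _ u0 bw bB) heatH_cst// addrK.
have bh := bmeas_heatH s0 bw; have bhB := bmeas_heatH s0 bwB.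
have wB0 y : (0 <= (EFin \o (fun z => w z + B)%R) y)%E.
  by rewrite lee_fin; case: bw => _ /(_ y); rewrite ler_norml => /andP[]; lra.
have mwB : measurable_fun setT (EFin \o (fun z => w z + B)).
  by apply/measurable_EFinP; case: bwB.
rewrite (E _ x ts).
have -> : heatH s w = fun y => heatH s (fun z => w z + B) y - B.
  by apply/funext => y; exact: E.
rewrite (heatHB _ t0 bhB bB) heatH_cst//; congr (_ - _).
apply: EFin_inj; rewrite (heatH_heatE _ t0 bhB) (heatH_heatE _ ts bwB).
rewrite -heatE_semigroup//; congr heatE; apply/funext => y /=.
exact: (heatH_heatE _ s0 bwB).
Qed.

Lemma Rintegral_subv (g : V -> R) (x : V) : measurable_fun setT g ->
  \int[mu]_y g (x - y) = \int[mu]_y g y.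
Proof.
move=> mg; have mE : measurable_fun setT (EFin \o g) by exact/measurable_EFinP.
rewrite /Rintegral; congr fine; rewrite integralE [RHS]integralE; congr (_ - _)%E.
  apply: etrans (integral_subv x (measurable_funepos mE) (funepos_ge0 _)).
  by apply: eq_integral => y _; rewrite !funeposE.
apply: etrans (integral_subv x (measurable_funeneg mE) (funeneg_ge0 _)).
by apply: eq_integral => y _; rewrite !funenegE.
Qed.

Lemma Rintegral_addv (g : V -> R) (x : V) : measurable_fun setT g ->
  \int[mu]_y g (y + x) = \int[mu]_y g y.
Proof.
move=> mg; have mE : measurable_fun setT (EFin \o g) by exact/measurable_EFinP.
rewrite /Rintegral; congr fine; rewrite integralE [RHS]integralE; congr (_ - _)%E.
  apply: etrans (integral_addv x (measurable_funepos mE) (funepos_ge0 _)).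
  by apply: eq_integral => y _; rewrite !funeposE.
apply: etrans (integral_addv x (measurable_funeneg mE) (funeneg_ge0 _)).
by apply: eq_integral => y _; rewrite !funenegE.
Qed.

Lemma heatHE (t : R) (w : V -> R) (x : V) : measurable_fun setT w ->
  heatH t w x = \int[mu]_z (heatG t z * w (x - z)).
Proof.
move=> mw; rewrite -(Rintegral_subv (g := fun z => heatG t z * w (x - z)) x).
  by apply: eq_Rintegral => y _; rewrite subKr.
apply: measurable_funM; first exact: measurable_heatG.
by apply: measurableT_comp => //; exact: measurable_subv.
Qed.

Lemma heatK_shift j (t : R) (w : V -> R) (x h : V) : measurable_fun setT w ->
  heatK j t w (x + h) = heatK j t (fun y => w (y + h)) x.
Proof.
move=> mw; rewrite /heatK -(Rintegral_addv (g := fun y => heatDG j t (x + h - y) * w y) h).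
  by apply: eq_Rintegral => y _; rewrite opprD addrACA subrr addr0.
apply: measurable_funM => //; apply: measurable_heatDG_param => //; exact: measurable_subv.
Qed.

Lemma enorm_line (s : R) j (z : V) :
  enorm (s *: ei R j + z) ^+ 2 = enorm z ^+ 2 + 2 * s * z 0 j + s ^+ 2.
Proof.
rewrite !enorm_sq (bigD1 j)//= [in RHS](bigD1 j)//= !mxE !eqxx mulr1.
rewrite (eq_bigr (fun i => z 0 i ^+ 2)); first by ring.
by move=> i ij; rewrite !mxE (negbTE ij) andbF mulr0 add0r.
Qed.

Lemma is_derive_heatG_line j (t s : R) (z : V) : 0 < t ->
  is_derive s 1 (fun s => heatG t (s *: ei R j + z)) (heatDG j t (s *: ei R j + z)).
Proof.
move=> t0; rewrite /heatDG /heatG.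
under eq_fun do rewrite enorm_line.
rewrite enorm_line.
set c := (4 * pi * t) `^ _.
pose g := fun s : R => - (enorm z ^+ 2 + 2 * s * z 0 j + s ^+ 2) / (4 * t).
have dg : is_derive s 1 g (- (2 * z 0 j + 2 * s) / (4 * t)).
  rewrite /g; apply: is_derive_eq.
  by rewrite /GRing.scale /=; field; rewrite gt_eqF.
have dE := is_deriveZ c (is_derive1_comp (is_derive_expR (g s)) dg).
apply: is_derive_eq.
rewrite /GRing.scale /= /g !mxE !eqxx mulr1; field; rewrite gt_eqF//.
Qed.

Lemma heatH_derive j (t B : R) (w : V -> R) (x : V) : 0 < t -> bmeas B w ->
  is_derive x (ei R j) (heatH t w) (heatK j t w x).
Proof.
move=> t0 bw; apply/derive_line.
pose f (s : R) (y : V) := heatG t (s *: ei R j + x - y) * w y.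
have B0 := bmeas_ge0 bw.
have df (s : R) (y : V) : is_derive s 1 (f ^~ y) (heatDG j t (s *: ei R j + x - y) * w y).
  have := is_derive_heatG_line j s (x - y) t0; rewrite addrA => H.
  have E : f ^~ y = (fun s => w y *: heatG t (s *: ei R j + (x - y))).
    by apply/funext => r; rewrite /f addrA /GRing.scale /= mulrC.
  by rewrite E mulrC; exact: (is_deriveZ (w y) H).
have t2 : 0 < 2 * t by lra.
have t4 : 0 < 2 * (2 * t) by lra.
(* Majorant for |s| < 1: the bound on the differentiated kernel leads from G_t to G_2t, the shift by
   s from G_2t to G_4t. *)
pose C := Num.sqrt 2 * cN / Num.sqrt t * (cN * expR (1 / (4 * (2 * t)))) * B.
pose Gd (y : V) : R := C * heatG (2 * (2 * t)) (x - y).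
have C0 : 0 <= C.
  by rewrite !mulr_ge0 ?invr_ge0 ?sqrtr_ge0 ?cN_ge0 ?expR_ge0.
have iG : mu.-integrable setT (EFin \o Gd).
  exact: (integrableZl _ _ (integrable_heatG_sub x t4)).
have fb (s : R) (y : V) : `]-1, 1[%classic s -> setT y -> `|partial1of2 f s y| <= Gd y.
  move=> /=; rewrite in_itv/= => /andP[s1 s2] _.
  rewrite partial1of2E derive_val normrM /Gd /C.
  rewrite (mulrAC _ B) -(mulrA (Num.sqrt 2 * cN / Num.sqrt t)).
  apply: ler_pM => //; last by case: bw.
  apply: (le_trans (heatDG_le _ _ t0)).
  rewrite ler_wpM2l ?divr_ge0 ?mulr_ge0 ?sqrtr_ge0 ?cN_ge0//.
  apply: heatG_shift_le => //.
  rewrite (_ : _ - _ = s *: ei R j + 0); last by rewrite addr0 -(addrA (s *: ei R j)) addrK.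
  rewrite enorm_line mxE mulr0 addr0 (_ : enorm 0 = 0) ?expr0n ?add0r; first by nra.
  by apply/eqP; rewrite enorm_eq0.
have mint s : mu.-integrable setT (EFin \o f s).
  by rewrite /f; exact: (integrable_heatH (s *: ei R j + x) t0 bw).
have I0 : `]-1, 1[%classic (0 : R) by rewrite /= in_itv/=; apply/andP; split; lra.
have derf (s : R) (y : V) : `]-1, 1[%classic s -> setT y -> derivable (f ^~ y) s 1.
  by move=> _ _; case: (df s y).
have Gd0 y : 0 <= Gd y by rewrite mulr_ge0// heatG_ge0.
have H1 := derivable_under_integral (mu := mu) measurableT I0 (fun s _ => mint s) derf Gd0 iG fb.
have H2 := differentiation_under_integral (mu := mu) measurableT I0 (fun s _ => mint s) derf Gd0 iG fb.
apply: DeriveDef; first exact: H1.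
rewrite -derive1E H2; apply: eq_Rintegral => y _.
by rewrite partial1of2E derive_val scale0r add0r.
Qed.

End HeatOperators.

Lemma measurable_uncurry d d1 d2 d3 (T : measurableType d) (T1 : measurableType d1)
    (T2 : measurableType d2) (U : measurableType d3) (h : T1 -> T2 -> U) (xi : T -> T1) (tau : T -> T2) :
  measurable_fun setT (fun q : T1 * T2 => h q.1 q.2) ->
  measurable_fun setT xi -> measurable_fun setT tau ->
  measurable_fun setT (fun p => h (xi p) (tau p)).
Proof.
move=> mh mx mt; exact: (measurableT_comp mh (measurable_fun_pair mx mt)).
Qed.

Lemma is_derive_ext (K : numFieldType) (U W : normedModType K) (x v : U) (f g : U -> W) (l m : W) :
  is_derive x v f l -> (forall y, f y = g y) -> l = m -> is_derive x v g m.
Proof. by move=> df /funext <- <-. Qed.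

Section OneDim.
Variable R : realType.
Local Notation leb := (@lebesgue_measure R).

Lemma lip_of_derive (phi dphi : R -> R) (C a b : R) :
  (forall s : R, is_derive s 1 phi (dphi s)) -> (forall s, `|dphi s| <= C) ->
  `|phi b - phi a| <= C * `|b - a|.
Proof.
move=> dp dC; wlog ab : a b / a <= b.
  move=> H; have [|/ltW] := leP a b; first exact: H.
  by move=> /H; rewrite distrC (distrC a b).
have [|c _ ->] := @MVT_segment R phi dphi a b ab (fun x _ => dp x).
  by apply: derivable_within_continuous => x _; case: (dp x).
by rewrite normrM ler_wpM2r.
Qed.

(** The fundamental theorem with possibly singular endpoints: it holds on closed subintervals, where
    the increment of [F] is at most [C], and monotone convergence extends the bound to the open
    interval. *)
Lemma ge0_integral_itvoo_le (f F : R -> R) (a b C : R) :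
  (forall x, a < x < b -> 0 <= f x) ->
  (forall x, a < x < b -> is_derive x 1 F (f x)) ->
  (forall x, a < x < b -> {for x, continuous f}) ->
  (forall x y, a < x -> x < y -> y < b -> F y - F x <= C) -> 0 <= C ->
  (\int[leb]_(x in `]a, b[) (f x)%:E <= C%:E)%E.
Proof.
move=> f0 dF cf FC C0.
have [ab|ba] := ltP a b; last first.
  rewrite (_ : `]a, b[%classic = set0) ?integral_set0 ?lee_fin//.
  by rewrite -subset0 => x /=; rewrite in_itv/= => /andP[]; lra.
(* The offset 3 keeps the margin removed at each end below half of the interval, so that no [S n]
   degenerates. *)
pose S (n : nat) := `[a + (b - a) / (n.+3)%:R, b - (b - a) / (n.+3)%:R]%classic : set R.
have S1 n : 0 < (b - a) / n.+3%:R /\ (b - a) / n.+3%:R < (b - a) / 2.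
  have n3 : (2 : R) < n.+3%:R by rewrite ltr_nat.
  split; first by rewrite divr_gt0; lra.
  by rewrite ltr_pM2l; [rewrite ltf_pV2 ?posrE; lra|lra].
have Sn n x : S n x -> a < x < b.
  move: (S1 n); rewrite /S /= in_itv/=; set e := _ / _ => -[? ?] /andP[? ?].
  by apply/andP; split; lra.
have cw n : {within S n, continuous f}.
  apply: continuous_in_subspaceT => x /set_mem /Sn; exact: cf.
have -> : `]a, b[%classic = \bigcup_n S n.
  apply/seteqP; split => x /=; last by move=> [n _ /Sn]; rewrite in_itv.
  rewrite in_itv/= => /andP[ax xb].
  have e0 : 0 < Num.min (x - a) (b - x) / (b - a).
    by rewrite divr_gt0 ?lt_min; [|apply/andP; split|]; lra.
  have [n _ /(_ n (leqnn _)) /= nP] := near_infty_natSinv_lt (PosNum e0).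
  exists n => //; rewrite /S /= in_itv/=.
  have : (b - a) / n.+3%:R <= Num.min (x - a) (b - x).
    rewrite mulrC -ler_pdivlMr ?subr_gt0//; apply: le_trans (ltW nP).
    by rewrite lef_pV2 ?posrE ?ltr0n// ler_nat; apply/leqW/leqW.
  by set e := _ / _; rewrite le_min => /andP[? ?]; apply/andP; split; lra.
have mS n : measurable (S n) by exact: measurable_itv.
suff cv : (\int[leb]_(x in S i) (f x)%:E)%E @[i --> \oo] --> (\int[leb]_(x in \bigcup_n S n) (f x)%:E)%E.
  rewrite -(cvg_lim _ cv)//; apply: lime_le.
    apply: ereal_nondecreasing_is_cvgn => m n mn.
    apply: ge0_subset_integral => //.
    + exact: mS.
    + exact: mS.
    + by apply/measurable_EFinP; exact: subspace_continuous_measurable_fun.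
    + by move=> x /Sn /f0; rewrite lee_fin.
    + rewrite /S => x /=; rewrite !in_itv/= => /andP[H H0].
      have : (b - a) / n.+3%:R <= (b - a) / m.+3%:R.
        by rewrite ler_pM2l ?subr_gt0// lef_pV2 ?posrE ?ltr0n// ler_nat.
      by move: H H0; set e := _ / _; set e' := _ / _ => ? ? ?; apply/andP; split; lra.
  apply: nearW => n; have [e0 e1] := S1 n.
  move: e0 e1; rewrite /S; set e := _ / n.+3%:R => e0 e1.
  set p := a + e; set q := b - e.
  have pq : p < q by rewrite /p /q; lra.
  have ap : a < p by rewrite /p; lra.
  have qb : q < b by rewrite /q; lra.
  have dFx x : p <= x <= q -> is_derive x 1 F (f x) by move=> ?; apply: dF; lra.
  have cF x : p <= x <= q -> {for x, continuous F}.
    by move=> /dFx [d _]; apply: differentiable_continuous; exact/derivable1_diffP.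
  rewrite [X in (X <= _)%E](@continuous_FTC2 _ f F p q)//.
  + by rewrite -EFinB lee_fin; exact: FC.
  + exact: (cw n).
  + split.
    * by move=> x; rewrite in_itv/= => /andP[? ?]; case: (dFx x _) => //; lra.
    * by apply: cvg_at_right_filter; apply: cF; lra.
    * by apply: cvg_at_left_filter; apply: cF; lra.
  + move=> x; rewrite in_itv/= => /andP[? ?]; rewrite derive1E.
    by case: (dFx x _) => //; lra.
apply: ge0_nondecreasing_set_cvg_integral => //.
- move=> m n mn; apply/subsetPset; rewrite /S => x /=; rewrite !in_itv/= => /andP[H H0].
  have : (b - a) / n.+3%:R <= (b - a) / m.+3%:R.
    by rewrite ler_pM2l ?subr_gt0// lef_pV2 ?posrE ?ltr0n// ler_nat.
  by move: H H0; set e := _ / _; set e' := _ / _ => ? ? ?; apply/andP; split; lra.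
- by move=> n; apply/measurable_EFinP; exact: subspace_continuous_measurable_fun.
- by move=> n x /Sn /f0; rewrite lee_fin.
Qed.

Lemma is_derive_sqrt (x : R) : 0 < x -> is_derive x 1 (@Num.sqrt R) (2 * Num.sqrt x)^-1.
Proof. exact: is_derive1_sqrt. Qed.

Lemma integral_invsqrt_le (a t : R) : a <= t ->
  (\int[leb]_(s in `]a, t[) ((Num.sqrt (t - s))^-1)%:E <= (2 * Num.sqrt (t - a))%:E)%E.
Proof.
move=> att.
apply: (@ge0_integral_itvoo_le (fun s => (Num.sqrt (t - s))^-1) (fun s => - 2 * Num.sqrt (t - s))).
- by move=> x _; rewrite invr_ge0 sqrtr_ge0.
- move=> x /andP[ax xt]; have tx : 0 < t - x by lra.
  have d1 : is_derive x 1 (fun s : R => t - s) (- 1).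
    by have := is_deriveB (is_derive_cst t x 1) (is_derive_id x (1 : R)); rewrite sub0r.
  have d2 := @is_derive1_comp _ (@Num.sqrt R) (fun s => t - s) x _ _ (is_derive_sqrt tx) d1.
  apply: (is_derive_ext (is_deriveZ (-2) d2)) => //.
  by rewrite /GRing.scale /=; field; rewrite gt_eqF// sqrtr_gt0.
- move=> x /andP[ax xt].
  apply: cvgV; first by rewrite gt_eqF// sqrtr_gt0; lra.
  apply: (@continuous_comp _ _ _ (fun s => t - s) (@Num.sqrt R)); last exact: sqrt_continuous.
  by apply: cvgB; [exact: cvg_cst|exact: cvg_id].
- move=> x y ax xy yt.
  have : Num.sqrt (t - x) <= Num.sqrt (t - a) by rewrite ler_sqrt; lra.
  have := sqrtr_ge0 (t - y); lra.
- by rewrite mulr_ge0// sqrtr_ge0.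
Qed.

End OneDim.

(** * Lipschitz estimates and the Duhamel integral *)

Section HeatEstimates.
Variables (R : realType) (N : nat).
Local Notation V := 'rV[R]_N.
Local Notation mu := (lebn R N).
Local Notation leb := (@lebesgue_measure R).

(** Bound of the L^1 norm of the differentiated kernel. Its order t^(-1/2) is integrable at 0, which
    is what makes Duhamel integrals differentiable in space. *)
Definition kap (t : R) : R := Num.sqrt 2 * cN R N / Num.sqrt t.

Lemma kap_ge0 t : 0 <= kap t.
Proof. by rewrite divr_ge0 ?mulr_ge0 ?sqrtr_ge0 ?cN_ge0. Qed.

Lemma heatK_semigroup j (t s B : R) (w : V -> R) (x : V) : 0 < t -> 0 < s -> bmeas B w ->
  heatK j t (heatH s w) x = heatK j (t + s) w x.
Proof.
move=> t0 s0 bw; have ts : 0 < t + s by lra.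
have [_ <-] := heatH_derive j x t0 (bmeas_heatH s0 bw).
have [_ <-] := heatH_derive j x ts bw.
have -> // : heatH t (heatH s w) = heatH (t + s) w.
by apply/funext => y; exact: (heatH_semigroup y t0 s0 bw).
Qed.

Lemma heatH_lip1 j (t B h : R) (w : V -> R) (x : V) : 0 < t -> bmeas B w ->
  `|heatH t w (h *: ei R j + x) - heatH t w x| <= kap t * B * `|h|.
Proof.
move=> t0 bw.
have := @lip_of_derive R (fun s => heatH t w (s *: ei R j + x))
  (fun s => heatK j t w (s *: ei R j + x)) (kap t * B) 0 h.
rewrite scale0r add0r subr0; apply.
  by move=> s; apply: (iffLR (derive_line_at (heatH t w) x (ei R j) s _)); exact: heatH_derive t0 bw.
by move=> s; exact: heatK_le.
Qed.

Definition l1 (y : V) : R := \sum_i `|y 0 i|.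

Lemma l1_ge0 y : 0 <= l1 y. Proof. by rewrite sumr_ge0. Qed.

(** The point is moved from x to x + y one coordinate at a time; this is why the l^1 norm measures
    increments in the Lipschitz estimates. *)
Lemma lip_coord (g : V -> R) (C : R) :
  (forall j h x, `|g (h *: ei R j + x) - g x| <= C * `|h|) ->
  forall x y, `|g (x + y) - g x| <= C * l1 y.
Proof.
move=> gC x y; rewrite {1}[y]row_sum_delta /l1.
elim: (index_enum _) x => [|i s IH] x; first by rewrite !big_nil addr0 subrr normr0 mulr0.
rewrite !big_cons mulrDr (_ : x + _ = (y 0 i *: ei R i + x) + \sum_(j <- s) y 0 j *: ei R j);
  last by rewrite addrA (addrC x).
rewrite -(subrKA (g (y 0 i *: ei R i + x))) addrC.
apply: (le_trans (ler_normD _ _)); apply: lerD; [exact: gC|exact: IH].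
Qed.

Lemma heatH_lip (t B : R) (w : V -> R) (x y : V) : 0 < t -> bmeas B w ->
  `|heatH t w (x + y) - heatH t w x| <= kap t * B * l1 y.
Proof. by move=> t0 bw; apply: lip_coord => j h z; exact: heatH_lip1. Qed.

Lemma bmeas_shift (B : R) (w : V -> R) (y : V) : bmeas B w -> bmeas B (fun x => w (x + y)).
Proof.
by move=> [mw wB]; split => //; apply: measurableT_comp => //; exact: measurable_addv.
Qed.

(** By the semigroup law half of the time makes [w] Lipschitz and the other half is spent on the
    derivative, so that only first derivatives of the kernel occur. *)
Lemma heatK_lip j (t B : R) (w : V -> R) (x y : V) : 0 < t -> bmeas B w ->
  `|heatK j t w (x + y) - heatK j t w x| <= kap (t / 2) * (kap (t / 2) * B * l1 y).
Proof.
move=> t0 bw; have t2 : 0 < t / 2 by lra.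
have b1 := bmeas_heatH t2 bw; have b2 := bmeas_shift y b1.
rewrite (_ : t = t / 2 + t / 2); last by field.
rewrite -!(heatK_semigroup j _ t2 t2 bw) -(_ : t = t / 2 + t / 2); last by field.
rewrite heatK_shift; last by case: b1.
rewrite -(heatKB j x t2 b2 b1); apply: heatK_le => //; split.
  by apply: measurable_funB; [case: b2|case: b1].
by move=> z; exact: heatH_lip.
Qed.

Lemma heatG_l1_le (h : R) (z : V) : 0 < h ->
  heatG h z * l1 z <= N%:R * (2 * h * kap h) * heatG (2 * h) z.
Proof.
move=> h0; rewrite /l1 mulr_sumr.
apply: (@le_trans _ _ (\sum_(i < N) (2 * h * kap h) * heatG (2 * h) z)); last first.
  by rewrite le_eqVlt; apply/orP; left; apply/eqP; rewrite big_const_ord iter_addr_0 -[RHS]mulrA [RHS]mulr_natl.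
apply: ler_sum => i _; have := heatDG_le i z h0.
have i0 : 0 < (2 * h)^-1 by rewrite invr_gt0 mulr_gt0.
rewrite /heatDG normrM normrN normrM (ger0_norm (heatG_ge0 _ _)) (gtr0_norm i0).
rewrite -/(kap h) => H.
rewrite (_ : _ * `|_| = 2 * h * (`|z 0 i| / (2 * h) * heatG h z)); last by field; rewrite gt_eqF.
by rewrite -[leRHS]mulrA ler_pM2l// mulr_gt0.
Qed.

(** The first moment of G_h is of order h^(1/2) by [heatG_l1_le], and a Lipschitz function is
    displaced by at most that order. *)
Lemma heatH_near (h B L : R) (w : V -> R) (x : V) : 0 < h -> bmeas B w -> 0 <= L ->
  (forall z, `|w (x + z) - w x| <= L * l1 z) ->
  `|heatH h w x - w x| <= L * (N%:R * (2 * h * kap h)).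
Proof.
move=> h0 bw L0 wL; have h2 : 0 < 2 * h by lra.
have bd : bmeas (B + `|w x|) (fun y => w y - w x) := bmeasB bw (bmeas_cst _ (w x)).
rewrite -[X in _ - X](heatH_cst (w x) x h0) -(heatHB x h0 bw (bmeas_cst _ (w x))).
set c := N%:R * _.
have ig := integrable_heatG_sub x h2.
apply: (@le_trans _ _ (\int[mu]_y (L * c * heatG (2 * h) (x - y)))).
  apply: normr_Rintegral_le => //; first exact: (integrable_heatH x h0 bd).
    exact: (integrableZl _ _ ig).
  move=> y _; rewrite normrM ger0_norm ?heatG_ge0//.
  have := wL (y - x); rewrite [x + _]addrC subrK => /(ler_wpM2l (heatG_ge0 h (x - y))) /le_trans; apply.
  rewrite mulrCA -mulrA ler_wpM2l// (_ : l1 (y - x) = l1 (x - y)); first exact: heatG_l1_le.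
  by apply: eq_bigr => i _; rewrite !mxE distrC.
by rewrite RintegralZl// Rintegral_heatG_sub// mulr1.
Qed.

Definition duhE (a t : R) (h : V -> R -> \bar R) (x : V) : \bar R :=
  (\int[leb]_(s in `]a, t[) heatE (t - s) (fun y => h y s) x)%E.

Lemma measurable_duhE_integrand (t : R) (h : V -> R -> \bar R) (x : V) :
  measurable_fun setT (fun q : V * R => h q.1 q.2) -> (forall x s, 0 <= h x s)%E ->
  measurable_fun setT (fun s : R => heatE (t - s) (fun y => h y s) x).
Proof.
move=> mh h0; apply: (@measurable_heatE_param R N _ _ (fun s : R => t - s) (fun=> x)
  (fun p : R * V => h p.2 p.1)) => //; first exact: measurable_funB.
exact: (measurable_uncurry mh).
Qed.

Lemma measurable_duhE (a : R) (h : V -> R -> \bar R) :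
  measurable_fun setT (fun q : V * R => h q.1 q.2) -> (forall x s, 0 <= h x s)%E ->
  measurable_fun setT (fun q : V * R => duhE a q.2 h q.1).
Proof.
move=> mh h0.
pose k (p : (V * R) * R) : \bar R :=
  (heatE (p.1.2 - p.2) (fun y => h y p.2) p.1.1 * (\1_(`]a, p.1.2[) p.2)%:E)%E.
have mk : measurable_fun setT k.
  apply: emeasurable_funM.
    apply: (@measurable_heatE_param R N _ _ (fun p : (V * R) * R => p.1.2 - p.2) (fun p => p.1.1)
      (fun q => h q.2 q.1.2)).
    - by apply: measurable_funB => //; apply: measurableT_comp.
    - exact: measurableT_comp.
    - apply: (measurable_uncurry mh) => //.
      exact: measurableT_comp.
    - by [].
  apply/measurable_EFinP.
  rewrite (_ : (fun _ => _) = \1_[set p : (V * R) * R | (a < p.2) && (p.2 < p.1.2)]); last first.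
    apply/funext => p; rewrite !indicE.
    suff -> : (p.2 \in `]a, p.1.2[%classic) = (p \in [set p : (V * R) * R | (a < p.2) && (p.2 < p.1.2)]) by [].
    by apply/idP/idP => /set_mem/=; rewrite ?in_itv/= => H; apply/mem_set; rewrite /= ?in_itv/=.
  apply: measurable_indic; rewrite -[X in measurable X]setTI.
  have mb : measurable_fun setT (fun p : (V * R) * R => (a < p.2) && (p.2 < p.1.2)).
    apply: measurable_and; apply: measurable_fun_ltr => //; exact: measurableT_comp.
  exact: (mb measurableT [set true]).
have k0 p : (0 <= k p)%E.
  by rewrite mule_ge0 ?lee_fin//; apply: heatE_ge0.
rewrite (_ : (fun _ => _) = fubini_F leb k); first exact: measurable_fun_fubini_tonelli_F.
apply/funext => q; rewrite /duhE integral_mkcond; apply: eq_integral => s _.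
by rewrite epatch_indic.
Qed.

Lemma duhE_ge0 a t h x : (forall x s, 0 <= h x s)%E -> (0 <= duhE a t h x)%E.
Proof. by move=> h0; apply: integral_ge0 => s _; exact: heatE_ge0. Qed.

(** For s < sg the kernel at time t - s is the convolution of those at times t - sg and sg - s;
    Tonelli then exchanges the integral in s with the outer convolution. This makes the integral
    equation restartable at any time. *)
Lemma duhE_split (a sg t : R) (h : V -> R -> \bar R) (x : V) :
  measurable_fun setT (fun q : V * R => h q.1 q.2) -> (forall x s, 0 <= h x s)%E ->
  a < sg -> sg < t ->
  duhE a t h x = (heatE (t - sg) (duhE a sg h) x + duhE sg t h x)%E.
Proof.
move=> mh h0 asg sgt.
have mi u z := measurable_duhE_integrand u z mh h0.
rewrite {1}/duhE (_ : `]a, t[%classic = `]a, sg[ `|` `[sg, t[); last first.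
  apply/seteqP; split => s /=; rewrite !in_itv/=.
    by move=> /andP[? ?]; have [?|?] := ltP s sg; [left|right]; apply/andP; split; lra.
  by move=> [] /andP[? ?]; apply/andP; split; lra.
rewrite ge0_integral_setU//=; first last.
- by apply/disj_setPS => s [] /=; rewrite !in_itv/= => /andP[? ?] /andP[? ?]; lra.
- by move=> s _; exact: heatE_ge0.
- by apply: measurable_funTS; exact: mi.
congr (_ + _)%E; last first.
  by rewrite -integral_itv_obnd_cbnd//; apply: measurable_funTS; exact: mi.
pose D := `]a, sg[%classic : set R.
pose k (p : V * R) : \bar R :=
  ((heatG (t - sg) (x - p.1))%:E * (heatE (sg - p.2) (fun y => h y p.2) p.1 * (\1_D p.2)%:E))%E.
have mk : measurable_fun setT k.
  apply: emeasurable_funM.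
    apply/measurable_EFinP; apply: measurable_heatG_param => //; exact: measurable_subv.
  apply: emeasurable_funM.
    apply: (@measurable_heatE_param R N _ _ (fun p : V * R => sg - p.2) (fun p => p.1)
      (fun q => h q.2 q.1.2)) => //; [exact: measurable_funB|exact: measurable_fst|].
    apply: (measurable_uncurry mh) => //.
    exact: measurableT_comp.
  apply/measurable_EFinP; apply: measurableT_comp => //.
  by apply: measurable_indic; exact: measurable_itv.
have k0 p : (0 <= k p)%E.
  rewrite mule_ge0 ?lee_fin ?heatG_ge0// mule_ge0 ?lee_fin//; exact: heatE_ge0.
transitivity (\int[leb]_s \int[mu]_y k (y, s))%E.
  rewrite integral_mkcond; apply: eq_integral => s _.
  rewrite epatch_indic /= -/D.
  have [Ds|Ds] := boolP (s \in D); last first.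
    rewrite indicE (negbTE Ds) mule0; apply/esym; apply: integral0_eq => y _.
    by rewrite /k /= indicE (negbTE Ds) !mule0.
  rewrite indicE Ds mule1.
  have : D s by exact: set_mem.
  rewrite /D /= in_itv/= => /andP[a1 s1].
  rewrite (_ : t - s = (t - sg) + (sg - s)); last by ring.
  rewrite -heatE_semigroup//; [|lra|lra|].
    by apply: eq_integral => y _; rewrite /k /= indicE Ds mule1.
  exact: (measurable_uncurry mh).
rewrite -(@fubini_tonelli _ _ _ _ _ mu leb k)//; apply: eq_integral => y _.
rewrite /k /= ge0_integralZl//; first last.
- by rewrite lee_fin heatG_ge0.
- by move=> s _; rewrite mule_ge0 ?lee_fin//; exact: heatE_ge0.
- apply: emeasurable_funM; first exact: mi.
  by apply/measurable_EFinP; apply: measurable_indic; exact: measurable_itv.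
congr (_ * _)%E; rewrite [RHS]integral_mkcond; apply: eq_integral => s _.
by rewrite epatch_indic.
Qed.

End HeatEstimates.

Section Duhamel.
Variables (R : realType) (N : nat).
Local Notation V := 'rV[R]_N.
Local Notation mu := (lebn R N).
Local Notation leb := (@lebesgue_measure R).

Definition duh (a t : R) (h : V -> R -> R) (x : V) : R :=
  \int[leb]_(s in `]a, t[) heatH (t - s) (h ^~ s) x.

Definition dduh (j : 'I_N) (a t : R) (h : V -> R -> R) (x : V) : R :=
  \int[leb]_(s in `]a, t[) heatK j (t - s) (h ^~ s) x.

Definition jmeas (h : V -> R -> R) := measurable_fun setT (fun q : V * R => h q.1 q.2).

Lemma jmeas_comp d (T : measurableType d) h (xi : T -> V) (tau : T -> R) : jmeas h ->
  measurable_fun setT xi -> measurable_fun setT tau ->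
  measurable_fun setT (fun p => h (xi p) (tau p)).
Proof.
move=> mh mx mt.
exact: (measurableT_comp (f := fun q : V * R => h q.1 q.2) mh (measurable_fun_pair mx mt)).
Qed.

Definition bsrc (a t M : R) (h : V -> R -> R) :=
  jmeas h /\ forall s x, a < s < t -> `|h x s| <= M.

Lemma jmeas_sec h s : jmeas h -> measurable_fun setT (h ^~ s).
Proof. by move=> mh; exact: (@jmeas_comp _ _ h id (fun=> s) mh). Qed.

Lemma bsrc_bmeas (a t M s : R) h : bsrc a t M h -> a < s < t -> bmeas M (h ^~ s).
Proof. by move=> [mh hM] st; split; [exact: jmeas_sec|move=> x; exact: hM]. Qed.

Lemma bsrc_ge0 (a t M : R) h : a < t -> bsrc a t M h -> 0 <= M.
Proof.
move=> att [_ /(_ ((a + t) / 2) 0) H]; apply: le_trans (H _) => //; apply/andP; split; lra.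
Qed.

Lemma measurable_heatH_param d (T : measurableType d) (tau : T -> R) (xi : T -> V) (w : T * V -> R) :
  measurable_fun setT tau -> measurable_fun setT xi -> measurable_fun setT w ->
  measurable_fun setT (fun p => heatH (tau p) (fun y => w (p, y)) (xi p)).
Proof.
move=> mt mx mw; apply: (@measurable_Rintegral_param _ _ _ _ _ mu
  (fun q : T * V => heatG (tau q.1) (xi q.1 - q.2) * w q)).
apply: measurable_funM => //; apply: measurable_heatG_param; first exact: measurableT_comp.
by apply: measurable_subv => //; exact: measurableT_comp.
Qed.

Lemma measurable_heatK_param j d (T : measurableType d) (tau : T -> R) (xi : T -> V) (w : T * V -> R) :
  measurable_fun setT tau -> measurable_fun setT xi -> measurable_fun setT w ->
  measurable_fun setT (fun p => heatK j (tau p) (fun y => w (p, y)) (xi p)).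
Proof.
move=> mt mx mw; apply: (@measurable_Rintegral_param _ _ _ _ _ mu
  (fun q : T * V => heatDG j (tau q.1) (xi q.1 - q.2) * w q)).
apply: measurable_funM => //; apply: measurable_heatDG_param; first exact: measurableT_comp.
by apply: measurable_subv => //; exact: measurableT_comp.
Qed.

Lemma measurable_duh_integrand (t : R) h (x : V) : jmeas h ->
  measurable_fun setT (fun s : R => heatH (t - s) (h ^~ s) x).
Proof.
move=> mh; apply: (@measurable_heatH_param _ _ (fun s : R => t - s) (fun=> x)
  (fun p : R * V => h p.2 p.1)) => //; first exact: measurable_funB.
exact: (@jmeas_comp _ _ h (fun p : R * V => p.2) (fun p => p.1) mh measurable_snd measurable_fst).
Qed.

Lemma measurable_dduh_integrand j (t : R) h (x : V) : jmeas h ->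
  measurable_fun setT (fun s : R => heatK j (t - s) (h ^~ s) x).
Proof.
move=> mh; apply: (@measurable_heatK_param j _ _ (fun s : R => t - s) (fun=> x)
  (fun p : R * V => h p.2 p.1)) => //; first exact: measurable_funB.
exact: (@jmeas_comp _ _ h (fun p : R * V => p.2) (fun p => p.1) mh measurable_snd measurable_fst).
Qed.

Lemma integrable_itvoo_cst (a t c : R) : leb.-integrable `]a, t[ (EFin \o (fun=> c)).
Proof.
apply: measurable_bounded_integrable => //.
  by rewrite /= lebesgue_measure_itv/=; case: ifP => _; rewrite ?ltry// -EFinB ltry.
by exists `|c|; split; [exact: num_real|move=> r cr x _ /=; exact: ltW].
Qed.

Lemma Rintegral_itvoo_cst (a t c : R) : a <= t -> \int[leb]_(s in `]a, t[) c = c * (t - a).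
Proof.
move=> att; rewrite Rintegral_cst//= lebesgue_measure_itv/= lte_fin.
case: ltP => [//|ta]; rewrite /= ?mulr0.
have -> : t - a = 0 by lra.
by rewrite mulr0.
Qed.

Lemma integrable_duh (a t M : R) h (x : V) : bsrc a t M h ->
  leb.-integrable `]a, t[ (EFin \o (fun s => heatH (t - s) (h ^~ s) x)).
Proof.
move=> bh; apply: (@le_integrable _ _ _ leb _ _ _ (EFin \o (fun=> M))) => //.
- apply/measurable_EFinP; apply: measurable_funTS; apply: measurable_duh_integrand.
  by case: bh.
- move=> s /=; rewrite in_itv/= => st; rewrite lee_fin.
  have bm := bsrc_bmeas bh st; have M0 := bmeas_ge0 bm.
  by rewrite (ger0_norm M0); apply: heatH_le => //; move/andP: st => []; lra.
- exact: integrable_itvoo_cst.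
Qed.

Lemma duh_le (a t M : R) h (x : V) : a <= t -> bsrc a t M h -> `|duh a t h x| <= M * (t - a).
Proof.
move=> att bh; rewrite -(Rintegral_itvoo_cst M att).
apply: normr_Rintegral_le => //.
- exact: (integrable_duh x bh).
- exact: integrable_itvoo_cst.
- move=> s /=; rewrite in_itv/= => st.
  by apply: heatH_le (bsrc_bmeas bh st); move/andP: st => []; lra.
Qed.

Lemma duh_addc (a t M c : R) h (x : V) : a <= t -> bsrc a t M h ->
  duh a t (fun y s => h y s + c) x = duh a t h x + c * (t - a).
Proof.
move=> att bh; rewrite -(Rintegral_itvoo_cst c att) /duh -RintegralD//.
- apply: eq_Rintegral => s /set_mem/=; rewrite in_itv/= => st.
  have ts : 0 < t - s by move/andP: st => []; lra.
  by rewrite (heatHD x ts (bsrc_bmeas bh st) (bmeas_cst _ c)) heatH_cst.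
- exact: (integrable_duh x bh).
- exact: integrable_itvoo_cst.
Qed.

Lemma duh_duhE (a t M : R) h (x : V) : bsrc a t M h ->
  (duh a t h x)%:E = duhE a t (fun y s => (h y s)%:E) x.
Proof.
move=> bh; rewrite /duh /Rintegral fineK; last first.
  exact: (integrable_fin_num _ (integrable_duh x bh)).
apply: eq_integral => s /set_mem/=; rewrite in_itv/= => st.
by apply: heatH_heatE (bsrc_bmeas bh st); move/andP: st => []; lra.
Qed.

Let ck : R := Num.sqrt 2 * cN R N.

Let ck0 : 0 <= ck. Proof. by rewrite mulr_ge0 ?sqrtr_ge0 ?cN_ge0. Qed.

Lemma integrable_invsqrt (a t : R) : a <= t ->
  leb.-integrable `]a, t[ (EFin \o (fun s => (Num.sqrt (t - s))^-1)).
Proof.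
move=> att; apply/integrableP; split.
  apply/measurable_EFinP; apply: measurable_funTS.
  apply: (measurableT_comp (@measurable_invr R)).
  have ms : measurable_fun setT (@Num.sqrt R).
    by apply: continuous_measurable_fun; exact: sqrt_continuous.
  by apply: (measurableT_comp ms); exact: measurable_funB.
under eq_integral do rewrite /= ger0_norm ?invr_ge0 ?sqrtr_ge0//.
by apply: le_lt_trans (integral_invsqrt_le att) _; rewrite ltry.
Qed.

Lemma integrable_kap (a t : R) : a <= t ->
  leb.-integrable `]a, t[ (EFin \o (fun s => kap N (t - s))).
Proof.
move=> att; have H := integrable_invsqrt att.
exact: (integrableZl _ ck H).
Qed.

Lemma Rintegral_kap_le (a t : R) : a <= t ->
  \int[leb]_(s in `]a, t[) kap N (t - s) <= ck * (2 * Num.sqrt (t - a)).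
Proof.
move=> att; have H := integrable_invsqrt att.
rewrite /kap RintegralZl// -/ck ler_wpM2l// -lee_fin /Rintegral fineK.
  exact: integral_invsqrt_le.
exact: integrable_fin_num.
Qed.

Lemma integrable_dduh j (a t M : R) h (x : V) : a <= t -> bsrc a t M h ->
  leb.-integrable `]a, t[ (EFin \o (fun s => heatK j (t - s) (h ^~ s) x)).
Proof.
move=> att bh; apply: (@le_integrable _ _ _ leb _ _ _ (EFin \o (fun s => M * kap N (t - s)))) => //.
- apply/measurable_EFinP; apply: measurable_funTS; apply: measurable_dduh_integrand.
  by case: bh.
- move=> s /=; rewrite in_itv/= => st; rewrite lee_fin.
  apply: le_trans (ler_norm _); rewrite mulrC.
  by apply: heatK_le (bsrc_bmeas bh st); move/andP: st => []; lra.
- exact: (integrableZl _ M (integrable_kap att)).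
Qed.

Lemma dduh_le j (a t M : R) h (x : V) : a < t -> bsrc a t M h ->
  `|dduh j a t h x| <= M * (ck * (2 * Num.sqrt (t - a))).
Proof.
move=> att bh; have M0 := bsrc_ge0 att bh; have a' := ltW att.
apply: (@le_trans _ _ (\int[leb]_(s in `]a, t[) (M * kap N (t - s)))).
  apply: normr_Rintegral_le => //; first exact: (integrable_dduh j x a' bh).
    exact: (integrableZl _ M (integrable_kap a')).
  move=> s /=; rewrite in_itv/= => st; rewrite mulrC.
  by apply: heatK_le (bsrc_bmeas bh st); move/andP: st => []; lra.
rewrite RintegralZl//; last exact: integrable_kap.
by rewrite ler_wpM2l//; exact: Rintegral_kap_le.
Qed.

(** Differentiation under the time integral; the majorant [M * kap N (t - s)] is singular but
    integrable at s = t. *)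
Lemma duh_derive j (a t M : R) h (x : V) : a < t -> bsrc a t M h ->
  is_derive x (ei R j) (duh a t h) (dduh j a t h x).
Proof.
move=> att bh; apply/derive_line; have a' := ltW att.
pose f (r s : R) := heatH (t - s) (h ^~ s) (r *: ei R j + x).
have df (r s : R) : a < s < t -> is_derive r 1 (f ^~ s) (heatK j (t - s) (h ^~ s) (r *: ei R j + x)).
  move=> st; have ts : 0 < t - s by move/andP: st => []; lra.
  apply: (iffLR (derive_line_at (heatH (t - s) (h ^~ s)) x (ei R j) r _)).
  exact: (heatH_derive j _ ts (bsrc_bmeas bh st)).
have M0 := bsrc_ge0 att bh.
have mint r : leb.-integrable `]a, t[ (EFin \o f r) by exact: (integrable_duh (r *: ei R j + x) bh).
have I0 : `]-1, 1[%classic (0 : R) by rewrite /= in_itv/=; apply/andP; split; lra.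
have derf (r s : R) : `]-1, 1[%classic r -> `]a, t[%classic s -> derivable (f ^~ s) r 1.
  by move=> _ /=; rewrite in_itv/= => st; case: (df r s st).
pose Gd (s : R) := M * kap N (t - s).
have Gd0 s : 0 <= Gd s by rewrite mulr_ge0// kap_ge0.
have iG : leb.-integrable `]a, t[ (EFin \o Gd).
  exact: (integrableZl _ M (integrable_kap a')).
have fb (r s : R) : `]-1, 1[%classic r -> `]a, t[%classic s -> `|partial1of2 f r s| <= Gd s.
  move=> _ /=; rewrite in_itv/= => st; rewrite partial1of2E.
  have [_ ->] := df r s st; rewrite /Gd mulrC.
  by apply: heatK_le (bsrc_bmeas bh st); move/andP: st => []; lra.
have mI : measurable (`]a, t[%classic : set R) by exact: measurable_itv.
have H1 := derivable_under_integral (mu := leb) mI I0 (fun r _ => mint r) derf Gd0 iG fb.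
have H2 := differentiation_under_integral (mu := leb) mI I0 (fun r _ => mint r) derf Gd0 iG fb.
apply: DeriveDef; first exact: H1.
rewrite -derive1E H2; apply: eq_Rintegral => s /set_mem/=; rewrite in_itv/= => st.
by rewrite partial1of2E; have [_ ->] := df 0 s st; rewrite scale0r add0r.
Qed.

End Duhamel.

(** * Interior regularity of bounded mild solutions *)

Section MildRegularity.
Variables (R : realType) (N : nat).
Local Notation V := 'rV[R]_N.
Local Notation mu := (lebn R N).
Local Notation leb := (@lebesgue_measure R).

Lemma small_sqrt (C1 C2 e : R) : 0 <= C1 -> 0 <= C2 -> 0 < e ->
  exists2 d : R, 0 < d & forall h : R, 0 <= h < d -> C1 * Num.sqrt h + C2 * h < e.
Proof.
move=> C10 C20 e0; pose c := e / (C1 + C2 + 1).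
have c0 : 0 < c by rewrite divr_gt0//; lra.
exists (Num.min 1 (c ^+ 2)); first by rewrite lt_min ltr01 exprn_gt0.
move=> h /andP[h0]; rewrite lt_min => /andP[h1 hc].
have s0 := sqrtr_ge0 h.
have sh : Num.sqrt h ^+ 2 = h by rewrite sqr_sqrtr.
have sc : Num.sqrt h < c by rewrite -(@ltr_pXn2r _ 2)// ?nnegrE ?ltW// sh.
have hs : h <= Num.sqrt h.
  have : Num.sqrt h <= 1 by rewrite -(sqrtr1 R) ler_sqrt// ltW.
  by nra.
have E : (C1 + C2 + 1) * c = e by rewrite /c mulrC divfK// gt_eqF; lra.
nra.
Qed.

Lemma eta_window (a T t eta eta0 : R) : 0 < eta -> eta <= eta0 -> a + 3 * eta0 < t -> t < T ->
  [/\ a <= t - eta, t - eta < t, a + eta0 <= t - eta & t - eta < T].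
Proof. by move=> *; split; lra. Qed.

Lemma normr_lt_chain (A1 A2 A3 D1 D2 e : R) : `|A1 - A2| < e / 4 -> `|A2 - A3| < e / 4 ->
  `|D1| < e / 8 -> `|D2| < e / 8 -> `|A1 + D1 - (A3 + D2)| < e.
Proof.
rewrite !ltr_norml => /andP[? ?] /andP[? ?] /andP[? ?] /andP[? ?].
by apply/andP; split; lra.
Qed.

Lemma coord_le_norm (y : V) i : `|y 0 i| <= `|y|.
Proof.
rewrite [leRHS]/Num.norm /= mx_normrE; apply: (le_trans _ (le_bigmax _ _ (0, i))) => //=.
Qed.

Lemma l1_le_norm (y : V) : l1 y <= N%:R * `|y|.
Proof.
rewrite mulr_natl -[X in _ *+ X](card_ord N) -sumr_const.
by apply: ler_sum => i _; exact: coord_le_norm.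
Qed.

Lemma continuous_pairP (F : V -> R -> R) (x : V) (t : R) :
  (forall e : R, 0 < e -> exists2 d : R, 0 < d &
    forall (y : V) (s : R), l1 (y - x) < d -> `|s - t| < d -> `|F y s - F x t| < e) ->
  {for (x, t), continuous (fun q : V * R => F q.1 q.2)}.
Proof.
move=> H; apply/cvgrPdist_lt => e e0; have [d d0 dF] := H e e0.
have d1 : 0 < d / (N%:R + 1) by rewrite divr_gt0// ltr_wpDl.
have m0 : 0 < Num.min (d / (N%:R + 1)) d by rewrite lt_min d1.
exists (ball x (Num.min (d / (N%:R + 1)) d), ball t (Num.min (d / (N%:R + 1)) d)).
  by split; exact: nbhsx_ballx.
move=> q [/= b1 b2].
have h1 : `|x - q.1| < Num.min (d / (N%:R + 1)) d by move: b1; rewrite -ball_normE.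
have h2 : `|t - q.2| < Num.min (d / (N%:R + 1)) d by move: b2; rewrite -ball_normE.
move: h1 h2; rewrite !lt_min => /andP[h1 _] /andP[_ h2].
rewrite distrC; apply: dF; last by rewrite distrC.
apply: (le_lt_trans (l1_le_norm _)).
move: h1; rewrite distrC ltr_pdivlMr ?ltr_wpDl// => H'; apply: le_lt_trans H'.
by rewrite mulrC ler_wpM2l// lerDl.
Qed.

Lemma integrable_heatG (t : R) : 0 < t -> mu.-integrable setT (EFin \o @heatG R N t).
Proof.
move=> t0; apply/integrableP; split; first by apply/measurable_EFinP; exact: measurable_heatG.
under eq_integral do rewrite /= ger0_norm ?heatG_ge0//.
by rewrite integral_heatG// ltry.
Qed.

(** With the kernel at z and the datum at x - z, the derivative falls on the datum. Uniqueness of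
    the derivative identifies the result with the formula in which it falls on the kernel. *)
Lemma heatH_derive_move j (t B B' : R) (w dw : V -> R) (x : V) : 0 < t -> bmeas B w -> bmeas B' dw ->
  (forall y, is_derive y (ei R j) w (dw y)) ->
  heatK j t w x = heatH t dw x.
Proof.
move=> t0 bw bdw dwE.
suff H : is_derive x (ei R j) (heatH t w) (heatH t dw x).
  by have [_ <-] := heatH_derive j x t0 bw; have [_ <-] := H.
apply/derive_line.
pose f (r : R) (z : V) := heatG t z * w (r *: ei R j + x - z).
have [mw wB] := bw; have [mdw dwB] := bdw.
have msh (h : V -> R) (c : V) : measurable_fun setT h -> measurable_fun setT (fun z : V => h (c - z)).
  by move=> mh; apply: measurableT_comp => //; exact: measurable_subv.
have E : (fun r : R => heatH t w (r *: ei R j + x)) = fun r => \int[mu]_z f r z.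
  by apply/funext => r; rewrite heatHE.
have df (r : R) (z : V) : is_derive r 1 (f ^~ z) (heatG t z * dw (r *: ei R j + x - z)).
  have H := dwE (r *: ei R j + (x - z)).
  have H' := iffLR (derive_line_at w (x - z) (ei R j) r _) H.
  apply: (is_derive_ext (is_deriveZ (heatG t z) H')) => [s|].
    by rewrite /f -addrA.
  by rewrite -addrA.
have ig := integrable_heatG t0.
pose Gd (z : V) : R := B' * heatG t z.
have B0 := bmeas_ge0 bdw.
have iG : mu.-integrable setT (EFin \o Gd) by exact: (integrableZl _ B' ig).
have fb (r : R) (z : V) : `]-1, 1[%classic r -> setT z -> `|partial1of2 f r z| <= Gd z.
  move=> _ _; rewrite partial1of2E; have [_ ->] := df r z.
  by rewrite normrM ger0_norm ?heatG_ge0// mulrC ler_wpM2r ?heatG_ge0.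
have mint r : mu.-integrable setT (EFin \o f r).
  by apply: (integrable_mul_bounded (B := B)) => //; exact: msh.
have I0 : `]-1, 1[%classic (0 : R) by rewrite /= in_itv/=; apply/andP; split; lra.
have derf (r : R) (z : V) : `]-1, 1[%classic r -> setT z -> derivable (f ^~ z) r 1.
  by move=> _ _; case: (df r z).
have Gd0 y : 0 <= Gd y by rewrite mulr_ge0// heatG_ge0.
have H1 := derivable_under_integral (mu := mu) measurableT I0 (fun s _ => mint s) derf Gd0 iG fb.
have H2 := differentiation_under_integral (mu := mu) measurableT I0 (fun s _ => mint s) derf Gd0 iG fb.
rewrite E; apply: DeriveDef; first exact: H1.
rewrite -derive1E H2 heatHE//; apply: eq_Rintegral => z _.
by rewrite partial1of2E; have [_ ->] := df 0 z; rewrite scale0r add0r.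
Qed.

Let ck : R := Num.sqrt 2 * cN R N.

Let ck0 : 0 <= ck. Proof. by rewrite mulr_ge0 ?sqrtr_ge0 ?cN_ge0. Qed.

Lemma mul_kap (h : R) : 0 < h -> h * kap N h = ck * Num.sqrt h.
Proof.
move=> h0; rewrite /kap -/ck -{1}[h]sqr_sqrtr ?ltW//.
by field; rewrite gt_eqF// sqrtr_gt0.
Qed.

(** Bounded solutions of the variation-of-constants formula, restartable at every intermediate time.
    The source [g] is kept apart from [u], so that the gradient of a mild solution is again of this
    kind ([mild_mgrad]). *)
Definition mild (a T B M : R) (u g : V -> R -> R) :=
  [/\ jmeas u, jmeas g, (forall x s, a <= s < T -> `|u x s| <= B),
     (forall x s, a <= s < T -> `|g x s| <= M) &
     forall x s t, a <= s -> s < t -> t < T ->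
       u x t = heatH (t - s) (u ^~ s) x + duh s t g x].

Section Mild.
Variables (a T B M : R) (u g : V -> R -> R).
Hypothesis mildu : mild a T B M u g.
Hypothesis aT : a < T.

Let B0 : 0 <= B.
Proof.
have H : a <= a < T by rewrite lexx aT.
by case: mildu => _ _ /(_ 0 a H) H' _ _; exact: le_trans H'.
Qed.

Let M0 : 0 <= M.
Proof.
have H : a <= a < T by rewrite lexx aT.
by case: mildu => _ _ _ /(_ 0 a H) H' _; exact: le_trans H'.
Qed.

Lemma mild_bmeas s : a <= s < T -> bmeas B (u ^~ s).
Proof.
by move=> st; case: mildu => mu' _ H _ _; split; [exact: jmeas_sec|move=> x; exact: H].
Qed.

Lemma mild_bsrc s t : a <= s -> t <= T -> bsrc s t M g.
Proof.
by move=> as' tT; case: mildu => _ mg _ H _; split => // r x /andP[? ?]; apply: H; lra.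
Qed.

(** The gradient bound obtained by restarting the formula a time [eta] earlier: the first term is
    the smoothed datum, the second the Duhamel part. *)
Definition gbd (eta : R) : R := kap N eta * B + M * (ck * (2 * Num.sqrt eta)).

Lemma gbd_ge0 eta : 0 <= gbd eta.
Proof. by rewrite addr_ge0 ?mulr_ge0 ?kap_ge0 ?sqrtr_ge0 ?cN_ge0. Qed.

Lemma mild_derive j x s t : a <= s -> s < t -> t < T ->
  is_derive x (ei R j) (u ^~ t) (heatK j (t - s) (u ^~ s) x + dduh j s t g x).
Proof.
move=> as' st tT.
have bu : bmeas B (u ^~ s) by apply: mild_bmeas; lra.
have bg : bsrc s t M g by apply: mild_bsrc; lra.
have ts : 0 < t - s by lra.
apply: (is_derive_ext (is_deriveD (heatH_derive j x ts bu) (duh_derive j x st bg))) => //.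
by move=> y; case: mildu => _ _ _ _ H; rewrite (H y s t).
Qed.

Lemma mild_grad_le j x t eta : 0 < eta -> a + eta <= t -> t < T ->
  `|'D_(ei R j) (u ^~ t) x| <= gbd eta.
Proof.
move=> e0 et tT; have [] : [/\ a <= t - eta, t - eta < t & t - (t - eta) = eta] by split; lra.
move=> as' st tE; have [_ ->] := mild_derive j x as' st tT.
rewrite tE; apply: (le_trans (ler_normD _ _)); apply: lerD.
  by apply: heatK_le => //; apply: mild_bmeas; lra.
rewrite -[X in Num.sqrt X]tE; apply: dduh_le => //; apply: mild_bsrc => //; lra.
Qed.

Lemma mild_lip x y t eta : 0 < eta -> a + eta <= t -> t < T ->
  `|u (x + y) t - u x t| <= gbd eta * l1 y.
Proof.
move=> e0 et tT; apply: (lip_coord (g := u ^~ t)) => j h z.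
have := @lip_of_derive R (fun s => u (s *: ei R j + z) t)
  (fun s => 'D_(ei R j) (u ^~ t) (s *: ei R j + z)) (gbd eta) 0 h.
rewrite scale0r add0r subr0; apply; last by move=> s; exact: mild_grad_le.
move=> s; apply: (iffLR (derive_line_at (u ^~ t) z (ei R j) s _)).
have [||H1 H2] := @mild_derive j (s *: ei R j + z) (t - eta) t _ _ tT; [lra|lra|].
by apply: DeriveDef.
Qed.

(** Lipschitz continuity in space gives exponent 1/2 in time: over a time h the heat operator moves
    a Lipschitz function by O(h^(1/2)), and the source adds O(h). *)
Lemma mild_time x t t' eta : 0 < eta -> a + eta <= t -> t < t' -> t' < T ->
  `|u x t' - u x t| <= gbd eta * (N%:R * 2 * ck) * Num.sqrt (t' - t) + M * (t' - t).
Proof.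
move=> e0 et tt tT; have h0 : 0 < t' - t by lra.
have [_ _ _ _ /(_ x t t') ->//] := mildu; last by lra.
have bu : bmeas B (u ^~ t) by apply: mild_bmeas; lra.
rewrite addrAC; apply: (le_trans (ler_normD _ _)); apply: lerD; last first.
  by apply: duh_le; [lra|apply: mild_bsrc; lra].
have := @heatH_near R N (t' - t) B (gbd eta) (u ^~ t) x h0 bu (gbd_ge0 _).
rewrite -mulrA mul_kap// => H; rewrite -mulrA -(mulrA _ ck) -(mulrA _ 2).
by apply: H => z; apply: mild_lip => //; lra.
Qed.

Lemma mild_timeC x t t' eta : 0 < eta -> a + eta <= t < T -> a + eta <= t' < T ->
  `|u x t' - u x t| <= gbd eta * (N%:R * 2 * ck) * Num.sqrt `|t' - t| + M * `|t' - t|.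
Proof.
move=> e0 /andP[t1 t2] /andP[t3 t4]; have [tt|tt|->] := ltgtP t t'.
- by rewrite (gtr0_norm (_ : 0 < t' - t)); [exact: mild_time|lra].
- by rewrite distrC (distrC t') (gtr0_norm (_ : 0 < t - t')); [exact: mild_time|lra].
- by rewrite !subrr normr0 sqrtr0 !mulr0 addr0.
Qed.

Lemma mild_continuous x t : a < t < T ->
  {for (x, t), continuous (fun q : V * R => u q.1 q.2)}.
Proof.
move=> /andP[at' tT]; apply: continuous_pairP => e e0.
pose eta := (t - a) / 2; have et : 0 < eta by rewrite /eta; lra.
have L0 := gbd_ge0 eta.
have N0 : 0 <= N%:R :> R by [].
have e2 : 0 < e / 2 by lra.
have [d1 d10 Hd1] := @small_sqrt (gbd eta * (N%:R * 2 * ck)) M (e / 2) (mulr_ge0 L0 (mulr_ge0 (mulr_ge0 N0 (ler0n R 2)) ck0)) M0 e2.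
have q0 : 0 < (e / 2) / (gbd eta + 1) by rewrite divr_gt0//; lra.
exists (Num.min (Num.min d1 ((e / 2) / (gbd eta + 1))) (Num.min eta (T - t))).
  by rewrite !lt_min d10 q0 et /=; lra.
move=> y s; rewrite !lt_min => /andP[/andP[_ ly] _] /andP[/andP[sd _] /andP[se sT]].
have st : a + eta <= s < T.
  move: se sT; rewrite !ltr_norml => /andP[? ?] /andP[? ?].
  have tE : t = a + 2 * eta by rewrite /eta; lra.
  by apply/andP; split; lra.
have tt : a + eta <= t < T by apply/andP; split => //; rewrite /eta; lra.
rewrite -(subrKA (u x s)); apply: (le_lt_trans (ler_normD _ _)).
rewrite [ltRHS]splitr; apply: ltrD.
  have /andP[s1 s2] := st.
  have := mild_lip x (y - x) et s1 s2; rewrite [x + _]addrC subrK => /le_lt_trans; apply.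
  move: ly; rewrite ltr_pdivlMr; last by lra.
  have := l1_ge0 (y - x); nra.
apply: (le_lt_trans (mild_timeC x et tt st)); apply: Hd1; rewrite normr_ge0 //.
Qed.

(** Both gradients are represented by restarting with the same delay [eta]. The Duhamel parts are
    small with [eta], uniformly; for fixed [eta] the other part depends continuously on the point
    and on the restart datum, which varies continuously with time by [mild_timeC]. *)
Lemma mild_grad_continuous j x t : a < t < T ->
  {for (x, t), continuous (fun q : V * R => 'D_(ei R j) (u ^~ q.2) q.1)}.
Proof.
move=> /andP[at' tT].
apply: (@continuous_pairP (fun x t => 'D_(ei R j) (u ^~ t) x)) => e e0.
pose eta0 := (t - a) / 4; have et0 : 0 < eta0 by rewrite /eta0; lra.
have tE : t = a + 4 * eta0 by rewrite /eta0; lra.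
have C0 : 0 <= M * ck * 2 by rewrite !mulr_ge0 ?sqrtr_ge0 ?cN_ge0.
have e8 : 0 < e / 8 by lra.
have [d1 d10 Hd1] := @small_sqrt (M * ck * 2) 0 (e / 8) C0 (lexx _) e8.
(* Small enough for the Duhamel parts, and at most [eta0], so that the restart times stay where the
   estimate in time with constant [gbd eta0] holds. *)
pose eta := Num.min eta0 (d1 / 2).
have et : 0 < eta by rewrite lt_min et0; lra.
have ee0 : eta <= eta0 by rewrite ge_min lexx.
have ed1 : M * (ck * (2 * Num.sqrt eta)) < e / 8.
  have := Hd1 eta; rewrite mul0r addr0 !mulrA; apply.
  rewrite ltW//=; apply: (@le_lt_trans _ _ (d1 / 2)); first by rewrite ge_min lexx orbT.
  by lra.
pose K1 := kap N (eta / 2) * (kap N (eta / 2) * B).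
pose K2 := kap N eta.
have K10 : 0 <= K1 := mulr_ge0 (kap_ge0 _ _) (mulr_ge0 (kap_ge0 _ _) B0).
have K20 : 0 <= K2 by exact: kap_ge0.
pose C1 := K2 * (gbd eta0 * (N%:R * 2 * ck)).
have C10 : 0 <= C1.
  exact: mulr_ge0 K20 (mulr_ge0 (gbd_ge0 _) (mulr_ge0 (mulr_ge0 (ler0n _ _) (ler0n _ 2)) ck0)).
have C20 : 0 <= K2 * M by rewrite mulr_ge0.
have e4 : 0 < e / 4 by lra.
have [d2 d20 Hd2] := @small_sqrt C1 (K2 * M) (e / 4) C10 C20 e4.
have q0 : 0 < (e / 4) / (K1 + 1) by rewrite divr_gt0//; lra.
exists (Num.min (Num.min d2 ((e / 4) / (K1 + 1))) (Num.min eta0 (T - t))).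
  by rewrite !lt_min d20 q0 et0 /=; lra.
move=> y s; rewrite !lt_min => /andP[/andP[_ ly] _] /andP[/andP[sd _] /andP[se sT]].
have [s1 s2] : a + 3 * eta0 < s /\ s < T.
  by move: se sT; rewrite !ltr_norml => /andP[? ?] /andP[? ?]; split; lra.
have E r (rT : r < T) (ra : a + 3 * eta0 < r) z : 'D_(ei R j) (u ^~ r) z =
    heatK j eta (u ^~ (r - eta)) z + dduh j (r - eta) r g z.
  have [w1 w2 _ _] := eta_window et ee0 ra rT.
  have [_ ->] := @mild_derive j z (r - eta) r w1 w2 rT.
  by rewrite (_ : r - (r - eta) = eta); last by ring.
have Db r (rT : r < T) (ra : a + 3 * eta0 < r) z : `|dduh j (r - eta) r g z| < e / 8.
  have [w1 rr _ _] := eta_window et ee0 ra rT.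
  have br : bsrc (r - eta) r M g by apply: mild_bsrc => //; exact: ltW.
  have := dduh_le j z rr br; rewrite (_ : r - (r - eta) = eta); last by ring.
  by move=> /le_lt_trans; apply.
have t3 : a + 3 * eta0 < t by lra.
rewrite !E//.
have tT' : t < T by [].
have [w1 _ w3 w4] := eta_window et ee0 s1 s2; have [v1 _ v3 v4] := eta_window et ee0 t3 tT'.
have bs : bmeas B (u ^~ (s - eta)) by apply: mild_bmeas; rewrite w1.
have bt : bmeas B (u ^~ (t - eta)) by apply: mild_bmeas; rewrite v1.
have H1 : `|heatK j eta (u ^~ (s - eta)) y - heatK j eta (u ^~ (s - eta)) x| < e / 4.
  have := heatK_lip j x (y - x) et bs; rewrite [x + _]addrC subrK => /le_lt_trans; apply.
  rewrite (_ : _ * (_ * l1 _) = K1 * l1 (y - x)); last by rewrite /K1; ring.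
  move: ly; rewrite ltr_pdivlMr; last by lra.
  have := l1_ge0 (y - x); nra.
have H2 : `|heatK j eta (u ^~ (s - eta)) x - heatK j eta (u ^~ (t - eta)) x| < e / 4.
  rewrite -(heatKB j x et bs bt).
  set om := gbd eta0 * (N%:R * 2 * ck) * Num.sqrt `|s - t| + M * `|s - t|.
  have bd : bmeas om (fun z => u z (s - eta) - u z (t - eta)).
    split; first by apply: measurable_funB; [case: bs|case: bt].
    move=> z; have := @mild_timeC z (t - eta) (s - eta) eta0 et0.
    rewrite (_ : s - eta - (t - eta) = s - t); last by ring.
    by apply; apply/andP.
  apply: (le_lt_trans (heatK_le j x et bd)); rewrite -/(kap N eta) -/K2.
  have := Hd2 `|s - t|; rewrite normr_ge0 sd /= => /(_ isT).
  by rewrite (_ : K2 * om = C1 * Num.sqrt `|s - t| + K2 * M * `|s - t|)// /om /C1; ring.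
have H3 := Db s s2 s1 y; have H4 := Db t tT t3 x.
exact: (normr_lt_chain H1 H2 H3 H4).
Qed.

(** The value 0 outside ]a, T[ makes the gradient a jointly measurable function on all of
    space-time, as [mild] asks. *)
Definition mgrad (j : 'I_N) (x : V) (t : R) : R :=
  if (a < t) && (t < T) then 'D_(ei R j) (u ^~ t) x else 0.

Lemma jmeas_mgrad j : jmeas (mgrad j).
Proof.
have [mu' _ _ _ _] := mildu.
pose h (n : nat) (q : V * R) : R := if (a < q.2) && (q.2 < T)
  then n.+1%:R * (u (n.+1%:R^-1 *: ei R j + q.1) q.2 - u q.1 q.2) else 0.
apply: (@measurable_fun_cvg _ _ _ setT h).
  move=> n; apply: measurable_fun_ifT => //.
    by apply: measurable_and; apply: measurable_fun_ltr.
  apply: measurable_funM => //; apply: measurable_funB => //.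
  apply: (@jmeas_comp _ _ _ _ u (fun q : V * R => n.+1%:R^-1 *: ei R j + q.1) (fun q => q.2) mu').
    by apply: measurable_addv.
  exact: measurable_snd.
move=> [x t] _; rewrite /h /mgrad /=; case: ifP => [/andP[at' tT]|_]; last exact: cvg_cst.
have [H1 H2] := @mild_derive j x a t (lexx a) at' tT.
have /derive_line [D1 D2] : is_derive x (ei R j) (u ^~ t) ('D_(ei R j) (u ^~ t) x) by exact: DeriveDef.
move: D1; rewrite /derivable => /cvg_ex[l Hl].
have ll : l = 'D_(ei R j) (u ^~ t) x.
  by rewrite -D2 /derive; apply/esym/cvg_lim.
rewrite -ll.
have /cvgr_dnbhsP/(_ (fun n => n.+1%:R^-1)) H0 := Hl.
rewrite (_ : (fun n : nat => _) = (fun n : nat => (n.+1%:R^-1)^-1 *: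
  (((fun s : R => u (s *: ei R j + x) t) \o shift 0) (n.+1%:R^-1 *: 1) - u (0 *: ei R j + x) t))).
  apply: H0; split; first by move=> n; rewrite invr_eq0 pnatr_eq0.
  exact: cvg_harmonic.
by apply/funext => n; rewrite /= invrK addr0 [_ *: 1]mulr1 scale0r add0r.
Qed.

(** The bootstrap: differentiating the formula shows that the gradient solves the linearised problem
    with source phi'(u) grad u. The first-order results applied to it yield second derivatives of
    [u]. *)
Lemma mild_mgrad (phi dphi : R -> R) (L a' : R) j : a < a' -> a' < T ->
  (forall r : R, is_derive r 1 phi (dphi r)) -> (forall r, `|dphi r| <= L) ->
  measurable_fun setT dphi ->
  (forall x s, a <= s < T -> g x s = phi (u x s)) ->
  mild a' T (gbd (a' - a)) (L * gbd (a' - a)) (mgrad j)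
    (fun x s => dphi (u x s) * mgrad j x s).
Proof.
move=> aa aT' dphiE dphiL mdphi gE; have [mu' mg' _ _ H5] := mildu.
have L0 : 0 <= L by apply: le_trans (dphiL 0).
have e0 : 0 < a' - a by lra.
have gb x s : a' <= s < T -> `|mgrad j x s| <= gbd (a' - a).
  move=> /andP[s1 s2]; rewrite /mgrad ifT; last by apply/andP; split; lra.
  by apply: mild_grad_le => //; lra.
have mG := jmeas_mgrad j.
have mS : jmeas (fun x s => dphi (u x s) * mgrad j x s).
  by apply: measurable_funM => //; exact: (measurableT_comp mdphi mu').
have dE x t : a < t < T -> is_derive x (ei R j) (u ^~ t) (mgrad j x t).
  move=> /andP[t1 t2]; rewrite /mgrad t1 t2 /=.
  by have [H1 H2] := @mild_derive j x a t (lexx a) t1 t2; apply: DeriveDef.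
have bG s : a' <= s < T -> bmeas (gbd (a' - a)) (mgrad j ^~ s).
  by move=> st; split; [exact: jmeas_sec|move=> x; exact: gb].
have bS s : a' <= s < T -> bmeas (L * gbd (a' - a)) (fun x => dphi (u x s) * mgrad j x s).
  move=> st; split; first exact: (@jmeas_sec _ _ (fun x s => dphi (u x s) * mgrad j x s)).
  by move=> x; rewrite normrM ler_pM//; exact: gb.
split=> //.
- by move=> x s st; have [_] := bS s st; exact.
- move=> x s t as' st tT.
  rewrite {1}/mgrad ifT; last by apply/andP; split; lra.
  have as1 : a <= s by lra.
  have [_ ->] := mild_derive j x as1 st tT.
  have ts : 0 < t - s by lra.
  have bu : bmeas B (u ^~ s) by apply: mild_bmeas; lra.
  apply: (congr2 +%R).
    apply: (heatH_derive_move x ts bu (bG s _)); first by lra.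
    by move=> y; apply: dE; lra.
  apply: eq_Rintegral => r /set_mem/=; rewrite in_itv/= => /andP[r1 r2].
  have rT : a' <= r < T by apply/andP; split; lra.
  have tr : 0 < t - r by lra.
  have bg : bmeas M (g ^~ r) by apply: (bsrc_bmeas (mild_bsrc as1 (ltW tT))); rewrite r1 r2.
  apply: (heatH_derive_move x tr bg (bS r rT)) => y.
  have E : (fun z => phi (u z r)) =1 g ^~ r by move=> z; rewrite gE//; lra.
  have dy : is_derive y (ei R j) (u ^~ r) (mgrad j y r) by apply: dE; lra.
  apply/derive_line.
  have D1 := iffLR (derive_line (u ^~ r) y (ei R j) _) dy.
  have uE : u y r = u (0 *: ei R j + y) r by rewrite scale0r add0r.
  have D2 : is_derive (u (0 *: ei R j + y) r) 1 phi (dphi (u y r)) by rewrite uE.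
  have D3 := @is_derive1_comp R phi (fun s => u (s *: ei R j + y) r) 0 _ _ D2 D1.
  by apply: (is_derive_ext D3) => // z; rewrite /= -E.
Qed.

End Mild.
End MildRegularity.

(** * Second derivatives of the kernel and the heat equation *)

Section HeatSecondOrder.
Variables (R : realType) (N : nat).
Local Notation V := 'rV[R]_N.
Local Notation mu := (lebn R N).
Local Notation leb := (@lebesgue_measure R).
Local Notation cN := (cN R N).

Definition heatDDG (j : 'I_N) (t : R) (z : V) : R :=
  (z 0 j ^+ 2 / (4 * t ^+ 2) - (2 * t)^-1) * heatG t z.

Definition heatKK (j : 'I_N) (t : R) (w : V -> R) (x : V) : R :=
  \int[mu]_y (heatDDG j t (x - y) * w y).

Lemma heatG_le2 (t : R) (z : V) : 0 < t -> heatG t z <= cN * heatG (2 * t) z.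
Proof.
move=> t0; rewrite -heatG_2t// /heatG ler_wpM2l ?powR_ge0// ler_expR !mulNr lerN2.
by rewrite ler_wpM2l ?sqr_ge0// lef_pV2 ?posrE ?mulr_gt0//; lra.
Qed.

Lemma heatG_sq_le (t : R) (z : V) : 0 < t ->
  enorm z ^+ 2 * heatG t z <= 8 * t * (cN * heatG (2 * t) z).
Proof.
move=> t0; rewrite -heatG_2t// /heatG; set c := (_ `^ _); set e := enorm z ^+ 2.
have c0 : 0 <= c by exact: powR_ge0.
have -> : - e / (4 * t) = - e / (8 * t) + - e / (8 * t) by field; rewrite gt_eqF.
rewrite expRD; set E := expR _; have E0 : 0 < E by exact: expR_gt0.
have H : e * E <= 8 * t.
  rewrite /E mulNr expRN ler_pdivrMr ?expR_gt0//.
  have := expR_ge1Dx (e / (8 * t)).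
  have -> : e = 8 * t * (e / (8 * t)) by field; rewrite gt_eqF.
  set r := e / (8 * t); rewrite (_ : 8 * t * r / (8 * t) = r); last by field; rewrite gt_eqF.
  by move=> ?; rewrite ler_pM2l ?mulr_gt0//; lra.
rewrite (_ : e * _ = (c * E) * (e * E)); last by ring.
by rewrite [leRHS]mulrC ler_wpM2l// mulr_ge0// ltW.
Qed.

Lemma heatDDG_le j (t : R) (z : V) : 0 < t ->
  `|heatDDG j t z| <= (3 / t) * (cN * heatG (2 * t) z).
Proof.
move=> t0; rewrite /heatDDG normrM (ger0_norm (heatG_ge0 _ _)).
have ti : 0 < t^-1 by rewrite invr_gt0.
have zj : z 0 j ^+ 2 <= enorm z ^+ 2.
  by rewrite -real_normK ?num_real// lerXn2r ?nnegrE ?enorm_ge0// coord_le_enorm.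
have A : `|z 0 j ^+ 2 / (4 * t ^+ 2) - (2 * t)^-1| <= enorm z ^+ 2 / (4 * t ^+ 2) + t^-1.
  apply: (le_trans (ler_normB _ _)); apply: lerD.
    rewrite ger0_norm; first by apply: ler_wpM2r => //; rewrite invr_ge0 mulr_ge0 ?sqr_ge0.
    by apply: divr_ge0; rewrite ?sqr_ge0// mulr_ge0 ?sqr_ge0.
  by rewrite invfM normrM !ger0_norm ?invr_ge0 ?ltW//; lra.
apply: (le_trans (ler_wpM2r (heatG_ge0 t z) A)).
have := heatG_sq_le z t0; have := heatG_le2 z t0.
set G := heatG t z; set G2 := cN * _ => H1 H2.
rewrite mulrDl (_ : 3 / t * G2 = (8 * t * G2) / (4 * t ^+ 2) + t^-1 * G2); last first.
  by field; rewrite gt_eqF.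
apply: lerD; last by rewrite ler_wpM2l// ltW.
by rewrite mulrAC; apply: ler_wpM2r => //; rewrite invr_ge0 mulr_ge0 ?sqr_ge0.
Qed.

Lemma measurable_heatDDG_param d (T : measurableType d) j (tau : T -> R) (xi : T -> V) :
  measurable_fun setT tau -> measurable_fun setT xi ->
  measurable_fun setT (fun p => heatDDG j (tau p) (xi p)).
Proof.
move=> mt mx; apply: measurable_funM; last exact: measurable_heatG_param.
have mi := @measurable_invr R.
apply: measurable_funB.
  apply: measurable_funM; first by apply: measurable_funX; exact: measurable_coord_comp.
  by apply: (measurableT_comp mi); apply: measurable_funM => //; exact: measurable_funX.
by apply: (measurableT_comp mi); exact: measurable_funM.
Qed.

Lemma integrable_heatDDG_sub j (t : R) (x : V) : 0 < t ->
  mu.-integrable setT (EFin \o (fun y => heatDDG j t (x - y))).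
Proof.
move=> t0; have t2 : 0 < 2 * t by lra.
apply: (@le_integrable _ _ _ mu setT _ _
  (fun y => ((3 / t * cN)%:E * (heatG (2 * t) (x - y))%:E)%E)) => //.
- apply/measurable_EFinP; apply: measurable_heatDDG_param => //; exact: measurable_subv.
- by move=> y _; rewrite -EFinM /= lee_fin (le_trans (heatDDG_le _ _ t0))// mulrA ler_norm.
- by apply: integrableZl => //; exact: integrable_heatG_sub.
Qed.

Lemma is_derive_heatDG_line j (t s : R) (z : V) : 0 < t ->
  is_derive s 1 (fun s => heatDG j t (s *: ei R j + z)) (heatDDG j t (s *: ei R j + z)).
Proof.
move=> t0; have dG := is_derive_heatG_line j s z t0.
have d1 : is_derive s 1 (fun s : R => - ((s + z 0 j) / (2 * t))) (- (2 * t)^-1).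
  by apply: is_derive_eq; rewrite /GRing.scale /=; ring.
have E r : (r *: ei R j + z) 0 j = r + z 0 j by rewrite !mxE !eqxx mulr1.
apply: (is_derive_ext (is_deriveM d1 dG)) => [r|].
  by rewrite /heatDG E.
rewrite /GRing.scale /= /heatDDG /heatDG !E.
by field; rewrite gt_eqF.
Qed.

Lemma heatK_derive j (t B : R) (w : V -> R) (x : V) : 0 < t -> bmeas B w ->
  is_derive x (ei R j) (heatK j t w) (heatKK j t w x).
Proof.
move=> t0 bw; apply/derive_line.
pose f (s : R) (y : V) := heatDG j t (s *: ei R j + x - y) * w y.
have B0 := bmeas_ge0 bw.
have df (s : R) (y : V) : is_derive s 1 (f ^~ y) (heatDDG j t (s *: ei R j + x - y) * w y).
  have := is_derive_heatDG_line j s (x - y) t0; rewrite addrA => H.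
  apply: (is_derive_ext (is_deriveZ (w y) H)) => [r|].
    by rewrite /f -addrA mulrC.
  by rewrite mulrC.
have t2 : 0 < 2 * t by lra.
have t4 : 0 < 2 * (2 * t) by lra.
pose C := (3 / t * cN) * (cN * expR (1 / (4 * (2 * t)))) * B.
pose Gd (y : V) : R := C * heatG (2 * (2 * t)) (x - y).
have C0 : 0 <= C.
  by rewrite !mulr_ge0 ?invr_ge0 ?cN_ge0 ?expR_ge0// ltW.
have iG : mu.-integrable setT (EFin \o Gd).
  exact: (integrableZl _ _ (integrable_heatG_sub x t4)).
have fb (s : R) (y : V) : `]-1, 1[%classic s -> setT y -> `|partial1of2 f s y| <= Gd y.
  move=> /=; rewrite in_itv/= => /andP[s1 s2] _.
  rewrite partial1of2E; have [_ ->] := df s y; rewrite normrM /Gd /C.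
  rewrite (mulrAC _ B) -(mulrA (3 / t * cN)).
  apply: ler_pM => //; last by case: bw.
  apply: (le_trans (heatDDG_le _ _ t0)).
  rewrite (mulrA (3 / t) cN (heatG _ _)); apply: ler_wpM2l.
    by rewrite !mulr_ge0 ?invr_ge0 ?cN_ge0// ltW.
  apply: heatG_shift_le => //.
  rewrite (_ : _ - _ = s *: ei R j + 0); last by rewrite addr0 -(addrA (s *: ei R j)) addrK.
  rewrite enorm_line mxE mulr0 addr0 (_ : enorm 0 = 0) ?expr0n ?add0r; first by nra.
  by apply/eqP; rewrite enorm_eq0.
have mint s : mu.-integrable setT (EFin \o f s).
  by rewrite /f; exact: (integrable_heatK j (s *: ei R j + x) t0 bw).
have I0 : `]-1, 1[%classic (0 : R) by rewrite /= in_itv/=; apply/andP; split; lra.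
have derf (s : R) (y : V) : `]-1, 1[%classic s -> setT y -> derivable (f ^~ y) s 1.
  by move=> _ _; case: (df s y).
have Gd0 y : 0 <= Gd y by rewrite mulr_ge0// heatG_ge0.
have H1 := derivable_under_integral (mu := mu) measurableT I0 (fun s _ => mint s) derf Gd0 iG fb.
have H2 := differentiation_under_integral (mu := mu) measurableT I0 (fun s _ => mint s) derf Gd0 iG fb.
apply: DeriveDef; first exact: H1.
rewrite -derive1E H2; apply: eq_Rintegral => y _.
by rewrite partial1of2E; have [_ ->] := df 0 y; rewrite scale0r add0r.
Qed.

Lemma is_derive_heatG_time (t : R) (z : V) : 0 < t ->
  is_derive t 1 (fun t => heatG t z) (\sum_j heatDDG j t z).
Proof.
move=> t0; rewrite /heatG.
have pp := @pi_gt0 R.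
have d1 : is_derive t 1 (fun r : R => 4 * pi * r) (4 * pi).
  by apply: is_derive_eq; rewrite /GRing.scale /=; ring.
have pt : 0 < 4 * pi * t by rewrite !mulr_gt0.
have d2 := @is_derive1_comp R _ (fun r : R => 4 * pi * r) t _ _ (is_derive1_powR (- (N%:R / 2)) pt) d1.
have t40 : 4 * t != 0 by rewrite gt_eqF// mulr_gt0.
have d3 : is_derive t 1 (fun r : R => - enorm z ^+ 2 / (4 * r)) (enorm z ^+ 2 / (4 * t ^+ 2)).
  have d4 : is_derive t 1 (fun r : R => 4 * r) 4.
    by apply: is_derive_eq; rewrite /GRing.scale /=; ring.
  apply: (is_derive_ext (is_deriveZ (- enorm z ^+ 2) (is_deriveV t40 d4))) => //.
  by rewrite /GRing.scale /=; field; rewrite gt_eqF.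
have d5 := @is_derive1_comp R _ (fun r : R => - enorm z ^+ 2 / (4 * r)) t _ _ (is_derive_expR _) d3.
apply: (is_derive_ext (is_deriveM d2 d5)) => //.
rewrite /GRing.scale /= /heatDDG -mulr_suml big_split /= -!mulr_suml -enorm_sq /heatG.
rewrite powRD; last by rewrite (gt_eqF pt) implybT.
rewrite powR_inv1 ?ltW// (_ : \sum_(i < N) - (2 * t)^-1 = - (N%:R / (2 * t))); last first.
  by rewrite big_const_ord iter_addr_0 mulNrn -[X in - X]mulr_natl.
have tn : t != 0 by rewrite gt_eqF.
have pn : (pi : R) != 0 by rewrite gt_eqF.
set c := (_ `^ _); set E := expR _.
move: pn; clearbody c E; move: (pi : R) => p pn; by field; rewrite tn pn.
Qed.

(** On a range of times away from 0, the Gaussian at the largest time dominates all others; this is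
    the majorant for differentiation in time. *)
Lemma heatG_time_le (t1 t t2 : R) (z : V) : 0 < t1 -> t1 <= t -> t <= t2 ->
  heatG t z <= (t2 / t1) `^ (N%:R / 2) * heatG t2 z.
Proof.
move=> t10 t1t tt2; have [t0 t20] : 0 < t /\ 0 < t2 by split; lra.
have pp := @pi_gt0 R.
rewrite /heatG mulrA; apply: ler_pM; rewrite ?powR_ge0 ?expR_ge0//; last first.
  rewrite ler_expR !mulNr lerN2 ler_wpM2l ?sqr_ge0// lef_pV2 ?posrE ?mulr_gt0//; lra.
rewrite !powRN -ler_pdivrMr; last by rewrite invr_gt0 powR_gt0// !mulr_gt0.
rewrite invrK mulrC ler_pdivrMr ?powR_gt0 ?mulr_gt0//.
have h1 : 0 <= t2 / t1 by rewrite divr_ge0// ltW.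
have h2 : 0 <= 4 * pi * t by rewrite !mulr_ge0// ltW.
have h3 : 0 <= 4 * pi * t2 by rewrite !mulr_ge0// ltW.
rewrite -powRM//; apply: ge0_ler_powR; rewrite ?nnegrE//; first exact: mulr_ge0.
rewrite (_ : t2 / t1 * (4 * pi * t) = 4 * pi * (t2 * (t / t1))); last by field; rewrite gt_eqF.
rewrite ler_pM2l ?mulr_gt0// -[leLHS]mulr1 ler_pM2l// ler_pdivlMr// mul1r//.
Qed.

Lemma heatH_time_derive (t B : R) (w : V -> R) (x : V) : 0 < t -> bmeas B w ->
  is_derive t 1 (fun t => heatH t w x) (\sum_j heatKK j t w x).
Proof.
move=> t0 bw.
pose f (r : R) (y : V) := heatG r (x - y) * w y.
have B0 := bmeas_ge0 bw.
have df (r : R) (y : V) : 0 < r -> is_derive r 1 (f ^~ y) ((\sum_j heatDDG j r (x - y)) * w y).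
  move=> r0; apply: (is_derive_ext (is_deriveZ (w y) (is_derive_heatG_time (x - y) r0))) => [s|].
    by rewrite /f mulrC.
  by rewrite mulrC.
have t4 : 0 < 4 * t by lra.
(* For r in ]t/2, 2t[ each second-order kernel is at most (3 / r) [cN] G_2r; here 3 / r <= 3 / (t /
   2), and G_2r is dominated by G_4t. *)
pose C := N%:R * (3 / (t / 2)) * cN * (4 * t / (2 * (t / 2))) `^ (N%:R / 2) * B.
pose Gd (y : V) : R := C * heatG (4 * t) (x - y).
have h3 : 0 <= 3 / (t / 2) by rewrite divr_ge0//; lra.
have C0 : 0 <= C.
  exact: mulr_ge0 (mulr_ge0 (mulr_ge0 (mulr_ge0 (ler0n _ _) h3) (cN_ge0 _ _)) (powR_ge0 _ _)) B0.
have iG : mu.-integrable setT (EFin \o Gd).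
  exact: (integrableZl _ _ (integrable_heatG_sub x t4)).
have fb (r : R) (y : V) : `]t / 2, 2 * t[%classic r -> setT y -> `|partial1of2 f r y| <= Gd y.
  move=> /=; rewrite in_itv/= => /andP[r1 r2] _; have r0 : 0 < r by lra.
  rewrite partial1of2E; have [_ ->] := df r y r0; rewrite normrM /Gd /C.
  rewrite (mulrAC _ B); apply: ler_pM => //; last by case: bw.
  apply: (le_trans (ler_norm_sum _ _ _)).
  set K := (_ `^ _).
  apply: (@le_trans _ _ (\sum_(j < N) (3 / (t / 2) * (cN * (K * heatG (4 * t) (x - y)))))).
    apply: ler_sum => j _; apply: (le_trans (heatDDG_le _ _ r0)).
    have e1 : 3 / r <= 3 / (t / 2) by rewrite ler_pM2l// lef_pV2 ?posrE; lra.
    have e2 : cN * heatG (2 * r) (x - y) <= cN * (K * heatG (4 * t) (x - y)).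
      by apply: ler_wpM2l; [exact: cN_ge0|apply: heatG_time_le; lra].
    apply: ler_pM => //; first by rewrite divr_ge0// ltW.
    by rewrite mulr_ge0 ?cN_ge0 ?heatG_ge0.
  by rewrite big_const_ord iter_addr_0 -[X in X <= _]mulr_natl !mulrA lexx.
have mint r : `]t / 2, 2 * t[%classic r -> mu.-integrable setT (EFin \o f r).
  move=> /=; rewrite in_itv/= => /andP[r1 r2]; have r0 : 0 < r by lra.
  exact: (integrable_heatH x r0 bw).
have I0 : `]t / 2, 2 * t[%classic t by rewrite /= in_itv/=; apply/andP; split; lra.
have derf (r : R) (y : V) : `]t / 2, 2 * t[%classic r -> setT y -> derivable (f ^~ y) r 1.
  move=> /=; rewrite in_itv/= => /andP[r1 r2] _; have r0 : 0 < r by lra.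
  by case: (df r y r0).
have Gd0 y : 0 <= Gd y by rewrite mulr_ge0// heatG_ge0.
have H1 := derivable_under_integral (mu := mu) measurableT I0 mint derf Gd0 iG fb.
have H2 := differentiation_under_integral (mu := mu) measurableT I0 mint derf Gd0 iG fb.
apply: DeriveDef; first exact: H1.
rewrite -derive1E H2 /heatKK.
transitivity (\int[mu]_y (\sum_j (heatDDG j t (x - y) * w y))).
  apply: eq_Rintegral => y _; rewrite partial1of2E; have [_ ->] := df t y t0.
  by rewrite mulr_suml.
have ikk j : mu.-integrable setT (EFin \o (fun y => heatDDG j t (x - y) * w y)).
  have [mw wB] := bw.
  by apply: (integrable_mul_bounded (B := B)) => //; exact: integrable_heatDDG_sub.
elim: (index_enum _) => [|j s IH].
  by rewrite big_nil; under eq_Rintegral do rewrite big_nil; rewrite Rintegral_cst// mul0r.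
rewrite big_cons -IH -RintegralD//.
  by apply: eq_Rintegral => y _; rewrite big_cons.
rewrite (_ : EFin \o _ = fun y => (\sum_(j <- s) (heatDDG j t (x - y) * w y)%:E)%E); last first.
  by apply/funext => y /=; rewrite sumEFin.
by apply: integrable_sum => // i _; exact: ikk.
Qed.

Lemma heatH_near_affine (h B L e c : R) (w : V -> R) (x : V) : 0 < h -> bmeas B w -> 0 <= L ->
  (forall y, `|w y - c| <= e + L * l1 (y - x)) ->
  `|heatH h w x - c| <= e + L * (N%:R * 2 * (Num.sqrt 2 * cN)) * Num.sqrt h.
Proof.
move=> h0 bw L0 wL; have h2 : 0 < 2 * h by lra.
have bd := bmeasB bw (bmeas_cst N c).
rewrite -[X in _ - X](heatH_cst c x h0) -(heatHB x h0 bw (bmeas_cst _ c)).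
set k := L * (N%:R * 2 * (Num.sqrt 2 * cN)) * Num.sqrt h.
have ig := integrable_heatG_sub x h0; have ig2 := integrable_heatG_sub x h2.
have i1 : mu.-integrable setT (EFin \o (fun y => e * heatG h (x - y))) by exact: (integrableZl _ e ig).
have i2 : mu.-integrable setT (EFin \o (fun y => k * heatG (2 * h) (x - y))).
  exact: (integrableZl _ k ig2).
apply: (@le_trans _ _ (\int[mu]_y (e * heatG h (x - y) + k * heatG (2 * h) (x - y)))).
  apply: normr_Rintegral_le => //; first exact: (integrable_heatH x h0 bd).
    exact: (integrableD _ i1 i2).
  move=> y _; rewrite normrM ger0_norm ?heatG_ge0//.
  apply: (le_trans (ler_wpM2l (heatG_ge0 h (x - y)) (wL y))).
  rewrite mulrDr (mulrC e) lerD2l.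
  rewrite mulrCA /k -!(mulrA L) ler_wpM2l// (_ : l1 (y - x) = l1 (x - y)); last first.
    by apply: eq_bigr => i _; rewrite !mxE distrC.
  apply: (le_trans (heatG_l1_le _ h0)).
  by rewrite -(mulrA 2) mul_kap// !mulrA lexx.
rewrite RintegralD// (@RintegralZl _ _ _ mu setT (fun y => heatG h (x - y)) e)//.
rewrite (@RintegralZl _ _ _ mu setT (fun y => heatG (2 * h) (x - y)) k)//.
by rewrite !Rintegral_heatG_sub// !mulr1.
Qed.

(** Near x continuity is used, beyond distance d the bound 2 B, which is at most 2 B / d times the
    distance. In this form mere continuity can replace a Lipschitz condition in the estimates of
    [heatH]. *)
Lemma continuous_affine_bound (w : V -> R) (x : V) (B e : R) : 0 < e ->
  (forall y, `|w y| <= B) -> {for x, continuous w} ->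
  exists2 L : R, 0 <= L & forall y, `|w y - w x| <= e + L * l1 (y - x).
Proof.
move=> e0 wB cw; have B0 : 0 <= B by apply: le_trans (wB 0).
have cw' : w @ x --> w x := cw.
have /cvgrPdist_lt/(_ e e0)/nbhs_ballP[d /= d0 dH] := cw'.
exists (2 * B / d); first by rewrite divr_ge0 ?mulr_ge0// ltW.
move=> y; have l0 := l1_ge0 (y - x).
have L0 : 0 <= 2 * B / d by rewrite divr_ge0 ?mulr_ge0// ltW.
have [ld|ld] := ltP (l1 (y - x)) d.
  have : `|w x - w y| < e.
    apply: dH; rewrite -ball_normE /=; apply: le_lt_trans ld.
    rewrite distrC [leLHS]/Num.norm /= mx_normrE; apply: bigmax_le => [|[i j] _ /=]; first exact: l1_ge0.
    rewrite ord1 /l1 (bigD1 j)//= lerDl sumr_ge0//.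
  by rewrite distrC => /ltW H; apply: (le_trans H); rewrite lerDl mulr_ge0.
apply: (@le_trans _ _ (2 * B)).
  by apply: (le_trans (ler_normB _ _)); rewrite mulr_natl mulr2n lerD.
have : 2 * B <= 2 * B / d * l1 (y - x).
  by rewrite mulrAC ler_pdivlMr// ler_wpM2l// mulr_ge0.
lra.
Qed.

End HeatSecondOrder.

(** * Time derivatives of the heat flow and of mild solutions *)

Section HeatFlowC2.
Variables (R : realType) (N : nat).
Local Notation V := 'rV[R]_N.
Local Notation mu := (lebn R N).
Local Notation leb := (@lebesgue_measure R).
Let ck : R := Num.sqrt 2 * cN R N.
Let cH : R := N%:R * 2 * ck.

Let ck0 : 0 <= ck. Proof. by rewrite mulr_ge0 ?sqrtr_ge0 ?cN_ge0. Qed.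
Let cH0 : 0 <= cH. Proof. by exact: mulr_ge0 (mulr_ge0 (ler0n _ _) (ler0n _ 2)) ck0. Qed.

Lemma derivable_continuous (f : R -> R) (t : R) : derivable f t 1 -> f @ t --> f t.
Proof.
move=> D; have : {for t, continuous f}; last by [].
by apply: differentiable_continuous; apply/derivable1_diffP.
Qed.

Lemma continuous_sum_at (T : topologicalType) (F : 'I_N -> T -> R) (p : T) :
  (forall i, {for p, continuous (F i)}) -> {for p, continuous (fun q => \sum_i F i q)}.
Proof.
move=> cF; have : (fun q => \sum_i F i q) @ p --> \sum_i F i p; last by [].
elim: (index_enum _) => [|i s IH].
  by under eq_fun do rewrite big_nil; rewrite big_nil; exact: cvg_cst.
by under eq_fun do rewrite big_cons; rewrite big_cons; apply: cvgD => //; exact: cF.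
Qed.

Lemma heatKK_move j (t B B1 B2 : R) (w D1 D2 : V -> R) (x : V) : 0 < t ->
  bmeas B w -> bmeas B1 D1 -> bmeas B2 D2 ->
  (forall y, is_derive y (ei R j) w (D1 y)) -> (forall y, is_derive y (ei R j) D1 (D2 y)) ->
  heatKK j t w x = heatH t D2 x.
Proof.
move=> t0 bw b1 b2 d1 d2.
have [_ <-] := heatK_derive j x t0 bw.
have -> : heatK j t w = heatH t D1.
  by apply/funext => y; exact: (heatH_derive_move y t0 bw b1 d1).
have [_ ->] := heatH_derive j x t0 b1.
exact: (heatH_derive_move x t0 b1 b2 d2).
Qed.

Lemma bmeas_sum (B : R) (w : 'I_N -> V -> R) : (forall j, bmeas B (w j)) ->
  bmeas (N%:R * B) (fun y => \sum_j w j y).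
Proof.
move=> bw; split; first by apply: measurable_sum => j; case: (bw j).
move=> x; apply: (le_trans (ler_norm_sum _ _ _)).
rewrite mulr_natl -[X in _ *+ X](card_ord N) -sumr_const.
by apply: ler_sum => j _; case: (bw j).
Qed.

Lemma heatH_sum (t B : R) (w : 'I_N -> V -> R) (x : V) : 0 < t -> (forall j, bmeas B (w j)) ->
  heatH t (fun y => \sum_j w j y) x = \sum_j heatH t (w j) x.
Proof.
move=> t0 bw.
suff [C _ ->] : exists2 C, bmeas C (fun y => \sum_j w j y) &
  heatH t (fun y => \sum_j w j y) x = \sum_j heatH t (w j) x by [].
elim: (index_enum _) => [|j s [C bC IH]].
  exists `|0 : R|.
    by under eq_fun do rewrite big_nil; exact: bmeas_cst.
  by rewrite big_nil; under eq_fun do rewrite big_nil; rewrite heatH_cst.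
exists (B + C); first by under eq_fun do rewrite big_cons; exact: bmeasD.
rewrite big_cons -IH; under eq_fun do rewrite big_cons.
exact: (heatHD x t0 (bw j) bC).
Qed.

Lemma heatH_cvg0 (B : R) (w : V -> R) (x : V) : bmeas B w -> {for x, continuous w} ->
  heatH s w x @[s --> 0^'+] --> w x.
Proof.
move=> bw cw; apply/cvgrPdist_lt => e e0.
have e2 : 0 < e / 2 by lra.
have [L L0 HL] := continuous_affine_bound e2 (proj2 bw) cw.
have [d d0 Hd] := @small_sqrt R (L * cH) 0 (e / 2) (mulr_ge0 L0 cH0) (lexx _) e2.
near=> s; have s0 : 0 < s by near: s; exact: nbhs_right_gt.
have sd : s < d by near: s; exact: nbhs_right_lt.
rewrite distrC; apply: (le_lt_trans (heatH_near_affine s0 bw L0 HL)).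
rewrite -/ck -/cH; have := Hd s; rewrite (ltW s0) sd mul0r addr0 => /(_ isT); lra.
Unshelve. all: by end_near.
Qed.

(** The fundamental theorem for s |-> H_s w (x). Its derivative is H_s (Delta w) (x), because the
    derivatives can be moved onto [w]; extended by their values at s = 0, both functions ([k] and
    [kd]) are continuous up to the endpoint. *)
Lemma heat_flow_C2 (t B B1 B2 : R) (w : V -> R) (D1 D2 : 'I_N -> V -> R) (x : V) : 0 < t ->
  bmeas B w -> (forall j, bmeas B1 (D1 j)) -> (forall j, bmeas B2 (D2 j)) ->
  (forall j y, is_derive y (ei R j) w (D1 j y)) ->
  (forall j y, is_derive y (ei R j) (D1 j) (D2 j y)) ->
  {for x, continuous w} -> {for x, continuous (fun y => \sum_j D2 j y)} ->
  heatH t w x - w x = \int[leb]_(s in `]0, t[) heatH s (fun y => \sum_j D2 j y) x.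
Proof.
move=> t0 bw b1 b2 d1 d2 cw cl; pose lap (y : V) := \sum_j D2 j y; rewrite -/lap in cl *.
have bl : bmeas (N%:R * B2) lap by exact: bmeas_sum.
pose k (s : R) := if 0 < s then heatH s w x else w x.
pose kd (s : R) := if 0 < s then heatH s lap x else lap x.
have nE (f g : R -> R) (s c : R) : 0 < s -> (forall r, 0 < r -> f r = g r) ->
    f @ s --> c -> g @ s --> c.
  move=> s0 fg; apply: cvg_trans; apply: near_eq_cvg; near=> r; rewrite fg//.
  by near: r; exact: lt_nbhsr.
have dH (s : R) : 0 < s -> is_derive s 1 (fun s => heatH s w x) (heatH s lap x).
  move=> s0; have := heatH_time_derive x s0 bw.
  rewrite /lap (heatH_sum x s0 b2).
  by under eq_bigr do rewrite (heatKK_move x s0 bw (b1 _) (b2 _) (d1 _) (d2 _)).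
have ckd (s : R) : 0 < s -> {for s, continuous kd}.
  move=> s0; apply: (nE (fun s => heatH s lap x)) => // [r r0|].
    by rewrite /kd r0.
  have -> : kd s = heatH s lap x by rewrite /kd s0.
  have [D _] := heatH_time_derive x s0 bl.
  exact: (derivable_continuous D).
have ck' (s : R) : 0 < s -> {for s, continuous k}.
  move=> s0; apply: (nE (fun s => heatH s w x)) => // [r r0|].
    by rewrite /k r0.
  have -> : k s = heatH s w x by rewrite /k s0.
  have [D _] := dH s s0.
  exact: (derivable_continuous D).
have r0 (f : V -> R) (g : R -> R) : heatH s f x @[s --> 0^'+] --> f x ->
    (forall s, g s = if 0 < s then heatH s f x else f x) -> g @ 0^'+ --> g 0.
  move=> H gE; rewrite gE ltxx; apply: cvg_trans H; apply: near_eq_cvg; near=> s.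
  by rewrite gE ifT//; near: s; exact: nbhs_right_gt.
have FTC := @continuous_FTC2 R kd k 0 t t0.
have E : (\int[leb]_(s in `[0%R, t]) (kd s)%:E = (k t)%:E - (k 0)%:E)%E.
  apply: FTC.
  - apply/(continuous_within_itvP _ t0); split.
    + by move=> s; rewrite in_itv/= => /andP[? _]; exact: ckd.
    + exact: (r0 lap kd (heatH_cvg0 bl cl)).
    + by apply: cvg_at_left_filter; exact: ckd.
  - split.
    + move=> s; rewrite in_itv/= => /andP[s0 _].
      have [D _] := dH s s0; move: D; apply: near_eq_derivable.
      near=> r; rewrite /k ifT//; near: r; exact: lt_nbhsr.
    + exact: (r0 w k (heatH_cvg0 bw cw)).
    + by apply: cvg_at_left_filter; exact: ck'.
  - move=> s; rewrite in_itv/= => /andP[s0 _]; rewrite derive1E.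
    have -> : kd s = heatH s lap x by rewrite /kd s0.
    have [_ <-] := dH s s0.
    apply: near_eq_derive.
    near=> r; rewrite /k ifT//; near: r; exact: lt_nbhsr.
have -> : heatH t w x - w x = k t - k 0 by rewrite /k t0 ltxx.
rewrite /Rintegral; apply: EFin_inj; rewrite EFinB -E.
have mk : measurable_fun setT (fun s : R => heatH s lap x).
  apply: (@measurable_heatH_param R N _ _ id (fun=> x) (fun p : R * V => lap p.2)) => //.
  by apply: measurableT_comp => //; case: bl.
have bi : bsrc 0 t (N%:R * B2) (fun y _ => lap y).
  split; last by move=> s y _; case: bl.
  by apply: (measurableT_comp (f := lap)) => //; case: bl.
have ib : leb.-integrable `]0, t[ (EFin \o (fun s => heatH s lap x)).
  apply: (@le_integrable _ _ _ leb _ _ _ (EFin \o (fun=> N%:R * B2))) => //.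
  - by apply/measurable_EFinP; exact: measurable_funTS.
  - move=> s /=; rewrite in_itv/= => /andP[s0 _]; rewrite lee_fin.
    by rewrite (ger0_norm (bmeas_ge0 bl)); exact: heatH_le.
  - exact: integrable_itvoo_cst.
rewrite fineK; last exact: (integrable_fin_num _ ib).
transitivity (\int[leb]_(s in `]0%R, t[) (kd s)%:E)%E; last first.
  apply: eq_integral => s /set_mem/=; rewrite in_itv/= => /andP[s0 _].
  by rewrite /kd s0.
have mkd : measurable_fun setT kd.
  apply: measurable_fun_ifT => //; exact: measurable_fun_ltr.
rewrite -integral_itv_bndo_bndc; last by apply: measurable_funTS; exact/measurable_EFinP.
by rewrite -integral_itv_obnd_cbnd//; apply: measurable_funTS; exact/measurable_EFinP.
Unshelve. all: by end_near.
Qed.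

(** The hypothesis concerns pairs t1 < t2 only, the order in which integral formulas are available;
    left and right difference quotients are then covered together. *)
Lemma is_derive_of_increments (phi : R -> R) (t c : R) :
  (forall e : R, 0 < e -> exists2 d : R, 0 < d & forall t1 t2, t - d < t1 -> t1 < t2 -> t2 < t + d ->
    `|phi t2 - phi t1 - (t2 - t1) * c| <= e * (t2 - t1)) ->
  is_derive t 1 phi c.
Proof.
move=> H.
suff C : h^-1 *: ((phi \o shift t) (h *: 1) - phi t) @[h --> 0^'] --> c.
  apply: DeriveDef; first by apply/cvg_ex; exists c.
  by apply/cvg_lim.
apply/cvgrPdist_le => e e0; have [d d0 dH] := H e e0.
near=> h; have h0 : h != 0 by near: h; exact: nbhs_dnbhs_neq.
have hd : `|h| < d by near: h; apply: dnbhs0_lt.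
rewrite /= [h *: 1]mulr1 /GRing.scale /=.
have {}hd : - d < h < d by rewrite -ltr_norml.
case/andP: hd => h1 h2.
rewrite (_ : c - _ = - (h^-1 * (phi (h + t) - phi t - h * c))); last by field.
rewrite normrN normrM normfV mulrC ler_pdivrMr ?normr_gt0//.
move: h0; rewrite neq_lt => /orP[h0|h0].
  have := dH (h + t) t; rewrite (_ : phi t - _ - _ = - (phi (h + t) - phi t - h * c)); last by ring.
  rewrite normrN (ltr0_norm h0) (_ : t - (h + t) = - h); last by ring.
  by apply; lra.
have := dH t (h + t); rewrite (_ : h + t - t = h); last by ring.
by rewrite (gtr0_norm h0); apply; lra.
Unshelve. all: by end_near.
Qed.

Lemma continuous_pair_affine (F : V -> R -> R) (x : V) (t B d0 e : R) : 0 < e -> 0 < d0 ->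
  (forall y s, `|s - t| < d0 -> `|F y s| <= B) ->
  {for (x, t), continuous (fun q : V * R => F q.1 q.2)} ->
  exists d L : R, [/\ 0 < d, 0 <= L & forall y s, `|s - t| < d ->
    `|F y s - F x t| <= e + L * l1 (y - x)].
Proof.
move=> e0 d00 FB cF.
have B0 : 0 <= B by apply: le_trans (FB 0 t _) => //; rewrite subrr normr0.
have cF' : (fun q : V * R => F q.1 q.2) @ (x, t) --> F x t := cF.
have /cvgrPdist_lt/(_ e e0) [[A1 A2] /= [n1 n2] A12] := cF'.
have /nbhs_ballP[r1 /= r10 b1] := n1.
have /nbhs_ballP[r2 /= r20 b2] := n2.
exists (Num.min r2 d0), (2 * B / r1); split.
- by rewrite lt_min r20.
- by rewrite divr_ge0 ?mulr_ge0// ltW.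
move=> y s; rewrite lt_min => /andP[sr sd]; have l0 := l1_ge0 (y - x).
have L0 : 0 <= 2 * B / r1 by rewrite divr_ge0 ?mulr_ge0// ltW.
have [ld|ld] := ltP (l1 (y - x)) r1.
  have : `|F x t - F y s| < e.
    apply: (A12 (y, s)); split => /=.
      apply: b1; rewrite -ball_normE /=; apply: le_lt_trans ld.
      rewrite distrC [leLHS]/Num.norm /= mx_normrE; apply: bigmax_le => [|[i j] _ /=]; first exact: l1_ge0.
      by rewrite ord1 /l1 (bigD1 j)//= lerDl sumr_ge0.
    by apply: b2; rewrite -ball_normE /= distrC.
  by rewrite distrC => /ltW H; apply: (le_trans H); rewrite lerDl mulr_ge0.
apply: (@le_trans _ _ (2 * B)).
  apply: (le_trans (ler_normB _ _)); rewrite mulr_natl mulr2n lerD ?FB//.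
  by rewrite subrr normr0.
have : 2 * B <= 2 * B / r1 * l1 (y - x).
  by rewrite mulrAC ler_pdivlMr// ler_wpM2l// mulr_ge0.
lra.
Qed.

Lemma continuous_pair_sec (F : V -> R -> R) (x : V) (t : R) :
  {for (x, t), continuous (fun q : V * R => F q.1 q.2)} -> {for x, continuous (F ^~ t)}.
Proof.
move=> cF; have cF' : (fun q : V * R => F q.1 q.2) @ (x, t) --> F x t := cF.
apply: (cvg_comp (fun y : V => (y, t)) _ _ cF').
apply: (@cvg_pair _ _ _ (nbhs x) (nbhs x) (nbhs t) _ _ _ id (fun=> t)); [exact: cvg_id|exact: cvg_cst].
Qed.

(** Between t1 and t2 the heat part contributes about (t2 - t1) times the Laplacian at time t1, the
    Duhamel part (t2 - t1) times the source. The affine bounds given by joint continuity keep both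
    close to their values at (x, t). *)
Lemma mild_time_derive (a T B M B1 B2 : R) (u g : V -> R -> R) (D1 D2 : 'I_N -> V -> R -> R)
    (x : V) (t : R) :
  mild a T B M u g -> a < t < T ->
  (forall j s, a < s < T -> bmeas B1 (D1 j ^~ s)) ->
  (forall j s, a < s < T -> bmeas B2 (D2 j ^~ s)) ->
  (forall j y s, a < s < T -> is_derive y (ei R j) (u ^~ s) (D1 j y s)) ->
  (forall j y s, a < s < T -> is_derive y (ei R j) (D1 j ^~ s) (D2 j y s)) ->
  (forall s, a < s < T -> {for (x, s), continuous (fun q : V * R => \sum_j D2 j q.1 q.2)}) ->
  {for (x, t), continuous (fun q : V * R => g q.1 q.2)} ->
  is_derive t 1 (u x) (\sum_j D2 j x t + g x t).
Proof.
move=> mil /andP[at' tT] b1 b2 d1 d2 cl cg; have aT : a < T by lra.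
apply: is_derive_of_increments => e e0.
pose d0 : R := Num.min (t - a) (T - t).
have d00 : 0 < d0 by rewrite lt_min; apply/andP; split; lra.
have inT s : `|s - t| < d0 -> a < s < T.
  by rewrite lt_min ltr_norml => /andP[/andP[? ?]]; rewrite ltr_norml => /andP[? ?]; apply/andP; split; lra.
clearbody d0.
have e4 : 0 < e / 4 by lra.
pose lap (y : V) s := \sum_j D2 j y s.
have bl s : a < s < T -> bmeas (N%:R * B2) (lap ^~ s).
  by move=> sT; apply: bmeas_sum => j; exact: b2.
have [d3 [L1 [d30 L10 H1]]] := @continuous_pair_affine lap x t (N%:R * B2) d0 (e / 4) e4 d00
  (fun y s H => proj2 (bl s (inT s H)) y) (cl t (introT andP (conj at' tT))).
have gM y s : `|s - t| < d0 -> `|g y s| <= M.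
  by move=> /inT /andP[? ?]; case: mil => _ _ _ H _; apply: H; lra.
have [d4 [L2 [d40 L20 H2]]] := @continuous_pair_affine g x t M d0 (e / 4) e4 d00 gM cg.
have [d5 d50 H5] := @small_sqrt R (L1 * cH) 0 (e / 4) (mulr_ge0 L10 cH0) (lexx _) e4.
have [d6 d60 H6] := @small_sqrt R (L2 * cH) 0 (e / 4) (mulr_ge0 L20 cH0) (lexx _) e4.
pose d := Num.min (Num.min (Num.min d3 d4) d0) (Num.min d5 d6).
have dd : 0 < d by rewrite !lt_min d30 d40 d00 d50 d60.
exists (d / 2); first by lra.
move=> t1 t2 t1d t12 t2d.
have near_t s : t1 <= s -> s <= t2 -> `|s - t| < d.
  by move=> s1 s2; rewrite ltr_norml; clear - t1d t2d s1 s2 dd; apply/andP; split; lra.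
have nd s : t1 <= s -> s <= t2 -> [/\ `|s - t| < d3, `|s - t| < d4 & a < s < T].
  move=> s1 s2; have := near_t s s1 s2; rewrite !lt_min => /andP[/andP[/andP[? ?] ?] _]; split=> //.
  exact: inT.
have [n1 _ t1T] := nd t1 (lexx _) (ltW t12).
have [_ _ /andP[_ t2T]] := nd t2 (ltW t12) (lexx _).
have h0 : 0 < t2 - t1 by rewrite subr_gt0.
have hd : t2 - t1 < d by clear - t1d t2d; lra.
have [h5 h6] : t2 - t1 < d5 /\ t2 - t1 < d6.
  by move: hd; rewrite !lt_min => /andP[_ /andP[? ?]].
have [_ _ _ _ Hm] := mil.
rewrite (Hm x t1 t2 _ t12 t2T); last by case/andP: t1T => /ltW.
have bu : bmeas B (u ^~ t1) by apply: (mild_bmeas mil); case/andP: t1T => /ltW -> ->.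
have cut : {for x, continuous (u ^~ t1)}.
  by apply: continuous_pair_sec; apply: (mild_continuous mil aT).
have HL := heat_flow_C2 h0 bu (fun j => b1 j t1 t1T) (fun j => b2 j t1 t1T)
  (fun j y => d1 j y t1 t1T) (fun j y => d2 j y t1 t1T) cut
  (continuous_pair_sec (F := fun y s => \sum_j D2 j y s) (cl t1 t1T)).
rewrite (addrAC (heatH _ _ _) (duh _ _ _ _)) HL.
set I1 := \int[_]_(s in _) _; set I2 := duh _ _ _ _.
have K (I c L : R) (f : R -> R) (p q : R) : p < q -> leb.-integrable `]p, q[ (EFin \o f) ->
    I = \int[leb]_(s in `]p, q[) f s -> (forall s, p < s < q -> `|f s - c| <= e / 2) ->
    `|I - (q - p) * c| <= e / 2 * (q - p).
  move=> pq fi -> fc.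
  rewrite (mulrC (q - p)) -(Rintegral_itvoo_cst c (ltW pq)) -RintegralB//; last first.
    exact: integrable_itvoo_cst.
  rewrite -(Rintegral_itvoo_cst (e / 2) (ltW pq)).
  have i2 : leb.-integrable `]p, q[ (EFin \o (fun s => f s - c)).
    exact: (integrableB _ fi (integrable_itvoo_cst _ _ _)).
  have i3 := integrable_itvoo_cst p q (e / 2).
  exact: normr_Rintegral_le.
have A1 : `|I1 - (t2 - t1) * lap x t| <= e / 2 * (t2 - t1).
  have := K I1 (lap x t) L1 (fun s => heatH s (lap ^~ t1) x) 0 (t2 - t1) h0.
  rewrite subr0; apply => //.
    have bi : bsrc 0 (t2 - t1) (N%:R * B2) (fun y s => lap y t1).
      split; last by move=> s y _; case: (bl t1 t1T).
      by apply: (measurableT_comp (f := lap ^~ t1)) => //; case: (bl t1 t1T).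
    apply: (@le_integrable _ _ _ leb _ _ _ (EFin \o (fun=> N%:R * B2))) => //.
    - apply/measurable_EFinP; apply: measurable_funTS.
      apply: (@measurable_heatH_param R N _ _ id (fun=> x) (fun p : R * V => lap p.2 t1)) => //.
      by apply: (measurableT_comp (f := lap ^~ t1)) => //; case: (bl t1 t1T).
    - move=> s /=; rewrite in_itv/= => /andP[s0 _]; rewrite lee_fin.
      by rewrite (ger0_norm (bmeas_ge0 (bl t1 t1T))); exact: heatH_le (bl t1 t1T).
    - exact: integrable_itvoo_cst.
  move=> s /andP[s0 s1].
  apply: (le_trans (heatH_near_affine s0 (bl t1 t1T) L10 (fun y => H1 y t1 n1))).
  have := H5 s; rewrite (ltW s0) (lt_trans s1 h5) mul0r addr0 => /(_ isT) h.
  by rewrite -/ck -/cH; clear - h; lra.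
have bg : bsrc t1 t2 M g by apply: (mild_bsrc mil); [case/andP: t1T => /ltW|exact: ltW].
have A2 : `|I2 - (t2 - t1) * g x t| <= e / 2 * (t2 - t1).
  apply: (K I2 (g x t) L2 (fun s => heatH (t2 - s) (g ^~ s) x) t1 t2 t12 (integrable_duh x bg) erefl).
  move=> s s12; case/andP: (s12) => s1 s2; have ts : 0 < t2 - s by rewrite subr_gt0.
  have [_ n4 _] := nd s (ltW s1) (ltW s2).
  apply: (le_trans (heatH_near_affine ts (bsrc_bmeas bg s12) L20 (fun y => H2 y s n4))).
  have := H6 (t2 - s); rewrite (ltW ts) mul0r addr0 (_ : t2 - s < d6); last by apply: lt_trans h6; rewrite ltrD2l ltrN2.
  by move=> /(_ isT) h; rewrite -/ck -/cH; clear - h; lra.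
rewrite (_ : I1 + I2 - _ = (I1 - (t2 - t1) * lap x t) + (I2 - (t2 - t1) * g x t)); last first.
  by rewrite /lap; ring.
by apply: (le_trans (ler_normD _ _)); clear - A1 A2; lra.
Qed.

End HeatFlowC2.

(** * Bounded mild solutions are classical *)

Section Classical.
Variables (R : realType) (N : nat).
Local Notation V := 'rV[R]_N.
Local Notation mu := (lebn R N).
Local Notation leb := (@lebesgue_measure R).

Lemma continuous_pair_near (F G : V * R -> R) (x : V) (t a T : R) : a < t < T ->
  (forall y s, a < s < T -> F (y, s) = G (y, s)) ->
  {for (x, t), continuous F} -> {for (x, t), continuous G}.
Proof.
move=> tT FG cF; have cF' : F @ (x, t) --> F (x, t) := cF.
suff : G @ (x, t) --> G (x, t) by [].
rewrite -FG//; apply: cvg_trans cF'; apply: near_eq_cvg.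
have nt : nbhs t [set s | a < s < T].
  case/andP: tT => ta tT; apply: filterS2 (lt_nbhsr ta) (lt_nbhsl tT) => s /= ? ?.
  exact/andP.
exists ([set: V], [set s | a < s < T]) => /=; first by split => //; exact: filterT.
by move=> [y s] /= [_ st]; rewrite FG.
Qed.

Lemma mildS (a T B M a' : R) (u g : V -> R -> R) : mild a T B M u g -> a <= a' ->
  mild a' T B M u g.
Proof.
move=> [mu' mg H1 H2 H3] aa; split=> // [x s /andP[? ?]|x s /andP[? ?]|x s t as' st tT].
- by apply: H1; lra.
- by apply: H2; lra.
- by apply: H3 => //; lra.
Qed.

Section MildClassical.
Variables (a T B M L : R) (u g : V -> R -> R) (phi dphi : R -> R).
Hypothesis mildu : mild a T B M u g.
Hypothesis aT : a < T.
Hypothesis dphiE : forall r : R, is_derive r 1 phi (dphi r).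
Hypothesis dphiL : forall r, `|dphi r| <= L.
Hypothesis mdphi : measurable_fun setT dphi.
Hypothesis gE : forall x s, a <= s < T -> g x s = phi (u x s).

Let mg (a' : R) i : a < a' -> a' < T -> exists B' M' : R,
  mild a' T B' M' (mgrad a T u i) (fun x s => dphi (u x s) * mgrad a T u i x s).
Proof.
move=> h1 h2; eexists; eexists.
exact: (mild_mgrad mildu i h1 h2 dphiE dphiL mdphi gE).
Qed.

Let mgE i s : a < s < T -> mgrad a T u i ^~ s = 'D_(ei R i) (u ^~ s).
Proof. by move=> st; apply/funext => y; rewrite /mgrad st. Qed.

Lemma mild_derivable1 i x t : a < t < T -> derivable (u ^~ t) x (ei R i).
Proof. by move=> /andP[h1 h2]; case: (mild_derive mildu i x (lexx _) h1 h2). Qed.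

Lemma mild_derivable2 i j x t : a < t < T -> derivable ('D_(ei R i) (u ^~ t)) x (ei R j).
Proof.
move=> tT; case/andP: (tT) => h1 h2; rewrite -mgE//.
have [||B' [M' m]] := @mg ((a + t) / 2) i; [lra|lra|].
have h3 : (a + t) / 2 < t by lra.
by case: (mild_derive m j x (lexx _) h3 h2).
Qed.

Lemma mild_continuous2 i j x t : a < t < T ->
  {for (x, t), continuous (fun q : V * R => 'D_(ei R j) ('D_(ei R i) (u ^~ q.2)) q.1)}.
Proof.
move=> tT; case/andP: (tT) => h1 h2.
have [||B' [M' m]] := @mg ((a + t) / 2) i; [lra|lra|].
have h3 : (a + t) / 2 < t < T by lra.
have h4 : (a + t) / 2 < T by lra.
have := mild_grad_continuous m h4 (j := j) (x := x) h3.
apply: continuous_pair_near h3 _ => y s /andP[? ?] /=; rewrite mgE//; lra.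
Qed.

Let g_continuous x t : a < t < T -> {for (x, t), continuous (fun q : V * R => g q.1 q.2)}.
Proof.
move=> tT.
have cu := mild_continuous mildu aT (x := x) tT.
have cp : {for u x t, continuous phi}.
  by have [D _] := dphiE (u x t); exact: (derivable_continuous D).
have : {for (x, t), continuous (fun q : V * R => phi (u q.1 q.2))}.
  by apply: (continuous_comp (f := fun q : V * R => u q.1 q.2)).
apply: continuous_pair_near tT _ => y s /andP[? ?] /=; rewrite gE//; lra.
Qed.

Let lap (q : V * R) := \sum_i 'D_(ei R i) ('D_(ei R i) (u ^~ q.2)) q.1.

Let lap_continuous x t : a < t < T -> {for (x, t), continuous lap}.
Proof.
by move=> tT; apply: continuous_sum_at => i; exact: (@mild_continuous2 i i x t tT).
Qed.

Lemma mild_heat_eq x t : a < t < T ->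
  is_derive t 1 (u x) (\sum_i 'D_(ei R i) ('D_(ei R i) (u ^~ t)) x + g x t).
Proof.
move=> tT; case/andP: (tT) => h1 h2.
(* Each differentiation costs some time: first derivatives are bounded from [a1] on, second
   derivatives from [a2] on. *)
pose a1 := a + (t - a) / 3; pose a2 := a + 2 * ((t - a) / 3).
have [aa1 a12 a2t] : [/\ a < a1, a1 < a2 & a2 < t] by rewrite /a1 /a2; split; lra.
have a1T : a1 < T by lra.
have a2T : a2 < T by lra.
pose Bg := gbd N B M (a1 - a); pose Mg := L * Bg.
have m i : mild a1 T Bg Mg (mgrad a T u i) (fun x s => dphi (u x s) * mgrad a T u i x s).
  exact: (mild_mgrad mildu i aa1 a1T dphiE dphiL mdphi gE).
have m2 := mildS mildu (ltW (lt_trans aa1 a12)).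
have sub s : a2 < s < T -> a < s < T by move=> /andP[? ?]; lra.
have E := @mild_time_derive R N a2 T B M Bg (gbd N Bg Mg (a2 - a1)) u g (fun i => mgrad a T u i)
  (fun i y s => 'D_(ei R i) (mgrad a T u i ^~ s) y) x t m2.
suff E' : is_derive t 1 (u x) (\sum_j 'D_(ei R j) (mgrad a T u j ^~ t) x + g x t).
  apply: (is_derive_ext E') => [y //|]; congr (_ + _); apply: eq_bigr => i _.
  by rewrite (mgE i tT).
apply: E; first by rewrite a2t h2.
- by move=> i s /andP[? ?]; apply: (mild_bmeas (m i)); lra.
- move=> i s /andP[? ?]; split.
    rewrite (_ : (fun y => _) = mgrad a1 T (mgrad a T u i) i ^~ s); last first.
      by apply/funext => y; rewrite {2}/mgrad ifT//; apply/andP; split; lra.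
    by apply: jmeas_sec; exact: (jmeas_mgrad (m i)).
  by move=> y; apply: (mild_grad_le (m i)) => //; lra.
- move=> i y s /sub sT; have D := @mild_derivable1 i y s sT.
  rewrite /mgrad sT; exact: DeriveDef.
- move=> i y s /sub sT; have D := @mild_derivable2 i i y s sT.
  rewrite (mgE i sT); exact: DeriveDef.
- move=> s sT; have := @lap_continuous x s (sub s sT); apply: continuous_pair_near sT _.
  by move=> y r /sub rT; apply: eq_bigr => i _ /=; rewrite (mgE i rT).
- exact: g_continuous.
Qed.

Lemma mild_time_derive_continuous x t : a < t < T ->
  {for (x, t), continuous (fun q : V * R => derive1 (u q.1) q.2)}.
Proof.
move=> tT.
have : {for (x, t), continuous (fun q => lap q + g q.1 q.2)}.
  exact: (continuousD (lap_continuous tT) (g_continuous tT)).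
apply: continuous_pair_near tT _ => y s st /=; rewrite derive1E.
by have [_ ->] := mild_heat_eq y st.
Qed.

End MildClassical.

Lemma heatED (t : R) (w1 w2 : V -> \bar R) (x : V) : measurable_fun setT w1 -> measurable_fun setT w2 ->
  (forall y, 0 <= w1 y)%E -> (forall y, 0 <= w2 y)%E ->
  heatE t (fun y => w1 y + w2 y)%E x = (heatE t w1 x + heatE t w2 x)%E.
Proof.
move=> m1 m2 p1 p2; rewrite /heatE -ge0_integralD//.
- by apply: eq_integral => y _; rewrite ge0_muleDr.
- by move=> y _; rewrite mule_ge0// lee_fin heatG_ge0.
- exact: measurable_heat_integrand.
- by move=> y _; rewrite mule_ge0// lee_fin heatG_ge0.
- exact: measurable_heat_integrand.
Qed.

(** Leads from an integral equation whose datum at time 0 may be unbounded to the bounded setting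
    after [tau]: [duhE_split] and the semigroup law reassemble the state at the restart time. *)
Lemma mild_restart (tau T B M : R) (u g : V -> R -> R) (u0 : V -> \bar R) (h : V -> R -> \bar R) :
  0 < tau -> measurable_fun setT u0 -> (forall x, 0 <= u0 x)%E ->
  measurable_fun setT (fun q : V * R => h q.1 q.2) -> (forall x s, 0 <= h x s)%E ->
  (forall x t, 0 < t < T -> (u x t)%:E = (heatE t u0 x + duhE 0 t h x)%E) ->
  jmeas u -> jmeas g ->
  (forall x s, tau <= s < T -> `|u x s| <= B) ->
  (forall x s, tau <= s < T -> `|g x s| <= M) ->
  (forall x s, tau <= s < T -> h x s = (g x s)%:E) ->
  mild tau T B M u g.
Proof.
move=> tau0 mu0 u00 mh h0 eq mu' mg uB gM hg; split=> // x s t ts st tT.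
have s0 : 0 < s by lra.
have bu : bmeas B (u ^~ s) by split; [exact: jmeas_sec|move=> y; apply: uB; lra].
have bg : bsrc s t M g by split => // r y /andP[? ?]; apply: gM; lra.
have ts0 : 0 < t - s by lra.
apply: EFin_inj; rewrite EFinD (heatH_heatE x ts0 bu) (duh_duhE x bg) eq; last by lra.
rewrite (duhE_split x mh h0 s0 st) addeA; congr (_ + _)%E; last first.
  rewrite /duhE; apply: eq_integral => r /set_mem/=; rewrite in_itv/= => /andP[? ?].
  by congr heatE; apply/funext => y; apply: hg; lra.
have -> : EFin \o u ^~ s = (fun y => heatE s u0 y + duhE 0 s h y)%E.
  by apply/funext => y /=; rewrite eq//; lra.
have md : measurable_fun setT (duhE 0 s h).
  exact: (measurableT_comp (f := fun q : V * R => duhE 0 q.2 h q.1) (g := fun y => (y, s)) (measurable_duhE 0 mh h0)).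
rewrite heatED//.
- by rewrite (heatE_semigroup x ts0 s0 mu0 u00) subrK.
- exact: measurable_heatE.
- by move=> y; exact: heatE_ge0.
- by move=> y; exact: duhE_ge0.
Qed.

End Classical.

Section Monotone.
Variable R : realType.

Lemma MVT_is_derive (F dF : R -> R) (a b : R) : a < b ->
  (forall x, a <= x <= b -> is_derive x 1 F (dF x)) ->
  exists2 c, a < c < b & F b - F a = dF c * (b - a).
Proof.
move=> ab H.
have H1 (x : R) : x \in `]a, b[ -> is_derive x 1 F (dF x).
  by rewrite in_itv/= => /andP[? ?]; apply: H; lra.
have H2 : {within `[a, b], continuous F}.
  apply: continuous_in_subspaceT => x /set_mem /=; rewrite in_itv/= => xab.
  by have [D _] := H x xab; exact: (derivable_continuous D).
have [c cab ->] := MVT ab H1 H2.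
by exists c => //; move: cab; rewrite in_itv.
Qed.

Lemma nondecreasing_is_derive (F dF : R -> R) (a b : R) : a <= b ->
  (forall x, a <= x <= b -> is_derive x 1 F (dF x)) ->
  (forall x, a <= x <= b -> 0 <= dF x) -> F a <= F b.
Proof.
rewrite le_eqVlt => /predU1P[->//|ab] H p.
have [c /andP[? ?] E] := MVT_is_derive ab H.
by rewrite -subr_ge0 E mulr_ge0 ?p// ?subr_ge0 ?ltW//; lra.
Qed.

Lemma nonincreasing_is_derive (F dF : R -> R) (a b : R) : a <= b ->
  (forall x, a <= x <= b -> is_derive x 1 F (dF x)) ->
  (forall x, a <= x <= b -> dF x <= 0) -> F b <= F a.
Proof.
rewrite le_eqVlt => /predU1P[->//|ab] H p.
have [c /andP[? ?] E] := MVT_is_derive ab H.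
by rewrite -subr_le0 E mulr_le0_ge0 ?p// ?subr_ge0 ?ltW//; lra.
Qed.

End Monotone.

(** * Growth of the nonlinearity and decay of F *)

Section Nonlinearity.
Variables (R : realType) (f : R -> R) (q : R).
Local Notation leb := (@lebesgue_measure R).
Local Notation f1 := (derive1 f).
Local Notation f2 := (derive1 (derive1 f)).
Hypothesis f0 : f 0 = 0.
Hypothesis fc : {within `[0, +oo[%classic, continuous f}.
Hypothesis fd : forall x, 0 < x -> derivable f x 1.
Hypothesis f1d : forall x, 0 < x -> derivable f1 x 1.
Hypothesis f12p : forall x, 0 < x -> 0 < f1 x /\ 0 < f2 x.

Lemma f_is_derive (x : R) : 0 < x -> is_derive x 1 f (f1 x).
Proof. by move=> x0; rewrite derive1E; apply: DeriveDef => //; exact: fd. Qed.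

Lemma f1_is_derive (x : R) : 0 < x -> is_derive x 1 f1 (f2 x).
Proof. by move=> x0; rewrite derive1E; apply: DeriveDef => //; exact: f1d. Qed.

Lemma f1_mono (x y : R) : 0 < x -> x <= y -> f1 x <= f1 y.
Proof.
move=> x0 xy; apply: (nondecreasing_is_derive (dF := f2) xy) => z /andP[xz _].
  by apply: f1_is_derive; lra.
by have [_ /ltW] := f12p (lt_le_trans x0 xz).
Qed.

(** Continuity up to 0 suffices for the mean value theorem on [0, x]; positivity of [f] follows from
    it. *)
Lemma f_MVT0 (x : R) : 0 < x -> exists2 c, 0 < c < x & f x = f1 c * x.
Proof.
move=> x0.
have H1 (z : R) : z \in `]0, x[ -> is_derive z 1 f (f1 z).
  by rewrite in_itv/= => /andP[? ?]; exact: f_is_derive.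
have H2 : {within `[0, x], continuous f}.
  by apply: continuous_subspaceW fc => z /=; rewrite !in_itv/= => /andP[-> _].
have [c cx] := MVT x0 H1 H2.
rewrite f0 !subr0 => ->; exists c => //; move: cx; by rewrite in_itv.
Qed.

Lemma f_gt0 (x : R) : 0 < x -> 0 < f x.
Proof.
by move=> x0; have [c /andP[c0 _] ->] := f_MVT0 x0; rewrite mulr_gt0//; case: (f12p c0).
Qed.

Lemma f_ge0 (x : R) : 0 <= x -> 0 <= f x.
Proof. by rewrite le_eqVlt => /predU1P[<-|/f_gt0/ltW//]; rewrite f0. Qed.

Lemma f_mono (x y : R) : 0 <= x -> x <= y -> f x <= f y.
Proof.
rewrite le_eqVlt => /predU1P[<- y0|x0 xy]; first by rewrite f0 f_ge0.
apply: (nondecreasing_is_derive (dF := f1) xy) => z /andP[xz _].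
  by apply: f_is_derive; lra.
by have [/ltW] := f12p (lt_le_trans x0 xz).
Qed.

Lemma f_cont (x : R) : 0 < x -> {for x, continuous f}.
Proof. by move=> x0; exact: (derivable_continuous (fd x0)). Qed.

Lemma f_tangent_le (x y : R) : 0 < y -> y <= x -> f y + f1 y * (x - y) <= f x.
Proof.
move=> y0; rewrite le_eqVlt => /predU1P[<-|yx]; first by rewrite subrr mulr0 addr0.
have [|c /andP[? ?] E] := @MVT_is_derive R f f1 y x yx.
  by move=> z /andP[? ?]; apply: f_is_derive; lra.
have : f1 y * (x - y) <= f1 c * (x - y).
  by apply: ler_wpM2r; [lra|apply: f1_mono; lra].
by rewrite -E; lra.
Qed.

Hypothesis q1 : 1 < q.
Hypothesis flim : f1 u ^+ 2 / (f u * f2 u) @[u --> +oo] --> q.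

Lemma f_eventually (e : R) : 0 < e -> exists2 K : R, 0 < K &
  forall u, K <= u -> f1 u ^+ 2 <= (q + e) * (f u * f2 u).
Proof.
move=> e0; have /cvgrPdist_lt/(_ e e0) [K [_ HK]] := flim.
exists (Num.max (K + 1) 1); first by rewrite lt_max ltr01 orbT.
move=> u; rewrite ge_max => /andP[Ku u1]; have u0 : 0 < u by lra.
have [_ p2] := f12p u0; have p := f_gt0 u0.
have := HK u; rewrite /= => /(_ _)/wrap[|]; first by lra.
rewrite ltr_norml => /andP[h _]; rewrite -ler_pdivrMr ?mulr_gt0//; lra.
Qed.

(** F with real values. It is used from a threshold [U0] on, at which the integral is known to be
    finite, so that [fine] loses nothing. *)
Definition Fr (u : R) : R := fine (Fint f u).

Variable U0 : R.
Hypothesis U00 : 0 < U0.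
Hypothesis Ffin : (Fint f U0 < +oo)%E.

Let minvf (u : R) (D : set R) : 0 < u -> measurable D -> D `<=` `[u, +oo[ ->
  measurable_fun D (fun s => ((f s)^-1)%:E).
Proof.
move=> u0 mD Du; apply/measurable_EFinP.
apply: (measurableT_comp (f := fun x : R => x^-1)); first exact: measurable_invr.
apply: subspace_continuous_measurable_fun => //.
apply: continuous_in_subspaceT => x /set_mem/Du /=; rewrite in_itv/= andbT => ux.
by apply: f_cont; lra.
Qed.

Let invf_ge0 (u s : R) : 0 < u -> u <= s -> (0 <= ((f s)^-1)%:E)%E.
Proof. by move=> u0 us; rewrite lee_fin invr_ge0 ltW// f_gt0//; lra. Qed.

Lemma Fint_split (u v : R) : 0 < u -> u <= v ->
  Fint f u = (\int[leb]_(s in `[u, v[) ((f s)^-1)%:E + Fint f v)%E.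
Proof.
move=> u0 uv; rewrite /Fint -ge0_integral_setU//.
- congr (integral _ _ _); apply/seteqP; split => [s /=|s /=].
    rewrite !in_itv/= !andbT => us; case: (ltP s v) => sv; [left|right].
      by rewrite us.
    by [].
  by rewrite !in_itv/= !andbT => -[/andP[]//|]; exact: le_trans.
- apply: (@minvf u) => //; first exact: measurableU.
  move=> s /= []; rewrite !in_itv/= !andbT; first by case/andP.
  exact: le_trans.
- move=> s /= []; rewrite !in_itv/= ?andbT; first by case/andP => us _; exact: invf_ge0 us.
  by move=> vs; exact: invf_ge0 (le_trans uv vs).
- apply/disj_setPS => s /= []; rewrite !in_itv/= andbT => /andP[_ sv] vs; lra.
Qed.

Let slab_le (u v : R) : 0 < u -> u <= v ->
  (\int[leb]_(s in `[u, v[) ((f s)^-1)%:E <= ((v - u) / f u)%:E)%E.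
Proof.
move=> u0 uv; apply: (@le_trans _ _ (\int[leb]_(s in `[u, v[) (cst ((f u)^-1)%:E s))%E).
  apply: ge0_le_integral => //.
  - by move=> s /=; rewrite in_itv/= => /andP[us _]; exact: invf_ge0 us.
  - by apply: (@minvf u) => // s /=; rewrite !in_itv/= => /andP[->].
  - move=> s /=; rewrite in_itv/= => /andP[us _]; rewrite lee_fin lef_pV2 ?posrE ?f_gt0//; last by lra.
    by apply: f_mono => //; lra.
rewrite integral_cst//= lebesgue_measure_itv/= lte_fin.
case: ltP => uv'; first by rewrite -EFinB -EFinM lee_fin mulrC.
by rewrite mule0 lee_fin divr_ge0 ?subr_ge0// ltW// f_gt0.
Qed.

Let slab_ge (u v : R) : 0 < u -> u <= v ->
  (((v - u) / f v)%:E <= \int[leb]_(s in `[u, v[) ((f s)^-1)%:E)%E.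
Proof.
move=> u0 uv; apply: (@le_trans _ _ (\int[leb]_(s in `[u, v[) (cst ((f v)^-1)%:E s))%E).
  rewrite integral_cst//= lebesgue_measure_itv/= lte_fin.
  case: ltP => uv'; first by rewrite -EFinB -EFinM lee_fin mulrC.
  have -> : v = u by apply/eqP; rewrite eq_le uv uv'.
  by rewrite mule0 subrr mul0r.
have v0 : 0 < v by lra.
apply: ge0_le_integral => //.
- by move=> s _; exact: (invf_ge0 v0).
- by apply: (@minvf u) => // s /=; rewrite !in_itv/= => /andP[->].
- move=> s /=; rewrite in_itv/= => /andP[us sv]; rewrite lee_fin lef_pV2 ?posrE ?f_gt0//; last by lra.
  by apply: f_mono => //; lra.
Qed.

Let Fint_ge0 (u : R) : 0 < u -> (0 <= Fint f u)%E.
Proof.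
by move=> u0; apply: integral_ge0 => s /=; rewrite in_itv/= andbT => us; exact: invf_ge0 us.
Qed.

Lemma FrE (u : R) : U0 <= u -> Fint f u = (Fr u)%:E.
Proof.
have U0p := U00; move=> Uu; rewrite /Fr fineK//; rewrite ge0_fin_numE; last by apply: Fint_ge0; lra.
apply: le_lt_trans Ffin; rewrite (Fint_split U00 Uu) leeDr//.
by apply: integral_ge0 => s /=; rewrite in_itv/= => /andP[us _]; exact: invf_ge0 us.
Qed.

Lemma Fr_increment (u v : R) : U0 <= u -> u <= v ->
  (v - u) / f v <= Fr u - Fr v <= (v - u) / f u.
Proof.
have U0p := U00; move=> Uu uv; have u0 : 0 < u by lra.
have Uv : U0 <= v by lra.
have := Fint_split u0 uv; have := slab_le u0 uv; have := slab_ge u0 uv.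
rewrite !FrE//; set I := (\int[_]_(s in _) _)%E.
case: I => [r| |] //=; rewrite !lee_fin => h1 h2 [] E.
by rewrite E addrK h1 h2.
Qed.

Lemma Fr_is_derive (u : R) : U0 < u -> is_derive u 1 Fr (- (f u)^-1).
Proof.
have U0p := U00; move=> Uu; have u0 : 0 < u by lra.
apply: is_derive_of_increments => e e0.
have fu := f_gt0 u0.
have cf : {for u, continuous (fun x : R => (f x)^-1)}.
  by apply: (@continuousV _ _ f); [rewrite gt_eqF|exact: f_cont].
have cf' : (fun x : R => (f x)^-1) @ u --> (f u)^-1 := cf.
have /cvgrPdist_lt/(_ e e0) /nbhs_ballP[d /= d0 Hd] := cf'.
exists (Num.min d (u - U0)); first by rewrite lt_min d0 subr_gt0.
move=> t1 t2 h1 h2 h3.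
have [hd hU] : Num.min d (u - U0) <= d /\ Num.min d (u - U0) <= u - U0.
  by rewrite !ge_min !lexx orbT.
have UU : U0 <= t1 by lra.
have /andP[i1 i2] := Fr_increment UU (ltW h2).
have b s : u - d < s -> s < u + d -> `|(f u)^-1 - (f s)^-1| < e.
  by move=> s1 s2; apply: Hd; rewrite -ball_normE /= ltr_norml; apply/andP; split; lra.
have := b t1; have := b t2; rewrite !ltr_norml => b2 b1.
have /andP[b3 b4] : - e < (f u)^-1 - (f t2)^-1 < e by apply: b2; lra.
have /andP[b5 b6] : - e < (f u)^-1 - (f t1)^-1 < e by apply: b1; lra.
have t0 : 0 < t2 - t1 by rewrite subr_gt0.
have j1 : (t2 - t1) * ((f u)^-1 - (f t2)^-1) <= (t2 - t1) * e.
  by apply: ler_wpM2l; exact: ltW.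
have j2 : (t2 - t1) * (- e) <= (t2 - t1) * ((f u)^-1 - (f t1)^-1).
  by apply: ler_wpM2l; exact: ltW.
rewrite ler_norml; apply/andP; split; nra.
Qed.

Lemma Fr_anti (u v : R) : U0 <= u -> u < v -> Fr v < Fr u.
Proof.
have U0p := U00; move=> Uu uv; have /andP[h _] := Fr_increment Uu (ltW uv).
by rewrite -subr_gt0; apply: lt_le_trans h; rewrite divr_gt0 ?f_gt0 ?subr_gt0//; lra.
Qed.

Lemma Fr_antiW (u v : R) : U0 <= u -> u <= v -> Fr v <= Fr u.
Proof.
by move=> Uu; rewrite le_eqVlt => /predU1P[->//|/(Fr_anti Uu)/ltW].
Qed.

Lemma Fr_gt0 (u : R) : U0 <= u -> 0 < Fr u.
Proof.
have U0p := U00; move=> Uu; have uu : u < u + 1 by lra.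
apply: le_lt_trans (Fr_anti Uu uu).
by rewrite -lee_fin -FrE; [apply: Fint_ge0; lra|lra].
Qed.

Lemma Fr_lt_anti (u v : R) : U0 <= u -> U0 <= v -> Fr u < Fr v -> v < u.
Proof. by move=> Uu Uv h; rewrite ltNge; apply/negP => /(Fr_antiW Uu); lra. Qed.

Hypothesis Fr_cvg0 : forall e : R, 0 < e -> exists2 u, U0 <= u & Fr u < e.

(** For large arguments P = F - (q + e) / f' is nondecreasing, since P' = ((q + e) f f'' - f'^2) /
    (f f'^2) >= 0. As P < F and F becomes arbitrarily small, P cannot be positive there. *)
Lemma f1_Fr (e : R) : 0 < e -> exists2 K, U0 < K & forall u, K <= u -> f1 u * Fr u <= q + e.
Proof.
have U0p := U00; have qp := q1; move=> e0; have [K K0 HK] := f_eventually e0.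
exists (Num.max K (U0 + 1)); first by rewrite lt_max; apply/orP; right; lra.
move=> u; rewrite ge_max => /andP[Ku Uu]; have u0 : 0 < u by lra.
have [p1 _] := f12p u0.
rewrite leNgt; apply/negP => h.
pose P (v : R) := Fr v - (q + e) * (f1 v)^-1.
have Pu : 0 < P u.
  by rewrite /P subr_gt0 ltr_pdivrMr// mulrC.
have [w Uw Fw] := Fr_cvg0 Pu.
pose v := Num.max u w.
have [uv wv] : u <= v /\ w <= v by rewrite !le_max !lexx orbT.
have v0 : 0 < v by lra.
have Pv : P v < Fr v.
  by rewrite /P gtrBl mulr_gt0 ?invr_gt0//; [lra|case: (f12p v0)].
have := Fr_antiW Uw wv.
suff : P u <= P v by lra.
apply: (nondecreasing_is_derive (dF := fun x => - (f x)^-1 - (q + e) * (- (f1 x) ^- 2 * f2 x))) => // x /andP[xu _].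
  have x0 : 0 < x by lra.
  have [p _] := f12p x0.
  have n1 : f1 x != 0 by rewrite gt_eqF.
  have Ux : U0 < x by lra.
  apply: (is_derive_ext (is_deriveB (Fr_is_derive Ux) (is_deriveZ (q + e) (is_deriveV n1 (f1_is_derive x0))))) => //.
have x0 : 0 < x := lt_le_trans u0 xu.
have [p p2] := f12p x0; have pf := f_gt0 x0.
have Kx : K <= x := le_trans Ku xu.
rewrite (_ : - (f x)^-1 - _ = ((q + e) * (f x * f2 x) - f1 x ^+ 2) / (f x * f1 x ^+ 2)); last first.
  by field; rewrite !gt_eqF.
by rewrite divr_ge0 ?subr_ge0 ?HK// mulr_ge0 ?exprn_ge0// ltW.
Qed.

(** For large arguments (f / f')' = 1 - f f'' / f'^2 <= 1 - (q + e)^-1; this is integrated from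
    [K]. *)
Lemma f_le_f1 (e : R) : 0 < e -> exists K C : R, 0 < K /\
  forall u, K <= u -> f u <= f1 u * ((1 - (q + e)^-1) * u + C).
Proof.
have qp := q1; move=> e0; have [K K0 HK] := f_eventually e0.
exists K, (f K / f1 K); split=> // u Ku; have u0 : 0 < u by lra.
have [p1 _] := f12p u0; have qe : 0 < q + e by lra.
have c0 : 0 <= 1 - (q + e)^-1 by rewrite subr_ge0 invf_le1//; lra.
rewrite mulrC -ler_pdivrMr//.
suff : f u / f1 u - (1 - (q + e)^-1) * u <= f K / f1 K - (1 - (q + e)^-1) * K.
  have : 0 <= (1 - (q + e)^-1) * K by rewrite mulr_ge0// ltW.
  lra.
apply: (nonincreasing_is_derive (F := fun x => f x / f1 x - (1 - (q + e)^-1) * x)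
  (dF := fun x => f x * (- (f1 x) ^- 2 * f2 x) + f1 x * (f1 x)^-1 - (1 - (q + e)^-1) * 1) Ku) => x /andP[Kx _];
  have x0 : 0 < x by lra.
  have [p _] := f12p x0.
  have n1 : f1 x != 0 by rewrite gt_eqF.
  apply: (is_derive_ext (is_deriveB (is_deriveM (f_is_derive x0) (is_deriveV n1 (f1_is_derive x0)))
    (is_deriveZ (1 - (q + e)^-1) (is_derive_id x 1)))) => //.
  by rewrite /GRing.scale /=; ring.
have [p p2] := f12p x0; have pf := f_gt0 x0.
rewrite (_ : _ + _ - _ = (f1 x ^+ 2 - (q + e) * (f x * f2 x)) / ((q + e) * f1 x ^+ 2)); last first.
  by field; rewrite !gt_eqF.
by rewrite mulr_le0_ge0 ?subr_le0 ?HK// invr_ge0 mulr_ge0 ?exprn_ge0// ltW.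
Qed.

(** The two preceding bounds combine to F f <= F f' ((1 - (q + e)^-1) u + C) <= (q + e - 1) u + (q +
    e) C. One half of the gap d - (q - 1) is [e]; the other half absorbs the constant once u >=
    [K3]. *)
Lemma Fr_f (d : R) : q - 1 < d -> exists2 K, U0 < K & forall u, K <= u -> Fr u * f u <= d * u.
Proof.
have qp := q1; have U0p := U00; move=> qd.
pose e := (d - (q - 1)) / 2; have e0 : 0 < e by rewrite /e; lra.
have [K1 UK1 H1] := f1_Fr e0.
have [K2 [C [K20 H2]]] := f_le_f1 e0.
pose K3 := (q + e) * C / e.
exists (Num.max K1 (Num.max K2 K3)); first by rewrite lt_max UK1.
move=> u; rewrite !ge_max => /and3P[k1 k2 k3].
have u0 : 0 < u by lra.
have [p1 _] := f12p u0; have pf := f_gt0 u0.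
have Uu : U0 <= u by lra.
have F0 := Fr_gt0 Uu.
have h1 := H1 u k1; have h2 := H2 u k2.
have qe : 0 < q + e by lra.
set s := (1 - (q + e)^-1) * u + C in h2.
have s0 : 0 <= s.
  by rewrite -(pmulr_rge0 _ p1); apply: le_trans h2; exact: ltW.
have h3 : Fr u * f u <= Fr u * (f1 u * s) by rewrite ler_pM2l.
have h4 : (f1 u * Fr u) * s <= (q + e) * s by exact: ler_wpM2r.
have h5 : (q + e) * s = (q + e - 1) * u + (q + e) * C.
  by rewrite /s; field; rewrite gt_eqF.
have h6 : (q + e) * C <= e * u by rewrite -ler_pdivrMl// mulrC.
have h7 : d = q + e - 1 + e by rewrite /e; lra.
rewrite h7 mulrDl; move: h4; rewrite h5 => h4.
by move: h3; rewrite mulrCA mulrA => h3; lra.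
Qed.

(** The logarithmic form of a bound on u^gam F(u)^k. Its derivative gam / u - k / (F f) is
    nonpositive by [Fr_f] with d = k / gam; here the relation between the exponent and q - 1
    enters. *)
Lemma ln_Fr_le (gam k : R) : 0 < gam -> 0 < k -> gam * (q - 1) < k ->
  exists K C : R, U0 < K /\ forall u, K <= u -> gam * ln u + k * ln (Fr u) <= C.
Proof.
have qp := q1; have U0p := U00; move=> g0 k0 gk.
have [|K UK HK] := @Fr_f (k / gam); first by rewrite ltr_pdivlMr// mulrC.
exists K, (gam * ln K + k * ln (Fr K)); split; [exact: UK|move=> u Ku].
apply: (nonincreasing_is_derive (F := fun u => gam * ln u + k * ln (Fr u))
  (dF := fun x => gam * x^-1 + k * ((Fr x)^-1 * (- (f x)^-1))) Ku) => x /andP[Kx _];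
  have Ux : U0 < x by lra.
  have x0 : 0 < x by lra.
  have F0 := Fr_gt0 (ltW Ux).
  have d1 := @is_derive1_comp R _ Fr x _ _ (is_derive1_ln F0) (Fr_is_derive Ux).
  exact: (is_derive_ext (is_deriveD (is_deriveZ gam (is_derive1_ln x0)) (is_deriveZ k d1))).
have x0 : 0 < x by lra.
have F0 := Fr_gt0 (ltW Ux); have pf := f_gt0 x0.
rewrite (_ : _ + _ = (gam * (Fr x * f x) - k * x) / (x * (Fr x * f x))); last first.
  by field; rewrite !gt_eqF.
rewrite mulr_le0_ge0 ?subr_le0//; last by rewrite invr_ge0 !mulr_ge0// ltW.
by have := HK x Kx; rewrite mulrAC ler_pdivlMr// mulrC.
Qed.

End Nonlinearity.

Section Directional.
Variables (R : realType) (N : nat).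
Local Notation V := 'rV[R]_N.

Lemma is_derive_comp_dir (g : R -> R) (h : V -> R) (x v : V) (dg dh : R) :
  is_derive (h x) 1 g dg -> is_derive x v h dh -> is_derive x v (fun y => g (h y)) (dg * dh).
Proof.
move=> Hg /derive_line Hh; apply/derive_line.
have Hg' : is_derive (h (0 *: v + x)) 1 g dg by rewrite scale0r add0r.
exact: (@is_derive1_comp R g (fun s : R => h (s *: v + x)) 0 dg dh Hg' Hh).
Qed.

Lemma is_derive_enorm2 j (x : V) : is_derive x (ei R j) (fun y : V => enorm y ^+ 2) (2 * x 0 j).
Proof.
apply/derive_line.
have d1 : is_derive (0 : R) 1 (fun s : R => enorm x ^+ 2 + (2 * x 0 j) * s + s ^+ 2) (2 * x 0 j).
  apply: is_derive_eq; rewrite /GRing.scale /=; ring.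
by apply: (is_derive_ext d1) => // s; rewrite enorm_line; ring.
Qed.

Lemma is_derive_coord j (x : V) : is_derive x (ei R j) (fun y : V => y 0 j) 1.
Proof.
apply/derive_line.
have d1 : is_derive (0 : R) 1 (fun s : R => s + x 0 j) 1.
  by apply: is_derive_eq; rewrite addr0.
by apply: (is_derive_ext d1) => // s; rewrite !mxE !eqxx mulr1.
Qed.

Lemma enorm_scale_ei (c : R) j : enorm (c *: ei R j : V) = `|c|.
Proof.
have := enorm_line c j (0 : V); rewrite addr0 mxE mulr0 addr0.
have -> : enorm (0 : V) = 0 by apply/eqP; rewrite enorm_eq0.
rewrite expr0n add0r => E.
by apply/eqP; rewrite -(@eqrXn2 _ 2) ?enorm_ge0 ?normr_ge0// E real_normK ?num_real.
Qed.

Lemma coord_continuous_rV j : continuous (fun y : V => y 0 j).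
Proof. exact: coord_continuous. Qed.

Lemma enorm2_continuous : continuous (fun y : V => enorm y ^+ 2).
Proof.
move=> x; rewrite (_ : (fun y : V => _) = fun y : V => \sum_i y 0 i ^+ 2); last first.
  by apply/funext => y; rewrite enorm_sq.
apply: continuous_sum_at => i.
by apply: (@continuousM _ _ (fun y : V => y 0 i)); exact: coord_continuous_rV.
Qed.

End Directional.

(** * The singular solution as a function of the squared radius *)

Section RadialProfile.
Variables (R : realType) (N : nat) (i0 : 'I_N) (f : R -> R) (ustar : 'rV[R]_N -> R).
Local Notation V := 'rV[R]_N.
Hypothesis upos : forall x, x != 0 -> 0 < ustar x.
Hypothesis urad : forall x y, enorm x = enorm y -> ustar x = ustar y.
Hypothesis uC2 : C2_on [set x | x != 0] ustar.
Hypothesis upde : forall x, x != 0 -> - laplacian ustar x = f (ustar x).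

Let ra (r : R) : V := Num.sqrt r *: ei R i0.
Definition prof (r : R) := ustar (ra r).
Let pa (s : R) := partial i0 ustar (s *: ei R i0 : V).
Let pb (s : R) := partial i0 (partial i0 ustar) (s *: ei R i0 : V).
Definition prof1 (r : R) := pa (Num.sqrt r) * (2 * Num.sqrt r)^-1.
Definition prof2 (r : R) :=
  pa (Num.sqrt r) * (- (2 * Num.sqrt r) ^- 2 * (2 * (2 * Num.sqrt r)^-1))
  + (2 * Num.sqrt r)^-1 * (pb (Num.sqrt r) * (2 * Num.sqrt r)^-1).

Let ra_neq0 (r : R) : 0 < r -> ra r != 0.
Proof. by move=> r0; rewrite -enorm_gt0 enorm_scale_ei ger0_norm ?sqrtr_ge0// sqrtr_gt0. Qed.

Let s_neq0 (s : R) : 0 < s -> s *: ei R i0 != 0 :> V.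
Proof. by move=> s0; rewrite -enorm_gt0 enorm_scale_ei gtr0_norm. Qed.

Lemma ustar_prof (x : V) : ustar x = prof (enorm x ^+ 2).
Proof.
by apply: urad; rewrite enorm_scale_ei sqrtr_sqr !ger0_norm ?enorm_ge0// normr_ge0.
Qed.

Lemma prof_gt0 (r : R) : 0 < r -> 0 < prof r.
Proof. by move=> r0; apply: upos; exact: ra_neq0. Qed.

Let psi_derive (s : R) : 0 < s -> is_derive s 1 (fun s : R => ustar (s *: ei R i0)) (pa s).
Proof.
move=> s0; have [_ [/(_ i0) [D _] _]] := uC2 (s_neq0 s0).
have d : is_derive (s *: ei R i0 + 0 : V) (ei R i0) ustar (pa s).
  by rewrite addr0; exact: DeriveDef.
by apply: (is_derive_ext (iffLR (derive_line_at _ _ _ _ _) d)) => // y; rewrite addr0.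
Qed.

Let pa_derive (s : R) : 0 < s -> is_derive s 1 pa (pb s).
Proof.
move=> s0; have [_ [_ /(_ i0 i0) [D _]]] := uC2 (s_neq0 s0).
have d : is_derive (s *: ei R i0 + 0 : V) (ei R i0) (partial i0 ustar) (pb s).
  by rewrite addr0; exact: DeriveDef.
by apply: (is_derive_ext (iffLR (derive_line_at _ _ _ _ _) d)) => // y; rewrite addr0.
Qed.

Lemma prof_derive (r : R) : 0 < r -> is_derive r 1 prof (prof1 r).
Proof.
move=> r0; have s0 : 0 < Num.sqrt r by rewrite sqrtr_gt0.
exact: (@is_derive1_comp R (fun s : R => ustar (s *: ei R i0)) (@Num.sqrt R) r _ _
  (psi_derive s0) (is_derive_sqrt r0)).
Qed.

Lemma prof1_derive (r : R) : 0 < r -> is_derive r 1 prof1 (prof2 r).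
Proof.
move=> r0; have s0 : 0 < Num.sqrt r by rewrite sqrtr_gt0.
have d1 := @is_derive1_comp R pa (@Num.sqrt R) r _ _ (pa_derive s0) (is_derive_sqrt r0).
have d2 : is_derive r 1 (fun r : R => 2 * Num.sqrt r) (2 * (2 * Num.sqrt r)^-1).
  by apply: (is_derive_ext (is_deriveZ (2 : R) (is_derive_sqrt r0))) => //.
have n2 : 2 * Num.sqrt r != 0 by rewrite gt_eqF// mulr_gt0.
have D := is_deriveM d1 (is_deriveV (f := fun r : R => 2 * Num.sqrt r) n2 d2).
have E : is_derive r 1 (fun r : R => pa (Num.sqrt r) * (2 * Num.sqrt r)^-1) (prof2 r).
  by apply: (is_derive_ext D) => //.
exact: E.
Qed.

Let sqrt_cont (r : R) : {for r, continuous (@Num.sqrt R)}.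
Proof. exact: sqrt_continuous. Qed.

Lemma prof2_cont (r : R) : 0 < r -> {for r, continuous prof2}.
Proof.
move=> r0; have s0 : 0 < Num.sqrt r by rewrite sqrtr_gt0.
have n2 : 2 * Num.sqrt r != 0 by rewrite gt_eqF// mulr_gt0.
have cs : {for r, continuous (fun r : R => (2 * Num.sqrt r)^-1)}.
  apply: (@continuousV _ _ (fun r : R => 2 * Num.sqrt r)) => //.
  by apply: continuousM; [exact: cst_continuous|exact: sqrt_cont].
have c3 : {for r, continuous (fun r : R => (2 * Num.sqrt r) ^- 2)}.
  apply: (@continuousV _ _ (fun r : R => (2 * Num.sqrt r) ^+ 2)); first by rewrite expf_neq0.
  have c2 : {for r, continuous (fun r : R => 2 * Num.sqrt r)}.
    by apply: continuousM; [exact: cst_continuous|exact: sqrt_cont].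
  exact: (@continuousM _ _ (fun r : R => 2 * Num.sqrt r)).
have cpa : {for r, continuous (pa \o @Num.sqrt R)}.
  apply: continuous_comp; first exact: sqrt_cont.
  by have [D _] := pa_derive s0; exact: (derivable_continuous D).
have cpb : {for r, continuous (pb \o @Num.sqrt R)}.
  apply: continuous_comp; first exact: sqrt_cont.
  have [_ [_ /(_ i0 i0) [_ c]]] := uC2 (s_neq0 s0).
  have cl : (fun s : R => s *: ei R i0 : V) @ Num.sqrt r --> (Num.sqrt r *: ei R i0 : V).
    exact: scalel_continuous.
  have c' : partial i0 (partial i0 ustar) @ (Num.sqrt r *: ei R i0 : V) --> pb (Num.sqrt r) := c.
  exact: (cvg_comp _ _ cl c').
apply: continuousD.
  apply: (@continuousM _ _ (pa \o @Num.sqrt R)) => //.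
  apply: (@continuousM _ _ (fun r : R => - (2 * Num.sqrt r) ^- 2)); first exact: continuousN.
  by apply: (@continuousM _ _ (fun=> 2)) => //; exact: cst_continuous.
apply: (@continuousM _ _ (fun r : R => (2 * Num.sqrt r)^-1)) => //.
exact: (@continuousM _ _ (pb \o @Num.sqrt R)).
Qed.

Lemma ustar_derive j (x : V) : x != 0 ->
  is_derive x (ei R j) ustar (prof1 (enorm x ^+ 2) * (2 * x 0 j)).
Proof.
move=> x0; have e0 : 0 < enorm x ^+ 2 by rewrite exprn_gt0// enorm_gt0.
apply: (is_derive_ext (is_derive_comp_dir (prof_derive e0) (is_derive_enorm2 j x))) => // y.
by rewrite -ustar_prof.
Qed.

Lemma prof_ode (r : R) : 0 < r -> 4 * r * prof2 r + 2 * N%:R * prof1 r = - f (prof r).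
Proof.
move=> r0; have x0 := ra_neq0 r0; set x := ra r in x0.
have xr : enorm x ^+ 2 = r by rewrite enorm_scale_ei real_normK ?num_real// sqr_sqrtr// ltW.
have <- : laplacian ustar x = - f (prof r) by rewrite -upde// opprK.
clearbody x.
rewrite /laplacian (eq_bigr (fun j => 2 * prof1 r + 4 * prof2 r * x 0 j ^+ 2)); last first.
  move=> j _; rewrite /partial.
  have e0 : 0 < enorm x ^+ 2 by rewrite xr.
  have d : is_derive x (ei R j) (fun y : V => prof1 (enorm y ^+ 2) * (2 * y 0 j))
      (2 * prof1 r + 4 * prof2 r * x 0 j ^+ 2).
    have d2 : is_derive x (ei R j) (fun y : V => 2 * y 0 j) 2.
      by apply: (is_derive_ext (is_deriveZ (2 : R) (is_derive_coord j x))) => //; rewrite /GRing.scale /= mulr1.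
    apply: (is_derive_ext (is_deriveM (is_derive_comp_dir (prof1_derive e0) (is_derive_enorm2 j x)) d2)) => //.
    by rewrite xr /GRing.scale /=; ring.
  rewrite (near_eq_derive (g := fun y : V => prof1 (enorm y ^+ 2) * (2 * y 0 j))).
    by have [_ ->] := d.
  near=> y; have y0 : y != 0.
    near: y; apply: (@filterS _ _ _ (~` [set (0 : V)])); first by move=> z /eqP.
    apply: open_nbhs_nbhs; split; last exact/eqP.
    by apply: closed_openC; exact: (accessible_closed_set1 (hausdorff_accessible (@norm_hausdorff _ V))).
  by have [_ ->] := ustar_derive j y0.
rewrite big_split /= sumr_const card_ord -mulr_sumr -enorm_sq xr -mulr_natl; ring.
Unshelve. all: by end_near.
Qed.

End RadialProfile.

(** Collects what the analysis uses of [ustar] in the variable r = |x|^2. Since |grad ustar|^2 = 4 r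
    p1^2, [pr_grad] is the gradient bound needed for the error of the truncations; [pr_F] keeps
    every slope below the critical (2N - 4q)^-1, which the barrier requires. *)
Record profile (R : realType) (N : nat) (f : R -> R) (q U0 : R) (p p1 p2 : R -> R) : Prop := Profile {
  pr_gt0 : forall r, 0 < r -> 0 < p r;
  pr_d1 : forall r : R, 0 < r -> is_derive r 1 p (p1 r);
  pr_d2 : forall r : R, 0 < r -> is_derive r 1 p1 (p2 r);
  pr_c2 : forall r : R, 0 < r -> {for r, continuous p2};
  pr_ode : forall r, 0 < r -> 4 * r * p2 r + 2 * N%:R * p1 r = - f (p r);
  pr_neg : forall r, 0 < r -> p1 r < 0;
  pr_oo : forall K, exists2 r, 0 < r & forall s, 0 < s -> s <= r -> K <= p s;
  pr_grad : exists2 C, 0 <= C & forall r, 0 < r -> 4 * r * p1 r ^+ 2 <= C * (1 + p r * f (p r));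
  pr_grad_far : forall r0, 0 < r0 -> exists B, forall r, r0 <= r -> 4 * r * p1 r ^+ 2 <= B;
  pr_U0 : 0 < U0;
  pr_Ffin : (Fint f U0 < +oo)%E;
  pr_F0 : forall e, 0 < e -> exists2 u, U0 <= u & Fr f u < e;
  pr_F : forall A, A < (2 * N%:R - 4 * q)^-1 -> exists2 r1, 0 < r1 &
    forall r, 0 < r -> r <= r1 -> U0 < p r /\ A * r <= Fr f (p r) }.

Section MakeProfile.
Variables (R : realType) (N : nat) (f : R -> R) (q : R) (p p1 p2 : R -> R).
Local Notation f1 := (derive1 f).
Local Notation f2 := (derive1 (derive1 f)).
Hypothesis f0 : f 0 = 0.
Hypothesis fc : {within `[0, +oo[%classic, continuous f}.
Hypothesis fd : forall x, 0 < x -> derivable f x 1.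
Hypothesis f1d : forall x, 0 < x -> derivable f1 x 1.
Hypothesis f12p : forall x, 0 < x -> 0 < f1 x /\ 0 < f2 x.
Hypothesis q1 : 1 < q.
Hypothesis flim : f1 u ^+ 2 / (f u * f2 u) @[u --> +oo] --> q.
Hypothesis N0 : (0 < N)%N.
Hypothesis qN : q < N%:R / 2.
Hypothesis ppos : forall r, 0 < r -> 0 < p r.
Hypothesis pd : forall r : R, 0 < r -> is_derive r 1 p (p1 r).
Hypothesis p1d : forall r : R, 0 < r -> is_derive r 1 p1 (p2 r).
Hypothesis p2c : forall r : R, 0 < r -> {for r, continuous p2}.
Hypothesis ode : forall r, 0 < r -> 4 * r * p2 r + 2 * N%:R * p1 r = - f (p r).
Variables (r1 : R) (theta : R -> R).
Hypothesis r10 : 0 < r1.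
Hypothesis thd : forall r, 0 < r < r1 -> derivable theta r 1.
Hypothesis th0 : theta r @[r --> 0^'+] --> 0.
Hypothesis rth0 : r * derive1 theta r @[r --> 0^'+] --> 0.
Hypothesis pF : forall s, 0 < s -> s < r1 ->
  p (s ^+ 2) = Finv f (s ^+ 2 / (2 * N%:R - 4 * q) * (1 + theta s)).

Let As : R := (2 * N%:R - 4 * q)^-1.
Let As0 : 0 < As.
Proof. by have := qN => h; rewrite invr_gt0; lra. Qed.

Let right_small (h : R -> R) (e : R) : 0 < e -> h r @[r --> 0^'+] --> 0 ->
  exists2 d, 0 < d & forall s, 0 < s -> s < d -> `|h s| < e.
Proof.
move=> e0 /cvgrPdist_lt/(_ e e0) [d /= d0 H]; exists d => // s s0 sd.
have := H s; rewrite /ball_ /= !sub0r !normrN (gtr0_norm s0) => /(_ sd s0) h'.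
exact: h'.
Qed.

Let Fp (r : R) : 0 < r -> Num.sqrt r < r1 -> Fint f (p r) = (r * As * (1 + theta (Num.sqrt r)))%:E.
Proof.
move=> r0 rr; have s0 : 0 < Num.sqrt r by rewrite sqrtr_gt0.
have := pF s0 rr; rewrite sqr_sqrtr ?(ltW r0)// => E.
(* Without a preimage [Finv] would return its default value 0, against p > 0; hence F (p r) has the
   prescribed value. *)
have := ppos r0; rewrite E /Finv; case: xgetP => [u _ [_ ->]|_]; first by [].
by rewrite ltxx.
Qed.

Let small (e : R) : 0 < e -> exists2 d, 0 < d & forall r, 0 < r -> r <= d ->
  [/\ Num.sqrt r < r1, `|theta (Num.sqrt r)| < e & `|Num.sqrt r * derive1 theta (Num.sqrt r)| < e].
Proof.
have r1p := r10; move=> e0; have [d1 d10 H1] := right_small e0 th0.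
have [d2 d20 H2] := right_small e0 rth0.
pose d : R := Num.min (Num.min d1 d2) r1 / 2.
have m0 : 0 < Num.min (Num.min d1 d2) r1 by rewrite !lt_min d10 d20 r1p.
exists (d ^+ 2); first by rewrite exprn_gt0 /d; lra.
move=> r r0 rd; have s0 : 0 < Num.sqrt r by rewrite sqrtr_gt0.
have sd : Num.sqrt r < Num.min (Num.min d1 d2) r1.
  apply: (@le_lt_trans _ _ d); last by rewrite /d; lra.
  by rewrite -(ger0_norm (_ : 0 <= d)) -?sqrtr_sqr ?ler_wsqrtr//; rewrite /d; lra.
by move: sd; rewrite !lt_min => /andP[/andP[? ?] ?]; split => //; [exact: H1|exact: H2].
Qed.

Lemma exists_profile : exists U0, profile N f q U0 p p1 p2.
Proof.
have [N0' qN' q1' r10' As0'] : [/\ (0 : R) < N%:R, q < N%:R / 2, 1 < q, 0 < r1 & 0 < As].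
  by rewrite ltr0n; split.
have h2 : (0 : R) < 1 / 2 by lra.
have [d0 d00 H0] := small h2.
(* F is known to be finite at values taken by p near the origin, and one of them serves as
   threshold. *)
pose U0 := p d0.
have U00 : 0 < U0 := ppos d00.
have Ffin : (Fint f U0 < +oo)%E.
  by rewrite Fp// ?ltry//; case: (H0 d0 d00 (lexx _)).
have FE := FrE f0 fc fd f12p U00 Ffin.
have FA := Fr_antiW f0 fc fd f12p U00 Ffin.
have FG := Fr_gt0 f0 fc fd f12p U00 Ffin.
(* [Fint f (p r)] tends to [0], hence [p r] tends to infinity *)
have oo K : exists2 r, 0 < r & forall s, 0 < s -> s <= r -> K <= p s.
  pose K' := Num.max K U0.
  have [KK UK] : K <= K' /\ U0 <= K' by rewrite !le_max !lexx orbT.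
  have FK := FG K' UK.
  exists (Num.min d0 (Fr f K' / (4 * As))); first by rewrite lt_min d00 divr_gt0// mulr_gt0.
  move=> s s0; rewrite le_min => /andP[sd sF].
  have [h1 h3 _] := H0 s s0 sd.
  apply: (le_trans KK); rewrite leNgt; apply/negP => pK.
  have := Fint_split f0 fc fd f12p (ppos s0) (ltW pK); rewrite Fp// FE//.
  set I := (\int[_]_(_ in _) _)%E => E.
  have : (0 <= I)%E.
    apply: integral_ge0 => x /=; rewrite in_itv/= => /andP[px _].
    by rewrite lee_fin invr_ge0 ltW// (f_gt0 f0 fc fd f12p)//; exact: lt_le_trans (ppos s0) px.
  move: E; case: I => [i| |]//= [] E; rewrite lee_fin => i0.
  move: sF; rewrite ler_pdivlMr ?mulr_gt0// => sF.
  have := ltr_norml (theta (Num.sqrt s)) (1 / 2); rewrite h3 => /esym/andP[t1 t2].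
  have sA : 0 < s * As by rewrite mulr_gt0.
  have : s * As * (1 + theta (Num.sqrt s)) <= s * As * 2 by apply: ler_wpM2l; [exact: ltW|lra].
  lra.
have [d1 d10 H1] := oo (U0 + 1).
pose d := Num.min d0 d1.
have dd : 0 < d by rewrite lt_min d00.
have dn r : 0 < r -> r <= d -> [/\ Num.sqrt r < r1, `|theta (Num.sqrt r)| < 1 / 2,
    `|Num.sqrt r * derive1 theta (Num.sqrt r)| < 1 / 2, U0 < p r &
    Fr f (p r) = r * As * (1 + theta (Num.sqrt r))].
  move=> r0; rewrite le_min => /andP[rd rd1]; have [h1 h3 h4] := H0 r r0 rd.
  have Up : U0 < p r by have := H1 r r0 rd1; lra.
  split => //; apply: EFin_inj; rewrite -FE; [exact: Fp|exact: ltW].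
have F0 e : 0 < e -> exists2 u, U0 <= u & Fr f u < e.
  move=> e0; pose r := Num.min d (e / (2 * As)).
  have r0 : 0 < r by rewrite lt_min dd divr_gt0// mulr_gt0.
  have rd : r <= d by rewrite ge_min lexx.
  have [h1 h3 h4 h5 h6] := dn r r0 rd.
  exists (p r); first exact: ltW.
  rewrite h6; have rA : 0 < r * As by rewrite mulr_gt0.
  have re : r * As * 2 <= e.
    have : r <= e / (2 * As) by rewrite ge_min lexx orbT.
    by rewrite ler_pdivlMr ?mulr_gt0// => ?; lra.
  move: h3; rewrite ltr_norml => /andP[t1 t2].
  have : r * As * (1 + theta (Num.sqrt r)) < r * As * 2 by rewrite ltr_pM2l//; lra.
  lra.
(* differentiate [Fr (p r) = As r (1 + theta (sqrt r))] *)
have slope r : 0 < r -> r < d -> As / 4 * f (p r) <= - p1 r <= 2 * As * f (p r).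
  move=> r0 rd; have [h1 h3 h4 h5 h6] := dn r r0 (ltW rd).
  have pr0 := ppos r0; have fp := f_gt0 f0 fc fd f12p pr0.
  have s0 : 0 < Num.sqrt r by rewrite sqrtr_gt0.
  have D1 := @is_derive1_comp R (Fr f) p r _ _ (Fr_is_derive f0 fc fd f12p U00 Ffin h5) (pd r0).
  have dth : is_derive (Num.sqrt r) 1 theta (derive1 theta (Num.sqrt r)).
    by rewrite derive1E; apply: DeriveDef => //; apply: thd; rewrite s0.
  have D2 := @is_derive1_comp R theta (@Num.sqrt R) r _ _ dth (is_derive_sqrt r0).
  have D3 : is_derive r 1 (fun r : R => r * As * (1 + theta (Num.sqrt r)))
      (As * (1 + theta (Num.sqrt r)) + As * (Num.sqrt r * derive1 theta (Num.sqrt r)) / 2).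
    apply: (is_derive_ext (is_deriveM (is_deriveM (is_derive_id r 1) (is_derive_cst As r 1))
      (is_deriveD (is_derive_cst (1 : R) r 1) D2))) => //.
    rewrite /= !fctE /GRing.scale /=.
    have rr : r = Num.sqrt r * Num.sqrt r by rewrite -expr2 sqr_sqrtr ?ltW.
    rewrite mulr0 !add0r mulr1 {1}rr.
    by move: (Num.sqrt r) s0 => c c0; field; rewrite gt_eqF.
  have E : - (f (p r))^-1 * p1 r =
      As * (1 + theta (Num.sqrt r)) + As * (Num.sqrt r * derive1 theta (Num.sqrt r)) / 2.
    have [_ <-] := D3; have [_ <-] := D1; apply: near_eq_derive.
    near=> z; have z0 : 0 < z by near: z; exact: lt_nbhsr.
    have zd : z < d by near: z; exact: lt_nbhsl.
    by have [_ _ _ _] := dn z z0 (ltW zd).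
  move: h3 h4; set t1 := theta _ in E *; set t2 := Num.sqrt r * derive1 theta (Num.sqrt r) in E *.
  rewrite !ltr_norml => /andP[a1 a2] /andP[a3 a4].
  have -> : - p1 r = (- (f (p r))^-1 * p1 r) * f (p r) by field; rewrite gt_eqF.
  rewrite E; have [b1 b2] : As / 4 <= As * (1 + t1) + As * t2 / 2 /\ As * (1 + t1) + As * t2 / 2 <= 2 * As.
    by split; nra.
  by rewrite !ler_wpM2r// ltW.
have neg0 r : 0 < r -> r < d -> p1 r < 0.
  move=> r0 rd; have /andP[h _] := slope r r0 rd.
  have := mulr_gt0 (_ : 0 < As / 4) (f_gt0 f0 fc fd f12p (ppos r0)).
  by move=> /(_ _)/wrap[|h']; lra.
(* Beyond the range governed by [theta]: the equation gives (r^(N/2) p1)' = - r^(N/2 - 1) f(p) / 4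
   <= 0, so the negative sign at d / 2 persists. *)
have neg r : 0 < r -> p1 r < 0.
  move=> r0; have [rd|rd] := ltP r d; first exact: neg0.
  pose a : R := N%:R / 2.
  have e0 : 0 < d / 2 by lra.
  have er : d / 2 <= r by lra.
  have ed : d / 2 < d by lra.
  have n1 := neg0 (d / 2) e0 ed.
  have h3 : r `^ a * p1 r <= (d / 2) `^ a * p1 (d / 2).
    apply: (nonincreasing_is_derive (F := fun x => x `^ a * p1 x)
      (dF := fun x => - (x `^ (a - 1) * (f (p x) / 4))) er) => x /andP[x1 _];
      have x0 : 0 < x by lra.
      apply: (is_derive_ext (is_deriveM (is_derive1_powR a x0) (p1d x0))) => //.
      rewrite /GRing.scale /= (_ : x `^ a = x `^ (a - 1) * x); last first.
        rewrite -{3}(powRr1 (ltW x0)) -powRD; last by rewrite (gt_eqF x0) implybT.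
        by congr (_ `^ _); ring.
      rewrite (_ : f (p x) = - (4 * x * p2 x + 2 * N%:R * p1 x)); last by rewrite ode// opprK.
      by rewrite /a; set c := x `^ _; field.
    rewrite oppr_le0 mulr_ge0 ?powR_ge0// divr_ge0// ltW//.
    exact: (f_gt0 f0 fc fd f12p (ppos x0)).
  have : (d / 2) `^ a * p1 (d / 2) < 0 by rewrite nmulr_llt0// powR_gt0.
  move=> h1; have : r `^ a * p1 r < 0 by lra.
  by rewrite pmulr_rlt0// powR_gt0.
(* An energy argument: with C = f (p r0), the function 2 r p1^2 + C p has derivative - (2N - 2) p1^2
   + p1 (C - f(p)) <= 0 on r >= r0, because p decreases. *)
have far r0 : 0 < r0 -> exists B, forall r, r0 <= r -> 4 * r * p1 r ^+ 2 <= B.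
  move=> r00; pose C := f (p r0).
  have C0 : 0 < C := f_gt0 f0 fc fd f12p (ppos r00).
  exists (2 * (2 * r0 * p1 r0 ^+ 2 + C * p r0)) => r rr.
  have rpos : 0 < r by lra.
  have pr := ppos rpos.
  have anti x : r0 <= x -> p x <= p r0.
    move=> rx; apply: (nonincreasing_is_derive (dF := p1) rx) => y /andP[ry _].
      by apply: pd; lra.
    by apply/ltW/neg; lra.
  have : 2 * r * p1 r ^+ 2 + C * p r <= 2 * r0 * p1 r0 ^+ 2 + C * p r0.
    apply: (nonincreasing_is_derive (F := fun r => 2 * r * p1 r ^+ 2 + C * p r)
      (dF := fun x => (- (2 * N%:R - 2) * p1 x ^+ 2) + p1 x * (C - f (p x))) rr) => x /andP[x1 _];
      have x0 : 0 < x by lra.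
      have d2x : is_derive x 1 (fun r : R => 2 * r) 2.
        by apply: (is_derive_ext (is_deriveZ (2 : R) (is_derive_id x 1))) => //; rewrite /GRing.scale /= mulr1.
      have dsq : is_derive x 1 (fun r : R => p1 r ^+ 2) (2 * (p1 x * p2 x)).
        apply: (is_derive_ext (is_deriveM (p1d x0) (p1d x0))) => //.
        by rewrite /GRing.scale /=; ring.
      apply: (is_derive_ext (is_deriveD (is_deriveM d2x dsq) (is_deriveZ C (pd x0)))) => //.
      rewrite /GRing.scale /=.
      rewrite (_ : f (p x) = - (4 * x * p2 x + 2 * N%:R * p1 x)); last by rewrite ode// opprK.
      by ring.
    have n1 := neg x x0.
    have fC : f (p x) <= C.
      apply: (f_mono f0 fc fd f12p); first exact/ltW/ppos.
      exact: anti.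
    have N1 : (1 : R) <= N%:R by rewrite ler1n.
    have : 0 <= (2 * N%:R - 2) * p1 x ^+ 2 by rewrite mulr_ge0 ?sqr_ge0//; lra.
    have : p1 x * (C - f (p x)) <= 0 by rewrite mulr_le0_ge0 ?subr_ge0// ltW.
    lra.
  have : 0 <= C * p r by rewrite mulr_ge0// ltW.
  lra.
have pFA A : A < As -> exists2 r2, 0 < r2 & forall r, 0 < r -> r <= r2 -> U0 < p r /\ A * r <= Fr f (p r).
  move=> AA; pose e := (As - A) / As.
  have e0 : 0 < e by rewrite divr_gt0//; lra.
  have [d2 d20 H2] := small e0.
  exists (Num.min d d2); first by rewrite lt_min dd.
  move=> r r0; rewrite le_min => /andP[rd rd2].
  have [h1 h3 h4 h5 ->] := dn r r0 rd; split => //.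
  have [_ + _] := H2 r r0 rd2; rewrite ltr_norml => /andP[t1 _].
  have -> : A = As * (1 - e) by rewrite /e; field; rewrite gt_eqF.
  rewrite mulrAC [As * r]mulrC; apply: ler_wpM2l; last by lra.
  by rewrite mulr_ge0// ltW.
(* Near 0 one has - p1 <= 2 As f(p) and (As / 2) r f(p) <= F(p) f(p) <= q p, the last by [Fr_f];
   together they bound r p1^2 by a multiple of p f(p). Elsewhere [far] gives a constant. *)
have grad : exists2 C, 0 <= C & forall r, 0 < r -> 4 * r * p1 r ^+ 2 <= C * (1 + p r * f (p r)).
  have hq : q - 1 < q by lra.
  have [K UK HK] := Fr_f f0 fc fd f1d f12p q1 flim U00 Ffin F0 hq.
  have [d3 d30 H3] := oo K.
  have hA : As / 2 < As by lra.
  have [d4 d40 H4] := pFA _ hA.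
  pose dm := Num.min (d / 2) (Num.min d3 d4).
  have dm0 : 0 < dm by rewrite !lt_min d30 d40 andbT; lra.
  have [B HB] := far dm dm0.
  have Aq : 0 <= 32 * As * q.
    by apply: mulr_ge0; [apply: mulr_ge0 => //; exact: ltW|exact: ltW (lt_trans ltr01 q1')].
  exists (Num.max 0 B + 32 * As * q); first by rewrite addr_ge0 ?le_max ?lexx.
  move=> r r0; have pr := ppos r0; have fp := f_gt0 f0 fc fd f12p pr.
  have pf0 : 0 < p r * f (p r) by rewrite mulr_gt0.
  have M0 : 0 <= Num.max 0 B by rewrite le_max lexx.
  have Mp : 0 <= Num.max 0 B * (p r * f (p r)) by rewrite mulr_ge0// ltW.
  have [rm|rm] := leP dm r.
    have := HB r rm; have : B <= Num.max 0 B by rewrite le_max lexx orbT.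
    have : 0 <= 32 * As * q * (1 + p r * f (p r)) by rewrite mulr_ge0//; lra.
    lra.
  move: rm; rewrite !lt_min => /and3P[m1 m2 m3].
  have rd : r < d by lra.
  have /andP[_ s2] := slope r r0 rd.
  have n1 := neg r r0.
  have [Up Ar] := H4 r r0 (ltW m3).
  have FF := HK (p r) (H3 r r0 (ltW m2)).
  have k1 : p1 r ^+ 2 <= (2 * As * f (p r)) ^+ 2.
    by rewrite -sqrrN ler_sqr ?nnegrE//; [lra|rewrite !mulr_ge0// ltW].
  have k2 : As / 2 * r * f (p r) <= q * p r.
    by apply: le_trans FF; rewrite ler_pM2r.
  have k3 : 4 * r * p1 r ^+ 2 <= 4 * r * (2 * As * f (p r)) ^+ 2.
    by rewrite ler_pM2l// mulr_gt0.
  have k4 : 4 * r * (2 * As * f (p r)) ^+ 2 = 32 * As * f (p r) * (As / 2 * r * f (p r)) by field.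
  have k5 : 32 * As * f (p r) * (As / 2 * r * f (p r)) <= 32 * As * f (p r) * (q * p r).
    by apply: ler_wpM2l => //; rewrite !mulr_ge0// ltW.
  have k6 : 32 * As * f (p r) * (q * p r) = 32 * As * q * (p r * f (p r)) by ring.
  lra.
by exists U0; split.
Unshelve. all: by end_near.
Qed.

End MakeProfile.

(** * Smooth concave truncations *)

Section TruncFun.
Variable R : realType.
Implicit Types m u : R.

(** For m > 0, the primitive of (1 - u / m)_+^2 that vanishes at 0: of class C^2, concave on the
    line, with slope 1 at 0, and constant equal to m / 3 from u = m on. [tr1] and [tr2] are its
    derivatives. *)
Definition tr m u : R := m / 3 * (1 - Num.max 0 (1 - u / m) ^+ 3).
Definition tr1 m u : R := Num.max 0 (1 - u / m) ^+ 2.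
Definition tr2 m u : R := - (2 / m) * Num.max 0 (1 - u / m).

Lemma is_derive_posX k (y : R) :
  is_derive y 1 (fun y : R => Num.max 0 y ^+ k.+2) (k.+2%:R * Num.max 0 y ^+ k.+1).
Proof.
have aux (z : R) (i : nat) : 0 <= z -> z <= 1 -> (i < k.+2)%N -> z ^+ (k.+1 - i) * z ^+ i <= z.
  move=> z0 z1 ik; rewrite -exprD subnK; last by rewrite -ltnS.
  by rewrite exprS; apply: ler_piMr => //; exact: exprn_ile1.
have [y0|y0|<-] := ltgtP 0 y.
- have d : is_derive y 1 (fun y : R => y ^+ k.+2) (k.+2%:R * y ^+ k.+1).
    apply: (is_derive_ext (is_deriveX k.+2 (is_derive_id y 1))); first by move=> z; rewrite exprfctE.
    by rewrite /GRing.scale /= mulr1.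
  have [D E] := d; apply: DeriveDef.
    apply: near_eq_derivable D; near=> z; rewrite max_r// ltW//; near: z; exact: lt_nbhsr.
  rewrite -E; apply: near_eq_derive; near=> z; rewrite max_r// ltW//; near: z; exact: lt_nbhsr.
- have d := is_derive_cst (0 : R) y 1.
  rewrite expr0n mulr0; have [D E] := d; apply: DeriveDef.
    apply: near_eq_derivable D; near=> z; rewrite max_l ?expr0n// ltW//; near: z; exact: lt_nbhsl.
  rewrite -[RHS]E; apply: near_eq_derive; near=> z; rewrite max_l ?expr0n// ltW//; near: z; exact: lt_nbhsl.
- rewrite expr0n mulr0; apply: is_derive_of_increments => e e0.
  exists (Num.min 1 (e / k.+2%:R)); first by rewrite lt_min ltr01 divr_gt0// ltr0n.
  move=> t1 t2 _ t12; rewrite add0r lt_min => /andP[t21 t2e]; rewrite mulr0 subr0.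
  have m12 : Num.max 0 t1 <= Num.max 0 t2 by rewrite ge_max le_max lexx/= le_max (ltW t12) orbT.
  have m10 : 0 <= Num.max 0 t1 by rewrite le_max lexx.
  have m20 : 0 <= Num.max 0 t2 by rewrite le_max lexx.
  have m21 : Num.max 0 t2 <= 1 by rewrite ge_max ler01 ltW.
  have dm : Num.max 0 t2 - Num.max 0 t1 <= t2 - t1.
    by rewrite /Num.max; case: ltP => ?; case: ltP => ?; lra.
  rewrite subrXX normrM ger0_norm ?subr_ge0// mulrC.
  apply: ler_pM; rewrite ?normr_ge0 ?subr_ge0//.
  apply: (le_trans (ler_norm_sum _ _ _)).
  apply: (@le_trans _ _ (\sum_(i < k.+2) Num.max 0 t2)).
    apply: ler_sum => i _; rewrite ger0_norm ?mulr_ge0 ?exprn_ge0//.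
    apply: (@le_trans _ _ (Num.max 0 t2 ^+ (k.+2.-1 - i) * Num.max 0 t2 ^+ i)).
      by apply: ler_wpM2l; [exact: exprn_ge0|rewrite lerXn2r// nnegrE].
    exact: aux.
  rewrite sumr_const card_ord -mulr_natl -ler_pdivlMl ?ltr0n// mulrC.
  by rewrite ge_max divr_ge0 ?(ltW e0) ?ler0n//= ltW.
Unshelve. all: by end_near.
Qed.

Let dlin m u : is_derive u 1 (fun u => 1 - u / m) (- m^-1).
Proof.
apply: (is_derive_ext (is_deriveB (is_derive_cst (1 : R) u 1) (is_deriveZ m^-1 (is_derive_id u 1)))) => //.
  by move=> y; rewrite /GRing.scale /= mulrC.
by rewrite /GRing.scale /=; ring.
Qed.

Lemma tr_derive m u : 0 < m -> is_derive u 1 (tr m) (tr1 m u).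
Proof.
move=> m0; have d := @is_derive1_comp R _ (fun u => 1 - u / m) u _ _ (is_derive_posX 1 _) (dlin m u).
apply: (is_derive_ext (is_deriveZ (m / 3) (is_deriveB (is_derive_cst (1 : R) u 1) d))) => //.
by rewrite /GRing.scale /= /tr1; set c := Num.max _ _; field; rewrite gt_eqF.
Qed.

Lemma tr1_derive m u : 0 < m -> is_derive u 1 (tr1 m) (tr2 m u).
Proof.
move=> m0; have d := @is_derive1_comp R _ (fun u => 1 - u / m) u _ _ (is_derive_posX 0 _) (dlin m u).
apply: (is_derive_ext d) => //.
by rewrite expr1 /tr2; set c := Num.max _ _; field; rewrite gt_eqF.
Qed.

Lemma tr2_cont m u : {for u, continuous (tr2 m)}.
Proof.
apply: (@continuousM _ _ (fun=> - (2 / m))); first exact: cst_continuous.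
have c1 : {for u, continuous (fun u => 1 - u / m)}.
  by have [D _] := dlin m u; exact: (derivable_continuous D).
have c2 : {for u, continuous (fun=> 0 : R)} by exact: cst_continuous.
exact: (continuous_max c2 c1).
Qed.

Lemma tr_flat m u : 0 < m -> m <= u -> [/\ tr m u = m / 3, tr1 m u = 0 & tr2 m u = 0].
Proof.
move=> m0 mu; have h : Num.max 0 (1 - u / m) = 0.
  by rewrite max_l// subr_le0 ler_pdivlMr// mul1r.
by rewrite /tr /tr1 /tr2 h !expr0n/= subr0 mulr1 mulr0.
Qed.

Variables (m u : R).
Hypothesis m0 : 0 < m.
Hypothesis u0 : 0 <= u.

Let ydef : exists2 y, 1 - u / m = y & [/\ u = m * (1 - y), y <= 1 & (u <= m) = (0 <= y)].
Proof.
have m0' := m0; have um : 0 <= u / m by rewrite divr_ge0// ltW.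
exists (1 - u / m) => //; split; first by field; rewrite gt_eqF.
  by lra.
by rewrite subr_ge0 ler_pdivrMr// mul1r.
Qed.

Lemma tr_props : [/\ 0 <= tr m u, tr m u <= m / 3, tr m u <= u, u - tr m u <= u ^+ 2 / m &
  [/\ 0 <= tr1 m u, tr1 m u <= 1 & tr2 m u <= 0]].
Proof.
have m0' := m0; have u0' := u0; have [y E [uE y1 yP]] := ydef.
rewrite /tr /tr1 /tr2 E; have um2 : u ^+ 2 / m = m * (1 - y) ^+ 2.
  by rewrite uE; field; rewrite gt_eqF.
have c0 : 0 < m / 3 by lra.
have [y0|y0] := leP 0 y.
  have y3 : y ^+ 3 <= 1 by rewrite exprn_ile1.
  have y30 : 0 <= y ^+ 3 by rewrite exprn_ge0.
  have y2 : y ^+ 2 <= 1 by rewrite exprn_ile1.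
  have y20 : 0 <= y ^+ 2 by rewrite exprn_ge0.
  split; [nra|nra| | |split => //].
  - rewrite [leRHS]uE -subr_ge0 (_ : _ - _ = m / 3 * (1 - y) * ((1 - y) * (2 + y))); last by field.
    by apply: mulr_ge0; [apply: mulr_ge0; lra|apply: mulr_ge0; lra].
  - rewrite um2 {1}uE -subr_ge0 (_ : _ - _ = m / 3 * ((1 - y) * (1 - y)) * (1 - y)); last by field.
    by apply: mulr_ge0; [apply: mulr_ge0; [lra|apply: mulr_ge0; lra]|lra].
  - by rewrite mulNr oppr_le0 mulr_ge0// divr_ge0// ltW.
have mu : m < u by rewrite ltNge yP -ltNge.
rewrite !expr0n /= mulr0 subr0 mulr1; split; [lra|lra|lra| |split; lra].
have : u <= u ^+ 2 / m by rewrite ler_pdivlMr// expr2 ler_pM2l//; lra.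
lra.
Qed.

(** For u <= m and y = 1 - u / m, the truncation is (u / 3) (1 + y + y^2), and y increases with m;
    for u >= m it is the constant m / 3. *)
Lemma tr_mono m' : m <= m' -> tr m u <= tr m' u /\ tr1 m u <= tr1 m' u.
Proof.
have m0p := m0; have u0p := u0; move=> mm; have m'0 : 0 < m' by lra.
have yy : 1 - u / m <= 1 - u / m'.
  by rewrite lerD2l lerN2 ler_wpM2l// lef_pV2.
have ym : Num.max 0 (1 - u / m) <= Num.max 0 (1 - u / m').
  by rewrite ge_max !le_max lexx /= yy orbT.
have yp : 0 <= Num.max 0 (1 - u / m) by rewrite le_max lexx.
split; last by rewrite /tr1 lerXn2r// nnegrE// (le_trans yp).
have [y E [uE y1 yP]] := ydef.
have [z z1 [z2 z3]] : exists2 z, 1 - u / m' = z & u = m' * (1 - z) /\ (u <= m') = (0 <= z).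
  exists (1 - u / m') => //; split; first by field; rewrite gt_eqF.
  by rewrite subr_ge0 ler_pdivrMr// mul1r.
have [um|um] := leP u m.
  have um' : u <= m' by lra.
  move: um um'; rewrite yP z3 => y0 z0; move: yy; rewrite /tr E z1 => yy.
  rewrite !max_r//.
  have -> : m / 3 * (1 - y ^+ 3) = m * (1 - y) / 3 * (1 + y + y ^+ 2) by field.
  have -> : m' / 3 * (1 - z ^+ 3) = m' * (1 - z) / 3 * (1 + z + z ^+ 2) by field.
  rewrite -uE -z2; apply: ler_wpM2l; first by lra.
  have : y ^+ 2 <= z ^+ 2 by rewrite lerXn2r// nnegrE.
  lra.
have [-> _ _] := tr_flat m0p (ltW um).
have [um'|um'] := leP u m'; last by have [-> _ _] := tr_flat m'0 (ltW um'); lra.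
move: um'; rewrite z3 => z0; rewrite /tr z1 max_r//.
have -> : m' / 3 * (1 - z ^+ 3) = m' * (1 - z) / 3 * (1 + z + z ^+ 2) by field.
rewrite -z2; have : u / 3 * 1 <= u / 3 * (1 + z + z ^+ 2).
  by apply: ler_wpM2l; [lra|have := sqr_ge0 z; lra].
lra.
Qed.

(** The curvature of the truncation at level m is paid for by the increase of its slope from level m
    to level 2m: for u <= m and y = 1 - u / m the two sides differ by 2 (1 - y) (1 + 2 y). In
    [us_solution] the right-hand side becomes a difference of two terms of a convergent sequence. *)
Lemma tr2_bound : - tr2 m u * u <= 8 * (tr1 (2 * m) u - tr1 m u).
Proof.
have m0p := m0; have u0p := u0; have [y E [uE y1 yP]] := ydef.
have [um|um] := leP u m; last first.
  have [_ -> ->] := tr_flat m0p (ltW um).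
  by rewrite oppr0 mul0r addr0 mulr_ge0// /tr1 sqr_ge0.
move: um; rewrite yP => y0; rewrite /tr2 /tr1.
have -> : 1 - u / (2 * m) = (1 + y) / 2 by rewrite {1}uE; field; rewrite gt_eqF.
rewrite E !max_r//; last by lra.
rewrite {1}uE -subr_ge0 (_ : _ - _ = 2 * (1 - y) * (1 + 2 * y)); last by field; rewrite gt_eqF.
by apply: mulr_ge0; lra.
Qed.

End TruncFun.

(** * Monotone convergence in heat and Duhamel terms *)

Section MonotoneLimits.
Variables (R : realType) (N : nat).
Local Notation V := 'rV[R]_N.
Local Notation mu := (lebn R N).
Local Notation leb := (@lebesgue_measure R).

Lemma heatE_le (t : R) (w1 w2 : V -> \bar R) (x : V) : measurable_fun setT w1 -> measurable_fun setT w2 ->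
  (forall y, 0 <= w1 y)%E -> (forall y, w1 y <= w2 y)%E -> (heatE t w1 x <= heatE t w2 x)%E.
Proof.
move=> m1 m2 p1 p12; apply: ge0_le_integral => //.
- by move=> y _; rewrite mule_ge0// lee_fin heatG_ge0.
- exact: measurable_heat_integrand.
- exact: measurable_heat_integrand.
- by move=> y _; apply: lee_wpmul2l => //; rewrite lee_fin heatG_ge0.
Qed.

Lemma heatE_cvg (t : R) (w_ : nat -> V -> \bar R) (w : V -> \bar R) (x : V) :
  (forall k, measurable_fun setT (w_ k)) -> (forall k y, 0 <= w_ k y)%E ->
  (forall y, nondecreasing_seq (w_ ^~ y)) -> (forall y, w_ k y @[k --> \oo] --> w y) ->
  heatE t (w_ k) x @[k --> \oo] --> heatE t w x.
Proof.
move=> mw w0 ndw cw; rewrite /heatE.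
have G0 (y : V) : (0 <= (heatG t (x - y))%:E)%E by rewrite lee_fin heatG_ge0.
have E (y : V) : ((heatG t (x - y))%:E * w y)%E =
    lim ((fun k => (heatG t (x - y))%:E * w_ k y)%E @ \oo).
  by apply/esym/cvg_lim => //; apply: cvgeZl => //; exact: cw.
under eq_integral do rewrite E.
apply: cvg_monotone_convergence => //.
- by move=> k; exact: measurable_heat_integrand.
- by move=> k y _; exact: mule_ge0.
- by move=> y _ a b ab; apply: lee_wpmul2l => //; exact: ndw.
Qed.

Lemma duhE_le (a t : R) (h1 h2 : V -> R -> \bar R) (x : V) :
  measurable_fun setT (fun q : V * R => h1 q.1 q.2) ->
  measurable_fun setT (fun q : V * R => h2 q.1 q.2) ->
  (forall y s, 0 <= h1 y s)%E -> (forall y s, (a < s < t)%R -> h1 y s <= h2 y s)%E ->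
  (forall y s, 0 <= h2 y s)%E ->
  (duhE a t h1 x <= duhE a t h2 x)%E.
Proof.
move=> m1 m2 p1 p12 p2; apply: ge0_le_integral => //.
- by move=> s _; exact: heatE_ge0.
- by apply: measurable_funTS; exact: measurable_duhE_integrand.
- by apply: measurable_funTS; exact: measurable_duhE_integrand.
- move=> s /=; rewrite in_itv/= => st; apply: heatE_le => //.
  + exact: (measurableT_comp (g := fun y : V => (y, s)) m1).
  + exact: (measurableT_comp (g := fun y : V => (y, s)) m2).
  + by move=> y; exact: p12.
Qed.

Lemma duhE_cvg (a t : R) (h_ : nat -> V -> R -> \bar R) (h : V -> R -> \bar R) (x : V) :
  (forall k, measurable_fun setT (fun q : V * R => h_ k q.1 q.2)) -> (forall k y s, 0 <= h_ k y s)%E ->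
  (forall y s, nondecreasing_seq (fun k => h_ k y s)) ->
  (forall y s, a < s < t -> h_ k y s @[k --> \oo] --> h y s) ->
  duhE a t (h_ k) x @[k --> \oo] --> duhE a t h x.
Proof.
move=> mh h0 ndh ch; rewrite /duhE.
have ms k s : measurable_fun setT (fun y => h_ k y s).
  exact: (measurableT_comp (g := fun y : V => (y, s)) (mh k)).
rewrite (_ : (\int[leb]_(s in `]a, t[) heatE (t - s) (fun y => h y s) x)%E =
   (\int[leb]_(s in `]a, t[) lim ((fun k => heatE (t - s) (fun y => h_ k y s) x) @ \oo))%E); last first.
  apply: eq_integral => s /set_mem/=; rewrite in_itv/= => st; apply/esym/cvg_lim => //.
  by apply: heatE_cvg => // y; exact: ch.
apply: cvg_monotone_convergence => //.
- by move=> k; apply: measurable_funTS; exact: measurable_duhE_integrand.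
- by move=> k s _; exact: heatE_ge0.
- by move=> s _ b c bc; apply: heatE_le => // y; exact: ndh.
Qed.

Lemma duhED (a t : R) (h1 h2 : V -> R -> \bar R) (x : V) :
  measurable_fun setT (fun q : V * R => h1 q.1 q.2) ->
  measurable_fun setT (fun q : V * R => h2 q.1 q.2) ->
  (forall y s, 0 <= h1 y s)%E -> (forall y s, 0 <= h2 y s)%E ->
  duhE a t (fun y s => h1 y s + h2 y s)%E x = (duhE a t h1 x + duhE a t h2 x)%E.
Proof.
move=> m1 m2 p1 p2; rewrite /duhE -ge0_integralD//.
- apply: eq_integral => s _; rewrite heatED//.
  + exact: (measurableT_comp (g := fun y : V => (y, s)) m1).
  + exact: (measurableT_comp (g := fun y : V => (y, s)) m2).
- by move=> s _; exact: heatE_ge0.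
- by apply: measurable_funTS; exact: measurable_duhE_integrand.
- by move=> s _; exact: heatE_ge0.
- by apply: measurable_funTS; exact: measurable_duhE_integrand.
Qed.

Lemma integral_itv_rev (t : R) (k : R -> \bar R) : measurable_fun setT k -> (forall s, 0 <= k s)%E ->
  (\int[leb]_(s in `]0%R, t[) k s = \int[leb]_(s in `]0%R, t[) k (t - s)%R)%E.
Proof.
move=> mk k0; rewrite integral_mkcond [RHS]integral_mkcond.
have n1 : (-1 : R) != 0 by rewrite oppr_eq0 oner_neq0.
rewrite -(@integral_affine1 R (-1) t) //.
- rewrite normrN normr1 mul1e; apply: eq_integral => s _; rewrite !patchE.
  rewrite (_ : -1 * s + t = t - s); last by ring.
  rewrite (_ : (t - s \in `]0%R, t[%classic) = (s \in `]0%R, t[%classic))//.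
  by rewrite !mem_setE !in_itv/= subr_gt0 ltrBlDr ltrDl andbC.
- by apply/measurable_restrict => //; rewrite setTI; exact: measurable_funTS.
- by move=> s; rewrite patchE; case: ifP.
Qed.

Lemma heatHN (t B : R) (w : V -> R) (x : V) : 0 < t -> bmeas B w ->
  heatH t (fun y => - w y) x = - heatH t w x.
Proof.
move=> t0 bw; have := heatHB x t0 (bmeas_cst N (0 : R)) bw.
by under eq_fun do rewrite sub0r; rewrite heatH_cst// sub0r.
Qed.

(** A C^2 function is a stationary mild solution with source - Delta w. [heat_flow_C2] integrates
    over the elapsed time s and [duh] over t - s; [integral_itv_rev] reconciles them. *)
Lemma heat_flow_duh (t B B1 B2 : R) (w g : V -> R) (D1 D2 : 'I_N -> V -> R) (x : V) : 0 < t ->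
  bmeas B w -> (forall j, bmeas B1 (D1 j)) -> (forall j, bmeas B2 (D2 j)) ->
  (forall j y, is_derive y (ei R j) w (D1 j y)) ->
  (forall j y, is_derive y (ei R j) (D1 j) (D2 j y)) ->
  {for x, continuous w} -> {for x, continuous (fun y => \sum_j D2 j y)} ->
  (forall y, \sum_j D2 j y = - g y) -> (forall y, 0 <= g y) ->
  w x = heatH t w x + duh 0 t (fun y _ => g y) x /\ bmeas (N%:R * B2) g.
Proof.
move=> t0 bw b1 b2 d1 d2 cw cl gE g0.
have bl := bmeas_sum b2.
have bg : bmeas (N%:R * B2) g.
  split; last by move=> y; have := proj2 bl y; rewrite gE normrN.
  rewrite (_ : g = fun y => - \sum_j D2 j y); last by apply/funext => y; rewrite gE opprK.
  by apply: measurable_funN; case: bl.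
split=> //.
have bs : bsrc 0 t (N%:R * B2) (fun y _ => g y).
  split; last by move=> s y _; exact: (proj2 bg).
  by apply: (measurableT_comp (f := g)) => //; case: bg.
have H := heat_flow_C2 t0 bw b1 b2 d1 d2 cw cl.
have e1 : (fun y => \sum_j D2 j y) = (fun y => - g y) by apply/funext.
suff E : \int[leb]_(s in `]0, t[) heatH s (fun y => \sum_j D2 j y) x = - duh 0 t (fun y _ => g y) x.
  by move: H; rewrite E; lra.
rewrite e1; have mk : measurable_fun setT (fun s : R => heatH s g x).
  apply: (@measurable_heatH_param R N _ _ id (fun=> x) (fun p : R * V => g p.2)) => //.
  by apply: (measurableT_comp (f := g)) => //; case: bg.
have ib : leb.-integrable `]0, t[ (EFin \o (fun s => heatH s g x)).
  apply: (@le_integrable _ _ _ leb _ _ _ (EFin \o (fun=> N%:R * B2))) => //.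
  - by apply/measurable_EFinP; exact: measurable_funTS.
  - move=> s /=; rewrite in_itv/= => /andP[s0 _]; rewrite lee_fin.
    by rewrite (ger0_norm (bmeas_ge0 bg)); exact: heatH_le.
  - exact: integrable_itvoo_cst.
transitivity (\int[leb]_(s in `]0, t[) (- 1 * heatH s g x)).
  apply: eq_Rintegral => s /set_mem/=; rewrite in_itv/= => /andP[s0 _].
  by rewrite (heatHN x s0 bg) mulN1r.
have -> : \int[leb]_(s in `]0, t[) (- 1 * heatH s g x) = - 1 * \int[leb]_(s in `]0, t[) heatH s g x.
  by apply: RintegralZl; [exact: measurable_itv|exact: ib].
suff E2 : \int[leb]_(s in `]0, t[) heatH s g x = duh 0 t (fun y _ => g y) x.
  by rewrite E2; exact: mulN1r.
apply: EFin_inj; rewrite [RHS](duh_duhE x bs).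
have -> : (\int[leb]_(s in `]0, t[) heatH s g x)%:E = (\int[leb]_(s in `]0%R, t[) (heatH s g x)%:E)%E.
  by apply: fineK; exact: (integrable_fin_num _ ib).
pose k (s : R) : \bar R := heatE s (EFin \o g) x.
have mkE : measurable_fun setT k.
  apply: (@measurable_heatE_param R N _ _ id (fun=> x) (fun p : R * V => (g p.2)%:E)) => //.
  - apply/measurable_EFinP; apply: (measurableT_comp (f := g)) => //; by case: bg.
  - by move=> q; rewrite lee_fin.
have k0 s : (0 <= k s)%E by apply: heatE_ge0 => y; rewrite lee_fin.
transitivity (\int[leb]_(s in `]0%R, t[) k s)%E.
  apply: eq_integral => s /set_mem/=; rewrite in_itv/= => /andP[s0 _].
  by rewrite (heatH_heatE x s0 bg).
by rewrite (integral_itv_rev t mkE k0).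
Qed.

End MonotoneLimits.

(** * The truncated data and their Laplacian *)

Section TruncatedData.
Variables (R : realType) (N : nat) (f : R -> R) (q U0 : R) (p p1 p2 : R -> R).
Local Notation V := 'rV[R]_N.
Local Notation f1 := (derive1 f).
Local Notation f2 := (derive1 (derive1 f)).
Hypothesis f0 : f 0 = 0.
Hypothesis fc : {within `[0, +oo[%classic, continuous f}.
Hypothesis fd : forall x, 0 < x -> derivable f x 1.
Hypothesis f12p : forall x, 0 < x -> 0 < f1 x /\ 0 < f2 x.
Hypothesis Hp : profile N f q U0 p p1 p2.

Let fpos u : 0 < u -> 0 < f u := @f_gt0 R f f0 fc fd f12p u.

Lemma prof_anti r s : 0 < r -> r <= s -> p s <= p r.
Proof.
move=> r0 rs; apply: (nonincreasing_is_derive (dF := p1) rs) => x /andP[rx _].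
  by apply: (pr_d1 Hp); lra.
by apply/ltW/(pr_neg Hp); lra.
Qed.

(* [u*] with the arbitrary value at the origin replaced by [0] *)
Definition us (x : V) : R := if x == 0 then 0 else p (enorm x ^+ 2).

Lemma enorm2_gt0 (x : V) : x != 0 -> 0 < enorm x ^+ 2.
Proof. by move=> x0; rewrite exprn_gt0// enorm_gt0. Qed.

Lemma us_ge0 x : 0 <= us x.
Proof. by rewrite /us; case: ifPn => // /enorm2_gt0/(pr_gt0 Hp)/ltW. Qed.

Section Fixed.
Variable m : R.
Hypothesis m0 : 0 < m.

(** Near r = 0 the profile exceeds m, where [tr m] is constant. Continued by m / 3 to r <= 0 the
    function is of class C^2 on the line, and [W] is therefore C^2 across the origin. *)
Definition trh r : R := if 0 < r then tr m (p r) else m / 3.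
Definition trh1 r : R := if 0 < r then tr1 m (p r) * p1 r else 0.
Definition trh2 r : R := if 0 < r then tr2 m (p r) * p1 r ^+ 2 + tr1 m (p r) * p2 r else 0.

Let flat : exists2 d, 0 < d & forall r, r <= d -> [/\ trh r = m / 3, trh1 r = 0 & trh2 r = 0].
Proof.
have [d d0 H] := pr_oo Hp m; exists d => // r rd; rewrite /trh /trh1 /trh2.
case: ltP => // r0; have [-> -> ->] := tr_flat m0 (H r r0 rd).
by rewrite !mul0r addr0.
Qed.

Let ext_derive (h hd k kd : R -> R) :
  (forall r : R, 0 < r -> is_derive r 1 k (kd r)) ->
  (forall r, 0 < r -> h r = k r) -> (forall r, 0 < r -> hd r = kd r) ->
  (exists c d : R, 0 < d /\ forall r, r <= d -> h r = c /\ hd r = 0) ->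
  forall r : R, is_derive r 1 h (hd r).
Proof.
move=> dk hk hdk [c [d [d0 H]]] r; have [r0|r0] := ltP 0 r.
  have [D E] := dk r r0; rewrite hdk//; apply: DeriveDef.
    by apply: near_eq_derivable D; near=> z; rewrite hk//; near: z; exact: lt_nbhsr.
  by rewrite -[RHS]E; apply: near_eq_derive; near=> z; rewrite hk//; near: z; exact: lt_nbhsr.
have rd : r < d by lra.
have [_ ->] := H r (ltW rd).
have [D E] := is_derive_cst c r 1; apply: DeriveDef.
  apply: near_eq_derivable D; near=> z; have [|-> _] := H z; last by [].
  by apply: ltW; near: z; exact: lt_nbhsl.
rewrite -[RHS]E; apply: near_eq_derive; near=> z; have [|-> _] := H z; last by [].
by apply: ltW; near: z; exact: lt_nbhsl.
Unshelve. all: by end_near.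
Qed.

Lemma trh_derive (r : R) : is_derive r 1 trh (trh1 r).
Proof.
have [d d0 H] := flat.
apply: (@ext_derive _ _ (fun r => tr m (p r)) (fun r => tr1 m (p r) * p1 r)).
- by move=> s s0; exact: (@is_derive1_comp R _ p s _ _ (tr_derive _ m0) (pr_d1 Hp s0)).
- by move=> s s0; rewrite /trh s0.
- by move=> s s0; rewrite /trh1 s0.
- by exists (m / 3), d; split => // s /H [].
Qed.

Lemma trh1_derive (r : R) : is_derive r 1 trh1 (trh2 r).
Proof.
have [d d0 H] := flat.
apply: (@ext_derive _ _ (fun r => tr1 m (p r) * p1 r)
  (fun r => tr2 m (p r) * p1 r ^+ 2 + tr1 m (p r) * p2 r)).
- move=> s s0; have d1 := @is_derive1_comp R _ p s _ _ (tr1_derive _ m0) (pr_d1 Hp s0).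
  apply: (is_derive_ext (is_deriveM d1 (pr_d2 Hp s0))) => //.
  by rewrite /GRing.scale /=; ring.
- by move=> s s0; rewrite /trh1 s0.
- by move=> s s0; rewrite /trh2 s0.
- by exists 0, d; split => // s /H [].
Qed.

Lemma trh2_cont (r : R) : {for r, continuous trh2}.
Proof.
have [d d0 H] := flat.
suff : trh2 @ r --> trh2 r by [].
have [r0|r0] := ltP 0 r.
  have cp : {for r, continuous p} by have [D _] := pr_d1 Hp r0; exact: (derivable_continuous D).
  have cp1 : {for r, continuous p1} by have [D _] := pr_d2 Hp r0; exact: (derivable_continuous D).
  have c1 : {for r, continuous (tr1 m \o p)}.
    apply: continuous_comp => //; have [D _] := tr1_derive (p r) m0.
    exact: (derivable_continuous D).
  have c2 : {for r, continuous (tr2 m \o p)}.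
    by apply: continuous_comp => //; exact: tr2_cont.
  have c : (fun r => tr2 m (p r) * p1 r ^+ 2 + tr1 m (p r) * p2 r) @ r -->
      tr2 m (p r) * p1 r ^+ 2 + tr1 m (p r) * p2 r.
    apply: cvgD; apply: cvgM => //; last exact: (pr_c2 Hp r0).
    by apply: cvgM.
  rewrite {2}/trh2 r0; apply: cvg_trans c; apply: near_eq_cvg; near=> z.
  by rewrite /trh2 ifT//; near: z; exact: lt_nbhsr.
have rd : r < d by lra.
have [_ _ ->] := H r (ltW rd).
apply: cvg_near_cst; near=> z; have [|_ _ ->] := H z; last by [].
by apply: ltW; near: z; exact: lt_nbhsl.
Unshelve. all: by end_near.
Qed.

Definition W (x : V) : R := trh (enorm x ^+ 2).
Definition dW j (x : V) : R := trh1 (enorm x ^+ 2) * (2 * x 0 j).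
Definition ddW j (x : V) : R :=
  trh2 (enorm x ^+ 2) * (2 * x 0 j) ^+ 2 + 2 * trh1 (enorm x ^+ 2).

Lemma W_us x : x != 0 -> W x = tr m (us x).
Proof. by move=> x0; rewrite /W /trh /us enorm2_gt0// (negbTE x0). Qed.

Lemma W_ge0 x : 0 <= W x.
Proof.
rewrite /W /trh; case: ifPn => [r0|_]; last by apply: divr_ge0 => //; exact: ltW.
by have [] := tr_props m0 (ltW (pr_gt0 Hp r0)).
Qed.

Lemma W_le x : W x <= m / 3.
Proof.
rewrite /W /trh; case: ifPn => // r0.
by have [] := tr_props m0 (ltW (pr_gt0 Hp r0)).
Qed.

Lemma W_derive j (x : V) : is_derive x (ei R j) W (dW j x).
Proof. exact: (is_derive_comp_dir (trh_derive _) (is_derive_enorm2 j x)). Qed.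

Lemma dW_derive j (x : V) : is_derive x (ei R j) (dW j) (ddW j x).
Proof.
have d2 : is_derive x (ei R j) (fun y : V => 2 * y 0 j) 2.
  by apply: (is_derive_ext (is_deriveZ (2 : R) (is_derive_coord j x))) => //; rewrite /GRing.scale /= mulr1.
have d1 := is_derive_comp_dir (trh1_derive _) (is_derive_enorm2 j x).
apply: (is_derive_ext (is_deriveM d1 d2)) => //.
by rewrite /ddW /GRing.scale /=; ring.
Qed.

Let trh_cts : continuous trh.
Proof. by move=> r; have [D _] := trh_derive r; exact: (derivable_continuous D). Qed.
Let trh1_cts : continuous trh1.
Proof. by move=> r; have [D _] := trh1_derive r; exact: (derivable_continuous D). Qed.

Lemma W_cont : continuous W.
Proof.
by move=> x; apply: (@continuous_comp _ _ _ (fun y : V => enorm y ^+ 2) trh);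
  [exact: enorm2_continuous|exact: trh_cts].
Qed.

Let menorm2 : measurable_fun setT (fun x : V => enorm x ^+ 2).
Proof. by apply: measurable_funX; exact: measurable_enorm. Qed.

Let mcomp (h : R -> R) : continuous h -> measurable_fun setT (fun x : V => h (enorm x ^+ 2)).
Proof.
by move=> ch; apply: (measurableT_comp (f := h)) => //; exact: continuous_measurable_fun.
Qed.

Lemma bmeas_W : bmeas (m / 3) W.
Proof.
split; first exact: mcomp.
by move=> x; rewrite ger0_norm ?W_ge0// W_le.
Qed.

Let sq_bound (y B : R) : y ^+ 2 <= B -> `|y| <= 1 + B.
Proof.
move=> yB; have [y1|y1] := leP `|y| 1; first by have := sqr_ge0 y; lra.
have : `|y| * 1 <= `|y| * `|y| by rewrite ler_pM2l; lra.
by rewrite mulr1 -expr2 real_normK ?num_real//; lra.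
Qed.

Let nn (a b : R) : 0 <= 4 * a ^+ 2 * b ^+ 2.
Proof. by apply: mulr_ge0 (sqr_ge0 _); apply: mulr_ge0 (sqr_ge0 _). Qed.

Let norm_sq2 (a b c : R) : `|a * b ^+ 2 * (2 * c) ^+ 2| = `|a| * (4 * c ^+ 2 * b ^+ 2).
Proof.
have -> : a * b ^+ 2 * (2 * c) ^+ 2 = a * (4 * c ^+ 2 * b ^+ 2) by ring.
by rewrite normrM (ger0_norm (nn _ _)).
Qed.

Let norm_sq1 (a b c : R) : `|a * b * (2 * c) ^+ 2| = `|a| * (4 * c ^+ 2 * `|b|).
Proof.
have c0 : 0 <= 4 * c ^+ 2 by apply: mulr_ge0 (sqr_ge0 _).
have -> : a * b * (2 * c) ^+ 2 = a * (4 * c ^+ 2 * b) by ring.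
by rewrite normrM (normrM (4 * _)) (ger0_norm c0).
Qed.

(** For r <= d the function is constant. Beyond, [pr_grad_far] bounds r p1^2, and the equation
    expresses r p2 through p1 and f(p), which are both bounded there. *)
Lemma W_bounds : exists B1 B2 : R, (forall j, bmeas B1 (dW j)) /\ (forall j, bmeas B2 (ddW j)).
Proof.
have [d d0 H] := flat; have [B HB] := pr_grad_far Hp d0.
have B0 : 0 <= B.
  by apply: le_trans (HB d (lexx _)); rewrite mulr_ge0 ?sqr_ge0// mulr_ge0// ltW.
have xj j (x : V) : x 0 j ^+ 2 <= enorm x ^+ 2.
  by rewrite enorm_sq (bigD1 j)//= lerDl sumr_ge0// => i _; exact: sqr_ge0.
have mj j : measurable_fun setT (fun x : V => 2 * x 0 j).
  by apply: measurable_funM => //; exact: measurable_coord.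
pose P := 1 + B / (4 * d).
have P0 : 0 <= P by rewrite addr_ge0// divr_ge0// mulr_ge0// ltW.
pose C := f (p d).
have C0 : 0 <= C by apply/ltW/fpos/(pr_gt0 Hp).
exists (1 + B), (2 / m * B + C + 2 * N%:R * P + 2 * P); split=> j; split.
- by apply: measurable_funM => //; exact: mcomp.
- move=> x; rewrite /dW; set r := enorm x ^+ 2; have [rd|rd] := leP r d.
    by have [_ -> _] := H r rd; rewrite mul0r normr0; lra.
  have r0 : 0 < r by lra.
  apply: sq_bound; apply: le_trans (HB r (ltW rd)); rewrite /trh1 r0.
  have [_ _ _ _ [a1 a2 _]] := tr_props m0 (ltW (pr_gt0 Hp r0)).
  have -> : (tr1 m (p r) * p1 r * (2 * x 0 j)) ^+ 2 = tr1 m (p r) ^+ 2 * (4 * x 0 j ^+ 2 * p1 r ^+ 2) by ring.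
  apply: (@le_trans _ _ (1 * (4 * x 0 j ^+ 2 * p1 r ^+ 2))).
    apply: ler_wpM2r; first exact: nn.
    by rewrite exprn_ile1.
  rewrite mul1r; apply: ler_wpM2r; first exact: sqr_ge0.
  by rewrite ler_pM2l.
- apply: measurable_funD; last by apply: measurable_funM => //; exact: mcomp.
  apply: measurable_funM; first by apply: mcomp => r; exact: trh2_cont.
  exact: measurable_funX.
- move=> x; rewrite /ddW; set r := enorm x ^+ 2; have [rd|rd] := leP r d.
    have [_ -> ->] := H r rd; rewrite mul0r mulr0 addr0 normr0.
    have : 0 <= 2 / m * B by rewrite !mulr_ge0// invr_ge0 ltW.
    have : 0 <= 2 * N%:R * P by rewrite !mulr_ge0.
    lra.
  have r0 : 0 < r by lra.
  rewrite /trh1 /trh2 r0.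
  have [_ _ _ _ [a1 a2 a3]] := tr_props m0 (ltW (pr_gt0 Hp r0)).
  have b0 : - tr2 m (p r) <= 2 / m.
    rewrite /tr2 mulNr opprK ger_pMr ?divr_gt0// ge_max ler01 /=.
    have : 0 <= p r / m by apply: divr_ge0; [exact/ltW/(pr_gt0 Hp)|exact: ltW].
    lra.
  have hB := HB r (ltW rd).
  have pP : `|p1 r| <= P.
    apply: sq_bound; rewrite ler_pdivlMr ?mulr_gt0//.
    apply: le_trans hB; rewrite mulrC; apply: ler_wpM2r; first exact: sqr_ge0.
    by rewrite ler_pM2l// ltW.
  have fC : f (p r) <= C.
    by apply: (f_mono f0 fc fd f12p); [exact/ltW/(pr_gt0 Hp)|apply: prof_anti => //; exact: ltW].
  have f0' : 0 <= f (p r) by apply/ltW/fpos/(pr_gt0 Hp).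
  have o := pr_ode Hp r0.
  have k1 : 4 * r * `|p2 r| <= C + 2 * N%:R * P.
    have -> : 4 * r * `|p2 r| = `|4 * r * p2 r| by rewrite normrM ger0_norm// mulr_ge0// ltW.
    have -> : 4 * r * p2 r = - f (p r) - 2 * N%:R * p1 r by rewrite -o; ring.
    apply: (le_trans (ler_normB _ _)); apply: lerD; first by rewrite normrN ger0_norm.
    by rewrite normrM ger0_norm ?mulr_ge0//; apply: ler_wpM2l => //; rewrite mulr_ge0.
  have xr : x 0 j ^+ 2 <= r by exact: xj.
  have x2 := sqr_ge0 (x 0 j).
  apply: (le_trans (ler_normD _ _)); apply: lerD; last first.
    rewrite normrM ger0_norm//; apply: ler_wpM2l => //.
    rewrite normrM ger0_norm//; apply: le_trans pP; by rewrite ler_piMl.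
  rewrite mulrDl; apply: (le_trans (ler_normD _ _)); rewrite -addrA; apply: lerD.
    have -> : `|tr2 m (p r) * p1 r ^+ 2 * (2 * x 0 j) ^+ 2| = - tr2 m (p r) * (4 * x 0 j ^+ 2 * p1 r ^+ 2).
      by rewrite norm_sq2 (ler0_norm a3).
    apply: ler_pM => //; first by rewrite oppr_ge0.
    apply: le_trans hB; apply: ler_wpM2r; first exact: sqr_ge0.
    by rewrite ler_pM2l.
  apply: le_trans k1.
  have -> : `|tr1 m (p r) * p2 r * (2 * x 0 j) ^+ 2| = tr1 m (p r) * (4 * x 0 j ^+ 2 * `|p2 r|).
    by rewrite norm_sq1 (ger0_norm a1).
  apply: (@le_trans _ _ (1 * (4 * x 0 j ^+ 2 * `|p2 r|))).
    by apply: ler_wpM2r => //; apply: mulr_ge0 => //; apply: mulr_ge0.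
  by rewrite mul1r; apply: ler_wpM2r => //; rewrite ler_pM2l.
Qed.

(** [aW] and [eW] are the two parts of - Delta W: the truncated source and the error - tr'' |grad
    ustar|^2, the squared gradient being 4 r p1^2 in terms of the profile. *)
Definition aW (x : V) : R := tr1 m (us x) * f (us x).
Definition eW (x : V) : R := if x == 0 then 0 else
  - tr2 m (us x) * (4 * enorm x ^+ 2 * p1 (enorm x ^+ 2) ^+ 2).

Lemma aW_ge0 x : 0 <= aW x.
Proof. by apply: mulr_ge0; [exact: sqr_ge0|apply: (f_ge0 f0 fc fd f12p); exact: us_ge0]. Qed.

Lemma eW_ge0 x : 0 <= eW x.
Proof.
rewrite /eW; case: ifP => // _; have [_ _ _ _ [_ _ h]] := tr_props m0 (us_ge0 x).
by apply: mulr_ge0; [rewrite oppr_ge0|exact: nn].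
Qed.

Lemma lapW x : \sum_j ddW j x = - (aW x + eW x).
Proof.
have -> : \sum_j ddW j x = 4 * enorm x ^+ 2 * trh2 (enorm x ^+ 2) + 2 * N%:R * trh1 (enorm x ^+ 2).
  rewrite /ddW big_split /= sumr_const card_ord -mulr_natl.
  rewrite (eq_bigr (fun j => 4 * trh2 (enorm x ^+ 2) * x 0 j ^+ 2)); last by move=> j _; ring.
  by rewrite -mulr_sumr -enorm_sq; ring.
rewrite /aW /eW /us; case: ifPn => [/eqP ->|x0].
  rewrite f0 mulr0 addr0 oppr0 (_ : enorm (0 : V) = 0); last by apply/eqP; rewrite enorm_eq0.
  by rewrite expr0n /trh1 ltxx mulr0 mul0r mulr0 addr0.
have r0 := enorm2_gt0 x0; have := pr_ode Hp r0.
set r := enorm x ^+ 2 in r0 *; rewrite /trh1 /trh2 r0 => o.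
have -> : f (p r) = - (4 * r * p2 r + 2 * N%:R * p1 r) by rewrite o opprK.
by ring.
Qed.

Lemma lapW_cont : continuous (fun x : V => \sum_j ddW j x).
Proof.
move=> x; apply: continuous_sum_at => j.
have c2 : {for x, continuous (fun y : V => 2 * y 0 j)}.
  by apply: (@continuousM _ _ (fun=> 2 : R)); [exact: cst_continuous|exact: coord_continuous_rV].
have c3 : {for x, continuous (fun y : V => trh2 (enorm y ^+ 2))}.
  by apply: continuous_comp; [exact: enorm2_continuous|exact: trh2_cont].
have c4 : {for x, continuous (fun y : V => trh1 (enorm y ^+ 2))}.
  by apply: continuous_comp; [exact: enorm2_continuous|exact: trh1_cts].
apply: continuousD; last by apply: (@continuousM _ _ (fun=> 2 : R)) => //; exact: cst_continuous.
apply: (@continuousM _ _ (fun y : V => trh2 (enorm y ^+ 2))) => //.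
exact: (@continuousM _ _ (fun y : V => 2 * y 0 j)).
Qed.

Lemma W_flow (t : R) (x : V) : 0 < t ->
  W x = heatH t W x + duh 0 t (fun y _ => aW y + eW y) x.
Proof.
move=> t0; have [B1 [B2 [b1 b2]]] := W_bounds.
have [E _] := @heat_flow_duh R N t _ _ _ W (fun y => aW y + eW y) dW ddW x t0 bmeas_W b1 b2
  W_derive dW_derive (@W_cont x) (@lapW_cont x) lapW (fun y => addr_ge0 (aW_ge0 y) (eW_ge0 y)).
exact: E.
Qed.

Lemma bmeas_aeW : exists B, bmeas B (fun y => aW y + eW y).
Proof.
have [B1 [B2 [b1 b2]]] := W_bounds; have t0 : (0 : R) < 1 by [].
have [_ b] := @heat_flow_duh R N 1 _ _ _ W (fun y => aW y + eW y) dW ddW 0 t0 bmeas_W b1 b2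
  W_derive dW_derive (@W_cont 0) (@lapW_cont 0) lapW (fun y => addr_ge0 (aW_ge0 y) (eW_ge0 y)).
by eexists; exact: b.
Qed.

End Fixed.

End TruncatedData.

(** * Tangent-line extension of the nonlinearity *)

Section LinearExtension.
Variables (R : realType) (f : R -> R).
Local Notation f1 := (derive1 f).
Local Notation f2 := (derive1 (derive1 f)).
Hypothesis f0 : f 0 = 0.
Hypothesis fc : {within `[0, +oo[%classic, continuous f}.
Hypothesis fd0 : (f h - f 0) / h @[h --> 0^'+] --> 0.
Hypothesis fd : forall x, 0 < x -> derivable f x 1.
Hypothesis f1d : forall x, 0 < x -> derivable f1 x 1.
Hypothesis f12p : forall x, 0 < x -> 0 < f1 x /\ 0 < f2 x.

(** With the value 0 on negative arguments the extension is C^1 on the whole line, because f'(0) =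
    0; its derivative is bounded by f'(M), and by convexity it lies below [f] on nonnegative
    arguments. *)
Definition fM (M u : R) : R :=
  if u <= 0 then 0 else if u <= M then f u else f M + f1 M * (u - M).
Definition dfM (M u : R) : R := if u <= 0 then 0 else f1 (Num.min u M).

Variable M : R.
Hypothesis M0 : 0 < M.

Let is_derive_sides (k : R -> R) (t c : R) :
  h^-1 *: (k (h + t) - k t) @[h --> 0^'+] --> c -> h^-1 *: (k (h + t) - k t) @[h --> 0^'-] --> c ->
  is_derive t 1 k c.
Proof.
move=> hr hl; have C : h^-1 *: ((k \o shift t) (h *: 1) - k t) @[h --> 0^'] --> c.
  rewrite (_ : (fun h : R => _) = fun h => h^-1 *: (k (h + t) - k t)).
    move=> P Pc; have [e1 /= e10 H1] := hr P Pc; have [e2 /= e20 H2] := hl P Pc.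
    exists (Num.min e1 e2); first by rewrite /= lt_min e10.
    move=> h; rewrite /ball_ /= lt_min => /andP[h1 h2].
    by rewrite neq_lt => /orP[h0|h0]; [exact: H2|exact: H1].
  by apply/funext => h; rewrite /= [h *: 1]mulr1.
apply: DeriveDef; first by apply/cvg_ex; exists c.
by apply/cvg_lim.
Qed.

Let quot (k : R -> R) (t c : R) : is_derive t 1 k c ->
  (h^-1 *: (k (h + t) - k t) @[h --> 0^'+] --> c) /\ (h^-1 *: (k (h + t) - k t) @[h --> 0^'-] --> c).
Proof.
move=> [D <-]; have H : h^-1 *: ((k \o shift t) (h *: 1) - k t) @[h --> 0^'] --> 'D_1 k t by exact: D.
rewrite (_ : (fun h : R => h^-1 *: (k (h + t) - k t)) =
  (fun h => h^-1 *: ((k \o shift t) (h *: 1) - k t))); last first.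
  by apply/funext => h; rewrite /= [h *: 1]mulr1.
split=> P Pc; have [e /= e0 He] := H P Pc; exists e => // h hb h0; apply: He => //.
  by rewrite gt_eqF.
by rewrite lt_eqF.
Qed.

Lemma fM_derive (u : R) : is_derive u 1 (fM M) (dfM M u).
Proof.
have M0' := M0; rewrite /dfM.
have [u0|u0|u0] := ltgtP u 0.
- have [D E] := is_derive_cst (0 : R) u 1; apply: DeriveDef.
    apply: near_eq_derivable D; near=> z; rewrite /fM ifT// ltW//; near: z; exact: lt_nbhsl.
  rewrite -[RHS]E; apply: near_eq_derive; near=> z; rewrite /fM ifT// ltW//; near: z; exact: lt_nbhsl.
- have [uM|uM|uM] := ltgtP u M.
  + have [D E] := f_is_derive fd u0; apply: DeriveDef.
      apply: near_eq_derivable D; near=> z; rewrite /fM leNgt ifF; last by apply/negbTE/negPn; near: z; exact: lt_nbhsr.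
      by rewrite ifT// ltW//; near: z; exact: lt_nbhsl.
    rewrite -[RHS]E; apply: near_eq_derive; near=> z; rewrite /fM leNgt ifF; last by apply/negbTE/negPn; near: z; exact: lt_nbhsr.
    by rewrite ifT// ltW//; near: z; exact: lt_nbhsl.
  + have dl : is_derive u 1 (fun u => f M + f1 M * (u - M)) (f1 M).
      apply: (is_derive_ext (is_deriveD (is_derive_cst (f M) u 1) (is_deriveZ (f1 M)
        (is_deriveB (is_derive_id u 1) (is_derive_cst M u 1))))) => //.
      by rewrite /GRing.scale /=; ring.
    have [D E] := dl; apply: DeriveDef.
      apply: near_eq_derivable D; near=> z; rewrite /fM leNgt ifF; last by apply/negbTE/negPn; near: z; exact: lt_nbhsr.
      by rewrite leNgt ifF//; apply/negbTE/negPn; near: z; exact: lt_nbhsr.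
    rewrite -[RHS]E; apply: near_eq_derive; near=> z; rewrite /fM leNgt ifF; last by apply/negbTE/negPn; near: z; exact: lt_nbhsr.
    by rewrite leNgt ifF//; apply/negbTE/negPn; near: z; exact: lt_nbhsr.
  + rewrite uM; have fMM : fM M M = f M by rewrite /fM lexx leNgt M0'.
    apply: is_derive_sides.
      have dl : is_derive M 1 (fun u => f M + f1 M * (u - M)) (f1 M).
        apply: (is_derive_ext (is_deriveD (is_derive_cst (f M) M 1) (is_deriveZ (f1 M)
          (is_deriveB (is_derive_id M 1) (is_derive_cst M M 1))))) => //.
        by rewrite /GRing.scale /=; ring.
      have [+ _] := quot dl; apply: cvg_trans; apply: near_eq_cvg; near=> h.
      have h0 : 0 < h by near: h; exact: nbhs_right_gt.
      rewrite fMM subrr mulr0 addr0 /fM leNgt ifF; last by apply/negbTE/negPn; lra.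
      by rewrite leNgt ifF//; apply/negbTE/negPn; lra.
    have [_ +] := quot (f_is_derive fd M0'); apply: cvg_trans; apply: near_eq_cvg; near=> h.
    have h0 : h < 0 by near: h; exact: nbhs_left_lt.
    have hM : - M < h by near: h; apply: nbhs_left_gt; lra.
    rewrite fMM /fM leNgt ifF; last by apply/negbTE/negPn; lra.
    by rewrite ifT//; lra.
- rewrite u0; have fM0 : fM M 0 = 0 by rewrite /fM lexx.
  apply: is_derive_sides.
    have := fd0; apply: cvg_trans; apply: near_eq_cvg; near=> h.
    have h0 : 0 < h by near: h; exact: nbhs_right_gt.
    have hM : h < M by near: h; exact: nbhs_right_lt.
    rewrite fM0 addr0 /fM leNgt h0 /= (ltW hM) f0 !subr0 /GRing.scale /= mulrC //.
  apply: cvg_near_cst; near=> h.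
  have h0 : h < 0 by near: h; exact: nbhs_left_lt.
  by rewrite fM0 addr0 /fM (ltW h0) subrr scaler0.
Unshelve. all: by end_near.
Qed.

Lemma dfM_ge0 u : 0 <= dfM M u.
Proof.
rewrite /dfM; case: (leP u 0) => // u0.
have m : 0 < Num.min u M by rewrite lt_min u0; exact: M0.
by have [/ltW] := f12p m.
Qed.

Lemma dfM_le u : dfM M u <= f1 M.
Proof.
rewrite /dfM; case: (leP u 0) => u0; first by have [/ltW] := f12p M0.
apply: (f1_mono f1d f12p); first by rewrite lt_min u0; exact: M0.
by rewrite ge_min lexx orbT.
Qed.

Lemma dfM_bound u : `|dfM M u| <= f1 M.
Proof. by rewrite ger0_norm ?dfM_ge0// dfM_le. Qed.

Lemma dfM_mono u v : u <= v -> dfM M u <= dfM M v.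
Proof.
move=> uv; rewrite /dfM; case: (leP u 0) => u0.
  by have := dfM_ge0 v; rewrite /dfM.
rewrite ifF; last by apply/negbTE; rewrite -ltNge (lt_le_trans u0 uv).
apply: (f1_mono f1d f12p); first by rewrite lt_min u0; exact: M0.
by rewrite le_min !ge_min uv lexx orbT.
Qed.

Lemma measurable_dfM : measurable_fun setT (dfM M).
Proof.
by apply: nondecreasing_measurable => // u v; exact: dfM_mono.
Qed.

Lemma fM_cont : continuous (fM M).
Proof. by move=> u; have [D _] := fM_derive u; exact: (derivable_continuous D). Qed.

Lemma measurable_fM : measurable_fun setT (fM M).
Proof. by apply: continuous_measurable_fun; exact: fM_cont. Qed.

Lemma fM_mono u v : u <= v -> fM M u <= fM M v.
Proof.
move=> uv; apply: (nondecreasing_is_derive (dF := dfM M) uv) => x _; first exact: fM_derive.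
exact: dfM_ge0.
Qed.

Lemma fM_ge0 u : 0 <= fM M u.
Proof.
have [u0|u0] := leP u 0; first by rewrite /fM u0.
by apply: le_trans (fM_mono (ltW u0)); rewrite /fM lexx.
Qed.

Lemma fM_le u : 0 <= u -> fM M u <= f u.
Proof.
move=> u0; rewrite /fM; case: (leP u 0) => u0'; first exact: (f_ge0 f0 fc fd f12p).
case: (leP u M) => // Mu; exact: (f_tangent_le fd f1d f12p M0 (ltW Mu)).
Qed.

Lemma fM_lip u : 0 <= u -> fM M u <= f1 M * u.
Proof.
have := lip_of_derive 0 u fM_derive dfM_bound; rewrite {2}/fM lexx !subr0 => h u0.
by move: h; rewrite !ger0_norm// fM_ge0.
Qed.

Lemma fM_eq u : 0 <= u -> u <= M -> fM M u = f u.
Proof.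
move=> u0 uM; rewrite /fM uM; case: (leP u 0) => // u0'.
by have -> : u = 0 by apply/eqP; rewrite eq_le u0 u0'.
Qed.

Lemma fM_monoM M' u : M <= M' -> fM M u <= fM M' u.
Proof.
have M0' := M0; move=> MM; rewrite /fM; case: (leP u 0) => // u0.
case: (leP u M) => uM; first by rewrite (le_trans uM MM).
case: (leP u M') => uM'; first exact: (f_tangent_le fd f1d f12p M0 (ltW uM)).
have h1 := f_tangent_le fd f1d f12p M0 MM.
have h2 : f1 M * (u - M') <= f1 M' * (u - M').
  by apply: ler_wpM2r; [lra|exact: (f1_mono f1d f12p)].
have -> : f M + f1 M * (u - M) = f M + f1 M * (M' - M) + f1 M * (u - M') by ring.
lra.
Qed.

End LinearExtension.

(** * Coordinate hyperplanes are null sets *)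

Section NullSets.
Variable R : realType.
Local Notation leb := (@lebesgue_measure R).

Lemma measurable_hyperplane n (i : 'I_n) (c : R) : measurable [set x : 'rV[R]_n | x 0 i = c].
Proof.
have := @measurable_coord R n i measurableT _ (measurable_set1 c).
by rewrite setTI.
Qed.

Lemma lebn_hyperplane n (i : 'I_n) (c : R) : lebn R n [set x : 'rV[R]_n | x 0 i = c] = 0%E.
Proof.
have mi := measurable_hyperplane i c.
have -> : lebn R n [set x : 'rV[R]_n | x 0 i = c] =
    (\int[lebn R n]_x (\1_[set x : 'rV[R]_n | x 0 i = c] x)%:E)%E.
  by rewrite integral_indic// setIT.
pose h (j : 'I_n) (s : R) : R := if j == i then \1_[set c] s else 1.
transitivity (\int[lebn R n]_x (\prod_j h j (x 0 j))%:E)%E.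
  apply: eq_integral => x _; congr (_%:E); rewrite (bigD1 i)//= big1 ?mulr1; last first.
    by move=> j ji; rewrite /h (negbTE ji).
  by rewrite /h eqxx !indicE; congr (_%:R); apply: asbool_equiv_eq.
rewrite integral_prodv.
- rewrite (bigD1 i)//= (_ : (\int[leb]_s (h i s)%:E)%E = 0%E) ?mul0e//.
  under eq_integral do rewrite /h eqxx.
  by rewrite integral_indic// setIT; exact: lebesgue_measure_set1.
- by move=> j; rewrite /h; case: (j == i); [exact: measurable_indic|exact: measurable_cst].
- by move=> j s; rewrite /h; case: (j == i) => //; rewrite indicE.
Qed.

(** The origin lies in the null hyperplane where the first coordinate vanishes. Heat integrals thus
    do not depend on the value chosen at the singularity. *)
Lemma heatE_eq_off0 n (t : R) (w1 w2 : 'rV[R]_n -> \bar R) (x : 'rV[R]_n) : (0 < n)%N ->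
  measurable_fun setT w1 -> measurable_fun setT w2 -> (forall y, y != 0 -> w1 y = w2 y) ->
  heatE t w1 x = heatE t w2 x.
Proof.
move=> n0 m1 m2 E; apply: ae_eq_integral => //.
- exact: measurable_heat_integrand.
- exact: measurable_heat_integrand.
- exists [set y : 'rV[R]_n | y 0 (Ordinal n0) = 0]; split.
  + exact: measurable_hyperplane.
  + exact: lebn_hyperplane.
  + move=> y /= H; apply: contra_notP H => y0 _; congr (_ * _)%E; apply: E.
    by apply/eqP => y00; apply: y0; rewrite y00 mxE.
Qed.

End NullSets.

Lemma le_of_EFin (R : realType) (a b : R) (A B : \bar R) :
  a%:E = A -> b%:E = B -> (A <= B)%E -> a <= b.
Proof. by move=> <- <-; rewrite lee_fin. Qed.

Lemma cvg_sum3 (R : realType) (w a b c : nat -> R) (la lb lc : R) :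
  (forall k, w k = a k + (b k + c k)) -> a k @[k --> \oo] --> la -> b k @[k --> \oo] --> lb ->
  c k @[k --> \oo] --> lc -> w k @[k --> \oo] --> la + (lb + lc).
Proof. by move=> E ca cb cc; under eq_fun do rewrite E; exact: (cvgD ca (cvgD cb cc)). Qed.

(** * The singular solution satisfies the integral equation *)

Section StarSolution.
Variables (R : realType) (N : nat) (f : R -> R) (q U0 : R) (p p1 p2 : R -> R).
Local Notation V := 'rV[R]_N.
Local Notation f1 := (derive1 f).
Local Notation f2 := (derive1 (derive1 f)).
Hypothesis f0 : f 0 = 0.
Hypothesis fc : {within `[0, +oo[%classic, continuous f}.
Hypothesis fd0 : (f h - f 0) / h @[h --> 0^'+] --> 0.
Hypothesis fd : forall x, 0 < x -> derivable f x 1.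
Hypothesis f1d : forall x, 0 < x -> derivable f1 x 1.
Hypothesis f12p : forall x, 0 < x -> 0 < f1 x /\ 0 < f2 x.
Hypothesis Hp : profile N f q U0 p p1 p2.
Hypothesis N0 : (0 < N)%N.

Local Notation usp := (@us R N p).

Lemma nat1_gt0 k : 0 < k.+1%:R :> R.
Proof. by rewrite ltr0n. Qed.

Let squeeze0 (a : nat -> R) (l c : R) : 0 <= c -> (forall k, l - c / k.+1%:R <= a k <= l) ->
  a k @[k --> \oo] --> l.
Proof.
move=> c0 H; apply: (@squeeze_cvgr _ _ _ _ (fun k => l - c * k.+1%:R^-1) (fun=> l)).
- by near=> k; exact: H.
- rewrite -[X in _ --> X]subr0; apply: cvgB; first exact: cvg_cst.
  by rewrite -(mulr0 c); apply: cvgM; [exact: cvg_cst|exact: cvg_harmonic].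
- exact: cvg_cst.
Unshelve. all: by end_near.
Qed.

Lemma tr_cvg (u : R) : 0 <= u -> tr k.+1%:R u @[k --> \oo] --> u.
Proof.
move=> u0; apply: (@squeeze0 _ _ (u ^+ 2)); first exact: sqr_ge0.
move=> k; have [_ _ h1 h2 _] := tr_props (nat1_gt0 k) u0.
move: h2; set e := u ^+ 2 / _ => h2; by apply/andP; split; lra.
Qed.

Lemma tr1_cvg (u : R) : 0 <= u -> tr1 k.+1%:R u @[k --> \oo] --> (1 : R).
Proof.
move=> u0; apply: (@squeeze0 _ _ (2 * u)); first by lra.
move=> k; have [_ _ _ _ [_ -> _]] := tr_props (nat1_gt0 k) u0; rewrite andbT.
rewrite /tr1; set y := 1 - u / _.
have -> : 2 * u / k.+1%:R = 2 * (1 - y) by rewrite /y; ring.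
have [y0|y0] := leP 0 y; last by rewrite expr0n /=; lra.
by have := sqr_ge0 (1 - y); rewrite !expr2; lra.
Qed.

Lemma us_le (x : V) r : 0 < r -> r <= enorm x ^+ 2 -> usp x <= p r.
Proof.
move=> r0 rx; rewrite /us; case: ifP => x0; first exact/ltW/(pr_gt0 Hp).
exact: (prof_anti Hp).
Qed.

Lemma measurable_us : measurable_fun setT usp.
Proof.
pose g (k : nat) (x : V) : R := if 0 < enorm x ^+ 2 then @W R N p k.+1%:R x else 0.
apply: (@measurable_fun_cvg _ _ _ setT g).
  move=> k; apply: measurable_fun_ifT => //.
    apply: measurable_fun_ltr => //; apply: measurable_funX; exact: measurable_enorm.
  by have [] := bmeas_W Hp (nat1_gt0 k).
move=> x _; rewrite /g /us; case: ifPn => [/eqP ->|x0].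
  rewrite (_ : enorm (0 : V) = 0); last by apply/eqP; rewrite enorm_eq0.
  by rewrite expr0n ltxx; exact: cvg_cst.
rewrite (enorm2_gt0 x0) /W /trh (enorm2_gt0 x0).
by apply: tr_cvg; exact/ltW/(pr_gt0 Hp)/enorm2_gt0.
Qed.

Lemma fM_cvg (u : R) : 0 <= u -> fM f k.+1%:R u @[k --> \oo] --> f u.
Proof.
move=> u0; apply: cvg_near_cst; near=> k; apply: fM_eq => //.
by apply: ltW; rewrite -truncn_le_nat; near: k; exact: nbhs_infty_ge.
Unshelve. all: by end_near.
Qed.

(** Nothing is known of [f] on negative arguments; on nonnegative functions it is the pointwise
    limit of the continuous [fM]. *)
Lemma measurable_f_comp d (T : measurableType d) (g : T -> R) : measurable_fun setT g ->
  (forall x, 0 <= g x) -> measurable_fun setT (fun x => f (g x)).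
Proof.
move=> mg g0; apply: (@measurable_fun_cvg _ _ _ setT (fun k x => fM f k.+1%:R (g x))).
  move=> k; apply: (measurableT_comp (f := fM f k.+1%:R)) => //.
  exact: (measurable_fM f0 fd0 fd (nat1_gt0 k)).
by move=> x _; exact: fM_cvg.
Qed.

Let usp0 x : 0 <= usp x := us_ge0 Hp x.
Let mus := measurable_us.
Let mfus : measurable_fun setT (fun x => f (usp x)) := measurable_f_comp mus usp0.

Lemma W_cvg (x : V) : x != 0 -> @W R N p k.+1%:R x @[k --> \oo] --> usp x.
Proof. by move=> x0; under eq_fun do rewrite W_us//; exact: tr_cvg. Qed.

Lemma W_nd (x : V) : nondecreasing_seq (fun k => @W R N p k.+1%:R x).
Proof.
move=> j k jk; have jk' : j.+1%:R <= k.+1%:R :> R by rewrite ler_nat ltnS.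
rewrite /W /trh; case: ifPn => [r0|_]; last by lra.
by have [] := tr_mono (nat1_gt0 j) (ltW (pr_gt0 Hp r0)) jk'.
Qed.

(** At the origin the truncations equal m / 3 and grow without bound, whereas [us] is 0 there;
    resetting them to 0 at that point ([Wz]) restores monotone convergence everywhere. *)
Lemma heatE_W_cvg (t : R) (x : V) :
  heatE t (EFin \o @W R N p k.+1%:R) x @[k --> \oo] --> heatE t (EFin \o usp) x.
Proof.
pose Wz k (y : V) : R := if y == 0 then 0 else @W R N p k.+1%:R y.
have mW k : measurable_fun setT (@W R N p k.+1%:R) by have [] := bmeas_W Hp (nat1_gt0 k).
have mWz k : measurable_fun setT (Wz k).
  have -> : Wz k = fun y => if 0 < enorm y ^+ 2 then @W R N p k.+1%:R y else 0.
    apply/funext => y; rewrite /Wz; case: ifPn => [/eqP ->|y0]; last by rewrite enorm2_gt0.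
    rewrite (_ : enorm (0 : V) = 0); last by apply/eqP; rewrite enorm_eq0.
    by rewrite expr0n ltxx.
  apply: measurable_fun_ifT => //.
  by apply: measurable_fun_ltr => //; apply: measurable_funX; exact: measurable_enorm.
have zE k : heatE t (EFin \o @W R N p k.+1%:R) x = heatE t (EFin \o Wz k) x.
  apply: heatE_eq_off0 => //.
  - exact/measurable_EFinP.
  - exact/measurable_EFinP.
  - by move=> y y0 /=; rewrite /Wz (negbTE y0).
under eq_fun do rewrite zE.
apply: heatE_cvg => //.
- by move=> k; exact/measurable_EFinP.
- by move=> k y; rewrite lee_fin /Wz; case: ifP => // _; exact: (W_ge0 Hp (nat1_gt0 k)).
- by move=> y j k jk; rewrite lee_fin /Wz; case: ifP => // _; exact: W_nd.
- move=> y; apply/cvg_EFin; first by near=> k.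
  have [->|y0] := eqVneq y 0.
    by rewrite /us eqxx; apply: cvg_near_cst; near=> k; rewrite /= /Wz eqxx.
  rewrite (_ : fine \o _ = fun k => @W R N p k.+1%:R y); first exact: W_cvg.
  by apply/funext => k /=; rewrite /Wz (negbTE y0).
Unshelve. all: by end_near.
Qed.

(** For x <> 0 the terms [be], [al] and [et] of the formula for W are nonnegative with sum at most
    [us p x]. The monotone limits of [be] and [al] are therefore finite, the difference of [al] at
    levels 2m and m tends to 0, and with it [et]. Finiteness of the integrals for [ustar] is a
    by-product. *)
Lemma us_solution (t : R) (x : V) : 0 < t -> x != 0 ->
  ((usp x)%:E = heatE t (EFin \o usp) x + duhE 0 t (fun y _ => (f (usp y))%:E) x)%E.
Proof.
move=> t0 x0.
pose al k := duh 0 t (fun y _ => @aW R N f p k.+1%:R y) x.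
pose et k := duh 0 t (fun y _ => @eW R N p p1 k.+1%:R y) x.
pose be k := heatH t (@W R N p k.+1%:R) x.
have fus y : 0 <= f (usp y) by apply: (f_ge0 f0 fc fd f12p).
have tr1_m k : measurable_fun setT (fun y => tr1 k.+1%:R (usp y)).
  apply: (measurableT_comp (f := tr1 k.+1%:R)) => //.
  apply: continuous_measurable_fun => u.
  by have [D _] := tr1_derive u (nat1_gt0 k); exact: (derivable_continuous D).
have ma k : measurable_fun setT (@aW R N f p k.+1%:R) by apply: measurable_funM.
have a0 k y : 0 <= @aW R N f p k.+1%:R y by exact: (aW_ge0 f0 fc fd f12p Hp).
have e0 k y : 0 <= @eW R N p p1 k.+1%:R y by exact: (eW_ge0 Hp (nat1_gt0 k)).
have me k : measurable_fun setT (@eW R N p p1 k.+1%:R).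
  have [B [mb _]] := bmeas_aeW f0 fc fd f12p Hp (nat1_gt0 k).
  have := measurable_funB mb (ma k); rewrite (_ : _ \- _ = @eW R N p p1 k.+1%:R)//.
  by apply/funext => y /=; rewrite addrC addKr.
have ba k : exists B, bmeas B (@aW R N f p k.+1%:R) /\ bmeas B (@eW R N p p1 k.+1%:R).
  have [B [mb b]] := bmeas_aeW f0 fc fd f12p Hp (nat1_gt0 k); exists B; split; split => // y.
    have := b y; have := a0 k y; have := e0 k y; rewrite !ger0_norm ?addr_ge0//; lra.
  have := b y; have := a0 k y; have := e0 k y; rewrite !ger0_norm ?addr_ge0//; lra.
have src (g : V -> R) B : bmeas B g -> bsrc 0 t B (fun y _ => g y).
  move=> [mg gB]; split; last by move=> s y _; exact: gB.
  exact: (measurableT_comp (f := g)).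
have jm (g : V -> R) : measurable_fun setT g -> measurable_fun setT (fun z : V * R => (g z.1)%:E).
  by move=> mg; apply/measurable_EFinP; exact: (measurableT_comp (f := g)).
have alE k : (al k)%:E = duhE 0 t (fun y _ => (@aW R N f p k.+1%:R y)%:E) x.
  by have [B [b1 _]] := ba k; exact: (duh_duhE x (src _ _ b1)).
have etE k : (et k)%:E = duhE 0 t (fun y _ => (@eW R N p p1 k.+1%:R y)%:E) x.
  by have [B [_ b1]] := ba k; exact: (duh_duhE x (src _ _ b1)).
have beE k : (be k)%:E = heatE t (EFin \o @W R N p k.+1%:R) x.
  exact: (heatH_heatE x t0 (bmeas_W Hp (nat1_gt0 k))).
have al0 k : 0 <= al k by rewrite -lee_fin alE; apply: duhE_ge0 => y s; rewrite lee_fin.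
have et0 k : 0 <= et k by rewrite -lee_fin etE; apply: duhE_ge0 => y s; rewrite lee_fin.
have be0 k : 0 <= be k.
  rewrite -lee_fin beE; apply: heatE_ge0 => y; rewrite lee_fin.
  exact: (W_ge0 Hp (nat1_gt0 k)).
have WE k : @W R N p k.+1%:R x = be k + (al k + et k).
  rewrite {1}(W_flow f0 fc fd f12p Hp (nat1_gt0 k) x t0); congr (_ + _).
  have [B b] := bmeas_aeW f0 fc fd f12p Hp (nat1_gt0 k).
  apply: EFin_inj; rewrite (duh_duhE x (src _ _ b)) EFinD alE etE -duhED//.
  - exact: jm.
  - exact: jm.
  - by move=> y s; rewrite lee_fin.
  - by move=> y s; rewrite lee_fin.
(* [e_m <= 2C/m + 8C (a_2m - a_m)] because [|grad u|^2 <= C (1 + u f(u))] *)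
have [C C0 HC] := pr_grad Hp.
have key k : et k + 8 * C * al k <= 2 * C * t / k.+1%:R + 8 * C * al k.*2.+1.
  have C8 : 0 <= 8 * C by rewrite mulr_ge0.
  have [B [b1 b2]] := ba k; have [B' [b3 _]] := ba k.*2.+1.
  have kk0 := nat1_gt0 k.
  have ck0 : 0 <= 2 * C / k.+1%:R by rewrite divr_ge0// ?mulr_ge0// ltW.
  (* Index k stands for level k + 1, so the level 2 (k + 1) has index [k.*2.+1]. *)
  have pt y : @eW R N p p1 k.+1%:R y + 8 * C * @aW R N f p k.+1%:R y <=
      8 * C * @aW R N f p k.*2.+2%:R y + 2 * C / k.+1%:R.
    have h1 := tr2_bound (nat1_gt0 k) (usp0 y).
    have [_ _ _ _ [_ _ h2]] := tr_props (nat1_gt0 k) (usp0 y).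
    have h3 : - tr2 k.+1%:R (usp y) <= 2 / k.+1%:R.
      rewrite /tr2 mulNr opprK ger_pMr ?divr_gt0// ge_max ler01 /=.
      have : 0 <= usp y / k.+1%:R by rewrite divr_ge0// ltW.
      by set e := usp y / _; lra.
    have E2 : k.*2.+2%:R = 2 * k.+1%:R :> R by rewrite -natrM mul2n doubleS.
    rewrite /eW /aW E2; case: ifPn => [_|y0].
      rewrite add0r; have := a0 k.*2.+1 y; rewrite /aW E2 => h4.
      have : tr1 k.+1%:R (usp y) * f (usp y) <= tr1 (2 * k.+1%:R) (usp y) * f (usp y).
        apply: ler_wpM2r => //; have [|_] := tr_mono kk0 (usp0 y) (_ : k.+1%:R <= 2 * k.+1%:R) => //.
        by lra.
      move=> /(ler_wpM2l C8) h5; move: ck0; set e := 2 * C / k.+1%:R; lra.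
    have r0 := enorm2_gt0 y0; have := HC _ r0.
    have usE : usp y = p (enorm y ^+ 2) by rewrite /us (negbTE y0).
    rewrite -usE; set G := 4 * _ * _; set T := tr2 _ _ in h1 h2 h3 *; set F := f (usp y).
    move=> hG; have F0 : 0 <= F by exact: fus.
    have k1 : - T * G <= - T * (C * (1 + usp y * F)) by apply: ler_wpM2l => //; rewrite oppr_ge0.
    have k2 : (- T * usp y) * (C * F) <= 8 * (tr1 (2 * k.+1%:R) (usp y) - tr1 k.+1%:R (usp y)) * (C * F).
      by apply: ler_wpM2r => //; exact: mulr_ge0.
    have k3 : - T * C <= 2 / k.+1%:R * C by exact: ler_wpM2r.
    have -> : 2 * C / k.+1%:R = 2 / k.+1%:R * C by ring.
    move: k1 k2 k3; set i := 2 / _; set A1 := tr1 _ _; set A2 := tr1 _ _; nra.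
  have c8 (g : V -> R) B0 : bmeas B0 g -> bmeas (8 * C * B0) (fun y => 8 * C * g y).
    move=> [mg gB]; split; first exact: measurable_funM.
    by move=> y; rewrite normrM (ger0_norm C8); exact: ler_wpM2l.
  have lin (g : V -> R) B0 : bmeas B0 g ->
      duh 0 t (fun y _ => 8 * C * g y) x = 8 * C * duh 0 t (fun y _ => g y) x.
    move=> bg; rewrite /duh -RintegralZl//; last exact: (integrable_duh x (src _ _ bg)).
    apply: eq_Rintegral => s /set_mem/=; rewrite in_itv/= => /andP[s0 st].
    have ts : 0 < t - s by lra.
    rewrite /heatH -RintegralZl//; last exact: (integrable_heatH x ts bg).
    by apply: eq_Rintegral => y _; rewrite mulrCA.
  have s1 := src _ _ (bmeasD b2 (c8 _ _ b1)).
  have L1 : duh 0 t (fun y _ => @eW R N p p1 k.+1%:R y + 8 * C * @aW R N f p k.+1%:R y) x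
      = et k + 8 * C * al k.
    apply: EFin_inj; rewrite (duh_duhE x s1) EFinD etE -(lin _ _ b1) (duh_duhE x (src _ _ (c8 _ _ b1))).
    rewrite -duhED//.
    - exact: jm.
    - by apply: (jm (fun y => 8 * C * @aW R N f p k.+1%:R y)); case: (c8 _ _ b1).
    - by move=> y s; rewrite lee_fin.
    - by move=> y s; rewrite lee_fin mulr_ge0.
  have s2 := src _ _ (c8 _ _ b3).
  have t00 : 0 <= t by exact: ltW.
  have L2 : duh 0 t (fun y _ => 8 * C * @aW R N f p k.*2.+2%:R y + 2 * C / k.+1%:R) x
      = 2 * C * t / k.+1%:R + 8 * C * al k.*2.+1.
    rewrite (duh_addc _ x t00 s2) (lin _ _ b3) subr0 -/(al _); ring.
  rewrite -[X in X <= _]L1 -[X in _ <= X]L2.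
  have s3 : bsrc 0 t (8 * C * B' + `|2 * C / k.+1%:R|)
      (fun y _ => 8 * C * @aW R N f p k.*2.+2%:R y + 2 * C / k.+1%:R).
    exact: (src _ _ (bmeasD (c8 _ _ b3) (bmeas_cst N _))).
  apply: (le_of_EFin (duh_duhE x s1) (duh_duhE x s3)); apply: duhE_le.
  - by apply/measurable_EFinP; case: s1.
  - by apply/measurable_EFinP; case: s3.
  - by move=> y s; rewrite lee_fin addr_ge0// mulr_ge0.
  - by move=> y s _; rewrite lee_fin.
  - by move=> y s; rewrite lee_fin addr_ge0// mulr_ge0.
have cb : (be k)%:E @[k --> \oo] --> heatE t (EFin \o usp) x.
  by under eq_fun do rewrite beE; exact: heatE_W_cvg.
have ca : (al k)%:E @[k --> \oo] --> duhE 0 t (fun y _ => (f (usp y))%:E) x.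
  under eq_fun do rewrite alE.
  apply: duhE_cvg.
  - by move=> k; exact: jm.
  - by move=> k y s; rewrite lee_fin.
  - move=> y s j k jk; rewrite lee_fin /aW; apply: ler_wpM2r => //.
    have jk' : j.+1%:R <= k.+1%:R :> R by rewrite ler_nat ltnS.
    by have [] := tr_mono (nat1_gt0 j) (usp0 y) jk'.
  - move=> y s _; apply/cvg_EFin; first by near=> k.
    rewrite (_ : fine \o _ = fun k => tr1 k.+1%:R (usp y) * f (usp y))//.
    by rewrite -[X in _ --> X]mul1r; apply: cvgM; [exact: tr1_cvg|exact: cvg_cst].
have Wle k : @W R N p k.+1%:R x <= usp x.
  by rewrite W_us//; have [] := tr_props (nat1_gt0 k) (usp0 x).
(* The bound by the finite number [usp x] turns convergence in the extended reals into convergence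
   in the reals. *)
have ub (g : nat -> R) (L : \bar R) : (g k)%:E @[k --> \oo] --> L -> (forall k, 0 <= g k <= usp x) ->
    exists2 l : R, L = l%:E & g k @[k --> \oo] --> l.
  move=> cg hg.
  have L0 : (0 <= L)%E.
    rewrite -(cvg_lim _ cg)//; apply: lime_ge; first by apply/cvg_ex; exists L.
    by near=> k; rewrite lee_fin; case/andP: (hg k).
  have L1 : (L <= (usp x)%:E)%E.
    rewrite -(cvg_lim _ cg)//; apply: lime_le; first by apply/cvg_ex; exists L.
    by near=> k; rewrite lee_fin; case/andP: (hg k).
  case: L cg L0 L1 => [l| |] // cg _ _; exists l => //.
  exact: (fine_cvg cg).
have [b -> cb'] : exists2 l : R, heatE t (EFin \o usp) x = l%:E & be k @[k --> \oo] --> l.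
  apply: ub cb _ => k; have := Wle k; rewrite WE.
  by have := al0 k; have := et0 k; have := be0 k => *; apply/andP; split; lra.
have [l -> ca'] : exists2 l : R, duhE 0 t (fun y _ => (f (usp y))%:E) x = l%:E & al k @[k --> \oo] --> l.
  apply: ub ca _ => k; have := Wle k; rewrite WE.
  by have := al0 k; have := et0 k; have := be0 k => *; apply/andP; split; lra.
have c2 : al k.*2.+1 @[k --> \oo] --> l.
  apply: (cvg_comp (fun k : nat => k.*2.+1) al _ ca') => P [n _ H]; exists n => // k /= nk.
  by apply: H; rewrite /= (leq_trans nk)// -addnn -addSn leq_addl.
have ce : et k @[k --> \oo] --> (0 : R).
  apply: (@squeeze_cvgr _ _ _ _ (fun=> 0) (fun k => 2 * C * t * k.+1%:R^-1 + 8 * C * (al k.*2.+1 - al k))).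
  - near=> k; rewrite et0 /= mulrBr addrA lerBrDr; exact: key.
  - exact: cvg_cst.
  - rewrite (_ : 0 = 2 * C * t * 0 + 8 * C * (l - l)); last by rewrite subrr !mulr0 addr0.
    apply: cvgD; apply: cvgM; try exact: cvg_cst; first exact: cvg_harmonic.
    exact: (cvgB c2 ca').
have cW : @W R N p k.+1%:R x @[k --> \oo] --> b + (l + 0).
  exact: (cvg_sum3 WE cb' ca' ce).
rewrite -EFinD; congr (_%:E).
have -> : b + l = b + (l + 0) by rewrite addr0.
exact: (cvg_unique _ (W_cvg x0) cW).
Unshelve. all: by end_near.
Qed.

End StarSolution.

(** * Picard iterates and the approximating solutions *)

Section Approximation.
Variables (R : realType) (N : nat) (f : R -> R) (q U0 : R) (p p1 p2 : R -> R).
Local Notation V := 'rV[R]_N.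
Local Notation leb := (@lebesgue_measure R).
Local Notation f1 := (derive1 f).
Local Notation f2 := (derive1 (derive1 f)).
Hypothesis f0 : f 0 = 0.
Hypothesis fc : {within `[0, +oo[%classic, continuous f}.
Hypothesis fd0 : (f h - f 0) / h @[h --> 0^'+] --> 0.
Hypothesis fd : forall x, 0 < x -> derivable f x 1.
Hypothesis f1d : forall x, 0 < x -> derivable f1 x 1.
Hypothesis f12p : forall x, 0 < x -> 0 < f1 x /\ 0 < f2 x.
Hypothesis Hp : profile N f q U0 p p1 p2.
Hypothesis N0 : (0 < N)%N.

Local Notation usp := (@us R N p).

(* Picard iterates for the data [W p m] and the nonlinearity [fM f m];
   for [t <= 0] they are frozen at the data *)
Fixpoint itr (m : R) (j : nat) (x : V) (t : R) : R :=
  if j is j'.+1 then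
    if 0 < t then
      fine (heatE t (EFin \o @W R N p m) x + duhE 0 t (fun y s => (fM f m (itr m j' y s))%:E) x)%E
    else @W R N p m x
  else 0.

Lemma itr0 m x t : itr m 0 x t = 0. Proof. by []. Qed.

Lemma itrS m j x t : itr m j.+1 x t = if 0 < t then
    fine (heatE t (EFin \o @W R N p m) x + duhE 0 t (fun y s => (fM f m (itr m j y s))%:E) x)%E
  else @W R N p m x.
Proof. by []. Qed.

Opaque itr.

Definition appr (m : R) (x : V) (t : R) : R := lim (itr m j x t @[j --> \oo]).

Section FixedLevel.
Variable m : R.
Hypothesis m0 : 0 < m.

Local Notation Wm := (@W R N p m).
Let L := f1 m.
Let B0 := m / 3.
Let bd (t : R) := B0 * expR (L * Num.max 0 t).

Let L0 : 0 < L. Proof. by have [] := f12p m0. Qed.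
Let B00 : 0 <= B0. Proof. by rewrite /B0 divr_ge0// ltW. Qed.
Let bWm : bmeas B0 Wm := bmeas_W Hp m0.
Let Wm0 x : 0 <= Wm x := W_ge0 Hp m0 x.

Let bd_mono s t : s <= t -> bd s <= bd t.
Proof.
move=> st; apply: ler_wpM2l => //; rewrite ler_expR; apply: ler_wpM2l; first exact: ltW.
by rewrite ge_max !le_max lexx st orbT.
Qed.

Let bd_B0 t : B0 <= bd t.
Proof.
rewrite /bd -[leLHS]mulr1; apply: ler_wpM2l => //; rewrite -expR0 ler_expR.
by apply: mulr_ge0; [exact: ltW|rewrite le_max lexx].
Qed.

Let heat_cst_E (t c : R) (x : V) : 0 < t -> heatE t (fun=> c%:E) x = c%:E.
Proof. by move=> t0; rewrite -[LHS](heatH_heatE x t0 (bmeas_cst N c)) heatH_cst. Qed.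

Let duhE_bound (t : R) (h : V -> R -> R) (x : V) : 0 < t -> jmeas h ->
  (forall y s, 0 <= h y s) -> (forall y s, 0 < s < t -> h y s <= L * bd s) ->
  (duhE 0 t (fun y s => (h y s)%:E) x <= (bd t - B0)%:E)%E.
Proof.
move=> t0 mh h0 hb.
have L0' := L0; have B00' := B00.
apply: (@le_trans _ _ (\int[leb]_(s in `]0%R, t[) (L * (B0 * expR (L * s)))%:E)%E).
  have mL : measurable_fun setT (fun s : R => L * (B0 * expR (L * s))).
    apply: measurable_funM => //; apply: measurable_funM => //.
    by apply: measurableT_comp => //; exact: measurable_funM.
  apply: ge0_le_integral => //.
  - by move=> s _; apply: heatE_ge0 => y; rewrite lee_fin.
  - apply: measurable_funTS; apply: measurable_duhE_integrand; last by move=> y s; rewrite lee_fin.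
    exact/measurable_EFinP.
  - by apply: measurable_funTS; exact/measurable_EFinP.
  - move=> s /=; rewrite in_itv/= => st; case/andP: (st) => s0 s1.
    have ts : 0 < t - s by lra.
    rewrite -(heat_cst_E _ x ts); apply: heatE_le => //.
    + by apply/measurable_EFinP; exact: jmeas_sec.
    + by move=> y; rewrite lee_fin.
    + by move=> y; rewrite lee_fin; have := hb y s st; rewrite /bd max_r// ltW.
apply: (@ge0_integral_itvoo_le R _ (fun s => B0 * expR (L * s))).
- by move=> s _; rewrite !mulr_ge0 ?expR_ge0// ltW.
- move=> s _; have d1 : is_derive s 1 (fun s : R => L * s) L.
    by apply: (is_derive_ext (is_deriveZ L (is_derive_id s 1))) => //; rewrite /GRing.scale /= mulr1.
  have d2 := @is_derive1_comp R expR (fun s : R => L * s) s _ _ (is_derive_expR _) d1.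
  by apply: (is_derive_ext (is_deriveZ B0 d2)) => //; rewrite /GRing.scale /=; ring.
- move=> s _; have d1 : is_derive s 1 (fun s : R => L * s) L.
    by apply: (is_derive_ext (is_deriveZ L (is_derive_id s 1))) => //; rewrite /GRing.scale /= mulr1.
  have d2 := @is_derive1_comp R expR (fun s : R => L * s) s _ _ (is_derive_expR _) d1.
  have [D _] := is_derive_ext (is_deriveZ L (is_deriveZ B0 d2))
    (fun s => erefl (L * (B0 * expR (L * s)))) erefl.
  exact: (derivable_continuous D).
- move=> x' y' x0 xy yt; apply: lerB.
    apply: (@le_trans _ _ (bd y')); last exact/bd_mono/ltW.
    by rewrite /bd max_r//; lra.
  rewrite -[leLHS]mulr1; apply: ler_wpM2l => //; rewrite -expR0 ler_expR mulr_ge0//; lra.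
- by rewrite subr_ge0.
Qed.

Let phi0 u : 0 <= fM f m u := fM_ge0 f0 fd0 fd f12p m0 u.
Let mphi : measurable_fun setT (fM f m) := measurable_fM f0 fd0 fd m0.

(** The three facts support each other: the bound and measurability of one iterate make the
    integrals for the next one finite, so that [fine] in the recursion loses nothing. *)
Lemma itr_props j : [/\ jmeas (itr m j), forall x t, 0 <= itr m j x t <= bd t &
  forall x t, 0 < t -> (itr m j.+1 x t)%:E =
    (heatE t (EFin \o Wm) x + duhE 0 t (fun y s => (fM f m (itr m j y s))%:E) x)%E].
Proof.
elim: j => [|j [IH1 IH2 IH3]].
  have mj : jmeas (itr m 0).
    by rewrite /jmeas; under eq_fun do rewrite itr0; exact: measurable_cst.
  have bj x t : 0 <= itr m 0 x t <= bd t by rewrite itr0 lexx mulr_ge0// expR_ge0.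
  split=> // x t t0; rewrite itrS t0 fineK//.
  have -> : (fun (y : V) s => (fM f m (itr m 0 y s))%:E) = (fun _ _ => 0%:E).
    by apply/funext => y; apply/funext => s; rewrite itr0 /fM lexx.
  rewrite -(heatH_heatE x t0 bWm).
  rewrite (_ : duhE _ _ _ _ = 0%E) ?adde0//.
  rewrite /duhE; apply: integral0_eq => s _; rewrite /heatE; apply: integral0_eq => y _.
  by rewrite mule0.
have fin h x t : jmeas h -> (forall y s, 0 <= h y s <= bd s) -> 0 < t ->
    exists r : R, [/\ (heatE t (EFin \o Wm) x + duhE 0 t (fun y s => (fM f m (h y s))%:E) x)%E = r%:E,
      0 <= r & r <= bd t].
  move=> mh hb t0.
  have mg : jmeas (fun y s => fM f m (h y s)) by exact: (measurableT_comp mphi mh).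
  have D0 : (0 <= duhE 0 t (fun y s => (fM f m (h y s))%:E) x)%E.
    by apply: duhE_ge0 => y s; rewrite lee_fin.
  have D1 : (duhE 0 t (fun y s => (fM f m (h y s))%:E) x <= (bd t - B0)%:E)%E.
    apply: duhE_bound => // y s _; case/andP: (hb y s) => h1 h2.
    apply: (le_trans (fM_lip f0 fd0 fd f1d f12p m0 h1)); apply: ler_wpM2l => //; exact: ltW.
  have H1 : heatH t Wm x <= B0 by apply: (le_trans (ler_norm _)); exact: heatH_le.
  have H0 : 0 <= heatH t Wm x.
    by rewrite -lee_fin (heatH_heatE x t0 bWm); apply: heatE_ge0 => y; rewrite lee_fin.
  rewrite -(heatH_heatE x t0 bWm).
  case: (duhE _ _ _ _) D0 D1 => [d| |]//=; rewrite !lee_fin => d0 d1.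
  by exists (heatH t Wm x + d); split => //; lra.
have b' x t : 0 <= itr m j.+1 x t <= bd t.
  have [t0|t0] := ltP 0 t.
    rewrite -!lee_fin IH3//; have [r [-> r0 r1]] := fin _ x t IH1 IH2 t0.
    by rewrite !lee_fin r0.
  rewrite itrS ltNge t0 /= Wm0 /=; apply: le_trans (bd_B0 t); exact: (W_le Hp m0).
have m' : jmeas (itr m j.+1).
  rewrite /jmeas; under eq_fun do rewrite itrS.
  apply: measurable_fun_ifT.
  - exact: measurable_fun_ltr.
  - apply: measurableT_comp => //; apply: emeasurable_funD.
      apply: (@measurable_heatE_param R N _ _ (fun z : V * R => z.2) (fun z => z.1)
        (fun z : (V * R) * V => (Wm z.2)%:E)) => //.
      + exact: measurable_snd.
      + exact: measurable_fst.
      + by apply/measurable_EFinP; apply: (measurableT_comp (f := Wm)) => //; case: bWm.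
      + by move=> z; rewrite lee_fin.
    apply: measurable_duhE; last by move=> y s; rewrite lee_fin.
    by apply/measurable_EFinP; exact: (measurableT_comp mphi IH1).
  - by apply: (measurableT_comp (f := Wm)) => //; case: bWm.
split; [exact: m'|exact: b'|move=> x t t0].
rewrite (itrS m j.+1 x t).
rewrite ifT; last exact: t0.
by have [r [-> _ _]] := fin _ x t m' b' t0.
Qed.

Let itr_m j : jmeas (itr m j). Proof. by case: (itr_props j). Qed.
Let itr_0 j x t : 0 <= itr m j x t. Proof. by case: (itr_props j) => _ /(_ x t)/andP[]. Qed.
Let itr_b j x t : itr m j x t <= bd t. Proof. by case: (itr_props j) => _ /(_ x t)/andP[]. Qed.
Let itr_e j x t : 0 < t -> (itr m j.+1 x t)%:E =
    (heatE t (EFin \o Wm) x + duhE 0 t (fun y s => (fM f m (itr m j y s))%:E) x)%E.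
Proof. by case: (itr_props j) => _ _; apply. Qed.
Let itr_w j x t : t <= 0 -> itr m j.+1 x t = Wm x.
Proof. by move=> t0; rewrite itrS ltNge t0. Qed.

Let msrc (h : V -> R -> R) : jmeas h -> measurable_fun setT (fun z : V * R => (fM f m (h z.1 z.2))%:E).
Proof. by move=> mh; apply/measurable_EFinP; exact: (measurableT_comp mphi mh). Qed.

Lemma itr_nd x t : nondecreasing_seq (fun j => itr m j x t).
Proof.
apply/nondecreasing_seqP => j; elim: j x t => [|j IH] x t; first by rewrite itr0; exact: itr_0.
have [t0|t0] := ltP 0 t; last by rewrite !itr_w.
apply: (le_of_EFin (itr_e j x t0) (itr_e j.+1 x t0)).
apply: leeD2l; apply: duhE_le.
- exact: (msrc (itr_m j)).
- exact: (msrc (itr_m j.+1)).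
- by move=> y s; rewrite lee_fin.
- by move=> y s _; rewrite lee_fin; apply: (fM_mono f0 fd0 fd f12p m0).
- by move=> y s; rewrite lee_fin.
Qed.

Lemma itr_cvg x t : itr m j x t @[j --> \oo] --> appr m x t.
Proof.
apply: nondecreasing_is_cvgn; first exact: itr_nd.
by exists (bd t) => _ [j _ <-]; exact: itr_b.
Qed.

Lemma itr_le_appr j x t : itr m j x t <= appr m x t.
Proof. by apply: nondecreasing_cvgn_le; [exact: itr_nd|apply/cvg_ex; eexists; exact: itr_cvg]. Qed.

Lemma appr_ge0 x t : 0 <= appr m x t.
Proof. by apply: le_trans (itr_le_appr 0 x t); rewrite itr0. Qed.

Lemma appr_le x t (b : R) : (forall j, itr m j x t <= b) -> appr m x t <= b.
Proof.
move=> H; apply: limr_le; first by apply/cvg_ex; eexists; exact: itr_cvg.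
by near=> j; exact: H.
Unshelve. all: by end_near.
Qed.

Lemma appr_bd (T : R) : exists B, forall x t, t <= T -> appr m x t <= B.
Proof.
exists (bd T) => x t tT; apply: appr_le => j; apply: (le_trans (itr_b j x t)); exact: bd_mono.
Qed.

Lemma jmeas_appr : jmeas (appr m).
Proof.
apply: (@measurable_fun_cvg _ _ _ setT (fun j z => itr m j z.1 z.2)); first exact: itr_m.
by move=> z _; exact: itr_cvg.
Qed.

Lemma appr_init x t : t <= 0 -> appr m x t = Wm x.
Proof.
move=> t0; apply/cvg_lim => //; rewrite -(cvg_shiftn 1).
by under eq_fun do rewrite addn1 itr_w//; exact: cvg_cst.
Qed.

Lemma appr_eq x t : 0 < t -> (appr m x t)%:E =
    (heatE t (EFin \o Wm) x + duhE 0 t (fun y s => (fM f m (appr m y s))%:E) x)%E.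
Proof.
move=> t0; have c1 : (itr m j.+1 x t)%:E @[j --> \oo] --> (appr m x t)%:E.
  apply/cvg_EFin; first by near=> j.
  have := @itr_cvg x t; rewrite -(cvg_shiftn 1).
  by under eq_fun do rewrite addn1.
have c2 : (itr m j.+1 x t)%:E @[j --> \oo] -->
    (heatE t (EFin \o Wm) x + duhE 0 t (fun y s => (fM f m (appr m y s))%:E) x)%E.
  under eq_fun do rewrite itr_e// -(heatH_heatE x t0 bWm).
  rewrite -(heatH_heatE x t0 bWm); apply: cvgeD; first by rewrite fin_num_adde_defr.
    exact: cvg_cst.
  apply: duhE_cvg.
  - by move=> j; exact: msrc.
  - by move=> j y s; rewrite lee_fin.
  - by move=> y s i j ij; rewrite lee_fin; apply: (fM_mono f0 fd0 fd f12p m0); exact: itr_nd.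
  - move=> y s _; apply/cvg_EFin; first by near=> j.
    exact: (cvg_comp _ _ (@itr_cvg y s) (@fM_cont _ f f0 fd0 fd m m0 (appr m y s))).
exact: (cvg_unique _ c1 c2).
Unshelve. all: by end_near.
Qed.

(** Induction on the iterates against [us_solution]: data and nonlinearity of the truncated problem
    lie below those of [ustar]. The comparison fails at the origin, where [us] is 0; the functions
    are reset to 0 there ([w1]), which the integrals do not see. *)
Lemma appr_le_us x t : x != 0 -> appr m x t <= usp x.
Proof.
move=> x0; apply: appr_le => j; elim: j x t x0 => [|j IH] x t x0; first by rewrite itr0; exact: (us_ge0 Hp).
have Wus y : y != 0 -> Wm y <= usp y.
  by move=> y0; rewrite W_us//; have [] := tr_props m0 (us_ge0 Hp y).
have [t0|t0] := ltP 0 t; last by rewrite itr_w// Wus.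
have mus := measurable_us Hp; have us0 := @us_ge0 R N f q U0 p p1 p2 Hp.
have fus y : 0 <= f (usp y) by apply: (f_ge0 f0 fc fd f12p).
rewrite -lee_fin itr_e// (us_solution f0 fc fd0 fd f12p Hp N0 t0 x0); apply: leeD.
  pose w1 y := if y == 0 then 0 else Wm y.
  have E1 : w1 = fun y => if 0 < enorm y ^+ 2 then Wm y else 0.
    apply/funext => y; rewrite /w1; case: ifPn => [/eqP ->|y0]; last by rewrite enorm2_gt0.
    rewrite (_ : enorm (0 : V) = 0); last by apply/eqP; rewrite enorm_eq0.
    by rewrite expr0n ltxx.
  have mw1 : measurable_fun setT w1.
    rewrite E1; apply: measurable_fun_ifT => //; last by case: bWm.
    by apply: measurable_fun_ltr => //; apply: measurable_funX; exact: measurable_enorm.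
  rewrite (_ : heatE t (EFin \o Wm) x = heatE t (EFin \o w1) x).
    apply: heatE_le; try exact/measurable_EFinP.
    - by move=> y; rewrite lee_fin /w1; case: ifP.
    - by move=> y; rewrite lee_fin /w1; case: ifPn => // /Wus.
  apply: heatE_eq_off0 => //; try exact/measurable_EFinP.
    by apply/measurable_EFinP; case: bWm.
  by move=> y y0 /=; rewrite /w1 (negbTE y0).
apply: ge0_le_integral => //.
- by move=> s _; apply: heatE_ge0 => y; rewrite lee_fin.
- apply: measurable_funTS; apply: measurable_duhE_integrand; last by move=> y s; rewrite lee_fin.
  exact: msrc.
- apply: measurable_funTS; apply: (@measurable_duhE_integrand R N t (fun y _ => (f (usp y))%:E)); last by move=> y s; rewrite lee_fin.
  apply/measurable_EFinP; apply: (measurableT_comp (f := fun y => f (usp y))) => //.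
  exact: (measurable_f_comp f0 fd0 fd).
- move=> s /=; rewrite in_itv/= => /andP[s0 st].
  pose w1 y := if y == 0 then 0 else fM f m (itr m j y s).
  have mfi : measurable_fun setT (fun y => fM f m (itr m j y s)).
    exact: (measurableT_comp mphi (jmeas_sec s (itr_m j))).
  have mw1 : measurable_fun setT w1.
    rewrite (_ : w1 = fun y => if 0 < enorm y ^+ 2 then fM f m (itr m j y s) else 0).
      apply: measurable_fun_ifT => //.
      by apply: measurable_fun_ltr => //; apply: measurable_funX; exact: measurable_enorm.
    apply/funext => y; rewrite /w1; case: ifPn => [/eqP ->|y0]; last by rewrite enorm2_gt0.
    rewrite (_ : enorm (0 : V) = 0); last by apply/eqP; rewrite enorm_eq0.
    by rewrite expr0n ltxx.
  rewrite (_ : heatE _ _ _ = heatE (t - s) (EFin \o w1) x).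
    apply: heatE_le.
    - exact/measurable_EFinP.
    - by apply/measurable_EFinP; exact: (measurable_f_comp f0 fd0 fd).
    - by move=> y; rewrite lee_fin /w1; case: ifP.
    - move=> y; rewrite lee_fin /w1; case: ifPn => // y0.
      apply: (@le_trans _ _ (fM f m (usp y))); last exact: (fM_le f0 fc fd f1d f12p m0).
      by apply: (fM_mono f0 fd0 fd f12p m0); exact: IH.
  apply: heatE_eq_off0 => //; try exact/measurable_EFinP.
  by move=> y y0 /=; rewrite /w1 (negbTE y0).
Qed.

(** Subtracting [W_flow], which contains the same heat term of [W], leaves two Duhamel integrals of
    bounded sources, each O(t) uniformly in x. *)
Lemma appr_near_init : exists2 C, 0 <= C & forall x t, 0 < t <= 1 -> `|appr m x t - Wm x| <= C * t.
Proof.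
have [B bB] := bmeas_aeW f0 fc fd f12p Hp m0.
have [B1 HB1] := appr_bd 1.
have B10 : 0 <= B1 by apply: le_trans (HB1 0 0 ler01); exact: appr_ge0.
have LB : 0 <= L * B1 by rewrite mulr_ge0// ltW.
exists (B + L * B1); first by rewrite addr_ge0// (bmeas_ge0 bB).
move=> x t /andP[t0 t1].
have bs : bsrc 0 t (L * B1) (fun y s => fM f m (appr m y s)).
  split; first exact: (measurableT_comp mphi jmeas_appr).
  move=> s y /andP[s0 st]; rewrite ger0_norm//.
  apply: (le_trans (fM_lip f0 fd0 fd f1d f12p m0 (appr_ge0 y s))); apply: ler_wpM2l; first exact: ltW.
  by apply: HB1; lra.
have bs2 : bsrc 0 t B (fun y _ => @aW R N f p m y + @eW R N p p1 m y).
  split; last by move=> s y _; case: bB.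
  by apply: (measurableT_comp (f := fun y => @aW R N f p m y + @eW R N p p1 m y)) => //; case: bB.
have E : appr m x t = heatH t Wm x + duh 0 t (fun y s => fM f m (appr m y s)) x.
  by apply: EFin_inj; rewrite EFinD (heatH_heatE x t0 bWm) (duh_duhE x bs) -appr_eq.
have E2 := W_flow f0 fc fd f12p Hp m0 x t0.
have d1 := duh_le x (ltW t0) bs; have d2 := duh_le x (ltW t0) bs2.
rewrite subr0 in d1; rewrite subr0 in d2.
rewrite E [in X in _ - X]E2 opprD addrACA subrr add0r.
by apply: (le_trans (ler_normB _ _)); rewrite mulrDl addrC lerD.
Qed.

Lemma mild_appr (tau T : R) : 0 < tau -> exists B M, mild tau T B M (appr m) (fun y s => fM f m (appr m y s)).
Proof.
move=> tau0; have [B HB] := appr_bd T.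
exists B, (L * B).
have LB x s : s <= T -> fM f m (appr m x s) <= L * B.
  move=> sT; apply: (le_trans (fM_lip f0 fd0 fd f1d f12p m0 (appr_ge0 x s))).
  by apply: ler_wpM2l; [exact: ltW|exact: HB].
apply: (@mild_restart R N tau T B (L * B) (appr m) _ (EFin \o Wm) (fun y s => (fM f m (appr m y s))%:E)) => //.
- by apply/measurable_EFinP; case: bWm.
- exact: (msrc jmeas_appr).
- by move=> x s; rewrite lee_fin.
- by move=> x t /andP[t0 _]; exact: appr_eq.
- exact: jmeas_appr.
- exact: (measurableT_comp mphi jmeas_appr).
- by move=> x s /andP[_ sT]; rewrite ger0_norm ?appr_ge0//; apply: HB; exact: ltW.
- by move=> x s /andP[_ sT]; rewrite ger0_norm//; apply: LB; exact: ltW.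
Qed.

(** Because times t <= 0 are frozen at the data, continuity holds on all of space-time; the
    first-contact argument needs it on a closed time interval including 0. *)
Lemma appr_continuous x t : {for (x, t), continuous (fun z : V * R => appr m z.1 z.2)}.
Proof.
have [t0|t0] := ltP 0 t.
  have h0 : 0 < t / 2 by lra.
  have [B [M' H]] := @mild_appr (t / 2) (t + 1) h0.
  have h1 : t / 2 < t + 1 by lra.
  have h2 : t / 2 < t < t + 1 by apply/andP; split; lra.
  exact: (mild_continuous H h1 h2).
have [C C0 HC] := appr_near_init.
apply: continuous_pairP => e e0; rewrite (appr_init _ t0).
have e2 : 0 < e / 2 by lra.
have cW : Wm @ x --> Wm x := @W_cont R N f q U0 p p1 p2 Hp m m0 x.
have /cvgrPdist_lt/(_ _ e2) /nbhs_ballP[d /= d0 Hd] := cW.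
pose d1 := Num.min (Num.min d 1) (e / (2 * (C + 1))).
have C10 : 0 < 2 * (C + 1) by lra.
exists d1; first by rewrite !lt_min d0 ltr01 divr_gt0.
move=> y s; rewrite !lt_min => /andP[/andP[yd _] _] /andP[/andP[_ s1] s2].
have hW : `|Wm y - Wm x| < e / 2.
  rewrite distrC; apply: Hd; rewrite -ball_normE /=; apply: le_lt_trans yd.
  rewrite distrC [leLHS]/Num.norm /= mx_normrE; apply: bigmax_le => [|[i j] _ /=]; first exact: l1_ge0.
  by rewrite ord1 /l1 (bigD1 j)//= lerDl sumr_ge0.
have [s0|s0] := ltP 0 s; last by rewrite (appr_init _ s0); lra.
have sle : s <= `|s - t|.
  by rewrite ger0_norm; lra.
have ss : 0 < s <= 1 by rewrite s0; lra.
have := HC y s ss; have : C * s < e / 2.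
  move: s2; rewrite ltr_pdivlMr// => s2.
  have : C * s <= s * (C + 1) by lra.
  have : s * (2 * (C + 1)) <= `|s - t| * (2 * (C + 1)) by apply: ler_wpM2r => //; exact: ltW.
  lra.
move=> a1 a2; rewrite (_ : _ - _ = (appr m y s - Wm y) + (Wm y - Wm x)); last by ring.
by apply: (le_lt_trans (ler_normD _ _)); lra.
Qed.

End FixedLevel.

Lemma appr_mono m m' x t : 0 < m -> m <= m' -> appr m x t <= appr m' x t.
Proof.
move=> m0 mm; have m'0 : 0 < m' := lt_le_trans m0 mm.
apply: appr_le => // j; apply: le_trans (itr_le_appr m'0 j x t).
have WW y : @W R N p m y <= @W R N p m' y.
  rewrite /W /trh; case: ifPn => [r0|_]; last by lra.
  by have [] := tr_mono m0 (ltW (pr_gt0 Hp r0)) mm.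
elim: j x t => [|j IH] x t; first by rewrite !itr0.
have [i1 i2 i3] := itr_props m0 j; have [k1 k2 k3] := itr_props m'0 j.
have [t0|t0] := ltP 0 t; last by rewrite !itrS ltNge t0 /= WW.
have ms m1 (h : V -> R -> R) : 0 < m1 -> jmeas h ->
    measurable_fun setT (fun z : V * R => (fM f m1 (h z.1 z.2))%:E).
  move=> m10 mh; apply/measurable_EFinP; exact: (measurableT_comp (measurable_fM f0 fd0 fd m10) mh).
apply: (le_of_EFin (i3 x t t0) (k3 x t t0)); apply: leeD.
  apply: heatE_le.
  - by apply/measurable_EFinP; case: (bmeas_W Hp m0).
  - by apply/measurable_EFinP; case: (bmeas_W Hp m'0).
  - by move=> y; rewrite lee_fin (W_ge0 Hp m0).
  - by move=> y; rewrite lee_fin.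
apply: duhE_le; [exact: ms|exact: ms| | |].
- by move=> y s; rewrite lee_fin (fM_ge0 f0 fd0 fd f12p m0).
- move=> y s _; rewrite lee_fin; apply: (le_trans (fM_mono f0 fd0 fd f12p m0 (IH y s))).
  exact: (fM_monoM fd f1d f12p m0).
- by move=> y s; rewrite lee_fin (fM_ge0 f0 fd0 fd f12p m'0).
Qed.

End Approximation.

(** * Extremum conditions and the barrier *)

Section LocalExtrema.
Variable R : realType.

(** At a first contact only earlier times can be compared, hence the one-sided condition and a sign
    in place of an equality. *)
Lemma left_min_derive (k : R -> R) (t c d : R) : is_derive t 1 k c -> 0 < d ->
  (forall s, t - d < s < t -> k t <= k s) -> c <= 0.
Proof.
move=> [D E] d0 H; rewrite -E leNgt; apply/negP => c0.
have C : h^-1 *: ((k \o shift t) (h *: 1) - k t) @[h --> 0^'] --> 'D_1 k t by exact: D.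
have /cvgrPdist_lt/(_ _ c0) [e /= e0 He] := C.
pose h := - (Num.min e d / 2).
have me : 0 < Num.min e d by rewrite lt_min e0.
have [m1 m2] : Num.min e d <= e /\ Num.min e d <= d by rewrite !ge_min !lexx orbT.
have hn : h < 0 by rewrite /h; lra.
have hb : ball_ Num.norm 0 e h by rewrite /ball_ /= sub0r normrN ltr0_norm// /h; lra.
have h0 : h != 0 by rewrite lt_eqF.
have := He h hb h0; rewrite [h *: 1]mulr1 ltr_norml => /andP[_].
have kk : k t <= k (h + t) by apply: H; rewrite /h; apply/andP; split; lra.
have : h^-1 *: (k (h + t) - k t) <= 0.
  by rewrite /GRing.scale /= mulr_le0_ge0 ?invr_le0 ?subr_ge0// ltW.
lra.
Qed.

Lemma local_min2 (h h1 : R -> R) (h2 d : R) : 0 < d ->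
  (forall s : R, `|s| < d -> is_derive s 1 h (h1 s)) -> is_derive (0 : R) 1 h1 h2 ->
  (forall s, `|s| < d -> h 0 <= h s) -> h1 0 = 0 /\ 0 <= h2.
Proof.
move=> d0 dh [D E] hm.
have dh0 : is_derive (0 : R) 1 h (h1 0) by apply: dh; rewrite normr0.
have z : h1 0 = 0.
  apply/eqP; rewrite eq_le; apply/andP; split.
    apply: (left_min_derive dh0 d0) => s /andP[s1 s2]; apply: hm; rewrite ltr_norml; apply/andP; split; lra.
  have dr : is_derive (0 : R) 1 (fun s => h (- s)) (- h1 0).
    have dn : is_derive (0 : R) 1 (fun s : R => - s) (-1).
      by apply: (is_derive_ext (is_deriveN (is_derive_id (0 : R) 1))) => //.
    have dh0' : is_derive (- 0 : R) 1 h (h1 0) by rewrite oppr0.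
    have := @is_derive1_comp R h (fun s : R => - s) 0 _ _ dh0' dn.
    by rewrite mulrN1.
  rewrite -oppr_le0; apply: (left_min_derive dr d0) => s /andP[s1 s2].
  by rewrite oppr0; apply: hm; rewrite normrN ltr_norml; apply/andP; split; lra.
split=> //; rewrite -E leNgt; apply/negP => c0.
have C : s^-1 *: ((h1 \o shift 0) (s *: 1) - h1 0) @[s --> 0^'] --> 'D_1 h1 0 by exact: D.
have nc0 : 0 < - 'D_1 h1 0 by lra.
have /cvgrPdist_lt/(_ _ nc0) [e /= e0 He] := C.
have neg s : 0 < s -> s < e -> h1 s < 0.
  move=> s0 se; have := He s; rewrite /ball_ /= sub0r normrN gtr0_norm// => /(_ se)/(_ (lt0r_neq0 s0)).
  rewrite [s *: 1]mulr1 z subr0 addr0 ltr_norml => /andP[h' _].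
  have : s^-1 *: h1 s < 0 by lra.
  by rewrite /GRing.scale /= pmulr_rlt0// invr_gt0.
pose s := Num.min e d / 2.
have me : 0 < Num.min e d by rewrite lt_min e0.
have [m1 m2] : Num.min e d <= e /\ Num.min e d <= d by rewrite !ge_min !lexx orbT.
have s0 : 0 < s by rewrite /s; lra.
have [|c /andP[c1 c2] Ec] := @MVT_is_derive R h h1 0 s s0.
  by move=> y /andP[y0 ys]; apply: dh; rewrite ger0_norm//; rewrite /s in ys; lra.
have hc : h1 c < 0 by apply: neg => //; rewrite /s in c2; lra.
have : h 0 <= h s by apply: hm; rewrite gtr0_norm// /s; lra.
have : h1 c * (s - 0) < 0 by rewrite nmulr_rlt0// subr0.
by rewrite -Ec; lra.
Qed.

Lemma compact_ball2 n (r : R) : (0 < n)%N -> compact [set x : 'rV[R]_n | enorm x ^+ 2 <= r].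
Proof.
case: n => // n _; apply: bounded_closed_compact.
  exists (Num.sqrt r); split; first exact: num_real.
  move=> M rM x /= xr; rewrite [leLHS]/Num.norm /= mx_normrE.
  have M0 : 0 <= M by apply: le_trans (sqrtr_ge0 r) _; exact: ltW.
  apply: bigmax_le => // -[i j] _ /=; rewrite ord1.
  apply: (le_trans (coord_le_enorm x j)); apply: le_trans (ltW rM).
  rewrite -(ger0_norm (enorm_ge0 x)) -sqrtr_sqr; exact: ler_wsqrtr.
rewrite (_ : mkset _ = (fun x : 'rV[R]_n.+1 => enorm x ^+ 2) @^-1` [set y | y <= r]); last by [].
apply: preimage_closed; last exact: closed_le.
by move=> x _; exact: enorm2_continuous.
Qed.

End LocalExtrema.

Section Constants.
Variables (R : realType) (n q : R).
Hypothesis qn : q < n / 2.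
Hypothesis nq : n / 4 < q.
Hypothesis n0 : 0 < n.

(** Let A = a (2n - 4q)^-1. In the limit A' = (2n - 4q)^-1, e = d = 0, the left side minus the right
    side is a positive multiple of (a - 1) (4 q (a + 1) - 2 n). At the midpoint a = n / (4q) of the
    roots it is minimal, equal to - [sg], and a < 1 because q > n / 4. An eighth of the slack [sg]
    is spent on each of d, e and the decrease of A'. *)
Lemma barrier_constants : exists A A' e d : R,
  [/\ 0 < A, A < A', A' < (2 * n - 4 * q)^-1, 0 < e /\ 0 < d &
    1 + A * d + 4 * A ^+ 2 * ((q + e) / A') < 2 * n * A].
Proof.
have qn' := qn; have nq' := nq; have n0' := n0.
have q0 : 0 < q by lra.
pose As := (2 * n - 4 * q)^-1.
have As0 : 0 < As by rewrite invr_gt0; lra.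
have AsE : (2 * n - 4 * q) * As = 1 by rewrite mulfV// gt_eqF//; lra.
pose a := n / (4 * q).
have a0 : 0 < a by rewrite divr_gt0// mulr_gt0.
have aE : 4 * q * a = n by rewrite /a; field; rewrite gt_eqF.
have a1 : a < 1 by rewrite ltr_pdivrMr ?mulr_gt0//; lra.
pose A := a * As.
have A0 : 0 < A by rewrite mulr_gt0.
pose sg := As * (1 - a) * (4 * q - n).
have sg0 : 0 < sg by rewrite !mulr_gt0//; lra.
pose K := 4 * A ^+ 2 * (q / As).
have K0 : 0 < K.
  by apply: mulr_gt0; [apply: mulr_gt0 => //; exact: exprn_gt0|exact: divr_gt0].
have KE : K = 4 * a ^+ 2 * As * q by rewrite /K /A; field; rewrite gt_eqF.
have sE : 2 * n * A = 1 + K + sg.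
  have -> : 1 + K + sg = (2 * n - 4 * q) * As + K + sg by rewrite AsE.
  by rewrite KE /sg /A -aE; ring.
(* Close enough to 1 for K / c <= K + sg / 8, and larger than a, so that A < A'. *)
pose c := Num.max ((1 + a) / 2) (K / (K + sg / 8)).
have [c1 c2] : (1 + a) / 2 <= c /\ K / (K + sg / 8) <= c by rewrite !le_max !lexx orbT.
have Ks : 0 < K + sg / 8 by lra.
have cl : c < 1 by rewrite gt_max; apply/andP; split; [lra|rewrite ltr_pdivrMr//; lra].
have c0 : 0 < c by lra.
pose A' := As * c.
have A'0 : 0 < A' by rewrite mulr_gt0.
pose e := sg * A' / (32 * A ^+ 2).
pose d := sg / (8 * A).
exists A, A', e, d; split => //.
- by rewrite /A /A' mulrC ltr_pM2l//; lra.
- by rewrite /A' gtr_pMr.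
- split; first by apply: divr_gt0; [exact: mulr_gt0|apply: mulr_gt0 => //; exact: exprn_gt0].
  by apply: divr_gt0 => //; exact: mulr_gt0.
- have -> : A * d = sg / 8 by rewrite /d; field; rewrite gt_eqF.
  have -> : 4 * A ^+ 2 * ((q + e) / A') = K / c + sg / 8.
    by rewrite /e /K /A'; field; rewrite !gt_eqF.
  have : K / c <= K + sg / 8 by rewrite ler_pdivrMr// mulrC -ler_pdivrMr.
  by rewrite sE; lra.
Qed.

End Constants.

Lemma quadratic_le (R : realFieldType) (E r S T n m : R) :
  n * (2 * m + 1) < r - E -> S <= n -> T <= 2 * n * m -> E + T + S <= r.
Proof. by lra. Qed.

Section Barrier.
Variables (R : realType) (N : nat) (f : R -> R) (q U0 : R) (p p1 p2 : R -> R).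
Local Notation V := 'rV[R]_N.
Local Notation f1 := (derive1 f).
Local Notation f2 := (derive1 (derive1 f)).
Hypothesis f0 : f 0 = 0.
Hypothesis fc : {within `[0, +oo[%classic, continuous f}.
Hypothesis fd0 : (f h - f 0) / h @[h --> 0^'+] --> 0.
Hypothesis fd : forall x, 0 < x -> derivable f x 1.
Hypothesis f1d : forall x, 0 < x -> derivable f1 x 1.
Hypothesis f12p : forall x, 0 < x -> 0 < f1 x /\ 0 < f2 x.
Hypothesis Hp : profile N f q U0 p p1 p2.
Hypothesis N0 : (0 < N)%N.
Hypothesis q1 : 1 < q.
Hypothesis flim : f1 u ^+ 2 / (f u * f2 u) @[u --> +oo] --> q.
Hypothesis qN : q < N%:R / 2.
Hypothesis Nq : N%:R / 4 < q.

Let U00 := pr_U0 Hp.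
Let Ffin := pr_Ffin Hp.

(* At a first contact point of [F(u)] with [A (|x|^2 + b + d t)] from above, the
   equation for [F(u)] contradicts the choice of the constants. *)
Lemma first_contact (m A A' e d b K rho t1 : R) (x : V) (t : R) : 0 < m ->
  0 < A -> A < A' -> 0 < e -> 0 < d -> 0 <= b -> U0 < K ->
  1 + A * d + 4 * A ^+ 2 * ((q + e) / A') < 2 * N%:R * A ->
  (forall u : R, K <= u -> f1 u * Fr f u <= q + e) ->
  (forall (y : V) (u : R), enorm y ^+ 2 <= rho -> u <= @us R N p y \/ enorm y ^+ 2 = 0 ->
     A' * enorm y ^+ 2 <= Fr f (Num.max K u)) ->
  A * (rho + b + d * t1) < Fr f K ->
  0 < t -> t <= t1 -> enorm x ^+ 2 < rho ->
  Fr f (Num.max K (@appr R N f p m x t)) = A * (enorm x ^+ 2 + b + d * t) ->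
  (forall y : V, enorm y ^+ 2 <= rho ->
     A * (enorm y ^+ 2 + b + d * t) <= Fr f (Num.max K (@appr R N f p m y t))) ->
  (forall s, 0 <= s < t -> A * (enorm x ^+ 2 + b + d * s) <= Fr f (Num.max K (@appr R N f p m x s))) ->
  False.
Proof.
move=> m0 A0 AA' e0 d0 b0 UK key HK G1 zK t0 tt1 xr Dz Dy Ds.
have A'0 : 0 < A' by lra.
pose u := @appr R N f p m; set u0 := u x t.
have U0p := U00; have K0 : 0 < K by lra.
have z0 : 0 < A * (enorm x ^+ 2 + b + d * t).
  by rewrite mulr_gt0//; have := sqr_ge0 (enorm x); have := mulr_gt0 d0 t0; lra.
have zFK : A * (enorm x ^+ 2 + b + d * t) < Fr f K.
  apply: le_lt_trans zK; rewrite ler_pM2l//.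
  have : d * t <= d * t1 by rewrite ler_pM2l.
  lra.
(* The barrier stays below F(K), so contact occurs only where u > K; near such a point the maximum
   with [K] disappears and F(u) is differentiable. *)
have uK : K < u0.
  rewrite ltNge; apply/negP => uK; move: Dz; rewrite max_l// => Dz; lra.
have Uu : U0 < u0 := lt_trans UK uK.
have u00 : 0 < u0 := lt_trans K0 uK.
have Fu := f_gt0 f0 fc fd f12p u00.
have FE : Fr f u0 = A * (enorm x ^+ 2 + b + d * t) by rewrite -Dz max_r// ltW.
have [T [Tt [B [M' mil]]]] : exists T, t < T /\ exists B M', mild (t / 2) T B M' u (fun y s => fM f m (u y s)).
  by exists (t + 1); split; [by rewrite ltrDl|apply: (mild_appr f0 fd0 fd f1d f12p Hp m0)]; rewrite divr_gt0.
have aT : t / 2 < T by apply: lt_trans Tt; rewrite ltr_pdivrMr// ltr_pMr// ltr1n.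
have tT : t / 2 < t < T by rewrite Tt andbT ltr_pdivrMr// ltr_pMr// ltr1n.
have dphiE := fM_derive f0 fd0 fd m0.
have dphiL := dfM_bound f1d f12p m0.
have mdphi := measurable_dfM f1d f12p m0.
have gE (y : V) s : t / 2 <= s < T -> fM f m (u y s) = fM f m (u y s) by [].
have ut := mild_heat_eq mil aT dphiE dphiL mdphi gE x tT.
have cu := mild_continuous mil aT (x := x) tT.
have [dl dl0 Hdl] : exists2 dl, 0 < dl & forall y s, l1 (y - x) < dl -> `|s - t| < dl -> K < u y s.
  have cu' : (fun z : V * R => u z.1 z.2) @ (x, t) --> u x t := cu.
  have uK0 : 0 < u0 - K by rewrite subr_gt0.
  have /cvgrPdist_lt/(_ _ uK0) [[A1 A2] /= [n1 n2] A12] := cu'.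
  have /nbhs_ballP[r1 /= r10 b1] := n1.
  have /nbhs_ballP[r2 /= r20 b2] := n2.
  exists (Num.min r1 r2); first by rewrite lt_min r10.
  move=> y s; rewrite !lt_min => /andP[y1 _] /andP[_ s2].
  have : `|u0 - u y s| < u0 - K.
    apply: (A12 (y, s)); split => /=.
      apply: b1; rewrite -ball_normE /=; apply: le_lt_trans y1.
      rewrite distrC [leLHS]/Num.norm /= mx_normrE; apply: bigmax_le => [|[i j] _ /=]; first exact: l1_ge0.
      by rewrite ord1 /l1 (bigD1 j)//= lerDl sumr_ge0.
    by apply: b2; rewrite -ball_normE /= distrC.
  by rewrite ltr_norml ltrD2l ltrN2 => /andP[_].
have l1e j (s : R) : l1 (s *: ei R j + x - x : V) = `|s|.
  rewrite addrK /l1 (bigD1 j)//= big1 ?addr0; last by move=> i ij; rewrite !mxE (negbTE ij) mulr0 normr0.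
  by rewrite !mxE !eqxx mulr1.
(* Time direction: F(u) minus the barrier is 0 at time t and nonnegative before, so its derivative
   is at most 0; u_t is replaced by means of the equation. *)
have ht : - (f u0)^-1 * (\sum_i 'D_(ei R i) ('D_(ei R i) (u ^~ t)) x + fM f m u0) - A * d <= 0.
  pose k (s : R) := Fr f (u x s) - A * (enorm x ^+ 2 + b + d * s).
  have dk : is_derive t 1 k (- (f u0)^-1 * (\sum_i 'D_(ei R i) ('D_(ei R i) (u ^~ t)) x + fM f m u0) - A * d).
    have d1 := @is_derive1_comp R (Fr f) (u x) t _ _ (Fr_is_derive f0 fc fd f12p U00 Ffin Uu) ut.
    have d2 : is_derive t 1 (fun s : R => A * (enorm x ^+ 2 + b + d * s)) (A * d).
      apply: (is_derive_ext (is_deriveZ A (is_deriveD (is_derive_cst (enorm x ^+ 2 + b) t 1)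
        (is_deriveZ d (is_derive_id t 1))))) => //.
      by rewrite /GRing.scale /=; ring.
    exact: (is_deriveB d1 d2).
  pose dm := Num.min dl t.
  have dm0 : 0 < dm by rewrite lt_min dl0.
  have [q1' q2'] : dm <= dl /\ dm <= t by rewrite !ge_min !lexx orbT.
  apply: (left_min_derive dk dm0) => s /andP[s1 s2].
  have uKs : K < u x s.
    apply: Hdl; [by rewrite subrr /l1 big1// => i _; rewrite mxE normr0|].
    have h : t - s < dm by rewrite ltrBlDr -ltrBlDl.
    by rewrite ltr_norml ltrNl opprB (lt_le_trans h q1') (lt_trans _ dl0)// subr_lt0.
  have := Ds s; rewrite max_r; last exact: ltW.
  rewrite /k FE subrr => h; rewrite subr_ge0; apply: h; rewrite s2 andbT ltW//.
  by apply: le_lt_trans s1; rewrite subr_ge0.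
(* Space directions: the contact point is an interior minimum along each axis. The first-order
   condition gives D_j u = - 2 A x_j f(u), which turns the gradient part of the second derivative
   into f'(u) (2 A x_j)^2. *)
have h2 j : 'D_(ei R j) (u ^~ t) x = - (f u0 * (2 * A * x 0 j)) /\
    0 <= - (f u0)^-1 * 'D_(ei R j) ('D_(ei R j) (u ^~ t)) x
      + f1 u0 * (2 * A * x 0 j) ^+ 2 - 2 * A.
  pose ul (s : R) : R := u (s *: ei R j + x) t.
  pose ul1 (s : R) : R := 'D_(ei R j) (u ^~ t) (s *: ei R j + x).
  have dul (s : R) : is_derive s 1 ul (ul1 s).
    apply: (iffLR (derive_line_at (u ^~ t) x (ei R j) s _)).
    have D := mild_derivable1 mil (i := j) (x := s *: ei R j + x) tT.
    exact: DeriveDef.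
  have dul1 : is_derive (0 : R) 1 ul1 ('D_(ei R j) ('D_(ei R j) (u ^~ t)) x).
    have D := mild_derivable2 mil dphiE dphiL mdphi gE (i := j) (j := j) (x := x) tT.
    have d' : is_derive x (ei R j) ('D_(ei R j) (u ^~ t)) ('D_(ei R j) ('D_(ei R j) (u ^~ t)) x).
      exact: DeriveDef.
    exact: (iffLR (derive_line _ _ _ _) d').
  have ul0 : ul 0 = u0 by rewrite /ul scale0r add0r.
  have ul10 : ul1 0 = 'D_(ei R j) (u ^~ t) x by rewrite /ul1 scale0r add0r.
  pose h (s : R) := Fr f (ul s) - A * (enorm (s *: ei R j + x) ^+ 2 + b + d * t).
  pose h1 (s : R) := - (f (ul s))^-1 * ul1 s - A * (2 * x 0 j + 2 * s).
  pose h2 := - (f u0)^-1 * 'D_(ei R j) ('D_(ei R j) (u ^~ t)) x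
      + 'D_(ei R j) (u ^~ t) x * ((f u0) ^- 2 * (f1 u0 * 'D_(ei R j) (u ^~ t) x)) - 2 * A.
  have dsq (s : R) : is_derive s 1 (fun s : R => A * (enorm (s *: ei R j + x) ^+ 2 + b + d * t)) (A * (2 * x 0 j + 2 * s)).
    have d1 : is_derive s 1 (fun s : R => enorm x ^+ 2 + (2 * x 0 j) * s + s * s + (b + d * t)) (2 * x 0 j + 2 * s).
      apply: (is_derive_ext (is_deriveD (is_deriveD (is_deriveD (is_derive_cst (enorm x ^+ 2) s 1)
        (is_deriveZ (2 * x 0 j) (is_derive_id s 1))) (is_deriveM (is_derive_id s 1) (is_derive_id s 1)))
        (is_derive_cst (b + d * t) s 1))) => //.
      by rewrite /GRing.scale /=; ring.
    rewrite (_ : (fun s : R => _) = fun s : R => A * (enorm x ^+ 2 + (2 * x 0 j) * s + s * s + (b + d * t))).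
      exact: (is_deriveZ A d1).
    by apply/funext => r; rewrite enorm_line; ring.
  (* a neighbourhood of [0] on which [u > K] and [|.|^2 <= rho] *)
  pose c := rho - enorm x ^+ 2.
  have c0 : 0 < c by rewrite subr_gt0.
  pose dr := Num.min dl (Num.min 1 (c / (2 * `|x 0 j| + 1))).
  have xj0 : 0 < 2 * `|x 0 j| + 1 by rewrite ltr_wpDl// mulr_ge0.
  have dr0 : 0 < dr by rewrite !lt_min dl0 ltr01 divr_gt0.
  have nb s : `|s| < dr -> K < ul s /\ enorm (s *: ei R j + x) ^+ 2 <= rho.
    rewrite !lt_min => /and3P[s1 s2 s3]; split.
      by apply: Hdl; [rewrite l1e|rewrite subrr normr0].
    rewrite enorm_line; move: s3; rewrite ltr_pdivlMr// => s3.
    have k1 : s ^+ 2 <= `|s|.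
      rewrite -real_normK ?num_real// expr2 ler_piMr//; exact: ltW.
    have k2 : 2 * s * x 0 j <= 2 * `|s| * `|x 0 j|.
      by rewrite -mulrA -[leRHS]mulrA ler_pM2l// -normrM ler_norm.
    exact: (quadratic_le s3 k1 k2).
  have E1 : h1 0 = 0 /\ 0 <= h2.
    apply: (@local_min2 R h h1 h2 dr dr0).
    - move=> s /nb[uKs _]; have Us : U0 < ul s := lt_trans UK uKs.
      exact: (is_deriveB (@is_derive1_comp R (Fr f) ul s _ _ (Fr_is_derive f0 fc fd f12p U00 Ffin Us) (dul s)) (dsq s)).
    - have fn : f (ul 0) != 0 by rewrite ul0 gt_eqF.
      have df0 : is_derive (ul 0) 1 f (f1 (ul 0)) by rewrite ul0; exact: f_is_derive.
      have d1 := @is_derive1_comp R f ul 0 _ _ df0 (dul 0).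
      have d2 : is_derive (0 : R) 1 (fun s : R => A * (2 * x 0 j + 2 * s)) (2 * A).
        apply: (is_derive_ext (is_deriveZ A (is_deriveD (is_derive_cst (2 * x 0 j) (0 : R) 1)
          (is_deriveZ (2 : R) (is_derive_id (0 : R) 1))))) => //.
        by rewrite /GRing.scale /=; ring.
      have d3 := is_deriveN (is_deriveV (f := f \o ul) fn d1).
      have d4 := is_deriveM d3 dul1.
      apply: (is_derive_ext (is_deriveB d4 d2)) => //.
      have E : - (f (ul 0))^-1 * 'D_(ei R j) ('D_(ei R j) (u ^~ t)) x
          + ul1 0 * - (- (f (ul 0)) ^- 2 * (f1 (ul 0) * ul1 0)) - 2 * A = h2.
        by rewrite /h2 ul0 ul10; field; rewrite gt_eqF.
      exact: E.
    - move=> s /nb[uKs sr]; have := Dy _ sr; rewrite max_r; last exact: ltW.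
      rewrite /h ul0 FE scale0r add0r subrr => ?; rewrite subr_ge0 //.
  have [z1 z2] := E1.
  move: z1; rewrite /h1 ul0 ul10 mulr0 addr0 => z1.
  have D1E : 'D_(ei R j) (u ^~ t) x = - (f u0 * (2 * A * x 0 j)).
    have -> : 'D_(ei R j) (u ^~ t) x = - f u0 * (- (f u0)^-1 * 'D_(ei R j) (u ^~ t) x).
      by field; rewrite gt_eqF.
    have -> : - (f u0)^-1 * 'D_(ei R j) (u ^~ t) x = A * (2 * x 0 j).
      by apply/eqP; rewrite -subr_eq0; exact/eqP.
    ring.
  split=> //; move: z2; rewrite /h2 D1E; congr (_ <= _).
  by field; rewrite gt_eqF.
have h3 : 0 <= - (f u0)^-1 * (\sum_i 'D_(ei R i) ('D_(ei R i) (u ^~ t)) x)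
    + f1 u0 * (4 * A ^+ 2 * enorm x ^+ 2) - 2 * N%:R * A.
  have : 0 <= \sum_(j < N) (- (f u0)^-1 * 'D_(ei R j) ('D_(ei R j) (u ^~ t)) x
      + f1 u0 * (2 * A * x 0 j) ^+ 2 - 2 * A).
    by apply: sumr_ge0 => j _; case: (h2 j).
  have sc : \sum_(j < N) - (2 * A) = - (2 * N%:R * A).
    by rewrite sumr_const card_ord -[LHS]mulr_natl; ring.
  have sq : \sum_(i < N) f1 u0 * (2 * A * x 0 i) ^+ 2 = f1 u0 * (4 * A ^+ 2 * enorm x ^+ 2).
    by rewrite enorm_sq !mulr_sumr; apply: eq_bigr => j _; ring.
  rewrite !big_split /= -mulr_sumr sc.
  by rewrite sq.
have [fp1 _] := f12p u00.
have h4 : fM f m u0 <= f u0 by apply: (fM_le f0 fc fd f1d f12p m0); exact: ltW.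
have Fr0 := Fr_gt0 f0 fc fd f12p U00 Ffin (ltW Uu).
(* A' |x|^2 <= F(u), inherited from u <= [ustar], together with f'(u) F(u) <= q + e: the term f'(u)
   |x|^2 is thus bounded by a constant, and [key] is contradicted. *)
have h5 : f1 u0 * (A' * enorm x ^+ 2) <= q + e.
  apply: (@le_trans _ _ (f1 u0 * Fr f u0)); last by apply: HK; exact: ltW.
  rewrite ler_pM2l//; have := G1 x u0 (ltW xr); rewrite max_r; last exact: ltW.
  apply; have [x0|x0] := eqVneq x 0; [right|left].
    by rewrite x0 (_ : enorm (0 : V) = 0) ?expr0n//; apply/eqP; rewrite enorm_eq0.
  exact: (appr_le_us f0 fc fd0 fd f1d f12p Hp N0 m0).
have h6 : f1 u0 * (4 * A ^+ 2 * enorm x ^+ 2) <= 4 * A ^+ 2 * ((q + e) / A').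
  have -> : f1 u0 * (4 * A ^+ 2 * enorm x ^+ 2) = 4 * A ^+ 2 * (f1 u0 * (A' * enorm x ^+ 2) / A').
    by field; rewrite gt_eqF.
  rewrite ler_pM2l ?mulr_gt0 ?exprn_gt0// ler_pM2r// invr_gt0//.
have h7 : (f u0)^-1 * fM f m u0 <= 1 by rewrite mulrC ler_pdivrMr// mul1r.
move: ht h3; set Su := \sum_i _; set i := (f u0)^-1 in h7 *.
by move: h6 key h7; set X := f1 u0 * _; set Y := 4 * A ^+ 2 * _; lra.
Qed.


(** Only the auxiliary height b depends on m, and it is dropped at the end. It is affordable at t =
    0 because [W] is bounded, and on |x|^2 = rho because A < A'. The contact point is an earliest
    point of the compact set where F(u) minus the barrier is nonpositive. *)
Lemma barrier : exists A d rho t1 K : R, [/\ 0 < A * d, 0 < rho, 0 < t1 & U0 < K] /\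
  forall (m : R) (x : V) (t : R), 0 < m -> enorm x ^+ 2 <= rho -> 0 <= t <= t1 ->
    A * d * t <= Fr f (Num.max K (@appr R N f p m x t)).
Proof.
have NR : 0 < N%:R :> R by rewrite ltr0n.
have [A [A' [e [d [A0 AA' A'n [e0 d0] key]]]]] := barrier_constants qN Nq NR.
have [K UK HK] := f1_Fr f0 fc fd f1d f12p q1 flim U00 Ffin (pr_F0 Hp) e0.
have [r1 r10 Hr1] := pr_F Hp A'n.
have A'0 : 0 < A' by lra.
have FK := Fr_gt0 f0 fc fd f12p U00 Ffin (ltW UK).
pose rho := Num.min r1 (Fr f K / A').
have rho0 : 0 < rho by rewrite lt_min r10 divr_gt0.
have rr1 : rho <= r1 by rewrite ge_min lexx.
have rK : A' * rho <= Fr f K by rewrite mulrC -ler_pdivlMr// ge_min lexx orbT.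
(* Chosen so that A (rho + gam) = A' rho: as long as b + d t < gam, the barrier is below A' rho on
   |x|^2 = rho. *)
pose gam := (A' - A) * rho / A.
have gamE : A * gam = (A' - A) * rho by rewrite /gam mulrC mulfVK// gt_eqF.
have gam0 : 0 < gam by rewrite divr_gt0// mulr_gt0// subr_gt0.
pose t1 := gam / (2 * d).
have t1E : d * t1 = gam / 2 by rewrite /t1; field; rewrite gt_eqF.
have t10 : 0 < t1 by rewrite divr_gt0// mulr_gt0.
have FrK u : 0 < Fr f (Num.max K u).
  by apply: (Fr_gt0 f0 fc fd f12p U00 Ffin); rewrite le_max (ltW UK).
have G1 (y : V) (u : R) : enorm y ^+ 2 <= rho -> u <= @us R N p y \/ enorm y ^+ 2 = 0 ->
    A' * enorm y ^+ 2 <= Fr f (Num.max K u).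
  move=> yr; have [y0 _|y0 yu] := eqVneq y 0.
    rewrite y0 (_ : enorm (0 : V) = 0) ?expr0n/= ?mulr0; first exact/ltW/FrK.
    by apply/eqP; rewrite enorm_eq0.
  have r0 := enorm2_gt0 y0; case: yu => [|yu]; last by rewrite yu ltxx in r0.
  rewrite /us (negbTE y0) => yu; have [_ h] := Hr1 _ r0 (le_trans yr rr1).
  have [uK|uK] := leP u K; first by apply: le_trans rK; rewrite ler_pM2l.
  apply: (le_trans h); apply: (Fr_antiW f0 fc fd f12p U00 Ffin) => //.
  by apply: ltW; exact: lt_trans UK uK.
exists A, d, rho, t1, K; split; first by split=> //; exact: mulr_gt0.
move=> m x t m0 xr /andP[t0 tt1].
pose Fm := Fr f (Num.max (m / 3) K).
have Fm0 : 0 < Fm by rewrite /Fm maxC; exact: FrK.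
have iA : 0 < 1 - A / A' by rewrite subr_gt0 ltr_pdivrMr// mul1r.
(* The first bound leaves room for d t1 = gam / 2 within [gam]. The second serves at t = 0: A |y|^2
   is at most the fraction A / A' of F(u), and A b is less than the remaining fraction. *)
pose b := Num.min (gam / 4) ((1 - A / A') * Fm / (2 * A)).
have b0 : 0 < b.
  by rewrite lt_min; apply/andP; split; apply: divr_gt0 => //; exact: mulr_gt0.
have b1 : b <= gam / 4 by rewrite ge_min lexx.
have b2 : 2 * (A * b) <= (1 - A / A') * Fm.
  by rewrite mulrA mulrC -ler_pdivlMr ?mulr_gt0// ge_min lexx orbT.
have A2 s : s <= t1 -> A * (b + d * s) < A * gam.
  move=> st; rewrite ltr_pM2l//; have : d * s <= d * t1 by rewrite ler_pM2l.
  rewrite t1E; lra.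
have zK : A * (rho + b + d * t1) < Fr f K.
  apply: lt_le_trans rK; have := A2 t1 (lexx _); rewrite gamE; lra.
pose u := @appr R N f p m.
have uus y s (y0 : y != 0) : u y s <= @us R N p y := appr_le_us f0 fc fd0 fd f1d f12p Hp N0 m0 s y0.
have uG y s : enorm y ^+ 2 <= rho -> A' * enorm y ^+ 2 <= Fr f (Num.max K (u y s)).
  move=> yr; apply: G1 => //; have [y0|y0] := eqVneq y 0; [right|left; exact: uus].
  by rewrite y0 (_ : enorm (0 : V) = 0) ?expr0n//; apply/eqP; rewrite enorm_eq0.
pose D (z : V * R) := Fr f (Num.max K (u z.1 z.2)) - A * (enorm z.1 ^+ 2 + b + d * z.2).
suff Dp : forall z : V * R, enorm z.1 ^+ 2 <= rho -> 0 <= z.2 <= t1 -> 0 < D z.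
  have := Dp (x, t) xr; rewrite /= t0 tt1 => /(_ isT); rewrite /D subr_gt0 => /ltW; apply: le_trans.
  rewrite /= -mulrA ler_pM2l//; have := sqr_ge0 (enorm x); lra.
have cD : continuous D.
  move=> z; apply: cvgB.
    apply: (@cvg_comp _ _ _ (fun z : V * R => Num.max K (u z.1 z.2)) (Fr f) (nbhs z) (nbhs (Num.max K (u z.1 z.2)))).
      have cm := @continuous_max R _ (fun=> K) (fun z : V * R => u z.1 z.2) z (cvg_cst _).
      apply: cm; case: z => y s; exact: (appr_continuous f0 fc fd0 fd f1d f12p Hp m0).
    have Um : U0 < Num.max K (u z.1 z.2) by rewrite lt_max UK.
    by apply: derivable_continuous; case: (Fr_is_derive f0 fc fd f12p U00 Ffin Um).
  apply: cvgM; first exact: cvg_cst.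
  apply: cvgD; last by apply: cvgM; [exact: cvg_cst|exact: cvg_snd].
  apply: cvgD; last exact: cvg_cst.
  apply: (@cvg_comp _ _ _ fst (fun y : V => enorm y ^+ 2) (nbhs z) (nbhs z.1)); first exact: cvg_fst.
  exact: enorm2_continuous.
move=> z zr zt; rewrite ltNge; apply/negP => Dz.
pose S := ([set y : V | enorm y ^+ 2 <= rho] `*` `[0, t1]%classic) `&` (D @^-1` [set y | y <= 0]).
have cS : compact S.
  apply: compact_closedI; first by apply: compact_setX; [exact: compact_ball2|exact: segment_compact].
  by apply: preimage_closed; [move=> w _; exact: cD|exact: closed_le].
have S0 : S !=set0 by exists z; split => //; split => //=; rewrite in_itv.
have c2 : {within S, continuous (fun z : V * R => z.2)}.
  by apply: continuous_subspaceT => w; exact: cvg_snd.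
have [[y s]] := compact_EVT_min S0 cS c2.
move=> /set_mem[[/= yr]]; rewrite in_itv /= => /andP[s0 st1] Dys smin.
have out (y' : V) s' : enorm y' ^+ 2 <= rho -> 0 <= s' -> s' < s -> 0 < D (y', s').
  move=> yr' s'0 s's; rewrite ltNge; apply/negP => D'.
  have : s <= s'.
    apply: (smin (y', s')); apply/mem_set; split=> //; split => //=; rewrite in_itv /= s'0.
    by apply: ltW; apply: lt_le_trans st1.
  by rewrite leNgt s's.
have sp : 0 < s.
  rewrite lt0r s0 andbT; apply/eqP => sE; move: Dys; rewrite /D /= sE mulr0 addr0 leNgt => /negP; apply.
  rewrite subr_gt0.
  have h1 := uG y 0 yr; have h2 : Fm <= Fr f (Num.max K (u y 0)).
    apply: (Fr_antiW f0 fc fd f12p U00 Ffin); first by rewrite le_max (ltW UK).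
    rewrite maxC /u appr_init// ge_max !le_max lexx orbT /=.
    by rewrite (W_le Hp m0).
  have h3 : A * enorm y ^+ 2 <= A / A' * Fr f (Num.max K (u y 0)).
    have -> : A * enorm y ^+ 2 = A / A' * (A' * enorm y ^+ 2) by field; rewrite gt_eqF.
    by rewrite ler_pM2l// divr_gt0.
  have h4 := ler_wpM2l (ltW iA) h2.
  have h5 := mulr_gt0 A0 b0.
  move: h3 h4 b2; set X := Fr f _; set c := A / A'; lra.
have yr' : enorm y ^+ 2 < rho.
  rewrite lt_neqAle yr andbT; apply/eqP => yE; move: Dys; rewrite /D /= leNgt => /negP; apply.
  rewrite subr_gt0; apply: lt_le_trans (uG y s yr); rewrite yE.
  have := A2 s st1; rewrite gamE; lra.
(* A negative value at time s would by continuity persist slightly earlier, against the minimality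
   of s. *)
have Dge (y' : V) : enorm y' ^+ 2 <= rho -> 0 <= D (y', s).
  move=> yr''; rewrite leNgt; apply/negP => D'.
  have nD : 0 < - D (y', s) by rewrite oppr_gt0.
  have /cvgrPdist_lt/(_ _ nD) [[A1 B1] /= [n1 n2] A12] := cD (y', s).
  have /nbhs_ballP[r2 /= r20 b2'] := n2.
  pose h := Num.min s r2 / 2.
  have m0' : 0 < Num.min s r2 by rewrite lt_min sp.
  have [k1 k2] : Num.min s r2 <= s /\ Num.min s r2 <= r2 by rewrite !ge_min !lexx orbT.
  have h0 : 0 < h by rewrite divr_gt0.
  have hm : h < Num.min s r2 by rewrite ltr_pdivrMr// ltr_pMr// ltr1n.
  have [hs hr] := (lt_le_trans hm k1, lt_le_trans hm k2).
  have : `|D (y', s) - D (y', s - h)| < - D (y', s).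
    apply: (A12 (y', s - h)); split => /=; first exact: nbhs_singleton.
    by apply: b2'; rewrite -ball_normE /= opprB addrC subrK gtr0_norm.
  have := out y' (s - h) yr''; rewrite subr_ge0 (ltW hs) gtrDl oppr_lt0 h0 => /(_ isT isT) => Dp.
  by rewrite ltr_norml opprK ltrDl oppr_gt0 (ltNge _ 0) (ltW Dp).
apply: (first_contact m0 A0 AA' e0 d0 (ltW b0) UK key HK G1 zK sp st1 yr').
- by apply/eqP; rewrite eq_le -subr_le0 -[X in _ && X]subr_ge0; apply/andP; split; [exact: Dys|exact: Dge].
- by move=> y' /Dge; rewrite subr_ge0.
- by move=> s' /andP[s'0 s's]; have /ltW := out y s' yr s'0 s's; rewrite subr_ge0.
Qed.

End Barrier.

Lemma integral_eq_off0 (R : realType) n (g1 g2 : 'rV[R]_n -> \bar R) : (0 < n)%N ->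
  measurable_fun setT g1 -> measurable_fun setT g2 -> (forall y, y != 0 -> g1 y = g2 y) ->
  (\int[lebn R n]_y g1 y = \int[lebn R n]_y g2 y)%E.
Proof.
move=> n0 m1 m2 E; apply: ae_eq_integral => //.
exists [set y : 'rV[R]_n | y 0 (Ordinal n0) = 0]; split.
- exact: measurable_hyperplane.
- exact: lebn_hyperplane.
- move=> y /= H; apply: contra_notP H => y0 _; apply: E.
  by apply/eqP => y00; apply: y0; rewrite y00 mxE.
Qed.

(** * Local integrability of negative powers of the radius *)

Section SmallBall.
Variable R : realType.
Local Notation leb := (@lebesgue_measure R).

(** |s|^(- al) restricted to 0 < |s| < 1, written with exp and ln. Likewise [ballpow] below is
    |y|^(-2k) on the punctured ball of squared radius rho. *)
Definition hpow (al s : R) : R := if (0 < `|s|) && (`|s| < 1) then expR (- al * ln `|s|) else 0.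

Lemma hpow_ge0 al s : 0 <= hpow al s.
Proof. by rewrite /hpow; case: ifP => // _; exact: expR_ge0. Qed.

Lemma measurable_hpow al : measurable_fun setT (hpow al).
Proof.
apply: measurable_fun_ifT => //.
  by apply: measurable_and; apply: measurable_fun_ltr => //; exact: normr_measurable.
apply: measurableT_comp; first exact: measurable_expR.
by apply: measurable_funM => //; apply: measurableT_comp; [exact: measurable_ln|exact: normr_measurable].
Qed.

Let g (al s : R) := expR (- al * ln s).
Let F (al s : R) := (1 - al)^-1 * expR ((1 - al) * ln s).

Let dF (al x : R) : al < 1 -> 0 < x -> is_derive x 1 (F al) (g al x).
Proof.
move=> al1 x0; have d2 := is_deriveZ (1 - al) (is_derive1_ln x0).
have d3 := @is_derive1_comp R expR (fun s : R => (1 - al) * ln s) x _ _ (is_derive_expR _) d2.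
apply: (is_derive_ext (is_deriveZ (1 - al)^-1 d3)) => //.
rewrite /GRing.scale /= /g (_ : (1 - al) * ln x = ln x + - al * ln x); last by ring.
rewrite expRD lnK ?posrE//; field.
by rewrite gt_eqF//= subr_eq0 gt_eqF.
Qed.

Let dg (al x : R) : 0 < x -> derivable (g al) x 1.
Proof.
move=> x0; have d2 := is_deriveZ (- al) (is_derive1_ln x0).
by have [] := @is_derive1_comp R expR (fun s : R => - al * ln s) x _ _ (is_derive_expR _) d2.
Qed.

Let Fb (al x y : R) : al < 1 -> 0 < x -> y < 1 -> F al y - F al x <= (1 - al)^-1.
Proof.
move=> al1 x0 y1; have i0 : 0 < (1 - al)^-1 by rewrite invr_gt0 subr_gt0.
have : 0 <= F al x by rewrite mulr_ge0 ?expR_ge0// ltW.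
have : F al y <= (1 - al)^-1.
  rewrite -[leRHS]mulr1 ler_pM2l// expR_le1; apply: mulr_ge0_le0; first by rewrite subr_ge0 ltW.
  by apply: ln_le0; exact: ltW.
lra.
Qed.

Lemma integral_hpow al : al < 1 -> (\int[leb]_s (hpow al s)%:E <= (2 / (1 - al))%:E)%E.
Proof.
move=> al1; pose D1 : set R := `]0, 1[%classic; pose D2 : set R := `](-1), 0[%classic.
have i0 : 0 <= (1 - al)^-1 by rewrite invr_ge0 subr_ge0 ltW.
have mD1 : measurable D1 by exact: measurable_itv.
have mD2 : measurable D2 by exact: measurable_itv.
have mh : measurable_fun setT (EFin \o hpow al) by apply/measurable_EFinP; exact: measurable_hpow.
have -> : (\int[leb]_s (hpow al s)%:E = \int[leb]_(s in D1 `|` D2) (hpow al s)%:E)%E.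
  rewrite [RHS]integral_mkcond; apply: eq_integral => s _; rewrite patchE; case: ifPn => // sD.
  congr (_%:E); rewrite /hpow; case: ifPn => // /andP[s0 s1]; exfalso; move/negP: sD; apply.
  apply/mem_set; move: s0 s1; rewrite normr_gt0 ltr_norml => s0 /andP[s1 s2].
  have [h|h|h] := ltgtP 0 s; [left|right|by rewrite -h eqxx in s0]; by rewrite /D1 /D2 /= in_itv /= h ?s1 ?s2.
rewrite ge0_integral_setU//=; first last.
- apply/disj_setPLR => s; rewrite /D1 /D2 /= !in_itv /= => /andP[s0 _] /andP[_ s1].
  by have := lt_trans s0 s1; rewrite ltxx.
- by move=> s _; rewrite lee_fin hpow_ge0.
- exact: measurable_funTS.
have -> : (2 / (1 - al))%:E = ((1 - al)^-1%:E + (1 - al)^-1%:E)%E :> \bar R by rewrite -EFinD; congr (_%:E); ring.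
apply: leeD.
  have -> : (\int[leb]_(s in D1) (hpow al s)%:E = \int[leb]_(s in D1) (g al s)%:E)%E.
    apply: eq_integral => s /set_mem; rewrite /D1 /= in_itv /= => /andP[s0 s1].
    by rewrite /hpow gtr0_norm// s0 s1.
  apply: (@ge0_integral_itvoo_le R (g al) (F al) 0 1).
  - by move=> x _; exact: expR_ge0.
  - by move=> x /andP[x0 _]; exact: dF.
  - by move=> x /andP[x0 _]; have h := derivable_continuous (@dg al x x0); exact h.
  - by move=> x y x0 _ y1; exact: Fb.
  - exact: i0.
have -> : (\int[leb]_(s in D2) (hpow al s)%:E = \int[leb]_(s in D2) (g al (- s))%:E)%E.
  apply: eq_integral => s /set_mem; rewrite /D2 /= in_itv /= => /andP[s1 s0].
  by rewrite /hpow ltr0_norm// oppr_gt0 s0 ltrNl s1.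
have dN (x : R) : is_derive x 1 (fun s : R => - s) (-1) by exact: (is_deriveN (is_derive_id x 1)).
apply: (@ge0_integral_itvoo_le R (fun s => g al (- s)) (fun s => - F al (- s)) (-1) 0).
- by move=> x _; exact: expR_ge0.
- move=> x /andP[_ x0]; have x0' : 0 < - x by rewrite oppr_gt0.
  apply: (is_derive_ext (is_deriveN (is_derive1_comp (dF al1 x0') (dN x)))) => //.
  by rewrite mulrN1 opprK.
- move=> x /andP[_ x0]; have x0' : 0 < - x by rewrite oppr_gt0.
  have d1 : is_derive (- x) 1 (g al) ('D_1 (g al) (- x)) by exact: DeriveDef (@dg al (- x) x0') erefl.
  have [h _] := is_derive1_comp d1 (dN x).
  have h' := derivable_continuous h; exact h'.
- move=> x y x1 xy y0; have y0' : 0 < - y by rewrite oppr_gt0.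
  have x1' : - x < 1 by rewrite ltrNl.
  by rewrite opprK addrC; exact: (Fb al1 y0' x1').
- exact: i0.
Qed.

Definition ballpow n (k rho : R) (y : 'rV[R]_n) : R :=
  if (0 < enorm y ^+ 2) && (enorm y ^+ 2 < rho) then expR (- k * ln (enorm y ^+ 2)) else 0.

Lemma measurable_ball_if n rho (h : 'rV[R]_n -> R) : measurable_fun setT h ->
  measurable_fun setT (fun y => if (0 < enorm y ^+ 2) && (enorm y ^+ 2 < rho) then h y else 0).
Proof.
move=> mh; have me : measurable_fun setT (fun y : 'rV[R]_n => enorm y ^+ 2).
  by apply: measurable_funX; exact: measurable_enorm.
by apply: measurable_fun_ifT => //; apply: measurable_and; exact: measurable_fun_ltr.
Qed.

Lemma measurable_ballpow n k rho : measurable_fun setT (@ballpow n k rho).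
Proof.
apply: measurable_ball_if; apply: measurableT_comp; first exact: measurable_expR.
apply: measurable_funM => //; apply: measurableT_comp; first exact: measurable_ln.
by apply: measurable_funX; exact: measurable_enorm.
Qed.

Lemma ballpow_ge0 n k rho y : 0 <= @ballpow n k rho y.
Proof. by rewrite /ballpow; case: ifP => // _; exact: expR_ge0. Qed.

Lemma prode_le (I : \bar R) (C : R) m : (0 <= I)%E -> (I <= C%:E)%E ->
  (0 <= \prod_(i < m) I)%E /\ (\prod_(i < m) I <= (C ^+ m)%:E)%E.
Proof.
move=> I0 IC; elim: m => [|m [IH1 IH2]]; first by rewrite big_ord0.
rewrite big_ord_recl exprS EFinM; split; first exact: mule_ge0.
exact: lee_pmul.
Qed.

(* Off the coordinate hyperplanes, [|y_i| <= |y|] bounds the radial power by a product of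
   one-dimensional powers. *)
Lemma integral_ballpow n (k : R) : (0 < n)%N -> 0 <= k -> 2 * k < n%:R ->
  exists2 J, 0 <= J & (\int[lebn R n]_y (@ballpow n k 1 y)%:E <= J%:E)%E.
Proof.
move=> n0 k0 kn; have nn : 0 < n%:R :> R by rewrite ltr0n.
pose al := 2 * k / n%:R; have al1 : al < 1 by rewrite ltr_pdivrMr// mul1r.
have C0 : 0 <= 2 / (1 - al) by rewrite divr_ge0// subr_ge0 ltW.
exists ((2 / (1 - al)) ^+ n); first exact: exprn_ge0.
apply: (@le_trans _ _ (\int[lebn R n]_y (\prod_(i < n) hpow al (y 0 i))%:E)%E).
  apply: ae_ge0_le_integral => //.
  - by move=> y _; rewrite lee_fin ballpow_ge0.
  - by apply/measurable_EFinP; exact: measurable_ballpow.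
  - by move=> y _; rewrite lee_fin prodr_ge0// => i _; exact: hpow_ge0.
  - apply/measurable_EFinP; apply: measurable_prod => i _.
    by apply: measurableT_comp; [exact: measurable_hpow|exact: measurable_coord].
  have H : {ae lebn R n, forall y : 'rV[R]_n, forall i, y 0 i != 0}.
    apply: filter_forall => i; exists [set y : 'rV[R]_n | y 0 i = 0]; split.
    - exact: measurable_hyperplane.
    - exact: lebn_hyperplane.
    - by move=> y /= /negP; rewrite negbK => /eqP.
  apply: filterS H => y Hy _; rewrite lee_fin /ballpow; case: ifPn => [/andP[r0 r1]|_]; last first.
    by rewrite prodr_ge0// => i _; exact: hpow_ge0.
  have -> : expR (- k * ln (enorm y ^+ 2)) = \prod_(i < n) expR (- (k / n%:R) * ln (enorm y ^+ 2)).
    by rewrite prodr_const card_ord -expRM_natl; congr expR; field; rewrite gt_eqF.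
  apply: ler_prod => i _; rewrite expR_ge0 /=.
  have yi : 0 < `|y 0 i| by rewrite normr_gt0.
  have yr : `|y 0 i| ^+ 2 <= enorm y ^+ 2.
    by rewrite lerXn2r ?nnegrE ?enorm_ge0//; exact: coord_le_enorm.
  have y1 : `|y 0 i| < 1.
    by rewrite -(@ltr_pXn2r _ 2)// ?nnegrE// expr1n (le_lt_trans yr).
  rewrite /hpow yi y1 ler_expR.
  have : ln (`|y 0 i| ^+ 2) <= ln (enorm y ^+ 2) by rewrite ler_ln//; rewrite posrE// exprn_gt0.
  rewrite (_ : ln (`|y 0 i| ^+ 2) = 2 * ln `|y 0 i|); last by rewrite expr2 lnM ?posrE//; ring.
  move=> /(ler_wpM2l (divr_ge0 k0 (ltW nn))).
  rewrite /al; set L := ln _; set L' := ln _ => h.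
  have -> : - (2 * k / n%:R) * L = - (k / n%:R * (2 * L)) by ring.
  by rewrite mulNr lerN2.
rewrite (@integral_prodv R n (fun=> hpow al)); [|by move=> i; exact: measurable_hpow|by move=> i s; exact: hpow_ge0].
have [|_ ->//] := @prode_le (\int[leb]_s (hpow al s)%:E)%E (2 / (1 - al)) n _ (integral_hpow al1).
by apply: integral_ge0 => s _; rewrite lee_fin hpow_ge0.
Qed.

(** For k = 0 [ballpow] is the indicator of the punctured unit ball, and translation invariance
    makes the bound independent of the centre. *)
Lemma integral_unit_ball n : (0 < n)%N -> exists2 J : R, 0 <= J &
  forall z : 'rV[R]_n, (\int[lebn R n]_y (\1_[set y' | enorm (y' - z) < 1] y)%:E <= J%:E)%E.
Proof.
move=> n0; have [||J J0 HJ] := @integral_ballpow n 0 n0; first by [].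
  by rewrite mulr0 ltr0n.
exists J => // z; pose g0 (y : 'rV[R]_n) : R := if enorm y ^+ 2 < 1 then 1 else 0.
have me : measurable_fun setT (fun y : 'rV[R]_n => enorm y ^+ 2).
  by apply: measurable_funX; exact: measurable_enorm.
have mg : measurable_fun setT g0 by apply: measurable_fun_ifT => //; exact: measurable_fun_ltr.
have g00 y : 0 <= g0 y by rewrite /g0; case: ifP.
have -> : (\int[lebn R n]_y (\1_[set y' | enorm (y' - z) < 1] y)%:E = \int[lebn R n]_y (g0 (y + - z))%:E)%E.
  apply: eq_integral => y _; congr (_%:E); rewrite indicE /g0.
  have -> : (y \in [set y' : 'rV[R]_n | enorm (y' - z) < 1]) = (enorm (y - z) ^+ 2 < 1).
    rewrite expr_lt1 ?enorm_ge0//.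
    by apply/idP/idP => [/set_mem//|h]; apply/mem_set.
  by case: ifP.
rewrite (@integral_addv R n (fun y => (g0 y)%:E)); [|exact/measurable_EFinP|by move=> y; rewrite lee_fin].
rewrite (@integral_eq_off0 R n _ (fun y => (ballpow 0 1 y)%:E))//.
- exact/measurable_EFinP.
- by apply/measurable_EFinP; exact: measurable_ballpow.
- by move=> y y0; rewrite /g0 /ballpow enorm2_gt0//= oppr0 mul0r expR0.
Qed.

End SmallBall.

Section StarPower.
Variables (R : realType) (N : nat) (f : R -> R) (q U0 : R) (p p1 p2 : R -> R).
Local Notation V := 'rV[R]_N.
Local Notation f1 := (derive1 f).
Local Notation f2 := (derive1 (derive1 f)).
Hypothesis f0 : f 0 = 0.
Hypothesis fc : {within `[0, +oo[%classic, continuous f}.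
Hypothesis fd : forall x, 0 < x -> derivable f x 1.
Hypothesis f1d : forall x, 0 < x -> derivable f1 x 1.
Hypothesis f12p : forall x, 0 < x -> 0 < f1 x /\ 0 < f2 x.
Hypothesis Hp : profile N f q U0 p p1 p2.
Hypothesis N0 : (0 < N)%N.
Hypothesis q1 : 1 < q.
Hypothesis flim : f1 u ^+ 2 / (f u * f2 u) @[u --> +oo] --> q.
Hypothesis qN : q < N%:R / 2.

(** [ln_Fr_le] bounds u^gam by a multiple of F(u)^(-k), and near the origin F(ustar) >= A |y|^2 by
    [pr_F]. *)
Lemma us_pow_small (gam k : R) : 0 < gam -> 0 < k -> gam * (q - 1) < k ->
  exists r0 C : R, [/\ 0 < r0, 0 <= C & forall y : V, 0 < enorm y ^+ 2 -> enorm y ^+ 2 <= r0 ->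
    powR (us p y) gam <= C * expR (- k * ln (enorm y ^+ 2))].
Proof.
move=> g0 k0 gk.
have [K [C0 [UK HK]]] := ln_Fr_le f0 fc fd f1d f12p q1 flim (pr_U0 Hp) (pr_Ffin Hp) (pr_F0 Hp) g0 k0 gk.
have i0 : 0 < (2 * N%:R - 4 * q)^-1 by rewrite invr_gt0; have h := qN; lra.
pose A := (2 * N%:R - 4 * q)^-1 / 2.
have A0 : 0 < A by rewrite /A; lra.
have [r1 r10 H1] : exists2 r1, 0 < r1 & forall r, 0 < r -> r <= r1 -> U0 < p r /\ A * r <= Fr f (p r).
  by apply: (pr_F Hp); rewrite /A; lra.
have [r2 r20 H2] := pr_oo Hp K.
exists (Num.min r1 r2), (expR (C0 - k * ln A)); split.
- by rewrite lt_min r10.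
- exact: expR_ge0.
move=> y y0; rewrite le_min => /andP[yr1 yr2].
have [_ h1] := H1 _ y0 yr1; have h2 := H2 _ y0 yr2.
have yN : y != 0 by apply: contraTneq y0 => ->; rewrite (_ : enorm (0 : V) = 0) ?expr0n ?ltxx//; apply/eqP; rewrite enorm_eq0.
have pp := pr_gt0 Hp y0; rewrite /us (negbTE yN) /powR gt_eqF// -expRD ler_expR.
have Ar : 0 < A * enorm y ^+ 2 by exact: mulr_gt0.
have := HK _ h2; have : ln (A * enorm y ^+ 2) <= ln (Fr f (p (enorm y ^+ 2))).
  by rewrite ler_ln ?posrE//; exact: lt_le_trans h1.
rewrite lnM ?posrE// -(ler_pM2l k0); set L1 := ln A; set L2 := ln (_ ^+ 2); set L3 := ln (Fr _ _); set L4 := ln _.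
lra.
Qed.

(** The exponents satisfy gam (q - 1) < k < k' < N / 2. With r = |y|^2, r^(-k) = r^(k' - k) r^(-k'),
    where r^(-k') is integrable and the first factor is at most e' as soon as r <= exp (ln e' / (k'
    - k)). *)
Lemma us_small_ball (gam e : R) : 0 < gam -> gam * (q - 1) < N%:R / 2 -> 0 < e ->
  exists2 rho, 0 < rho & (\int[lebn R N]_y
    (if ((0 < enorm y ^+ 2) && (enorm y ^+ 2 < rho))%R then powR (us p y) gam else 0)%:E <= e%:E)%E.
Proof.
move=> g0 gN e0; have gq : 0 < gam * (q - 1) by rewrite mulr_gt0// subr_gt0.
pose k := (gam * (q - 1) + N%:R / 2) / 2; pose k' := (k + N%:R / 2) / 2.
have k0 : 0 < k by rewrite /k; lra.
have gk : gam * (q - 1) < k by rewrite /k; lra.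
have kN : k < N%:R / 2 by rewrite /k; lra.
have dl : 0 < k' - k by rewrite /k'; lra.
have [r0 [C [r00 C0 HC]]] := us_pow_small g0 k0 gk.
have k'0 : 0 <= k' by rewrite /k'; lra.
have [|J J0 HJ] := @integral_ballpow R N k' N0 k'0; first by rewrite /k'; lra.
pose e' := e / (C * J + 1); have CJ : 0 < C * J + 1 by rewrite ltr_wpDl// mulr_ge0.
have e'0 : 0 < e' by rewrite divr_gt0.
pose rho := Num.min r0 (Num.min 1 (expR (ln e' / (k' - k)))).
have rho0 : 0 < rho by rewrite !lt_min r00 ltr01 expR_gt0.
exists rho => //.
apply: (@le_trans _ _ (\int[lebn R N]_y ((C * e')%:E * (@ballpow R N k' 1 y)%:E))%E).
  apply: ge0_le_integral => //.
  - by move=> y _; rewrite lee_fin; case: ifP => // _; exact: powR_ge0.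
  - apply/measurable_EFinP; apply: measurable_ball_if.
    exact: (measurableT_comp (@measurable_powR R gam) (measurable_us Hp)).
  - by apply: measurable_funeM; apply/measurable_EFinP; exact: measurable_ballpow.
  - move=> y _; rewrite -EFinM lee_fin; case: ifPn => [/andP[y0 yr]|_]; last first.
      by rewrite mulr_ge0 ?ballpow_ge0// mulr_ge0// ltW.
    move: yr; rewrite !lt_min => /and3P[yr y1 ye].
    rewrite /ballpow y0 y1; apply: (le_trans (HC y y0 (ltW yr))).
    rewrite -mulrA; apply: ler_wpM2l => //.
    rewrite (_ : - k * _ = (k' - k) * ln (enorm y ^+ 2) + - k' * ln (enorm y ^+ 2)); last by ring.
    rewrite expRD; apply: ler_wpM2r; first exact: expR_ge0.
    rewrite -[leRHS]lnK ?posrE// ler_expR -ler_pdivlMl// mulrC.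
    by rewrite -[leRHS]expRK ler_ln ?posrE ?expR_gt0//; exact: ltW.
rewrite ge0_integralZl//.
- apply: (@le_trans _ _ ((C * e')%:E * J%:E)%E).
    by apply: lee_wpmul2l => //; rewrite lee_fin mulr_ge0// ltW.
  rewrite -EFinM lee_fin /e' mulrAC mulrA ler_pdivrMr// mulrC ler_pM2l//; lra.
- by apply/measurable_EFinP; exact: measurable_ballpow.
- by move=> y _; rewrite lee_fin ballpow_ge0.
- by rewrite lee_fin mulr_ge0// ltW.
Qed.

End StarPower.

(* If [heatE t w = 0], so does every [heatE t (min(1, k w))], while these increase to [1]. *)
Lemma heatE_gt0 (R : realType) (N : nat) (t : R) (w : 'rV[R]_N -> R) (x : 'rV[R]_N) : (0 < N)%N -> 0 < t ->
  measurable_fun setT w -> (forall y, 0 <= w y) -> (forall y, y != 0 -> 0 < w y) ->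
  (0 < heatE t (EFin \o w) x)%E.
Proof.
move=> N0 t0 mw w0 wp.
have h0 : (0 <= heatE t (EFin \o w) x)%E by apply: heatE_ge0 => y; rewrite lee_fin.
rewrite lt_def h0 andbT; apply/eqP => hE.
pose w' (y : 'rV[R]_N) : R := if 0 < enorm y ^+ 2 then w y else 1.
have mw' : measurable_fun setT w'.
  apply: measurable_fun_ifT => //.
  by apply: measurable_fun_ltr => //; apply: measurable_funX; exact: measurable_enorm.
have w'p y : 0 < w' y.
  rewrite /w'; case: ifPn => // y0; apply: wp; apply/eqP => yE; move: y0.
  by rewrite yE (_ : enorm (0 : 'rV[R]_N) = 0) ?expr0n ?ltxx//; apply/eqP; rewrite enorm_eq0.
have hE' : heatE t (EFin \o w') x = 0%E.
  rewrite -hE; apply: heatE_eq_off0 => //; try exact/measurable_EFinP.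
  by move=> y y0; rewrite /= /w' enorm2_gt0.
pose w_ k (y : 'rV[R]_N) : \bar R := (Num.min 1 (k%:R * w' y))%:E.
have kw0 k y : 0 <= k%:R * w' y by apply: mulr_ge0 => //; exact: ltW.
have mw_ k : measurable_fun setT (w_ k).
  by apply/measurable_EFinP; apply: measurable_minr => //; exact: measurable_funM.
have w_0 k y : (0 <= w_ k y)%E by rewrite lee_fin le_min ler01 kw0.
have c1 : heatE t (w_ k) x @[k --> \oo] --> heatE t (fun=> 1%E) x.
  apply: heatE_cvg => //.
  - move=> y j k jk; rewrite lee_fin le_min ge_min lexx /= ge_min; apply/orP; right.
    by apply: ler_wpM2r; [exact: ltW|rewrite ler_nat].
  - move=> y; apply: cvg_near_cst; near=> k; rewrite /w_ min_l//.
    rewrite -ler_pdivrMr// mul1r; near: k; exact: nbhs_infty_ger.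
have c2 k : heatE t (w_ k) x = 0%E.
  apply/eqP; rewrite eq_le heatE_ge0// andbT.
  have <- : (k%:R%:E * heatE t (EFin \o w') x = 0)%E by rewrite hE' mule0.
  rewrite /heatE -ge0_integralZl//; last first.
    - by move=> y _; rewrite mule_ge0// lee_fin ?heatG_ge0//; exact: ltW.
    - by apply: measurable_heat_integrand; exact/measurable_EFinP.
  apply: ge0_le_integral => //.
  - by move=> y _; rewrite mule_ge0// lee_fin heatG_ge0.
  - exact: measurable_heat_integrand.
  - by apply: measurable_funeM; apply: measurable_heat_integrand; exact/measurable_EFinP.
  - move=> y _; rewrite muleCA; apply: lee_wpmul2l; first by rewrite lee_fin heatG_ge0.
    by rewrite -EFinM lee_fin ge_min lexx orbT.
have E1 : heatE t (fun=> 1%E) x = 1%E :> \bar R.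
  by have := heatH_heatE x t0 (bmeas_cst N (1 : R)); rewrite heatH_cst// => <-.
move: c1; under eq_fun do rewrite c2; rewrite E1 => c1.
have [/eqP] : 1%E = 0%E :> \bar R by apply: (cvg_unique (@ereal_hausdorff R) c1); exact: cvg_cst.
by rewrite oner_eq0.
Unshelve. all: by end_near.
Qed.

(** * The second solution and its properties *)

Section SecondSolution.
Variables (R : realType) (N : nat) (f : R -> R) (q U0 : R) (p p1 p2 : R -> R).
Local Notation V := 'rV[R]_N.
Local Notation f1 := (derive1 f).
Local Notation f2 := (derive1 (derive1 f)).
Hypothesis f0 : f 0 = 0.
Hypothesis fc : {within `[0, +oo[%classic, continuous f}.
Hypothesis fd0 : (f h - f 0) / h @[h --> 0^'+] --> 0.
Hypothesis fd : forall x, 0 < x -> derivable f x 1.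
Hypothesis f1d : forall x, 0 < x -> derivable f1 x 1.
Hypothesis f12p : forall x, 0 < x -> 0 < f1 x /\ 0 < f2 x.
Hypothesis Hp : profile N f q U0 p p1 p2.
Hypothesis N0 : (0 < N)%N.
Variables (c rho t1 K : R).
Hypothesis c0 : 0 < c.
Hypothesis rho0 : 0 < rho.
Hypothesis UK : U0 < K.
Hypothesis bar : forall (m : R) (x : V) (t : R), 0 < m -> enorm x ^+ 2 <= rho -> 0 <= t <= t1 ->
  c * t <= Fr f (Num.max K (@appr R N f p m x t)).

Local Notation ap k := (@appr R N f p k.+1%:R).
Local Notation usp := (@us R N p).
Let kp k : 0 < k.+1%:R :> R := nat1_gt0 R k.

(** For |x|^2 <= rho the barrier gives F(max K u) >= c t >= c a > F(v), hence u < v since F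
    decreases; elsewhere u <= [ustar] <= p rho. *)
Lemma appr_ub (a : R) : 0 < a -> exists2 M, 0 < M & forall k x t, a <= t <= t1 -> ap k x t <= M.
Proof.
move=> a0; have [v Uv Fv] := pr_F0 Hp (mulr_gt0 c0 a0).
have U0p := pr_U0 Hp.
exists (Num.max v (p rho)); first by rewrite lt_max; apply/orP; left; lra.
move=> k x t /andP[ta tt]; have [xr|xr] := leP (enorm x ^+ 2) rho; rewrite le_max.
  have tt' : 0 <= t <= t1 by rewrite tt andbT; lra.
  have h := bar (kp k) xr tt'.
  have h2 : Fr f v < Fr f (Num.max K (ap k x t)).
    by apply: (lt_le_trans Fv); apply: le_trans h; rewrite ler_pM2l.
  have Um : U0 <= Num.max K (ap k x t) by rewrite le_max (ltW UK).
  have := Fr_lt_anti f0 fc fd f12p (pr_U0 Hp) (pr_Ffin Hp) Uv Um h2.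
  by rewrite gt_max => /andP[_ /ltW ->].
have x0 : x != 0.
  apply/eqP => xE; move: xr; rewrite xE (_ : enorm (0 : V) = 0) ?expr0n /=; last by apply/eqP; rewrite enorm_eq0.
  by rewrite ltNge ltW.
apply/orP; right; apply: (le_trans _ (us_le Hp rho0 (ltW xr))).
exact: (appr_le_us f0 fc fd0 fd f1d f12p Hp N0 (kp k)).
Qed.

(** The limit is taken where the barrier guarantees that it is finite; the value 0 at other times
    keeps the function nonnegative and jointly measurable. *)
Definition u2 (x : V) (t : R) : R :=
  if (0 < t) && (t <= t1) then lim (ap k x t @[k --> \oo]) else 0.

Lemma appr_nd x t : nondecreasing_seq (fun k => ap k x t).
Proof.
move=> j k jk; apply: (appr_mono f0 fd0 fd f1d f12p Hp); first exact: kp.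
by rewrite ler_nat ltnS.
Qed.

Lemma u2_cvg x t : 0 < t <= t1 -> ap k x t @[k --> \oo] --> u2 x t.
Proof.
move=> tt; rewrite /u2 tt; have /andP[t0 tt1] := tt; have [M _ HM] := appr_ub t0.
apply: nondecreasing_is_cvgn; first exact: appr_nd.
by exists M => _ [k _ <-]; apply: HM; rewrite lexx.
Qed.

Lemma appr_le_u2 k x t : 0 < t <= t1 -> ap k x t <= u2 x t.
Proof.
move=> tt; have c' := @u2_cvg x t tt; rewrite /u2 tt; apply: nondecreasing_cvgn_le; first exact: appr_nd.
by apply/cvg_ex; eexists; exact: c'.
Qed.

Lemma u2_le x t b : 0 <= b -> (forall k, 0 < t <= t1 -> ap k x t <= b) -> u2 x t <= b.
Proof.
move=> b0 H; case: (boolP (0 < t <= t1)) => tt; last by rewrite /u2 (negbTE tt).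
have c' := @u2_cvg x t tt; rewrite /u2 tt; apply: limr_le; first by apply/cvg_ex; eexists; exact: c'.
by near=> k; exact: H.
Unshelve. all: by end_near.
Qed.

Lemma u2_ge0 x t : 0 <= u2 x t.
Proof.
case: (boolP (0 < t <= t1)) => tt; last by rewrite /u2 (negbTE tt).
by apply: le_trans (appr_le_u2 0 x tt); exact: (appr_ge0 f0 fd0 fd f1d f12p Hp (kp 0)).
Qed.

Lemma u2_bound (a : R) : 0 < a -> exists2 M, 0 < M & forall x t, a <= t -> u2 x t <= M.
Proof.
move=> a0; have [M M0 HM] := appr_ub a0; exists M => // x t ta.
by apply: u2_le; [exact: ltW|move=> k /andP[_ tt]; apply: HM; rewrite ta].
Qed.

Lemma u2_le_us x t : x != 0 -> u2 x t <= usp x.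
Proof.
move=> x0; apply: u2_le; first exact: (us_ge0 Hp).
by move=> k _; exact: (appr_le_us f0 fc fd0 fd f1d f12p Hp N0 (kp k)).
Qed.

Lemma jmeas_u2 : jmeas u2.
Proof.
pose h k (z : V * R) := if (0 < z.2) && (z.2 <= t1) then ap k z.1 z.2 else 0.
apply: (@measurable_fun_cvg _ _ _ setT h) => [k|z _].
  apply: measurable_fun_ifT => //; last exact: (jmeas_appr f0 fd0 fd f1d f12p Hp (kp k)).
  by apply: measurable_and; [exact: measurable_fun_ltr|exact: measurable_fun_ler].
rewrite /h; case: (boolP (0 < z.2 <= t1)) => tt; first exact: u2_cvg.
by rewrite /u2 (negbTE tt); exact: cvg_cst.
Qed.

Lemma measurable_f_u2 : measurable_fun setT (fun z : V * R => f (u2 z.1 z.2)).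
Proof. by apply: (measurable_f_comp f0 fd0 fd); [exact: jmeas_u2|move=> z; exact: u2_ge0]. Qed.

Lemma f_u2_ge0 x t : 0 <= f (u2 x t).
Proof. exact: (f_ge0 f0 fc fd f12p (u2_ge0 x t)). Qed.

Lemma u2_eq x t : 0 < t <= t1 ->
  (u2 x t)%:E = (heatE t (EFin \o usp) x + duhE 0 t (fun y s => (f (u2 y s))%:E) x)%E.
Proof.
move=> tt; have /andP[t0 tt1] := tt.
have a1 : (ap k x t)%:E @[k --> \oo] --> (u2 x t)%:E.
  by apply/cvg_EFin; [near=> k|exact: (@u2_cvg x t tt)].
have a2 : duhE 0 t (fun y s => (fM f k.+1%:R (ap k y s))%:E) x @[k --> \oo] -->
    duhE 0 t (fun y s => (f (u2 y s))%:E) x.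
  apply: duhE_cvg.
  - move=> k; apply/measurable_EFinP.
    exact: (measurableT_comp (measurable_fM f0 fd0 fd (kp k)) (jmeas_appr f0 fd0 fd f1d f12p Hp (kp k))).
  - by move=> k y s; rewrite lee_fin; exact: (fM_ge0 f0 fd0 fd f12p (kp k)).
  - move=> y s j k jk; rewrite lee_fin.
    apply: (le_trans (fM_mono f0 fd0 fd f12p (kp j) (appr_nd y s jk))).
    by apply: (fM_monoM fd f1d f12p (kp j)); rewrite ler_nat ltnS.
  - move=> y s /andP[s0 st]; have ss : 0 < s <= t1 by rewrite s0 ltW// (lt_le_trans st).
    (* At a fixed positive time all approximations stay below one [M], and from level [M] on every
       [fM] coincides with [f] on [0, M]; so convergence of the sources reduces to continuity of
       [fM f M]. *)
    have [M M0 HM] := appr_ub s0.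
    have uM : u2 y s <= M by apply: u2_le; [exact: ltW|move=> k _; apply: HM; rewrite lexx; case/andP: ss].
    apply/cvg_EFin; first by near=> k.
    rewrite -(fM_eq f0 (u2_ge0 y s) uM).
    have cM := cvg_comp _ _ (@u2_cvg y s ss) (@fM_cont _ f f0 fd0 fd M M0 (u2 y s)).
    apply: cvg_trans cM; apply: near_eq_cvg; near=> k => /=.
    have k0 : 0 <= ap k y s by exact: (appr_ge0 f0 fd0 fd f1d f12p Hp (kp k)).
    have kM : ap k y s <= M by apply: HM; rewrite lexx; case/andP: ss.
    rewrite !(fM_eq f0)//; apply: (le_trans kM); apply: (@le_trans _ _ k%:R); last by rewrite ler_nat.
    by near: k; exact: nbhs_infty_ger.
have a3 : (ap k x t)%:E @[k --> \oo] --> (heatE t (EFin \o usp) x + duhE 0 t (fun y s => (f (u2 y s))%:E) x)%E.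
  under eq_fun do rewrite (appr_eq f0 fd0 fd f1d f12p Hp (kp _) x t0).
  have dfn : (heatE t (EFin \o usp) x +? duhE 0 t (fun y s => (f (u2 y s))%:E) x)%E.
    apply: ge0_adde_def; rewrite inE.
      by apply: heatE_ge0 => y; rewrite lee_fin; exact: (us_ge0 Hp).
    by apply: duhE_ge0 => y s; rewrite lee_fin; exact: f_u2_ge0.
  have hW := @heatE_W_cvg R N f q U0 p p1 p2 Hp N0 t x.
  exact: (cvgeD dfn hW a2).
exact: (cvg_unique _ a1 a3).
Unshelve. all: by end_near.
Qed.

Lemma u2_gt0 x t : 0 < t <= t1 -> 0 < u2 x t.
Proof.
move=> tt; have /andP[t0 _] := tt; rewrite -lte_fin u2_eq//.
apply: (@lt_le_trans _ _ (heatE t (EFin \o usp) x)); last first.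
  by rewrite leeDl// duhE_ge0// => y s; rewrite lee_fin; exact: f_u2_ge0.
apply: heatE_gt0 => //; first exact: (measurable_us Hp).
  exact: (us_ge0 Hp).
by move=> y y0; rewrite /us (negbTE y0); apply: (pr_gt0 Hp); exact: enorm2_gt0.
Qed.

(** From time [tau] on the solution stays below some [M], so its source is [fM f M] composed with
    it; that function has a bounded derivative on the whole line, as the bootstrap requires. *)
Lemma u2_mild (tau : R) : 0 < tau -> exists M, 0 < M /\
  mild tau t1 M (f M) u2 (fun x s => f (u2 x s)) /\
  forall x s, tau <= s < t1 -> f (u2 x s) = fM f M (u2 x s).
Proof.
move=> tau0; have [M M0 HM] := u2_bound tau0; exists M; split=> //; split; last first.
  by move=> x s /andP[ts _]; rewrite (fM_eq f0)//; [exact: u2_ge0|exact: HM].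
apply: (@mild_restart _ _ tau t1 M (f M) u2 _ (EFin \o usp) (fun y s => (f (u2 y s))%:E)) => //.
- by apply/measurable_EFinP; exact: (measurable_us Hp).
- by move=> x; rewrite lee_fin; exact: (us_ge0 Hp).
- by apply/measurable_EFinP; exact: measurable_f_u2.
- by move=> x s; rewrite lee_fin; exact: f_u2_ge0.
- by move=> x t /andP[t0 tt]; apply: u2_eq; rewrite t0 ltW.
- exact: jmeas_u2.
- exact: measurable_f_u2.
- by move=> x s /andP[ts _]; rewrite ger0_norm ?u2_ge0//; exact: HM.
- move=> x s /andP[ts _]; rewrite ger0_norm ?f_u2_ge0//.
  by apply: (f_mono f0 fc fd f12p); [exact: u2_ge0|exact: HM].
Qed.

Lemma u2_classical : classical_solution f t1 u2.
Proof.
have loc (x : V) (t : R) : 0 < t < t1 -> [/\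
    is_derive t 1 (u2 x) (\sum_i 'D_(ei R i) ('D_(ei R i) (u2 ^~ t)) x + f (u2 x t)),
    (forall i, derivable (u2 ^~ t) x (ei R i)) /\
    (forall i j, derivable ('D_(ei R i) (u2 ^~ t)) x (ei R j)),
    {for (x, t), continuous (fun z : V * R => u2 z.1 z.2)} /\
    {for (x, t), continuous (fun z : V * R => derive1 (u2 z.1) z.2)},
    forall i, {for (x, t), continuous (fun z : V * R => 'D_(ei R i) (u2 ^~ z.2) z.1)} &
    forall i j, {for (x, t), continuous (fun z : V * R => 'D_(ei R j) ('D_(ei R i) (u2 ^~ z.2)) z.1)}].
  move=> /andP[t0 tt]; have t20 : 0 < t / 2 by lra.
  have [M [M0 [mil gE]]] := u2_mild t20.
  have aT : t / 2 < t1 by lra.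
  have tT : t / 2 < t < t1 by apply/andP; split; lra.
  have dphiE := fM_derive f0 fd0 fd M0.
  have dphiL := dfM_bound f1d f12p M0.
  have mdphi := measurable_dfM f1d f12p M0.
  split.
  - exact: (mild_heat_eq mil aT dphiE dphiL mdphi gE).
  - split=> [i|i j]; first exact: (mild_derivable1 mil).
    exact: (mild_derivable2 mil dphiE dphiL mdphi gE).
  - split; first exact: (mild_continuous mil aT).
    exact: (mild_time_derive_continuous mil aT dphiE dphiL mdphi gE).
  - by move=> i; exact: (mild_grad_continuous mil aT).
  - by move=> i j; exact: (mild_continuous2 mil dphiE dphiL mdphi gE).
split; last split.
- by move=> x t /= tt; have [[d1 _] [d2 d3] _ _ _] := loc x t tt.
- by move=> [x t] /= tt; have [_ _ [k1 k2] k3 k4] := loc x t tt.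
- move=> x t /= tt; have [d1 _ _ _ _] := loc x t tt; rewrite derive1E (@derive_val _ _ _ _ _ _ _ d1).
  by rewrite addrAC /laplacian /partial subrr add0r.
Qed.


Hypothesis q1 : 1 < q.
Hypothesis flim : f1 u ^+ 2 / (f u * f2 u) @[u --> +oo] --> q.
Hypothesis qN : q < N%:R / 2.
Hypothesis t10 : 0 < t1.

(** First the level is fixed: ustar - W <= ustar^2 / (k + 1) <= p(r)^2 / (k + 1). Then t is taken
    small: [u2] lies above the k-th approximation, which differs from W by at most C t. *)
Lemma us_sub_u2 (r eta : R) : 0 < r -> 0 < eta -> exists2 t', 0 < t' & forall t y, 0 < t < t' ->
  r <= enorm y ^+ 2 -> usp y - u2 y t <= eta.
Proof.
move=> r0 eta0.
have [k Hk] : exists k : nat, p r ^+ 2 / k.+1%:R <= eta / 2.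
  have [n _ Hn] := nbhs_infty_ger (p r ^+ 2 / (eta / 2)); exists n.
  have e20 : 0 < eta / 2 by lra.
  rewrite ler_pdivrMr// mulrC -ler_pdivrMr//; apply: (le_trans (Hn n (leqnn n))).
  by rewrite ler_nat.
have [C C0 HC] := appr_near_init f0 fc fd0 fd f1d f12p Hp (kp k).
have C1 : 0 < C + 1 by lra.
exists (Num.min t1 (Num.min 1 (eta / 2 / (C + 1)))).
  by rewrite !lt_min t10 ltr01 !divr_gt0.
move=> t y /andP[t0]; rewrite !lt_min => /and3P[tt1 tt2 tC] yr.
have y0 : y != 0.
  apply/eqP => yE; move: yr; rewrite yE (_ : enorm (0 : V) = 0) ?expr0n /=; last by apply/eqP; rewrite enorm_eq0.
  by rewrite leNgt r0.
have CT : C * t <= eta / 2.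
  by move: tC; rewrite ltr_pdivlMr// mulrDr mulr1 [t * C]mulrC; lra.
have tt : 0 < t <= t1 by rewrite t0 ltW.
have h1 := appr_le_u2 k y tt.
have h2 : `|ap k y t - W p k.+1%:R y| <= C * t by apply: HC; rewrite t0 ltW.
have [_ _ _ h3 _] := tr_props (kp k) (us_ge0 Hp y).
have h4 : usp y ^+ 2 / k.+1%:R <= p r ^+ 2 / k.+1%:R.
  apply: ler_wpM2r; first by rewrite invr_ge0.
  apply: lerXn2r; rewrite ?nnegrE; [exact: (us_ge0 Hp)|exact/ltW/(pr_gt0 Hp)|exact: (us_le Hp r0 yr)].
move: h2 h3 h4 Hk; rewrite W_us// ler_norml => /andP[h2 _].
by set a := _ / k.+1%:R; set b := _ / k.+1%:R; lra.
Qed.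

Lemma measurable_unit_ball (z : V) : measurable [set y' : V | enorm (y' - z) < 1].
Proof.
have mf : measurable_fun setT (fun y : V => enorm (y - z) < 1).
  apply: measurable_fun_ltr => //.
  by apply: measurableT_comp; [exact: measurable_enorm|exact: measurable_subv].
rewrite (_ : [set _ | _] = setT `&` (fun y' : V => enorm (y' - z) < 1) @^-1` [set true]).
  exact: mf.
by rewrite setTI; apply/seteqP; split => y /=.
Qed.

(** [w] is the given datum with its arbitrary value at 0. On |y|^2 < r the difference is at most
    [ustar], and [us_small_ball] costs e / 2 for every centre; elsewhere it is at most [eta], where
    eta^gam (J + 1) = e / 2. *)
Lemma u2_ul_small (w : V -> R) (gam e : R) : measurable_fun setT w ->
  (forall y, y != 0 -> w y = usp y) -> 1 <= gam -> gam * (q - 1) < N%:R / 2 -> 0 < e ->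
  exists2 t', 0 < t' & forall t z, 0 < t < t' ->
    (\int[lebn R N]_y (\1_[set y' | enorm (y' - z) < 1]%R y * powR `|u2 y t - w y| gam)%:E <= e%:E)%E.
Proof.
move=> mw wE gam1 gN e0; have g0 : 0 < gam by lra.
have e20 : 0 < e / 2 by lra.
have [r r0 Hr] := us_small_ball f0 fc fd f1d f12p Hp N0 q1 flim qN g0 gN e20.
have [J J0 HJ] := integral_unit_ball R N0.
have J1 : 0 < J + 1 by lra.
pose c1 := e / 2 / (J + 1); have c10 : 0 < c1 by rewrite divr_gt0.
pose eta := powR c1 gam^-1.
have eta0 : 0 < eta by rewrite powR_gt0.
have etaE : powR eta gam = c1 by rewrite /eta -powRrM mulVf ?gt_eqF// powRr1// ltW.
have [t' t'0 Ht'] := us_sub_u2 r0 eta0.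
exists t' => // t z tt.
pose S (y : V) : R := if (0 < enorm y ^+ 2) && (enorm y ^+ 2 < r) then powR (usp y) gam else 0.
pose B := [set y' : V | enorm (y' - z) < 1].
have S0 y : 0 <= S y by rewrite /S; case: ifP => // _; exact: powR_ge0.
have mS : measurable_fun setT S.
  by apply: measurable_ball_if; exact: (measurableT_comp (@measurable_powR R gam) (measurable_us Hp)).
have mB : measurable_fun setT (\1_B : V -> R) by apply: measurable_indic; exact: measurable_unit_ball.
pose G (y : V) : R := \1_B y * powR `|u2 y t - w y| gam.
have mG : measurable_fun setT G.
  apply: measurable_funM => //; apply: (measurableT_comp (@measurable_powR R gam)).
  apply: (measurableT_comp (@normr_measurable R setT)).
  by apply: measurable_funB => //; exact: (jmeas_sec _ jmeas_u2).
pose G' (y : V) : R := if 0 < enorm y ^+ 2 then G y else 0.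
have mG' : measurable_fun setT G'.
  apply: measurable_fun_ifT => //; apply: measurable_fun_ltr => //.
  by apply: measurable_funX; exact: measurable_enorm.
have G0 y : 0 <= G y by rewrite mulr_ge0// powR_ge0.
rewrite -/B (@integral_eq_off0 R N _ (fun y => (G' y)%:E))//.
- apply: (@le_trans _ _ (\int[lebn R N]_y ((S y)%:E + c1%:E * (\1_B y)%:E))%E).
    apply: ge0_le_integral => //.
    - by move=> y _; rewrite lee_fin /G'; case: ifP.
    - exact/measurable_EFinP.
    - apply: emeasurable_funD; first exact/measurable_EFinP.
      by apply: measurable_funeM; exact/measurable_EFinP.
    - move=> y _; rewrite -EFinM -EFinD lee_fin /G'; case: ifPn => [y0|_]; last first.
        by rewrite addr_ge0// mulr_ge0// ltW.
      have yN : y != 0.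
        by apply: contraTneq y0 => ->; rewrite (_ : enorm (0 : V) = 0) ?expr0n ?ltxx//; apply/eqP; rewrite enorm_eq0.
      have le1 := u2_le_us t yN.
      have nE : `|u2 y t - w y| = usp y - u2 y t by rewrite wE// distrC ger0_norm// subr_ge0.
      have [yr|yr] := ltP (enorm y ^+ 2) r.
        rewrite /S y0 yr /= -[leLHS]addr0; apply: lerD; last by rewrite mulr_ge0// ltW.
        rewrite /G nE indicE; case: (y \in B); last by rewrite mul0r powR_ge0.
        rewrite mul1r; apply: (ge0_ler_powR (ltW g0)); rewrite ?nnegrE ?subr_ge0//; first exact: (us_ge0 Hp).
        by rewrite lerBlDr lerDl u2_ge0.
      rewrite /S (_ : (enorm y ^+ 2 < r) = false) ?andbF ?add0r /G ?nE; last by apply/negbTE; rewrite -leNgt.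
      rewrite mulrC; apply: ler_wpM2r => //.
      rewrite -etaE; apply: (ge0_ler_powR (ltW g0)); rewrite ?nnegrE ?subr_ge0//; first exact: ltW.
      exact: Ht'.
  rewrite ge0_integralD//; first last.
  - by apply: measurable_funeM; exact/measurable_EFinP.
  - by move=> y _; rewrite mule_ge0// lee_fin// ltW.
  - exact/measurable_EFinP.
  - by move=> y _; rewrite lee_fin.
  rewrite ge0_integralZl//; first last.
  - by rewrite lee_fin ltW.
  - exact/measurable_EFinP.
  apply: (@le_trans _ _ ((e / 2)%:E + c1%:E * J%:E)%E).
    apply: leeD; first exact: Hr.
    by apply: lee_wpmul2l; [rewrite lee_fin ltW|exact: HJ].
  rewrite -EFinM -EFinD lee_fin.
  have : c1 * J <= e / 2 by rewrite /c1 mulrAC ler_pdivrMr// ler_pM2l//; lra.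
  lra.
- exact/measurable_EFinP.
- exact/measurable_EFinP.
- by move=> y y0; rewrite /G' enorm2_gt0.
Qed.

End SecondSolution.

(** * Passage to the integrals and null sets of the definitions *)

Section SpaceTime.
Variables (R : realType).
Local Notation leb := (@lebesgue_measure R).

(** Measurability is assumed for [g'] alone, so [iintE] cannot be applied to [g]. On every slice
    with first coordinate s <> 0 the two functions agree, and the slice s = 0 does not count in the
    outermost integral. *)
Lemma iint_eq_off0 n (g g' : 'rV[R]_n -> \bar R) : (0 < n)%N -> measurable_fun setT g' ->
  (forall x, 0 <= g' x)%E -> (forall y, y != 0 -> g y = g' y) -> iint g = iint g'.
Proof.
case: n g g' => // n g g' _ mg g0 E /=.
pose H' (s : R) := iint (fun v : 'rV[R]_n => g' (row_mx (s%:M : 'rV[R]_1) v)).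
pose H (s : R) := iint (fun v : 'rV[R]_n => g (row_mx (s%:M : 'rV[R]_1) v)).
have mH' : measurable_fun setT H'.
  rewrite (_ : H' = fun s => (\int[lebn R n]_v g' (consv (s, v)))%E).
    apply: (measurable_fun_fubini_tonelli_F (fun q : R * 'rV[R]_n => g' (consv q))) => //.
    by apply: (measurableT_comp mg); exact: measurable_consv.
  by apply/funext => s; apply: iintE => //; exact: (measurable_consv_sec s mg).
have HH s : s != 0 -> H s = H' s.
  move=> s0; congr iint; apply/funext => v; apply: E; apply/eqP => e0.
  have := consv0 (s, v); rewrite /consv /= e0 mxE => s0'.
  by rewrite -s0' eqxx in s0.
have mH : measurable_fun setT H.
  rewrite (_ : H = fun s => if s == 0 then H 0 else H' s).
    by apply: measurable_fun_ifT => //; exact: measurable_fun_eqr.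
  by apply/funext => s; have [->//|s0] := eqVneq s 0; exact: HH.
apply: ae_eq_integral => //; exists [set 0]; split => //; first exact: lebesgue_measure_set1.
by move=> s /= h; apply: contra_notP h => s0 _; apply: HH; apply/eqP.
Qed.

Lemma heat_termE N (w ws : 'rV[R]_N -> R) (x : 'rV[R]_N) (t : R) : (0 < N)%N ->
  measurable_fun setT ws -> (forall y, 0 <= ws y) -> (forall y, y != 0 -> w y = ws y) ->
  heat_term w x t = heatE t (EFin \o ws) x.
Proof.
move=> N0 mw w0 E; rewrite /heat_term.
have m : measurable_fun setT (fun y : 'rV[R]_N => (heatG t (x - y) * ws y)%:E).
  by apply: (@measurable_heat_integrand R N t (EFin \o ws) x); exact/measurable_EFinP.
have g0 (y : 'rV[R]_N) : (0 <= (heatG t (x - y) * ws y)%:E)%E by rewrite lee_fin mulr_ge0// heatG_ge0.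
rewrite (iint_eq_off0 N0 m g0); first exact: iintE.
by move=> y y0; rewrite E.
Qed.

Lemma duhamel_termE N (f : R -> R) (u : 'rV[R]_N -> R -> R) (x : 'rV[R]_N) (t : R) : 0 < t ->
  jmeas (fun y s => f (u y s)) -> (forall y s, 0 <= f (u y s)) ->
  duhamel_term f u x t = duhE 0 t (fun y s => (f (u y s))%:E) x.
Proof.
move=> t0 mh h0; rewrite /duhamel_term /duhE.
pose I s := heatE (t - s) (fun y => (f (u y s))%:E) x.
have mI : measurable_fun setT I.
  apply: (@measurable_heatE_param R N _ R (fun s => t - s) (fun=> x) (fun z => (f (u z.2 z.1))%:E)) => //.
  - exact: measurable_funB.
  - apply/measurable_EFinP.
    exact: (measurableT_comp mh (measurable_fun_pair (@measurable_snd _ _ R 'rV[R]_N) (@measurable_fst _ _ R 'rV[R]_N))).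
  - by move=> z; rewrite lee_fin.
transitivity (\int[leb]_(s in `[0%R, t]) I s)%E.
  apply: eq_integral => s _; apply: iintE.
    apply: (@measurable_heat_integrand R N (t - s) (fun y => (f (u y s))%:E) x).
    by apply/measurable_EFinP; exact: (jmeas_sec s mh).
  by move=> y; rewrite lee_fin mulr_ge0// heatG_ge0.
have mIS D : measurable_fun D I by exact: measurable_funTS.
by rewrite -integral_itv_bndo_bndc// -integral_itv_obnd_cbnd.
Qed.

Lemma measurable_xpt N : measurable_fun setT (@xpt R N).
Proof. by apply: measurable_rV => i; under eq_fun do rewrite mxE; exact: measurable_coord. Qed.

Lemma measurable_tpt N : measurable_fun setT (@tpt R N).
Proof. by rewrite /tpt; under eq_fun do rewrite mxE; exact: measurable_coord. Qed.

Lemma jmeas_measurable_st N (T : \bar R) (u : 'rV[R]_N -> R -> R) : jmeas u -> measurable_st T u.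
Proof.
move=> mu B mB.
have mu' : measurable_fun setT (fun z : 'rV[R]_(N + 1) => u (xpt z) (tpt z)).
  exact: (measurableT_comp mu (measurable_fun_pair (@measurable_xpt N) (@measurable_tpt N))).
have ms : measurable_fun setT (fun z : 'rV[R]_(N + 1) => (0 <= tpt z) && ((tpt z)%:E < T)%E).
  have mt := @measurable_tpt N.
  apply: measurable_and; first exact: measurable_fun_ler.
  case: T => [r| |].
  - by under eq_fun do rewrite lte_fin; exact: measurable_fun_ltr.
  - by under eq_fun do rewrite ltry; exact: measurable_cst.
  - by under eq_fun do rewrite ltNge leNye; exact: measurable_cst.
rewrite (_ : [set z | _] = (setT `&` (fun z : 'rV[R]_(N + 1) => (0 <= tpt z) && ((tpt z)%:E < T)%E) @^-1` [set true])
    `&` (setT `&` (fun z : 'rV[R]_(N + 1) => u (xpt z) (tpt z)) @^-1` B)).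
  by apply: (@measurableI _ 'rV[R]_(N + 1)); [exact: ms|exact: mu'].
apply/seteqP; split => z /=.
  by move=> [[a b] c]; rewrite a b.
by move=> [[_ /andP[a b]] [_ c]].
Qed.

Lemma iint_indic n (E : set 'rV[R]_n) : measurable E -> iint (fun z => (\1_E z)%:E) = lebn R n E.
Proof.
move=> mE; rewrite iintE//; last by apply/measurable_EFinP; exact: measurable_indic.
by rewrite integral_indic// setIT.
Qed.

(** The exceptional set consists of two null hyperplanes, one containing the points with x = 0, the
    other being the initial time. *)
Lemma ae_st_off0 N (T : \bar R) (P : 'rV[R]_N -> R -> Prop) : (0 < N)%N ->
  (forall x t, x != 0 -> 0 < t -> (t%:E < T)%E -> P x t) -> ae_st T P.
Proof.
move=> N0 H; pose i0 := Ordinal N0.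
pose E1 := [set z : 'rV[R]_(N + 1) | z 0 (lshift 1 i0) = 0].
pose E2 := [set z : 'rV[R]_(N + 1) | z 0 (rshift N ord0) = 0].
have m1 : measurable E1 by exact: measurable_hyperplane.
have m2 : measurable E2 by exact: measurable_hyperplane.
exists (E1 `|` E2); split; first exact: (measurableU _ _ m1 m2).
split.
  rewrite iint_indic; last exact: measurableU.
  by rewrite measureU0//; exact: lebn_hyperplane.
move=> z [t0 tT] nP; apply: contra_notP nP => nE; apply: H => //.
  apply/eqP => x0; apply: nE; left; rewrite /E1 /=.
  by have := congr1 (fun y : 'rV[R]_N => y 0 i0) x0; rewrite !mxE.
rewrite lt_neqAle t0 andbT; apply/eqP => tE; apply: nE; right.
by rewrite /E2 /= tE /tpt mxE.
Qed.

Lemma lebn_box_gt0 n (lo hi : 'I_n -> R) : (forall i, lo i < hi i) ->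
  measurable [set x : 'rV[R]_n | forall i, lo i < x 0 i < hi i] /\
  (0 < lebn R n [set x : 'rV[R]_n | forall i, (lo i < x 0 i < hi i)%R])%E.
Proof.
move=> lh; set Q := [set x | _].
have mQ : measurable Q.
  apply: sub_sigma_algebra; exists (fun i => `]lo i, hi i[%classic); split.
    by move=> i; exact: measurable_itv.
  by apply/seteqP; split => x /= h i; have := h i; rewrite /= in_itv.
split=> //; pose h (j : 'I_n) (s : R) : R := \1_(`]lo j, hi j[%classic) s.
have -> : lebn R n Q = (\int[lebn R n]_x (\prod_j h j (x 0 j))%:E)%E.
  transitivity (\int[lebn R n]_x (\1_Q x)%:E)%E; first by rewrite integral_indic// setIT.
  apply: eq_integral => x _; congr (_%:E).
  rewrite indicE; case: (boolP (x \in Q)) => [/set_mem xQ|xQ].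
    by rewrite big1// => j _; rewrite /h indicE mem_set//= in_itv; exact: xQ.
  have [j xj] : exists j, ~~ (lo j < x 0 j < hi j).
    apply: contrapT => H; move/negP: xQ; apply; apply/mem_set => j; apply: contrapT => xj.
    by apply: H; exists j; exact/negP.
  rewrite (bigD1 j)//= /h indicE memNset ?mul0r//= in_itv /=; exact/negP.
rewrite integral_prodv.
- rewrite (eq_bigr (fun j => (hi j - lo j)%:E)).
    elim/big_ind : _ => //= [a b a0 b0|j _]; first exact: mule_gt0.
    by rewrite lte_fin subr_gt0.
  move=> j _; have E := lebesgue_measure_itv `]lo j, hi j[; rewrite /= lte_fin lh in E.
  by rewrite /h integral_indic// setIT EFinB; exact: E.
- by move=> j; apply: measurable_indic; exact: measurable_itv.
- by move=> j s; rewrite /h.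
Qed.

(** On a space-time box of positive measure, near the spatial origin, u stays at most [M] while w
    exceeds it. Coordinates in ]0, eps[ exclude x = 0, and eps^2 <= eps <= r / N keeps |x|^2 <=
    r. *)
Lemma not_ae_st_eq N (u : 'rV[R]_N -> R -> R) (w : 'rV[R]_N -> R) (t0 M r : R) : (0 < N)%N -> 0 < t0 ->
  0 < r -> (forall x t, t0 / 3 <= t -> u x t <= M) ->
  (forall x, x != 0 -> enorm x ^+ 2 <= r -> M < w x) ->
  ~ ae_st t0%:E (fun x t => u x t = w x).
Proof.
move=> N0 t00 r0 uM wM [E [mE [E0 HE]]].
have NR : 0 < N%:R :> R by rewrite ltr0n.
pose eps := Num.min 1 (r / N%:R); have eps0 : 0 < eps by rewrite lt_min ltr01 divr_gt0.
pose lo (j : 'I_(N + 1)) : R := if fintype.split j is inr _ then t0 / 3 else 0.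
pose hi (j : 'I_(N + 1)) : R := if fintype.split j is inr _ then t0 / 2 else eps.
have lh j : lo j < hi j by rewrite /lo /hi; case: (fintype.split j) => // _; lra.
have [mQ Q0] := lebn_box_gt0 lh; set Q := [set x | _] in mQ Q0.
have QE : Q `<=` E.
  move=> z Qz; have := Qz (rshift N ord0).
  rewrite /lo /hi (unsplitK (inr ord0 : 'I_N + 'I_1)) => /andP[tl th].
  have tE : tpt z = z 0 (rshift N ord0) by rewrite /tpt mxE.
  have xi i : 0 < xpt z 0 i < eps.
    by have := Qz (lshift 1 i); rewrite /lo /hi (unsplitK (inl i : 'I_N + 'I_1)) mxE.
  apply: HE; first by split; rewrite ?lte_fin tE; lra.
  apply/eqP; rewrite lt_eqF//; apply: (@le_lt_trans _ _ M).
    by apply: uM; rewrite tE ltW.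
  apply: wM.
    apply/eqP => xz; have /andP[] := xi (Ordinal N0); rewrite xz mxE ltxx //.
  rewrite enorm_sq; apply: (@le_trans _ _ (\sum_(i < N) eps)).
    apply: ler_sum => i _; have /andP[a b] := xi i; move: b; rewrite lt_min => /andP[b1 b2].
    rewrite /eps le_min; apply/andP; split.
      by rewrite exprn_ile1// ltW.
    by rewrite expr2; apply: (le_trans _ (ltW b2)); rewrite ler_piMr// ltW.
  rewrite sumr_const card_ord -mulr_natl mulrC -ler_pdivlMr//.
  by rewrite ge_min lexx orbT.
have E0' : lebn R (N + 1) E = 0%E by rewrite -iint_indic.
suff : (0 < lebn R (N + 1) E)%E by rewrite E0' ltxx.
exact: lt_le_trans Q0 (le_measure (lebn R (N + 1)) (mem_set mQ) (mem_set mE) QE).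
Qed.

(** Integrals at most e^gam, uniformly in the centre, bound the supremum of their roots by e. *)
Lemma ul_norm_cvg0 N (g : R -> 'rV[R]_N -> R) (gam : R) : 1 <= gam ->
  (forall t, measurable_fun setT (g t)) ->
  (forall z : 'rV[R]_N, measurable [set y' : 'rV[R]_N | enorm (y' - z) < 1]) ->
  (forall e, 0 < e -> exists2 t', 0 < t' & forall t z, 0 < t < t' ->
    (\int[lebn R N]_y (\1_[set y' | enorm (y' - z) < 1]%R y * powR `|g t y| gam)%:E <= e%:E)%E) ->
  ul_norm gam (g t) @[t --> 0^'+] --> 0%E.
Proof.
move=> gam1 mg mB H; have g0 : 0 < gam by lra.
have bnd e : 0 < e -> exists2 t', 0 < t' & forall t, 0 < t < t' ->
    (0 <= ul_norm gam (g t))%E /\ (ul_norm gam (g t) <= e%:E)%E.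
  move=> e0; have [t' t'0 Ht] := H (powR e gam) (powR_gt0 _ e0); exists t' => // t tt; split.
    apply: le_trans (ereal_sup_ubound _); last by exists 0.
    exact: poweR_ge0.
  apply: ge_ereal_sup => _ [z _ <-].
  have I0 : (0 <= iint (fun y => (\1_[set y' | enorm (y' - z) < 1] y * powR `|g t y| gam)%:E))%E.
    rewrite iintE => [|| y]; [|apply/measurable_EFinP|by rewrite lee_fin mulr_ge0// powR_ge0].
      by apply: integral_ge0 => y _; rewrite lee_fin mulr_ge0// powR_ge0.
    apply: measurable_funM; first by apply: measurable_indic; exact: mB.
    apply: (measurableT_comp (@measurable_powR R gam)).
    exact: (measurableT_comp (@normr_measurable R setT) (mg t)).
  have I1 : (iint (fun y => (\1_[set y' | enorm (y' - z) < 1] y * powR `|g t y| gam)%:E) <= (powR e gam)%:E)%E.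
    rewrite iintE => [|| y]; [exact: Ht|apply/measurable_EFinP|by rewrite lee_fin mulr_ge0// powR_ge0].
    apply: measurable_funM; first by apply: measurable_indic; exact: mB.
    apply: (measurableT_comp (@measurable_powR R gam)).
    exact: (measurableT_comp (@normr_measurable R setT) (mg t)).
  have -> : e%:E = poweR (powR e gam)%:E gam^-1.
    by rewrite poweR_EFin -powRrM mulfV ?gt_eqF// powRr1// ltW.
  apply: gt0_ler_poweR => //; first by rewrite invr_ge0 ltW.
    by rewrite in_itv /= I0 leey.
  by rewrite in_itv /= lee_fin powR_ge0 leey.
apply/fine_cvgP; split.
  have [t' t'0 Ht] := bnd 1 ltr01; near=> t.
  have [] := Ht t; first by apply/andP; split; near: t; [exact: nbhs_right_gt|exact: nbhs_right_lt].
  by move=> a b; rewrite ge0_fin_numE//; apply: (le_lt_trans b); exact: ltry.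
apply/cvgr0Pnorm_le => e e0; have [t' t'0 Ht] := bnd e e0; near=> t => /=.
have [] := Ht t; first by apply/andP; split; near: t; [exact: nbhs_right_gt|exact: nbhs_right_lt].
move=> a b; rewrite ger0_norm ?fine_ge0// -lee_fin fineK//.
by rewrite ge0_fin_numE//; apply: (le_lt_trans b); exact: ltry.
Unshelve. all: by end_near.
Qed.

End SpaceTime.

Theorem theorem1p4 (R : realType) (N : nat) (f : R -> R) (qf : R)
    (ustar : 'rV[R]_N -> R) :
  (2 < N)%N ->
  (* (A1) f in C^1[0,oo) /\ C^2(0,oo), f(0) = 0, f'(0) = 0 *)
  {within `[0, +oo[%classic, continuous f} ->
  f 0 = 0 ->
  (f h - f 0) / h @[h --> 0^'+] --> 0 ->
  derive1 f x @[x --> 0^'+] --> 0 ->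
  (forall x, 0 < x -> derivable f x 1) ->
  (forall x, 0 < x -> derivable (derive1 f) x 1) ->
  {within `]0, +oo[%classic, continuous (derive1 (derive1 f))} ->
  (* (A2) *)
  (forall x, 0 < x -> 0 < derive1 f x /\ 0 < derive1 (derive1 f) x) ->
  (* (A3) q_f := lim_{u -> oo} f'(u)^2 / (f(u) f''(u)) *)
  derive1 f u ^+ 2 / (f u * derive1 (derive1 f) u) @[u --> +oo] --> qf ->
  (* (A7) q_S <= q_f < q_0 *)
  (N%:R + 2) / 4 <= qf -> qf < N%:R / 2 ->
  (* (A8) *)
  (forall x, x != 0 -> 0 < ustar x) ->
  (forall x y, enorm x = enorm y -> ustar x = ustar y) ->
  C2_on [set x | x != 0] ustar ->
  (forall x, x != 0 -> - laplacian ustar x = f (ustar x)) ->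
  (exists (r1 : R) (theta : R -> R),
     0 < r1 /\
     (forall r, 0 < r < r1 -> derivable theta r 1) /\
     {within `]0, r1[%classic, continuous (derive1 theta)} /\
     theta r @[r --> 0^'+] --> 0 /\
     r * derive1 theta r @[r --> 0^'+] --> 0 /\
     (forall x, 0 < enorm x < r1 ->
        ustar x = Finv f (enorm x ^+ 2 / (2 * N%:R - 4 * qf)
                          * (1 + theta (enorm x))))) ->
  (* first solution: u(x,t) = u*(x) a.e. on R^N x [0,oo) *)
  (exists u1 : 'rV[R]_N -> R -> R,
     is_solution f ustar +oo%E u1 /\
     ae_st +oo%E (fun x t => u1 x t = ustar x) /\
     ae_st +oo%E (fun x t => 0 < u1 x t)) /\
  (* second solution on R^N x [0,t0) *)
  (exists (t0 : R) (u2 : 'rV[R]_N -> R -> R),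
     0 < t0 /\
     is_solution f ustar t0%:E u2 /\
     ae_st t0%:E (fun x t => 0 < u2 x t) /\
     ~ ae_st t0%:E (fun x t => u2 x t = ustar x) /\
     (forall a b, 0 < a -> a <= b -> b < t0 ->
        exists M : R, forall x t, a <= t <= b -> `|u2 x t| <= M) /\
     classical_solution f t0 u2 /\
     (forall gam : R, 1 <= gam -> (gam%:E < gamma_star N qf)%E ->
        ul_norm gam (fun x => u2 x t - ustar x) @[t --> 0^'+] --> 0%E)).
Proof.
move=> N2 fc f0 fd0 _ fd f1d _ f12p flim qS qN upos urad uC2 ueq
  [r1 [theta [r10 [thd [_ [th0 [rth0 uF]]]]]]].
have N0 : (0 < N)%N by exact: ltnW (ltnW N2).
have NR : 3 <= N%:R :> R by rewrite (ler_nat R 3).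
(* The bound (N + 2) / 4 <= qf enters through two consequences, using N >= 3: qf > 1, which makes
   [gamma_star] finite, and qf > N / 4, on which the barrier rests. *)
have q1 : 1 < qf by lra.
have Nq : N%:R / 4 < qf by lra.
pose i0 := Ordinal N0.
pose p := prof i0 ustar; pose p1 := prof1 i0 ustar; pose p2 := prof2 i0 ustar.
have uE := ustar_prof i0 urad.
have [U0 Hp] : exists U0, profile N f qf U0 p p1 p2.
  apply: (@exists_profile R N f qf p p1 p2 f0 fc fd f1d f12p q1 flim N0 qN _ _ _ _ _ r1 theta r10 thd th0 rth0).
  - exact: prof_gt0.
  - exact: prof_derive.
  - exact: prof1_derive.
  - exact: prof2_cont.
  - exact: prof_ode.
  - move=> s s0 sr; have es : enorm (s *: ei R i0) = s by rewrite enorm_scale_ei gtr0_norm.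
    by have := uF (s *: ei R i0); rewrite es s0 sr => /(_ isT) <-; rewrite uE es.
have wE y : y != 0 -> ustar y = us p y by move=> y0; rewrite /us (negbTE y0) uE.
have us0 y : 0 <= us p y := us_ge0 Hp y.
have mus : measurable_fun setT (@us R N p) := measurable_us Hp.
(* The value of [ustar] at 0 is unconstrained; measurability is carried over from [us p] by changing
   one point. *)
have mst : measurable_fun setT ustar.
  have -> : ustar = fun y => if 0 < enorm y ^+ 2 then us p y else ustar 0.
    apply/funext => y; have [->|y0] := eqVneq y 0; last by rewrite enorm2_gt0// wE.
    by rewrite (_ : enorm (0 : 'rV[R]_N) = 0) ?expr0n ?ltxx//; apply/eqP; rewrite enorm_eq0.
  apply: measurable_fun_ifT => //; apply: measurable_fun_ltr => //.
  by apply: measurable_funX; exact: measurable_enorm.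
have usp (y : 'rV[R]_N) : y != 0 -> 0 < us p y by move=> y0; rewrite -wE//; exact: upos.
have [A [d [rho [t1 [K [[Ad rho0 t10 UK] bar]]]]]] := barrier f0 fc fd0 fd f1d f12p Hp N0 q1 flim qN Nq.
split.
  have jm : jmeas (fun (x : 'rV[R]_N) (_ : R) => us p x) by exact: (measurableT_comp mus measurable_fst).
  exists (fun x _ => us p x); split; [split=> //; split|split].
  - exact: jmeas_measurable_st.
  - apply: ae_st_off0 => // x t x0 t0 _.
    rewrite (heat_termE x t N0 mus us0 wE) duhamel_termE//.
    + exact: (us_solution f0 fc fd0 fd f12p Hp N0 t0 x0).
    + by apply: (measurable_f_comp f0 fd0 fd jm) => z; exact: us0.
    + by move=> y s; exact: (f_ge0 f0 fc fd f12p (us0 y)).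
  - by apply: ae_st_off0 => // x t x0 _ _; rewrite wE.
  - by apply: ae_st_off0 => // x t x0 _ _; exact: usp.
have ju := jmeas_u2 f0 fc fd0 fd f1d f12p Hp N0 Ad rho0 UK bar.
have u0 := u2_ge0 f0 fc fd0 fd f1d f12p Hp N0 Ad rho0 UK bar.
exists t1, (@u2 R N f p t1); split=> //; split; [split=> //; split|split; [|split; [|split; [|split]]]].
- exact: jmeas_measurable_st.
- apply: ae_st_off0 => // x t x0 t0 tt; rewrite lte_fin in tt.
  rewrite (heat_termE x t N0 mus us0 wE) duhamel_termE//.
  + by apply: (u2_eq f0 fc fd0 fd f1d f12p Hp N0 Ad rho0 UK bar); rewrite t0 ltW.
  + exact: (measurable_f_u2 f0 fc fd0 fd f1d f12p Hp N0 Ad rho0 UK bar).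
  + exact: (f_u2_ge0 f0 fc fd0 fd f1d f12p Hp N0 Ad rho0 UK bar).
- apply: ae_st_off0 => // x t x0 t0 tt; rewrite lte_fin in tt.
  by apply: (u2_gt0 f0 fc fd0 fd f1d f12p Hp N0 Ad rho0 UK bar); rewrite t0 ltW.
(* From time t1 / 3 on [u2] is bounded, whereas [ustar] exceeds any bound near the origin. *)
- have [|M M0 HM] := u2_bound f0 fc fd0 fd f1d f12p Hp N0 Ad rho0 UK bar (a := t1 / 3); first by lra.
  have [r r0 Hr] := pr_oo Hp (M + 1).
  apply: (not_ae_st_eq N0 t10 r0 HM) => x x0 xr; rewrite wE// /us (negbTE x0).
  by have := Hr _ (enorm2_gt0 x0) xr; lra.
- move=> a b a0 ab bt.
  have [M M0 HM] := u2_bound f0 fc fd0 fd f1d f12p Hp N0 Ad rho0 UK bar a0.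
  by exists M => x t /andP[ta tb]; rewrite ger0_norm ?u0//; exact: HM.
- exact: (u2_classical f0 fc fd0 fd f1d f12p Hp N0 Ad rho0 UK bar).
- move=> gam gam1; rewrite /gamma_star q1 lte_fin => gamN.
  have qq : 0 < 2 * (qf - 1) by lra.
  have gN : gam * (qf - 1) < N%:R / 2 by move: gamN; rewrite ltr_pdivlMr//; lra.
  apply: (@ul_norm_cvg0 R N (fun t x => u2 f p t1 x t - ustar x) gam gam1).
  + by move=> t; apply: measurable_funB => //; exact: (jmeas_sec t ju).
  + exact: measurable_unit_ball.
  + move=> e e0; exact: (u2_ul_small f0 fc fd0 fd f1d f12p Hp N0 Ad rho0 UK bar q1 flim qN t10 mst wE gam1 gN e0).
Qed.
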